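(* Let $I=(0,1)$, let $\boldsymbol{a}\in\mathbf{R}^3$ be an arbitrary vector with $|\boldsymbol{a}|=1$, and let $\boldsymbol{e}_3={}^t(0,0,1)$. Consider the initial-boundary value problem for $\boldsymbol{v}=\boldsymbol{v}(s,t)\in\mathbf{R}^3$: $$ \begin{cases} \boldsymbol{v}_t=\boldsymbol{v}\times\boldsymbol{v}_{ss}, & s\in I,\ t>0,\\ \boldsymbol{v}(s,0)=\boldsymbol{v}_0(s), & s\in I,\\ \boldsymbol{v}(0,t)=\boldsymbol{a},\quad \boldsymbol{v}(1,t)=\boldsymbol{e}_3, & t>0. \end{cases} \tag{P} $$ Let $l\ge 0$ be an integer. If $\boldsymbol{v}_0\in H^{l+3}(I)$, $|\boldsymbol{v}_0|\equiv 1$ on $I$, and $\boldsymbol{v}_0$ satisfies the compatibility conditions for (P) up to order $[\frac{l+3}{2}]$, then there exists a unique solution $\boldsymbol{v}$ of (P) satisfying $|\boldsymbol{v}|\equiv 1$ and $$ \boldsymbol{v}\in\bigcap_{j=0}^{[\frac{l+3}{2}]}C^{j}\big([0,\infty);H^{l+3-2j}(I)\big). $$ Here $[\frac{l+3}{2}]$ is the largest integer not exceeding $\frac{l+3}{2}$.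
   Context: $\times$ is the exterior (cross) product in $\mathbf{R}^3$; subscripts $s,t$ denote partial derivatives. $H^m(I)=W^{m,2}(I)$ is the usual $L^2$-based Sobolev space ($H^0=L^2$); a vector-valued function belongs to a function space if each component does. $C^j([0,\infty);X)$ is the space of functions that are $j$ times continuously differentiable in $t$ with respect to the norm of the Banach space $X$. Compatibility conditions for (P). Put $\boldsymbol{P}_0(\boldsymbol{v})=\boldsymbol{v}$, $\boldsymbol{P}_1(\boldsymbol{v})=\boldsymbol{v}\times\boldsymbol{v}_{ss}$, and successively $$\boldsymbol{P}_m=\sum_{j=0}^{m-1}\binom{m-1}{j}\boldsymbol{P}_j\times\partial_s^2\boldsymbol{P}_{m-1-j}$$ (so $\boldsymbol{P}_m$ is the expression of $\partial_t^m\boldsymbol{v}$ in terms of $s$-derivatives of $\boldsymbol{v}$ only). For an integer $m\ge 0$, $\boldsymbol{v}_0$ satisfies the $m$-th order compatibility condition for (P) if $\boldsymbol{v}_0\in H^{2m+1}(I)$ and: when $m=0$, $\boldsymbol{v}_0(0)=\boldsymbol{a}$ and $\boldsymbol{v}_0(1)=\boldsymbol{e}_3$; when $m\ge 1$, $\boldsymbol{P}_m(\boldsymbol{v}_0)|_{s=0}=\boldsymbol{P}_m(\boldsymbol{v}_0)|_{s=1}=\boldsymbol{0}$. It satisfies the compatibility conditions up to order $m$ if it satisfies the $k$-th order condition for all $0\le k\le m$. *)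

(* Defs.v *)
From HB Require Import structures.
From mathcomp Require Export all_boot all_order all_algebra.
From mathcomp Require Export all_classical all_reals all_analysis.

Set Implicit Arguments.
Unset Strict Implicit.
Unset Printing Implicit Defensive.

Import Order.TTheory GRing.Theory Num.Theory.
Import numFieldTopology.Exports numFieldNormedType.Exports.

Local Open Scope classical_set_scope.
Local Open Scope ring_scope.

(* Elements of L^2(I) and H^m(I) are represented by functions on the whole line R
   of which only the values almost everywhere on I = (0, 1) matter; equality of such
   elements is [eqI]. *)

Section Vectors.
Context {R : realType}.
Implicit Types u v : 'rV[R]_3.

(* Indices are taken modulo 3: (u x v)_k = u_{k+1} v_{k+2} - u_{k+2} v_{k+1}. *)
Definition cross u v : 'rV[R]_3 :=
  \row_(k < 3) (u 0 (k + 1) * v 0 (k + 2%:R) - u 0 (k + 2%:R) * v 0 (k + 1)).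

(* The library norm on row vectors is the sup norm. *)
Definition enorm u : R := Num.sqrt (\sum_(i < 3) u 0 i ^+ 2).

Definition e3 : 'rV[R]_3 := delta_mx 0 ord_max.

End Vectors.

Section Sobolev.
Context {R : realType}.
Implicit Types (f g phi : R -> R) (u w : R -> 'rV[R]_3).

Definition I01 : set R := `]0, 1[.

Definition eqI u w : Prop :=
  {ae (@lebesgue_measure R), forall s, I01 s -> u s = w s}.

Definition L2 f : Prop := f \_ I01 \in Lfun (@lebesgue_measure R) 2%:E.

Definition L2norm f : R :=
  fine ('N[@lebesgue_measure R]_2%:E [EFin \o (f \_ I01)])%E.

(* C_c^infty(I) *)
Definition test_function phi : Prop :=
  [/\ forall n x, derivable (derive1n n phi) x 1,
      compact (closure [set x | phi x != 0]) &
      closure [set x | phi x != 0] `<=` I01].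

(* [g] in L^2(I) is the k-th distributional derivative of [f] on I *)
Definition is_wderiv (k : nat) f g : Prop :=
  L2 g /\ forall phi, test_function phi ->
    \int[@lebesgue_measure R]_(s in I01) (f s * derive1n k phi s) =
    (-1) ^+ k * \int[@lebesgue_measure R]_(s in I01) (g s * phi s).

Definition wderiv (k : nat) f : R -> R := xget (cst 0) [set g | is_wderiv k f g].

Definition coord u (i : 'I_3) : R -> R := fun s => u s 0 i.

(* \partial_s^k u *)
Definition Ds (k : nat) u : R -> 'rV[R]_3 :=
  fun s => \row_(i < 3) wderiv k (coord u i) s.

(* u in H^m(I) *)
Definition sobolev (m : nat) u : Prop :=
  forall i, L2 (coord u i) /\
    forall k, (k <= m)%N -> exists g, is_wderiv k (coord u i) g.

Definition sobolev_norm (m : nat) u : R :=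
  Num.sqrt (\sum_(i < 3) \sum_(k < m.+1) L2norm (wderiv k (coord u i)) ^+ 2).

(* The boundary value u(x), x in {0, 1}, of an element of H^m(I), m >= 1, is
   that of its representative that is continuous on [0, 1]. *)
Definition has_trace u (x : R) (c : 'rV[R]_3) : Prop :=
  exists w, [/\ {within `[0, 1], continuous w}, eqI u w & w x = c].

End Sobolev.

Section TimeRegularity.
Context {R : realType}.
Implicit Types v w : R -> R -> 'rV[R]_3.  (* [v t s], with t >= 0 *)

(* v in C([0, oo); H^m(I)) *)
Definition Hcontinuous (m : nat) v : Prop :=
  (forall t, 0 <= t -> sobolev m (v t)) /\
  forall t, 0 <= t ->
    sobolev_norm m (v r \- v t) @[r --> within [set r | 0 <= r] (nbhs t)] --> 0.

(* d is the derivative at time t of v : [0, oo) -> H^m(I) (one-sided at 0) *)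
Definition is_Hderiv (m : nat) v (t : R) (d : R -> 'rV[R]_3) : Prop :=
  sobolev m d /\
  sobolev_norm m (fun s => (r - t)^-1 *: (v r s - v t s) - d s)
    @[r --> within [set r | 0 <= r] t^'] --> 0.

(* v in C^j([0, oo); H^m(I)) *)
Fixpoint CjHm (j m : nat) v : Prop :=
  Hcontinuous m v /\
  match j with
  | 0%N => True
  | j'.+1 => exists w, (forall t, 0 <= t -> is_Hderiv m v t (w t)) /\ CjHm j' m w
  end.

End TimeRegularity.

Section Problem.
Context {R : realType}.

(* [Ptab v0 n] agrees with m |-> P_m(v0) for m <= n; see [Pcomp0], [PcompS]. *)
Fixpoint Ptab (v0 : R -> 'rV[R]_3) (n : nat) : nat -> R -> 'rV[R]_3 :=
  match n with
  | 0%N => fun _ => v0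
  | n'.+1 => fun m =>
      if (m <= n')%N then Ptab v0 n' m else
      fun s => \sum_(j < n'.+1)
        'C(n', j)%:R *: cross (Ptab v0 n' j s) (Ds 2 (Ptab v0 n' (n' - j)%N) s)
  end.

Definition Pcomp (m : nat) (v0 : R -> 'rV[R]_3) : R -> 'rV[R]_3 := Ptab v0 m m.

Lemma Ptab_le (v0 : R -> 'rV[R]_3) n m : (m <= n)%N -> Ptab v0 n m = Pcomp m v0.
Proof.
elim: n => [|n IH]; first by rewrite leqn0 => /eqP ->.
by rewrite leq_eqVlt => /orP[/eqP -> //|]; rewrite ltnS /= => mn; rewrite mn IH.
Qed.

Lemma Pcomp0 (v0 : R -> 'rV[R]_3) : Pcomp 0 v0 = v0.
Proof. by []. Qed.

Lemma PcompS (v0 : R -> 'rV[R]_3) n : Pcomp n.+1 v0 =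
  fun s => \sum_(j < n.+1)
    'C(n, j)%:R *: cross (Pcomp j v0 s) (Ds 2 (Pcomp (n - j) v0) s).
Proof.
rewrite {1}/Pcomp /= ltnn; apply/funext => s; apply: eq_bigr => j _.
by rewrite !Ptab_le ?leq_subr // -ltnS.
Qed.

Lemma Pcomp1 (v0 : R -> 'rV[R]_3) : Pcomp 1 v0 = fun s => cross (v0 s) (Ds 2 v0 s).
Proof. by rewrite PcompS; apply/funext => s; rewrite big_ord1 bin0 scale1r. Qed.

Definition compatible (m : nat) (a : 'rV[R]_3) (v0 : R -> 'rV[R]_3) : Prop :=
  sobolev (2 * m + 1) v0 /\
  if m == 0%N then has_trace v0 0 a /\ has_trace v0 1 e3
  else has_trace (Pcomp m v0) 0 0 /\ has_trace (Pcomp m v0) 1 0.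

Definition compatible_up_to (m : nat) (a : 'rV[R]_3) (v0 : R -> 'rV[R]_3) : Prop :=
  forall k, (k <= m)%N -> compatible k a v0.

Definition unit_length (u : R -> 'rV[R]_3) : Prop :=
  {ae (@lebesgue_measure R), forall s, I01 s -> enorm (u s) = 1}.

(* The equation v_t = v x v_ss is an identity in L^2(I) for each t > 0. *)
Definition is_solution (a : 'rV[R]_3) (v0 : R -> 'rV[R]_3)
    (v : R -> R -> 'rV[R]_3) : Prop :=
  [/\ forall t, 0 < t -> sobolev 2 (v t),
      forall t, 0 < t -> is_Hderiv 0 v t (fun s => cross (v t s) (Ds 2 (v t) s)),
      eqI (v 0) v0 &
      forall t, 0 < t -> has_trace (v t) 0 a /\ has_trace (v t) 1 e3].

End Problem.

(* Main.v *)
Require Import Defs.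
From mathcomp Require Import ring lra zify measurable_realfun.

Set Implicit Arguments.
Unset Strict Implicit.
Unset Printing Implicit Defensive.

Import Order.TTheory GRing.Theory Num.Theory.
Import numFieldTopology.Exports numFieldNormedType.Exports.

Local Open Scope classical_set_scope.
Local Open Scope ring_scope.

(** A moving frame turns (P) into a cubic Schroedinger equation with Neumann conditions. Along s ->
    v(s, t) take fields e1, e2 such that (v, e1, e2) is a right-handed orthonormal basis and v_s =
    q1 e1 + q2 e2, e1_s = - q1 v, e2_s = - q2 v. If v_t = v x v_ss and the frame at s = 0 is kept
    fixed in time, then q = q1 + i q2 satisfies q_t = i (q_ss + (|q|^2 - |q(0, t)|^2) q / 2).
    Conversely, let q solve this equation with q_s = 0 at both ends, and rebuild the frame from q by
    the linear system in s. Then v_t = q1_s e2 - q2_s e1 = v x v_ss; this vanishes at s = 0 and s =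
    1, so the boundary values of v persist.

    Data. The compatibility conditions are what makes the odd derivatives of the initial q vanish at
    the ends. Let b be the value of v0 at an end. An odd number of derivatives of |v0|^2 = 1,
    together with P_k(v0) = 0, whose top order part is (b x)^k applied to the derivative of order
    2k, shows by induction that the derivatives of v0 of even order are parallel to b and those of
    odd order orthogonal to b ([parity]): the reflected curve is the rotation of the curve by pi
    about b. The normal fields have the opposite parity, so their products with v_s, the components
    of q, are even ([tfield_even], [data_frame]).

    Global existence for q. Functions of H^(2m) whose odd derivatives vanish at the ends correspond
    to cosine series with weighted l^2 coefficients ([ana], [is_syn_ex], [syn_unique]). On
    coefficients the free equation rotates each mode and the cubic term is locally Lipschitz, so the
    equation with a truncated nonlinearity is solved by Picard iteration in l^2 ([Cauchy_Lipschitz],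
    [semilinear]). Conservation of mass and energy bounds the H^1 norm ([H1_bound]); tame product
    estimates and Gronwall's inequality then bound the norms of H^2, H^4, ..., H^(2m) successively,
    by constants that do not depend on the truncation ([apriori]). A large enough truncation is
    therefore never active ([sol_ex], [NLS_global]).

    Back to v. The difference quotient in time of the frame, minus the expected derivative, solves
    the frame system with zero initial value and a small source ([x_derive]). The frame has one
    derivative more than q, so v is continuous with values in H^(2m+1) ([frame_jets], [evolution]).
    Differentiability in time is first known in L^2; it is lifted to higher norms through sine
    coefficients ([upgrade1]), and each time derivative costs two space derivatives
    ([CjJ_evolution]).

    Uniqueness. For the difference z = u - w of two solutions, u x z_ss is orthogonal to z_ss and z
    vanishes at the ends, so d/dt of the integral of |z_s|^2 is twice the integral of (z x w_sss) .
    z_s. This is at most a constant times the integral of |z_s|^2, and Gronwall's inequality applies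
    ([jets_uniq]).

    Elements of H^m are handled throughout as jets, that is, tuples of successive derivatives in
    which each entry but the last is the primitive of the next one; the sections on bridges
    translate between jets and the weak derivatives of the statement. *)

Local Notation pos t := (Num.max 0 t).

(** * Integrable and square-integrable functions on the unit interval *)

Section L2basics.
Context {R : realType}.
Implicit Types f g h : R -> R.
Local Notation mu := (@lebesgue_measure R).

Definition L1 f := mu.-integrable I01 (EFin \o f).
Definition int01 f : R := \int[mu]_(s in I01) f s.
Definition aeq f g := {ae mu, forall s, I01 s -> f s = g s}.

Lemma aeS (P Q : R -> Prop) : (forall x, P x -> Q x) ->
  {ae mu, forall x, P x} -> {ae mu, forall x, Q x}.
Proof. by move=> PQ; apply: (@filterS _ _ (ae_filter_ringOfSetsType mu)). Qed.
Lemma aeS2 (P Q S : R -> Prop) : (forall x, P x -> Q x -> S x) ->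
  {ae mu, forall x, P x} -> {ae mu, forall x, Q x} -> {ae mu, forall x, S x}.
Proof. by move=> PQ; apply: (@filterS2 _ _ (ae_filter_ringOfSetsType mu)). Qed.
Lemma aeI (P : R -> Prop) : (forall x, P x) -> {ae mu, forall x, P x}.
Proof. by move=> h; apply: aeW. Qed.

Lemma mI01 : measurable (I01 : set (measurableTypeR R)). Proof. exact: measurable_itv. Qed.
Hint Resolve mI01 : core.

Lemma muI01 : mu I01 = 1%:E.
Proof. by rewrite /I01 lebesgue_measure_itv/= lte_fin ltr01 oppr0 adde0. Qed.

Lemma L1_meas f : L1 f -> measurable_fun I01 f.
Proof. by move=> /measurable_int/measurable_EFinP. Qed.

Lemma L2_meas f : L2 f -> measurable_fun I01 f.
Proof.
rewrite /L2 inE => /andP[+ _]; rewrite inE/= => mf.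
by apply/(measurable_restrictT f mI01).
Qed.

Lemma L1_restrict f : L1 f <-> mu.-integrable setT (EFin \o (f \_ I01)).
Proof.
rewrite /L1 -restrict_EFin.
have := @integrable_restrict _ _ _ mu I01 mI01 setT measurableT (EFin \o f).
by rewrite setTI.
Qed.

Lemma restrictM f g : (f \* g) \_ I01 = (f \_ I01) \* (g \_ I01).
Proof. by apply/funext => x; rewrite /= /patch; case: ifP => //; rewrite mulr0. Qed.

Lemma L2P f : L2 f <-> measurable_fun I01 f /\ L1 (f \* f).
Proof.
split=> [Lf|[mf Lf]].
  split; first exact: L2_meas.
  have := Lfun2_integrable_sqr Lf => h.
  apply/L1_restrict; rewrite restrictM; apply: eq_integrable h => //.
have mf' : measurable_fun setT (f \_ I01) by apply/(measurable_restrictT f mI01).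
rewrite /L2 inE; apply/andP; split; rewrite inE //=.
rewrite /finite_norm unlock /Lnorm poweR_lty//.
move/L1_restrict/integrableP : Lf => [_]; apply: le_lt_trans.
rewrite le_eqVlt; apply/orP; left; apply/eqP.
apply: eq_integral => x _ /=; congr EFin.
by rewrite powR_mulrn// restrictM/= normrM.
Qed.

Lemma L2norm_sqr f : L2 f -> L2norm f ^+ 2 = int01 (f \* f).
Proof.
move=> Lf; rewrite /L2norm /int01 Rintegral_mkcond restrictM /Rintegral.
have := @powR_Lnorm _ _ _ mu (EFin \o (f \_ I01)) 2; rewrite pnatr_eq0 => /(_ isT).
have Nfin : ('N[mu]_2%:E[EFin \o f \_ I01] < +oo)%E.
  by move: Lf; rewrite /L2 inE => /andP[_]; rewrite inE.
have N0 := Lnorm_ge0 mu 2%:E (EFin \o (f \_ I01)).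
have NE : ('N[mu]_2%:E[EFin \o f \_ I01] = (L2norm f)%:E)%E.
  by rewrite /L2norm fineK// ge0_fin_numE.
rewrite NE poweR_EFin powR_mulrn; last by rewrite /L2norm fine_ge0.
move=> H; have <- : ((L2norm f)^+2)%:E = (\int[mu]_x ((f \_ I01 \* f \_ I01) x)%:E)%E.
  rewrite H; apply: eq_integral => x _ /=; congr EFin.
  by rewrite powR_mulrn// -normrX ger0_norm ?sqr_ge0// expr2.
by [].
Qed.

Lemma L2norm_ge0 f : 0 <= L2norm f.
Proof. by rewrite /L2norm fine_ge0// Lnorm_ge0. Qed.

Lemma L1D f g : L1 f -> L1 g -> L1 (f \+ g).
Proof. by move=> Lf Lg; have := integrableD mI01 Lf Lg. Qed.

Lemma L1Z a f : L1 f -> L1 (fun x => a * f x).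
Proof. by move=> Lf; have := integrableZl mI01 a Lf. Qed.

Lemma L1N f : L1 f -> L1 (\- f).
Proof. by move=> Lf; have := integrableN Lf. Qed.

Lemma L1B f g : L1 f -> L1 g -> L1 (f \- g).
Proof. by move=> Lf Lg; exact: (L1D Lf (L1N Lg)). Qed.

Lemma L1_abs f : L1 f -> L1 (fun x => `|f x|).
Proof. exact: integrable_norm. Qed.

Lemma L1_le f g : measurable_fun I01 f -> (forall x, I01 x -> `|f x| <= g x) ->
  L1 g -> L1 f.
Proof.
move=> mf fg Lg; apply: (le_integrable mI01 _ _ Lg); first exact/measurable_EFinP.
by move=> x Ix /=; rewrite lee_fin (le_trans (fg x Ix))// ler_norm.
Qed.

Lemma L1_cst a : L1 (cst a).
Proof.
apply/integrableP; split; first exact/measurable_EFinP/measurable_cst.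
rewrite /= integral_cst//= muI01 mule1; exact: ltey.
Qed.

Lemma L1_bounded f M : measurable_fun I01 f -> (forall x, I01 x -> `|f x| <= M) -> L1 f.
Proof. by move=> mf fM; apply: (L1_le mf fM (L1_cst M)). Qed.

Lemma eq_L1 f g : (forall x, I01 x -> f x = g x) -> L1 f -> L1 g.
Proof.
by move=> fg; apply: eq_integrable => // x; rewrite inE => Ix /=; rewrite fg.
Qed.

Lemma int01D f g : L1 f -> L1 g -> int01 (f \+ g) = int01 f + int01 g.
Proof. exact: RintegralD. Qed.
Lemma int01B f g : L1 f -> L1 g -> int01 (f \- g) = int01 f - int01 g.
Proof. exact: RintegralB. Qed.
Lemma int01Z a f : L1 f -> int01 (fun x => a * f x) = a * int01 f.
Proof. exact: RintegralZl. Qed.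
Lemma eq_int01 f g : (forall x, I01 x -> f x = g x) -> int01 f = int01 g.
Proof. by move=> fg; apply: eq_Rintegral => x; rewrite inE => /fg. Qed.
Lemma int01N f : L1 f -> int01 (\- f) = - int01 f.
Proof.
by move=> Lf; rewrite -mulN1r -int01Z//; apply: eq_int01 => x _; rewrite mulN1r.
Qed.
Lemma int01_cst a : int01 (cst a) = a.
Proof. by rewrite /int01 Rintegral_cst//= muI01/= mulr1. Qed.
Lemma int01_0 : int01 (fun=> 0) = 0. Proof. exact: int01_cst. Qed.
Lemma int01_ge0 f : (forall x, I01 x -> 0 <= f x) -> 0 <= int01 f.
Proof. by move=> h; rewrite /int01; apply: Rintegral_ge0. Qed.
Lemma le_int01 f g : L1 f -> L1 g -> (forall x, I01 x -> f x <= g x) ->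
  int01 f <= int01 g.
Proof. by move=> Lf Lg h; rewrite /int01; apply: le_Rintegral. Qed.
Lemma int01_abs f : L1 f -> `|int01 f| <= int01 (fun x => `|f x|).
Proof. by move=> Lf; rewrite /int01; apply: le_normr_Rintegral. Qed.
Lemma int01_bound f M : measurable_fun I01 f -> (forall x, I01 x -> `|f x| <= M) ->
  `|int01 f| <= M.
Proof.
move=> mf fM; have Lf := L1_bounded mf fM.
rewrite (le_trans (int01_abs Lf))// -[leRHS]int01_cst le_int01//; first exact: L1_abs.
exact: L1_cst.
Qed.

Lemma aeq_int01 f g : measurable_fun I01 f -> measurable_fun I01 g -> aeq f g ->
  int01 f = int01 g.
Proof.
move=> mf mg fg; congr fine; apply: ae_eq_integral => //; [exact/measurable_EFinP..|].
by apply: aeS fg => x h Ix; rewrite h.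
Qed.

Lemma aeq_refl f : aeq f f. Proof. exact: aeI. Qed.
Lemma aeq_sym f g : aeq f g -> aeq g f.
Proof. by apply: aeS => x h Ix; rewrite h. Qed.
Lemma aeq_trans f g h : aeq f g -> aeq g h -> aeq f h.
Proof. by apply: aeS2 => x h1 h2 Ix; rewrite h1// h2. Qed.
Lemma eq_aeq f g : (forall x, I01 x -> f x = g x) -> aeq f g.
Proof. by move=> h; exact: aeI. Qed.

Lemma L1M f g : L2 f -> L2 g -> L1 (f \* g).
Proof.
move=> Lf Lg; have /L2P[mf Lff] := Lf; have /L2P[mg Lgg] := Lg.
apply: (@L1_le _ (fun x => f x * f x + g x * g x)); last exact: L1D.
  exact: measurable_funM.
move=> x _ /=; rewrite normrM.
have : 0 <= (`|f x| - `|g x|) ^+ 2 by exact: sqr_ge0.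
have e1 : `|f x| * `|f x| = f x * f x by rewrite -normrM ger0_norm// -expr2 sqr_ge0.
have e2 : `|g x| * `|g x| = g x * g x by rewrite -normrM ger0_norm// -expr2 sqr_ge0.
have : 0 <= `|f x| * `|g x| by rewrite mulr_ge0.
rewrite sqrrB !expr2 e1 e2; nra.
Qed.

Lemma L2D f g : L2 f -> L2 g -> L2 (f \+ g).
Proof.
move=> Lf Lg; have /L2P[mf Lff] := Lf; have /L2P[mg Lgg] := Lg.
apply/L2P; split; first exact: measurable_funD.
have h := L1D (L1D Lff Lgg) (L1Z 2 (L1M Lf Lg)).
by apply: eq_L1 h => x _ /=; ring.
Qed.

Lemma L2Z a f : L2 f -> L2 (fun x => a * f x).
Proof.
move=> Lf; have /L2P[mf Lff] := Lf.
apply/L2P; split; first exact: measurable_funM.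
by apply: eq_L1 (L1Z (a * a) Lff) => x _ /=; ring.
Qed.

Lemma eq_L2 f g : (forall x, I01 x -> f x = g x) -> L2 f -> L2 g.
Proof.
move=> fg /L2P[mf Lff]; apply/L2P; split.
  by apply: eq_measurable_fun mf => x; rewrite inE => /fg.
by apply: eq_L1 Lff => x Ix /=; rewrite fg.
Qed.

Lemma L2N f : L2 f -> L2 (\- f).
Proof. by move=> /(L2Z (-1)); apply: eq_L2 => x _; rewrite mulN1r. Qed.
Lemma L2B f g : L2 f -> L2 g -> L2 (f \- g).
Proof. by move=> Lf Lg; exact: (L2D Lf (L2N Lg)). Qed.
Lemma L2_bounded f M : measurable_fun I01 f -> (forall x, I01 x -> `|f x| <= M) -> L2 f.
Proof.
move=> mf fM; apply/L2P; split => //; apply: (@L1_bounded _ (M * M)).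
  exact: measurable_funM.
by move=> x Ix /=; rewrite normrM ler_pM// fM.
Qed.
Lemma L2_cst (a : R) : L2 (cst a : R -> R).
Proof. by apply: (@L2_bounded _ `|a|) => //; exact: measurable_cst. Qed.
Lemma L2_L1 f : L2 f -> L1 f.
Proof.
by move=> Lf; apply: eq_L1 (L1M Lf (L2_cst 1)) => x _ /=; rewrite mulr1.
Qed.
Lemma L2M_bounded f g M : L2 f -> measurable_fun I01 g ->
  (forall x, I01 x -> `|g x| <= M) -> L2 (f \* g).
Proof.
move=> /L2P[mf Lff] mg gM; apply/L2P; split; first exact: measurable_funM.
apply: (L1_le _ _ (L1Z (M * M) Lff)).
  by apply: measurable_funM; apply: measurable_funM.
move=> x Ix /=; have -> : f x * g x * (f x * g x) = (g x * g x) * (f x * f x) by ring.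
rewrite normrM [`|f x * f x|]ger0_norm -?expr2 ?sqr_ge0// ler_wpM2r ?sqr_ge0//.
by rewrite normrX ler_sqr ?nnegrE// ?gM// (le_trans _ (gM x Ix)).
Qed.

Lemma eq_L2norm f g : (forall x, I01 x -> f x = g x) -> L2norm f = L2norm g.
Proof.
move=> fg; rewrite /L2norm (_ : f \_ I01 = g \_ I01)//.
by apply/funext => x; rewrite /patch; case: ifP => //; rewrite inE => /fg.
Qed.

Lemma le_sqr_ge0 (x y : R) : 0 <= y -> x ^+ 2 <= y ^+ 2 -> x <= y.
Proof.
move=> y0 h; have [x0|x0] := leP 0 x; last by rewrite (le_trans (ltW x0)).
by rewrite -ler_sqr// nnegrE.
Qed.

Lemma L2norm_le f M : L2 f -> 0 <= M -> int01 (f \* f) <= M ^+ 2 -> L2norm f <= M.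
Proof. by move=> Lf M0; rewrite -L2norm_sqr//; exact: le_sqr_ge0. Qed.

Lemma int01_CS f g : L2 f -> L2 g -> `|int01 (f \* g)| <= L2norm f * L2norm g.
Proof.
move=> Lf Lg.
apply: le_sqr_ge0; first by rewrite mulr_ge0 ?L2norm_ge0.
rewrite real_normK ?num_real// exprMn !L2norm_sqr//.
set a := int01 (f \* f); set b := int01 (f \* g); set c := int01 (g \* g).
have Lff := L1M Lf Lf; have Lfg := L1M Lf Lg; have Lgg := L1M Lg Lg.
(* The right-hand side is the integral of the square of f + t g. *)
have key t : 0 <= a + t * (2 * b) + t ^+ 2 * c.
  have L2' := L1Z (2 * t) Lfg; have L3' := L1Z (t ^+ 2) Lgg.
  have : 0 <= int01 ((f \* f) \+ (fun x => 2 * t * (f \* g) x) \+ (fun x => t ^+ 2 * (g \* g) x)).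
    by apply: int01_ge0 => x _ /=; have := sqr_ge0 (f x + t * g x); lra.
  by rewrite !int01D ?int01Z//; [rewrite /a /b /c; lra|exact: L1D].
have a0 : 0 <= a by have := key 0; lra.
have c0 : 0 <= c by apply: int01_ge0 => x _; rewrite /= -expr2 sqr_ge0.
have [cE|cN0] := eqVneq c 0.
  have [->|bN0] := eqVneq b 0; first by rewrite expr0n mulr_ge0.
  (* With [c = 0] the affine function of [t] takes the value -1 at this point. *)
  have := key (- (a + 1) / (2 * b)); rewrite cE mulr0 addr0 divfK; first by lra.
  by rewrite mulf_neq0.
have cp : 0 < c by rewrite lt_def cN0.
have := key (- b / c).
have -> : a + - b / c * (2 * b) + (- b / c) ^+ 2 * c = (a * c - b ^+ 2) / c by field.
by rewrite pmulr_lge0 ?invr_gt0// subr_ge0.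
Qed.

Lemma L2norm_triangle f g : L2 f -> L2 g -> L2norm (f \+ g) <= L2norm f + L2norm g.
Proof.
move=> Lf Lg; apply: L2norm_le; first exact: L2D.
  by rewrite addr_ge0 ?L2norm_ge0.
have -> : int01 ((f \+ g) \* (f \+ g)) =
    int01 (f \* f) + 2 * int01 (f \* g) + int01 (g \* g).
  have Lff := L1M Lf Lf; have Lfg := L1M Lf Lg; have Lgg := L1M Lg Lg.
  rewrite -int01Z//; have L2' := L1Z 2 Lfg.
  rewrite -int01D// -int01D//; last exact: L1D.
  by apply: eq_int01 => x _ /=; ring.
rewrite -!L2norm_sqr//; have := int01_CS Lf Lg.
by move=> /(le_trans (ler_norm _)); rewrite sqrrD; lra.
Qed.

Lemma L2normZ a f : L2 f -> L2norm (fun x => a * f x) = `|a| * L2norm f.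
Proof.
move=> Lf; apply/eqP; rewrite -(@eqrXn2 _ 2)// ?mulr_ge0 ?L2norm_ge0//.
rewrite exprMn !L2norm_sqr//; last exact: L2Z.
rewrite real_normK ?num_real// -int01Z; last exact: L1M.
by apply/eqP; apply: eq_int01 => x _ /=; ring.
Qed.

Lemma L2normN f : L2 f -> L2norm (\- f) = L2norm f.
Proof.
move=> Lf; rewrite -[RHS]mul1r -(normrN1 R) -L2normZ//.
by apply: eq_L2norm => x _; rewrite mulN1r.
Qed.

Lemma L2norm_triangleB f g : L2 f -> L2 g -> L2norm (f \- g) <= L2norm f + L2norm g.
Proof. by move=> Lf Lg; rewrite -(L2normN Lg) L2norm_triangle//; exact: L2N. Qed.

Lemma L2norm_leD f g h : L2 f -> L2 g -> L2 h ->
  L2norm (f \- h) <= L2norm (f \- g) + L2norm (g \- h).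
Proof.
move=> Lf Lg Lh; rewrite (@eq_L2norm (f \- h) ((f \- g) \+ (g \- h))).
  by apply: L2norm_triangle; exact: L2B.
by move=> x _ /=; rewrite addrA subrK.
Qed.

Lemma L2norm_cst (a : R) : L2norm (cst a : R -> R) = `|a|.
Proof.
apply/eqP; rewrite -(@eqrXn2 _ 2)// ?L2norm_ge0// L2norm_sqr; last exact: L2_cst.
rewrite real_normK ?num_real// (eq_int01 (g := cst (a ^+ 2))) ?int01_cst//.
Qed.

Lemma L2norm0 : L2norm ((fun=> 0) : R -> R) = 0.
Proof. by rewrite (L2norm_cst 0) normr0. Qed.

Lemma L2norm_bounded f M : measurable_fun I01 f -> (forall x, I01 x -> `|f x| <= M) ->
  L2norm f <= M.
Proof.
move=> mf fM; have M0 : 0 <= M.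
  by apply: le_trans (fM 2^-1 _) => //; rewrite /I01/= in_itv/=; lra.
apply: L2norm_le => //; first exact: L2_bounded fM.
rewrite (le_trans (ler_norm _))// int01_bound//; first exact: measurable_funM.
by move=> x Ix /=; rewrite normrM expr2 ler_pM// fM.
Qed.

Lemma L2normM_bounded f g M : L2 f -> measurable_fun I01 g ->
  (forall x, I01 x -> `|g x| <= M) -> L2norm (f \* g) <= M * L2norm f.
Proof.
move=> Lf mg gM; have M0 : 0 <= M.
  by apply: le_trans (gM 2^-1 _) => //; rewrite /I01/= in_itv/=; lra.
have Lfg := L2M_bounded Lf mg gM.
apply: L2norm_le => //; first by rewrite mulr_ge0// L2norm_ge0.
rewrite exprMn L2norm_sqr// -int01Z; last exact: L1M.
apply: le_int01; [exact: L1M|by apply/L1Z/L1M|move=> x Ix /=].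
have -> : f x * g x * (f x * g x) = g x ^+ 2 * (f x * f x) by ring.
rewrite ler_wpM2r ?(sqr_ge0, =^~expr2)//.
by rewrite -[g x ^+ 2]real_normK ?num_real// ler_sqr ?nnegrE ?gM.
Qed.

Lemma int01_abs_le f : L2 f -> int01 (fun x => `|f x|) <= L2norm f.
Proof.
move=> Lf.
have La : L2 (fun x => `|f x|).
  have /L2P[mf Lff] := Lf; apply/L2P; split; first exact: measurableT_comp.
  by apply: eq_L1 Lff => x _ /=; rewrite -normrM ger0_norm// -expr2 sqr_ge0.
have := int01_CS La (L2_cst 1).
rewrite L2norm_cst normr1.
have -> : L2norm (fun x => `|f x|) = L2norm f.
  apply/eqP; rewrite -(@eqrXn2 _ 2)// ?L2norm_ge0// !L2norm_sqr//; apply/eqP.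
  by apply: eq_int01 => x _ /=; rewrite -normrM ger0_norm// -expr2 sqr_ge0.
rewrite mulr1; apply: le_trans; rewrite (eq_int01 (g := (fun x => `|f x|) \* cst 1)) ?ler_norm//.
by move=> x _ /=; rewrite mulr1.
Qed.

Lemma aeqM f g f' g' : aeq f f' -> aeq g g' -> aeq (f \* g) (f' \* g').
Proof. by apply: aeS2 => x h1 h2 Ix /=; rewrite h1// h2. Qed.
Lemma aeqD f g f' g' : aeq f f' -> aeq g g' -> aeq (f \+ g) (f' \+ g').
Proof. by apply: aeS2 => x h1 h2 Ix /=; rewrite h1// h2. Qed.
Lemma aeqB f g f' g' : aeq f f' -> aeq g g' -> aeq (f \- g) (f' \- g').
Proof. by apply: aeS2 => x h1 h2 Ix /=; rewrite h1// h2. Qed.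
Lemma aeqZ a f f' : aeq f f' -> aeq (fun x => a * f x) (fun x => a * f' x).
Proof. by apply: aeS => x h1 Ix /=; rewrite h1. Qed.

Lemma aeq_L2norm f g : L2 f -> L2 g -> aeq f g -> L2norm f = L2norm g.
Proof.
move=> Lf Lg fg; apply/eqP; rewrite -(@eqrXn2 _ 2)// ?L2norm_ge0//.
rewrite !L2norm_sqr//; apply/eqP; apply: aeq_int01; last exact: aeqM.
  by apply: measurable_funM; exact: L2_meas.
by apply: measurable_funM; exact: L2_meas.
Qed.

Lemma L2norm_eq0 f : L2 f -> L2norm f = 0 -> aeq f (fun=> 0).
Proof.
move=> Lf f0.
have : fine ('N[mu]_2%:E[EFin \o (f \_ I01)])%E = 0 by [].
have := fine_Lnormr_eq0 (f := Lfun_Sub (lee1n 2) Lf) => /[apply].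
apply: aeS => x /= h Ix; have := h I; rewrite patchE mem_set//.
Qed.
End L2basics.
#[global] Hint Resolve mI01 : core.

(** * Fubini for a product of two functions restricted to a region of the plane *)

Section FubiniProd.
Context d (T : measurableType d) (R : realType).
Variable mu : {sigma_finite_measure set T -> \bar R}.
Variables (F G : T -> R) (P : T * T -> bool).
Hypotheses (iF : mu.-integrable setT (EFin \o F)) (iG : mu.-integrable setT (EFin \o G)).
Hypothesis mP : measurable_fun setT P.

Lemma EFin_Rint (k : T -> R) : mu.-integrable setT (EFin \o k) ->
  (\int[mu]_x k x)%:E = (\int[mu]_x (k x)%:E)%E.
Proof. by move=> ik; rewrite /Rintegral fineK// integrable_fin_num. Qed.

Lemma Fubini_prod :
  \int[mu]_x (F x * \int[mu]_y (if P (x, y) then G y else 0)) =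
  \int[mu]_y (G y * \int[mu]_x (if P (x, y) then F x else 0)).
Proof.
have mF : measurable_fun setT F by exact/measurable_EFinP/(measurable_int mu).
have mG : measurable_fun setT G by exact/measurable_EFinP/(measurable_int mu).
pose h (z : T * T) : R := if P z then F z.1 * G z.2 else 0.
have mh : measurable_fun setT h.
  apply: measurable_fun_ifT => //.
  by apply: measurable_funM; exact: measurableT_comp.
have ih : (mu \x mu)%E.-integrable setT (EFin \o h).
  apply/integrable12ltyP; first exact/measurable_EFinP.
  apply: (@le_lt_trans _ _ (\int[mu]_x (`|F x|%:E * \int[mu]_y `|(G y)%:E|))%E).
    apply: ge0_le_integral => //.
    - by move=> x _; exact: integral_ge0.
    - apply: (@measurable_fun_fubini_tonelli_F _ _ _ _ _ mu (fun z => `|(h z)%:E|)%E).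
        by apply/measurable_EFinP; exact: measurableT_comp.
      by [].
    - apply: emeasurable_funM; last exact: measurable_cst.
      by apply/measurable_EFinP; exact: measurableT_comp.
    - move=> x _; rewrite -ge0_integralZl//=; last exact/measurable_EFinP/measurableT_comp.
      apply: ge0_le_integral => //=.
      + apply/measurable_EFinP; apply: measurableT_comp => //.
        by apply: (measurableT_comp mh); exact: measurable_pair1.
      + apply: emeasurable_funM; first exact: measurable_cst.
        by apply/measurable_EFinP; exact: measurableT_comp.
      + move=> y _; rewrite /h/= -EFinM lee_fin -normrM; case: ifP => //.
        by rewrite normr0.
  rewrite ge0_integralZr//=; [|exact/measurable_EFinP/measurableT_comp|exact: integral_ge0].
  have /integrableP[_ iF'] := iF; have /integrableP[_ iG'] := iG.
  by apply: lte_mul_pinfty => //; [exact: integral_ge0|rewrite ge0_fin_numE//; exact: integral_ge0].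
have H : (\int[mu]_x \int[mu]_y (h (x, y))%:E = \int[mu]_y \int[mu]_x (h (x, y))%:E)%E.
  exact: (Fubini ih).
have ixy x : mu.-integrable setT (EFin \o (fun y => if P (x, y) then G y else 0)).
  apply: (le_integrable _ _ _ iG) => //.
    apply/measurable_EFinP; apply: measurable_fun_ifT => //.
    by apply: (measurableT_comp mP); exact: measurable_pair1.
  by move=> y _ /=; rewrite lee_fin; case: ifP => //; rewrite normr0.
have iyx y : mu.-integrable setT (EFin \o (fun x => if P (x, y) then F x else 0)).
  apply: (le_integrable _ _ _ iF) => //.
    apply/measurable_EFinP; apply: measurable_fun_ifT => //.
    by apply: (measurableT_comp mP); exact: measurable_pair2.
  by move=> x _ /=; rewrite lee_fin; case: ifP => //; rewrite normr0.
transitivity (fine (\int[mu]_x \int[mu]_y (h (x, y))%:E)%E).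
  congr fine; apply: eq_integral => x _; rewrite EFinM (EFin_Rint (ixy x)) -(integralZl measurableT (ixy x)).
  by apply: eq_integral => y _; rewrite /h/= -EFinM; case: ifP => //; rewrite mulr0.
rewrite H; congr fine; apply: eq_integral => y _; rewrite EFinM (EFin_Rint (iyx y)) -(integralZl measurableT (iyx y)).
by apply: eq_integral => x _; rewrite /h/= -EFinM; case: ifP => _; rewrite ?mulr0// mulrC.
Qed.

End FubiniProd.

(** * Absolutely continuous functions, product rule, integration by parts *)

Section Primitives.
Context {R : realType}.
Implicit Types f g h : R -> R.
Local Notation mu := (@lebesgue_measure R).

Definition ind (s x : R) : R := ((x < s)%R : bool)%:R.
Definition prim g (s : R) : R := int01 (fun x => ind s x * g x).
(** The equality is asked at every real [s], and [prim g] is constant on each side of [0, 1]; so [f]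
    is frozen outside the interval, is continuous on the whole line when [g] is in L^2, and its
    values at 0 and 1 are genuine boundary values. *)
Definition AC f g := forall s, f s = f 0 + prim g s.

Lemma meas_ind (s : R) : measurable_fun I01 (ind s).
Proof.
have -> : ind s = (fun x => if (x < s)%R then 1 else 0).
  by apply/funext => x; rewrite /ind; case: ifP.
apply: measurable_funTS; apply: measurable_fun_ifT => //.
exact: measurable_fun_ltr.
Qed.

Lemma ind_le1 (s x : R) : `|ind s x| <= 1 :> R.
Proof. by rewrite /ind; case: (x < s); rewrite ?normr1 ?normr0. Qed.

Lemma L1_ind s g : L1 g -> L1 (fun x => ind s x * g x).
Proof.
move=> Lg; apply: (L1_le _ _ (L1_abs Lg)).
  by apply: measurable_funM; [exact: meas_ind|exact: L1_meas].
by move=> x _; rewrite normrM ler_piMl ?ind_le1.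
Qed.

Lemma L2_ind s g : L2 g -> L2 (fun x => ind s x * g x).
Proof.
move=> Lg; have := L2M_bounded Lg (meas_ind s) (fun x _ => ind_le1 s x).
by apply: eq_L2 => x _ /=; rewrite mulrC.
Qed.

Lemma prim0 g : prim g 0 = 0.
Proof.
rewrite /prim -[RHS]int01_0; apply: eq_int01 => x; rewrite /I01/= in_itv/= => /andP[x0 _].
by rewrite /ind ltNge (ltW x0) mul0r.
Qed.

Lemma prim_ge1 g s : 1 <= s -> prim g s = int01 g.
Proof.
move=> s1; apply: eq_int01 => x; rewrite /I01/= in_itv/= => /andP[_ x1].
by rewrite /ind (lt_le_trans x1 s1) mul1r.
Qed.

Lemma prim1 g : prim g 1 = int01 g. Proof. exact: prim_ge1. Qed.

Lemma prim_le0 g s : s <= 0 -> prim g s = 0.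
Proof.
move=> s0; rewrite -[RHS]int01_0; apply: eq_int01 => x.
by rewrite /I01/= in_itv/= => /andP[x0 _]; rewrite /ind ltNge (le_trans s0 (ltW x0)) mul0r.
Qed.

Lemma primD f g s : L1 f -> L1 g -> prim (f \+ g) s = prim f s + prim g s.
Proof.
move=> Lf Lg; rewrite /prim -int01D; [|exact: L1_ind..].
by apply: eq_int01 => x _ /=; rewrite mulrDr.
Qed.
Lemma primZ a f s : L1 f -> prim (fun x => a * f x) s = a * prim f s.
Proof.
move=> Lf; rewrite /prim -int01Z; last exact: L1_ind.
by apply: eq_int01 => x _ /=; rewrite mulrCA.
Qed.
Lemma primN f s : L1 f -> prim (\- f) s = - prim f s.
Proof.
move=> Lf; rewrite /prim -int01N; last exact: L1_ind.
by apply: eq_int01 => x _ /=; rewrite mulrN.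
Qed.
Lemma primB f g s : L1 f -> L1 g -> prim (f \- g) s = prim f s - prim g s.
Proof. by move=> Lf Lg; rewrite primD ?primN//; exact: L1N. Qed.

Lemma aeq_prim f g s : measurable_fun I01 f -> measurable_fun I01 g -> aeq f g ->
  prim f s = prim g s.
Proof.
move=> mf mg fg; apply: aeq_int01; last exact: aeqM (aeq_refl _) fg.
  by apply: measurable_funM => //; exact: meas_ind.
by apply: measurable_funM => //; exact: meas_ind.
Qed.

Lemma int01_indB (r s : R) : r <= s -> int01 (fun x => ind s x - ind r x) <= s - r.
Proof.
move=> rs; rewrite (eq_int01 (g := fun x => \1_(`[r, s[ : set R) x)); last first.
  move=> x _; rewrite /ind indicE; case: ltP => xs; case: ltP => xr.
  - by rewrite memNset ?subrr//= in_itv/= leNgt xr.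
  - by rewrite mem_set ?subr0//= in_itv/= xr xs.
  - by have := lt_le_trans xr rs; rewrite ltNge xs.
  - by rewrite memNset ?subrr//= in_itv/= ltNge xs andbF.
rewrite /int01 /Rintegral integral_indic//.
have le1 : (mu (`[r, s[ `&` I01) <= (s - r)%:E)%E.
  apply: (@le_trans _ _ (mu `[r, s[)).
    apply: le_measure; rewrite ?inE//; exact: measurableI.
  rewrite lebesgue_measure_itv/= lte_fin; case: ltP => //.
  by rewrite lee_fin subr_ge0.
rewrite -[leRHS]/(fine (s - r)%:E) fine_le//.
by rewrite ge0_fin_numE// (le_lt_trans le1)// ltey.
Qed.

(** Cauchy-Schwarz against the indicator of [r, s[. *)
Lemma prim_diff_ge g (r s : R) : L2 g -> r <= s ->
  `|prim g s - prim g r| <= L2norm g * Num.sqrt (s - r).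
Proof.
move=> Lg rs; rewrite /prim -int01B; [|exact/L1_ind/L2_L1..].
set k : R -> R := fun x => ind s x - ind r x.
have k01 x : 0 <= k x <= 1.
  rewrite /k /ind; case: ltP => xs; case: ltP => xr //=; rewrite ?subrr ?subr0 ?lexx ?ler01//.
  by have := lt_le_trans xr rs; rewrite ltNge xs.
have mk : measurable_fun I01 k by apply: measurable_funB; exact: meas_ind.
have kb x : I01 x -> `|k x| <= 1 by move=> _; have /andP[? ?] := k01 x; rewrite ger0_norm.
have Lk : L2 k by exact: L2_bounded kb.
rewrite (eq_int01 (g := g \* k)); last by move=> x _; rewrite /k/=; ring.
apply: (le_trans (int01_CS Lg Lk)); rewrite ler_wpM2l ?L2norm_ge0//.
apply: L2norm_le => //; rewrite sqr_sqrtr ?subr_ge0//.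
apply: le_trans (int01_indB rs); apply: le_int01; [exact: L1M|exact: L2_L1|].
by move=> x _; rewrite -/(k x) /=; have /andP[? ?] := k01 x; nra.
Qed.

Lemma prim_diff g (r s : R) : L2 g ->
  `|prim g s - prim g r| <= L2norm g * Num.sqrt `|s - r|.
Proof.
move=> Lg; have [rs|sr] := leP r s; first by rewrite [in leRHS]ger0_norm ?subr_ge0// prim_diff_ge.
have h := prim_diff_ge Lg (ltW sr).
have e1 : `|s - r| = r - s by rewrite distrC ger0_norm// subr_ge0 ltW.
by rewrite distrC e1.
Qed.

Lemma prim_bound1 g s : L1 g -> `|prim g s| <= int01 (fun x => `|g x|).
Proof.
move=> Lg; apply: (le_trans (int01_abs (L1_ind s Lg))).
apply: le_int01; [exact/L1_abs/L1_ind|exact: L1_abs|].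
by move=> x _; rewrite normrM ler_piMl ?ind_le1.
Qed.

Lemma prim_bound g s : L2 g -> `|prim g s| <= L2norm g.
Proof. by move=> Lg; rewrite (le_trans (prim_bound1 s (L2_L1 Lg)))// int01_abs_le. Qed.

Lemma sqrt_small (C e : R) : 0 <= C -> 0 < e ->
  exists2 d, 0 < d & forall x, 0 <= x -> x < d -> C * Num.sqrt x < e.
Proof.
move=> C0 e0; exists ((e / (C + 1)) ^+ 2); first by rewrite exprn_gt0// divr_gt0// ltr_wpDl.
move=> x x0 xd; have C1 : 0 < C + 1 by rewrite ltr_wpDl.
have : Num.sqrt x < e / (C + 1).
  rewrite -[ltRHS]ger0_norm ?divr_ge0 ?(ltW e0) ?(ltW C1)// -sqrtr_sqr ltr_sqrt//.
  by rewrite exprn_gt0// divr_gt0.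
rewrite ltr_pdivlMr// => h; apply: le_lt_trans h.
by rewrite mulrC ler_wpM2l ?sqrtr_ge0// lerDl.
Qed.

Lemma prim_continuous g : L2 g -> continuous (prim g).
Proof.
move=> Lg x; apply/cvgrPdist_lt => e e0.
have [d d0 H] := sqrt_small (L2norm_ge0 g) e0.
near=> y; apply: (le_lt_trans (prim_diff y x Lg)); apply: H => //.
Unshelve. all: by end_near. Qed.

Lemma AC_continuous f g : L2 g -> AC f g -> continuous f.
Proof.
move=> Lg /funext ->; move=> x; apply: cvgD; first exact: cvg_cst.
exact: prim_continuous.
Qed.

Lemma cont_meas f : continuous f -> measurable_fun I01 f.
Proof. by move=> cf; apply: measurable_funTS; exact: continuous_measurable_fun. Qed.

Lemma AC_diff f g s r : L2 g -> AC f g -> `|f s - f r| <= L2norm g * Num.sqrt `|s - r|.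
Proof.
by move=> Lg H; rewrite (H s) (H r) opprD addrACA subrr add0r prim_diff.
Qed.

Lemma AC_clip_le0 f g s : AC f g -> s <= 0 -> f s = f 0.
Proof. by move=> H s0; rewrite H prim_le0// addr0. Qed.
Lemma AC_clip_ge1 f g s : AC f g -> 1 <= s -> f s = f 1.
Proof. by move=> H s0; rewrite H prim_ge1// -prim1 -H. Qed.

(* the sup norm is controlled by the H^1 norm: |f s - f r| <= |f'|_2, averaged over r *)
Lemma AC_sup f g s : L2 g -> AC f g -> `|f s| <= L2norm f + L2norm g.
Proof.
move=> Lg H.
have cf := AC_continuous Lg H.
have bd01 x y : 0 <= x <= 1 -> 0 <= y <= 1 -> `|f x - f y| <= L2norm g.
  move=> /andP[x0 x1] /andP[y0 y1]; apply: (le_trans (AC_diff x y Lg H)).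
  rewrite ler_piMr ?L2norm_ge0// -[leRHS]sqrtr1 ler_wsqrtr// ler_norml; lra.
wlog /andP[s0 s1] : s / 0 <= s <= 1 => [hw|].
  have [s0|s0] := leP s 0; first by rewrite (AC_clip_le0 H s0); apply: hw; rewrite lexx ler01.
  have [s1|s1] := leP 1 s; first by rewrite (AC_clip_ge1 H s1); apply: hw; rewrite lexx ler01.
  by apply: hw; rewrite !ltW.
have Lf : L2 f.
  apply: (@L2_bounded _ _ (`|f s| + L2norm g)); first exact: cont_meas.
  move=> x; rewrite /I01/= in_itv/= => /andP[x0 x1].
  have -> : f x = f s + (f x - f s) by ring.
  by rewrite (le_trans (ler_normD _ _))// lerD2l bd01// ?s0 ?s1// !ltW.
rewrite -lerBlDr -[X in X <= _]int01_cst.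
apply: le_trans (int01_abs_le Lf); apply: le_int01; [exact: L1_cst|exact/L1_abs/L2_L1|].
move=> x; rewrite /I01/= in_itv/= => /andP[x0 x1]; rewrite lerBlDr.
have -> : f s = f x + (f s - f x) by ring.
by rewrite (le_trans (ler_normD _ _))// lerD2l bd01// ?s0 ?s1// !ltW.
Qed.

Lemma AC_bounded f g x : L2 g -> AC f g -> `|f x| <= `|f 0| + L2norm g.
Proof. by move=> Lg ->; rewrite (le_trans (ler_normD _ _))// lerD2l prim_bound. Qed.

Lemma AC_L2 f g : L2 g -> AC f g -> L2 f.
Proof.
move=> Lg H; apply: (@L2_bounded _ _ (`|f 0| + L2norm g)).
  by apply: cont_meas; exact: (AC_continuous Lg H).
by move=> x _; exact: AC_bounded.
Qed.

Lemma L2_AC f f' g : L2 f -> AC g f' -> L2 f' -> L2 (f \* g).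
Proof.
move=> Lf H Lf'; apply: (@L2M_bounded _ _ _ (`|g 0| + L2norm f')) => //.
  by apply: cont_meas; exact: (AC_continuous Lf' H).
by move=> x _; exact: AC_bounded.
Qed.

(** The unit square is cut along its diagonal, and each triangle is one of the two iterated
    integrals. *)
Lemma int01_fubini f g : L2 f -> L2 g ->
  int01 f * int01 g = int01 (f \* prim g) + int01 (g \* prim f).
Proof.
move=> Lf Lg; have L1f := L2_L1 Lf; have L1g := L2_L1 Lg.
have [mf mg] := (L2_meas Lf, L2_meas Lg).
have mP : measurable_fun setT (fun z : measurableTypeR R * measurableTypeR R => z.2 < z.1).
  exact: measurable_fun_ltr.
have /L1_restrict iF := L1f; have /L1_restrict iG := L1g.
have H := Fubini_prod iF iG mP.
have A1 : int01 (f \* prim g) = \int[mu]_y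
    ((g \_ I01) y * \int[mu]_x (if y < x then (f \_ I01) x else 0)).
  rewrite -H /int01 Rintegral_mkcond; apply: eq_Rintegral => x _.
  rewrite restrictM/= !patchE; case: ifPn => Ix; last by rewrite !mul0r.
  congr (_ * _).
  rewrite /prim /int01 Rintegral_mkcond; apply: eq_Rintegral => y _.
  by rewrite !patchE /ind; case: ifP; case: ltP; rewrite ?mul1r ?mul0r.
clear H mP iF iG.
have A2 : int01 (g \* (fun y => int01 f - prim f y)) = \int[mu]_y
    ((g \_ I01) y * \int[mu]_x (if y < x then (f \_ I01) x else 0)).
  rewrite /int01 Rintegral_mkcond; apply: eq_Rintegral => y _.
  rewrite restrictM/= !patchE; case: ifPn => Iy; last by rewrite !mul0r.
  congr (_ * _).
  have mi : measurable_fun I01 (fun x => if (y < x)%R then 1 else 0 : R).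
    by apply: measurable_funTS; apply: measurable_fun_ifT => //; exact: measurable_fun_ltr.
  clear A1 Iy; rewrite -/(int01 f) -[prim f y]/(int01 _) -int01B//; last exact: L1_ind.
  transitivity (int01 (f \* (fun x => if (y < x)%R then 1 else 0))).
    (* The strict inequalities on both sides miss the point x = y, which is a null set. *)
    apply: aeq_int01; last first.
    - exists [set y]; split => //; first exact: lebesgue_measure_set1.
      move=> x /= /not_implyP[_].
      by rewrite /ind; case: ltgtP; rewrite ?mul1r ?mul0r ?mulr0 ?mulr1 ?subrr ?subr0.
    - exact: measurable_funM.
    - by apply: measurable_funB => //; apply: measurable_funM => //; exact: meas_ind.
  rewrite /int01 Rintegral_mkcond; apply: eq_Rintegral => x _.
  by rewrite !patchE/=; case: ifP => //; case: ifP; rewrite ?mulr1 ?mulr0.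
have mp : measurable_fun I01 (prim f) by apply: cont_meas; exact: prim_continuous.
have Lgp : L1 (g \* prim f).
  by apply: L2_L1; apply: (L2M_bounded Lg mp) => x _; exact: prim_bound.
rewrite A1 -A2 -[X in _ = X + _](_ : int01 ((fun y => int01 f * g y) \- (g \* prim f)) = _).
  by have LZ := L1Z (int01 f) L1g; rewrite int01B// int01Z// subrK.
by apply: eq_int01 => y _ /=; ring.
Qed.

Lemma prim_prim f s x : x <= s -> prim (fun y => ind s y * f y) x = prim f x.
Proof.
move=> xs; apply: eq_int01 => y _; rewrite /ind; case: ltP; rewrite ?mul0r// => yx.
by rewrite (lt_le_trans yx xs) !mul1r.
Qed.

(** For primitives vanishing at 0 the product rule is [int01_fubini] for the derivatives cut off at
    [s]; the values at 0 enter linearly. *)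
Lemma ACM f f' g g' : L2 f' -> L2 g' -> AC f f' -> AC g g' ->
  AC (f \* g) ((f' \* g) \+ (f \* g')).
Proof.
move=> Lf Lg Hf Hg s.
have Lp : L2 (prim f') by apply: (AC_L2 Lf) => x; rewrite prim0 add0r.
have Lq : L2 (prim g') by apply: (AC_L2 Lg) => x; rewrite prim0 add0r.
have ACp h : AC (prim h) h by move=> x; rewrite prim0 add0r.
have L1a : L2 (f' \* prim g') by apply: L2_AC (ACp _) _.
have L1b : L2 (g' \* prim f') by apply: L2_AC (ACp _) _.
have key : prim f' s * prim g' s = prim (f' \* prim g') s + prim (g' \* prim f') s.
  have := int01_fubini (L2_ind s Lf) (L2_ind s Lg).
  rewrite -/(prim f' s) -/(prim g' s) => ->; congr (_ + _); apply: eq_int01 => x _ /=;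
  rewrite /ind -!mulrA; case: ltP => xs; rewrite ?mul0r// ?mul1r prim_prim// ltW//.
rewrite /= (_ : (f' \* g) \+ (f \* g') = ((fun x => g 0 * f' x) \+ (f' \* prim g')) \+
    ((fun x => f 0 * g' x) \+ (g' \* prim f'))); last first.
  by apply/funext => x /=; rewrite (Hf x) (Hg x); ring.
have [K1 K2] := (L2_L1 L1a, L2_L1 L1b).
have [K3 K4] := (L1Z (g 0) (L2_L1 Lf), L1Z (f 0) (L2_L1 Lg)).
rewrite primD; [|exact: L1D..].
rewrite (primD _ K3 K1) (primD _ K4 K2) !primZ; [|exact: L2_L1..].
rewrite /= (Hf s) (Hg s).
move: key.
move: (prim f' s) (prim g' s) (prim _ _) (prim _ _) => a b c d.
move=> key; have -> : (f 0 + d) * (g 0 + c) = f 0 * g 0 + g 0 * d + f 0 * c + d * c by ring.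
by rewrite key; ring.
Qed.

Lemma ACM_L2 f f' g g' : L2 f' -> L2 g' -> AC f f' -> AC g g' ->
  L2 ((f' \* g) \+ (f \* g')).
Proof.
move=> Lf Lg Hf Hg; apply: L2D; first exact: L2_AC Hg Lg.
by apply: eq_L2 (L2_AC Lg Hf Lf) => x _ /=; rewrite mulrC.
Qed.

Lemma int01_byparts f f' g g' : L2 f' -> L2 g' -> AC f f' -> AC g g' ->
  int01 (f' \* g) + int01 (f \* g') = f 1 * g 1 - f 0 * g 0.
Proof.
move=> Lf Lg Hf Hg; rewrite -int01D.
- have /(_ 1)/= -> := ACM Lf Lg Hf Hg; rewrite prim1; ring.
- exact/L2_L1/(L2_AC Lf Hg).
- by apply: eq_L1 (L2_L1 (L2_AC Lg Hf Lf)) => x _ /=; rewrite mulrC.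
Qed.

Lemma AC_aeq f g h : measurable_fun I01 g -> measurable_fun I01 h -> aeq g h ->
  AC f g -> AC f h.
Proof. by move=> mg mh gh Hf s; rewrite Hf (aeq_prim s mg mh gh). Qed.

Lemma ACD f f' g g' : L2 f' -> L2 g' -> AC f f' -> AC g g' -> AC (f \+ g) (f' \+ g').
Proof.
by move=> Lf Lg Hf Hg s; rewrite /= Hf Hg primD ?L2_L1//; [ring|exact: L2_L1..].
Qed.
Lemma ACZ a f f' : L2 f' -> AC f f' -> AC (fun x => a * f x) (fun x => a * f' x).
Proof. by move=> Lf Hf s; rewrite Hf primZ ?mulrDr//; exact: L2_L1. Qed.
Lemma ACN f f' : L2 f' -> AC f f' -> AC (\- f) (\- f').
Proof. by move=> Lf Hf s; rewrite /= Hf primN ?opprD//; exact: L2_L1. Qed.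
Lemma ACB f f' g g' : L2 f' -> L2 g' -> AC f f' -> AC g g' -> AC (f \- g) (f' \- g').
Proof. by move=> Lf Lg Hf Hg; apply: ACD => //; [exact: L2N|exact: ACN]. Qed.
Lemma AC_cst (c : R) : AC (cst c : R -> R) ((fun=> 0) : R -> R).
Proof.
move=> s; rewrite /prim (eq_int01 (g := (fun=> 0) : R -> R)) ?int01_0 ?addr0// => x _.
by rewrite mulr0.
Qed.
Lemma AC_prim g : AC (prim g) g.
Proof. by move=> s; rewrite prim0 add0r. Qed.

(** Nearest-point projection onto [0, 1]; composing with it turns a formula valid on [0, 1] into an
    instance of [AC] ([AC_of_01]). *)
Definition clip (s : R) : R := Num.max 0 (Num.min s 1).

Lemma clipE s : 0 <= s <= 1 -> clip s = s.
Proof. by move=> /andP[? ?]; rewrite /clip min_l// max_r. Qed.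
Lemma clip01 s : 0 <= clip s <= 1.
Proof. by rewrite /clip le_max lexx/= ge_max ler01 ge_min lexx orbT. Qed.
Lemma I01_01 (s : R) : I01 s -> 0 <= s <= 1.
Proof. by rewrite /I01/= in_itv/= => /andP[? ?]; rewrite !ltW. Qed.

Lemma AC_of_01 f g : (forall s, 0 <= s <= 1 -> f s = f 0 + prim g s) -> AC (f \o clip) g.
Proof.
move=> H s; have c0 : clip 0 = 0 by rewrite clipE// lexx ler01.
rewrite /= H ?clip01// c0; congr (_ + _).
have [s0|s0] := leP s 0.
  by rewrite (prim_le0 _ s0) /clip min_l ?(le_trans s0 ler01)// max_l// prim0.
have [s1|s1] := leP 1 s; first by rewrite (prim_ge1 _ s1) /clip min_r// max_r// prim1.
by rewrite clipE// !ltW.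
Qed.

(** Differentiability is asked to the right of -1 only: the solutions of differential equations
    below are built there, so that 0 is an interior point. *)
Lemma FTC01_gt (f g : R -> R) : (forall x : R, -1 < x -> is_derive x 1 f (g x)) -> continuous g ->
  forall s, 0 <= s <= 1 -> f s = f 0 + prim g s.
Proof.
move=> df cg s /andP[s0 s1]; have [->|sN0] := eqVneq s 0; first by rewrite prim0 addr0.
have {sN0}s0 : 0 < s by rewrite lt_def sN0.
have cf x : -1 < x -> {for x, continuous f}.
  by move=> x1; have := df x x1; move=> dfx; apply: differentiable_continuous; apply/derivable1_diffP.
have m1 : -1 < 0 :> R by exact: ltrN10.
have ms : -1 < s := lt_trans m1 s0.
have := @continuous_FTC2 R g f 0 s s0 (continuous_subspaceT cg).
have dcf : derivable_oo_LRcontinuous f 0 s.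
  split.
  - move=> x; rewrite in_itv/= => /andP[x0 _]; have := df x (lt_trans m1 x0) => dfx; exact: ex_derive.
  - by apply: cvg_at_right_filter; exact: cf.
  - by apply: cvg_at_left_filter; exact: cf.
move=> /(_ dcf) H.
have E : \int[mu]_(x in `[0, s]) g x = f s - f 0.
  rewrite /Rintegral H// => x; rewrite in_itv/= => /andP[x0 _].
  by have := df x (lt_trans m1 x0) => dfx; rewrite derive1E derive_val.
suff -> : prim g s = \int[mu]_(x in `[0, s]) g x by rewrite E; ring.
have ig : mu.-integrable `[0, s] (EFin \o g).
  apply: continuous_compact_integrable; first exact: segment_compact.
  exact: continuous_subspaceT.
rewrite -Rintegral_itv_obnd_cbnd; last by apply: integrableS ig => //; exact: subset_itv_oc_cc.
rewrite -Rintegral_itv_bndo_bndc; last by apply: integrableS ig => //; exact: subset_itv_oo_cc.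
rewrite /prim /int01 [LHS]Rintegral_mkcond [RHS]Rintegral_mkcond.
apply: eq_Rintegral => x _; rewrite /ind !patchE.
have -> : (x \in (I01 : set R)) = (0 < x < 1).
  by apply/idP/idP; rewrite inE /I01/= in_itv.
have -> : (x \in (`]0, s[%classic : set R)) = (0 < x < s).
  by apply/idP/idP; rewrite inE/= in_itv.
case: (ltP 0 x) => //= x0; case: (ltP x s) => xs; last by rewrite mul0r; case: ifP.
by rewrite (lt_le_trans xs s1) mul1r.
Qed.

Lemma FTC01 (f g : R -> R) : (forall x : R, is_derive x 1 f (g x)) -> continuous g ->
  forall s, 0 <= s <= 1 -> f s = f 0 + prim g s.
Proof. by move=> df; apply: FTC01_gt => x _; exact: df. Qed.

End Primitives.

#[global] Opaque int01 prim L2norm L1 L2.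

(** * Smooth functions with compact support *)

Section TestFunctions.
Context {R : realType}.
Implicit Types (f g phi : R -> R) (w p : {poly R}).
Local Notation mu := (@lebesgue_measure R).

(** The functions p w^-n exp(- 1 / w), extended by 0 where w <= 0, form a family stable under
    derivation, so smoothness of bumps reduces to one first derivative; [bmp_next] is the new
    numerator. *)
Definition bmp w p (n : nat) (x : R) : R :=
  if 0 < w.[x] then p.[x] * (w.[x]^-1) ^+ n * expR (- w.[x]^-1) else 0.

Definition bmp_next w p n : {poly R} :=
  p^`() * w ^+ 2 - n%:R *: (p * w^`() * w) + p * w^`().

Lemma pow_expRN (n : nat) (u : R) : 0 <= u -> u ^+ n.+1 * expR (- u) <= n.+1`!%:R.
Proof.
move=> u0; rewrite expRN ler_pdivrMr ?expR_gt0//.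
rewrite -ler_pdivrMl ?ltr0n ?fact_gt0// mulrC.
by apply: le_trans (expR_ge1Dxn n u0); rewrite lerDr.
Qed.

(** With u = 1 / w the function is p w^2 times u^(n+2) exp(- u), and the last product is bounded by
    a factorial. Vanishing to second order gives derivative 0 at the zeros of [w]. *)
Lemma bmp_bound w p n x : `|bmp w p n x| <= n.+2`!%:R * `|p.[x]| * w.[x] ^+ 2.
Proof.
rewrite /bmp; case: ltP => w0; last by rewrite normr0 mulr_ge0 ?sqr_ge0// mulr_ge0.
set u := w.[x]^-1; have u0 : 0 <= u by rewrite invr_ge0 ltW.
rewrite -mulrA normrM [X in _ * X <= _]ger0_norm ?mulr_ge0 ?exprn_ge0 ?expR_ge0//.
rewrite mulrAC [leRHS]mulrC ler_wpM2l//.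
have -> : w.[x] ^+ 2 = (u ^+ 2)^-1 by rewrite /u exprVn invrK.
rewrite ler_pdivlMr ?exprn_gt0 ?invr_gt0//.
by apply: le_trans (pow_expRN n.+1 u0); rewrite mulrAC -exprD addn2.
Qed.

Lemma bmp_derive w p n (x : R) :
  is_derive x 1 (bmp w p n) (bmp w (bmp_next w p n) n.+2 x).
Proof.
have cw : {for x, continuous (horner w)} by exact: continuous_horner.
case: (ltgtP 0 w.[x]) => w0.
- have h : \forall y \near x, p.[y] * (w.[y]^-1) ^+ n * expR (- w.[y]^-1) = bmp w p n y.
    have : \forall y \near x, 0 < w.[y] by exact: (cvgr_gt _ cw).
    by apply: filterS => y wy; rewrite /bmp wy.
  apply: near_eq_is_derive h _.
  have wN0 : w.[x] != 0 by rewrite gt_eqF.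
  have dV : is_derive x 1 (fun y => (horner w y)^-1) (- (w.[x]) ^- 2 *: w^`().[x]).
    exact: is_deriveV.
  have dE : is_derive x 1 (expR \o (fun y => - (horner w y)^-1))
      (expR (- w.[x]^-1) * - (- (w.[x]) ^- 2 *: w^`().[x])).
    by apply: is_derive1_comp.
  have dX : is_derive x 1 ((fun y => (horner w y)^-1) ^+ n)
    ((n%:R * w.[x]^-1 ^+ n.-1) *: (- (w.[x]) ^- 2 *: w^`().[x])) by exact: is_deriveX.
  have dP := is_deriveM (is_derive_poly p x) dX.
  have := is_deriveM dP dE.
  rewrite [X in is_derive _ _ X _](_ : _ = (fun y => p.[y] * (w.[y]^-1) ^+ n * expR (- w.[y]^-1))); last first.
    by apply/funext => y; rewrite /= !fctE.
  move=> H; apply: is_derive_eq H _.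
  have sc (k l : R) : k *: (l : R^o) = k * l by [].
  rewrite !fctE /bmp w0 /bmp_next !(hornerD, hornerN, hornerZ, hornerM, horner_exp).
  move: (expR (- w.[x]^-1)) => E; rewrite !sc !exprVn; clear dX dP dE dV.
  case: n => [|n]; first by rewrite !expr0; field.
  rewrite -[n.+1.-1]/n -[n.+3]addn3 -addn1 !exprD.
  have An : w.[x] ^+ n != 0 by rewrite expf_neq0.
  move: (w.[x] ^+ n) An => A An.
  by field; rewrite wN0.
- have h : \forall y \near x, 0 = bmp w p n y.
    have : \forall y \near x, w.[y] < 0 by exact: (cvgr_lt _ cw).
    by apply: filterS => y wy; rewrite /bmp ltNge (ltW wy).
  apply: (near_eq_is_derive h).
  rewrite /bmp ltNge (ltW w0); exact: is_derive_cst.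
- have b0 : bmp w (bmp_next w p n) n.+2 x = 0 by rewrite /bmp -w0 ltxx.
  have b1 : bmp w p n x = 0 by rewrite /bmp -w0 ltxx.
  rewrite b0; apply/is_derive1_caratheodory.
  pose gg z := bmp w p n z / (z - x).
  have gg0 : gg x = 0 by rewrite /gg b1 mul0r.
  exists gg; split; rewrite /gg.
  + move=> z; rewrite b1 subr0; have [->|zx] := eqVneq z x; first by rewrite b1 !mul0r.
    by rewrite divfK// subr_eq0.
  + rewrite -/gg /prop_for /continuous_at gg0.
    (* Near its zero, w is a multiple of y - x, so [bmp_bound] makes the slope O(y - x). *)
    have /factor_theorem[q wq] : root w x by rewrite rootE -w0.
    apply/cvgr0Pnorm_lt => e e0.
    pose r : {poly R} := n.+2`!%:R *: (q ^+ 2).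
    have cr : (fun y => `|p.[y]| * r.[y] * `|y - x|) @ x --> `|p.[x]| * r.[x] * `|x - x|.
      apply: cvgM; first apply: cvgM.
      * by apply: cvg_norm; exact: continuous_horner.
      * exact: continuous_horner.
      * by apply: cvg_norm; apply: cvgB; [exact: cvg_id|exact: cvg_cst].
    rewrite subrr normr0 mulr0 in cr.
    have : \forall y \near x, `|p.[y]| * r.[y] * `|y - x| < e by exact: (cvgr_lt _ cr).
    apply: filterS => y; apply: le_lt_trans; rewrite normrM normfV.
    have [->|yx] := eqVneq y x; first by rewrite subrr normr0 invr0 !mulr0.
    rewrite ler_pdivrMr ?normr_gt0 ?subr_eq0//.
    apply: (le_trans (bmp_bound w p n y)).
    have -> : w.[y] ^+ 2 = q.[y] ^+ 2 * (`|y - x| * `|y - x|).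
      by rewrite -normrM ger0_norm -?expr2 ?sqr_ge0// wq hornerM hornerXsubC exprMn.
    rewrite /r hornerZ horner_exp.
    by rewrite le_eqVlt; apply/orP; left; apply/eqP; ring.
  + by rewrite b1 mul0r.
Qed.

Definition smooth phi := forall n (x : R), derivable (derive1n n phi) x 1.

Lemma bmp_derive1n w p n k : exists p' n', derive1n k (bmp w p n) = bmp w p' n'.
Proof.
elim: k => [|k [p' [n' IH]]]; first by exists p, n.
exists (bmp_next w p' n'), n'.+2; rewrite derive1nS IH; apply/funext => x.
by rewrite derive1E; have /@derive_val -> := bmp_derive w p' n' x.
Qed.

Lemma bmp_smooth w p n : smooth (bmp w p n).
Proof.
move=> k x; have [p' [n' ->]] := bmp_derive1n w p n k.
exact: (@ex_derive _ _ _ _ _ _ _ (bmp_derive w p' n' x)).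
Qed.

Lemma test_of phi (a b : R) : smooth phi -> 0 < a -> b < 1 ->
  (forall x, phi x != 0 -> a <= x <= b) -> test_function phi.
Proof.
move=> sphi a0 b1 sab.
have cab : closure [set x | phi x != 0] `<=` `[a, b].
  have ce : closure (`[a, b]%classic : set R) = `[a, b]%classic.
    by apply/esym/closure_id; exact: interval_closed.
  rewrite -ce.
  by apply: closure_subset => x /= /sab; rewrite in_itv.
split => //.
- apply: (subclosed_compact _ (@segment_compact _ a b)) => //; exact: closed_closure.
- move=> x /cab; rewrite /I01/= !in_itv/= => /andP[ax xb].
  by rewrite (lt_le_trans a0 ax) (le_lt_trans xb b1).
Qed.

Lemma test_smooth phi : test_function phi -> smooth phi. Proof. by case. Qed.

Lemma smooth_deriv phi : smooth phi -> smooth (derive1n 1 phi).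
Proof. by move=> s n x; have := s n.+1 x; rewrite derive1Sn. Qed.

Lemma smooth_cont phi : smooth phi -> continuous phi.
Proof.
by move=> s x; apply: differentiable_continuous; apply/derivable1_diffP; exact: (s 0%N x).
Qed.

Lemma smooth_is_derive phi (x : R) : smooth phi -> is_derive x 1 phi (derive1n 1 phi x).
Proof. by move=> s; rewrite derive1n1 derive1E; apply: derivableP; exact: (s 0%N x). Qed.

Lemma test_out phi (x : R) : test_function phi -> ~~ (0 < x < 1) -> phi x = 0.
Proof.
move=> [_ _ sub] xI; apply/eqP; apply: contraNT xI => px.
have : I01 x by apply: sub; apply: subset_closure.
by rewrite /I01/= in_itv.
Qed.

Lemma test_near0 phi (x : R) : test_function phi -> ~~ (0 < x < 1) -> \forall y \near x, phi y = 0.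
Proof.
move=> [_ _ sub] xI.
have nx : ~ closure [set x | phi x != 0] x.
  by move=> /sub; rewrite /I01/= in_itv/=; apply/negP.
have := @closed_openC _ _ (@closed_closure _ [set x | phi x != 0]).
move=> /(_ x nx) h; apply: filterS h => y ny; apply/eqP; apply: contra_notT ny => h.
by apply: subset_closure.
Qed.

Lemma test_deriv phi : test_function phi -> test_function (derive1n 1 phi).
Proof.
move=> tphi; have [s c sub] := tphi.
have cs : closure [set x | derive1n 1 phi x != 0] `<=` closure [set x | phi x != 0].
  rewrite [X in _ `<=` X]((@closure_id _ (closure [set x | phi x != 0])).1 (@closed_closure _ _)).
  apply: closure_subset => x /= dx; apply: contrapT => nx; move/eqP: dx; apply.
  have h : \forall y \near x, 0 = phi y.
    have := @closed_openC _ _ (@closed_closure _ [set x | phi x != 0]).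
    move=> /(_ x nx) h; apply: filterS h => y ny; apply/esym/eqP; apply: contra_notT ny => h.
    by apply: subset_closure.
  by rewrite derive1E -(near_eq_derive _ h) derive_cst.
split; first exact: smooth_deriv.
- by apply: (subclosed_compact _ c) => //; exact: closed_closure.
- exact: subset_trans sub.
Qed.

Lemma test_AC phi : test_function phi -> AC phi (derive1n 1 phi).
Proof.
move=> t; have s := test_smooth t.
have H := FTC01 (fun x => smooth_is_derive x s) (smooth_cont (smooth_deriv s)).
have p0 : phi 0 = 0 by apply: test_out => //; rewrite ltxx.
have p1 : phi 1 = 0 by apply: test_out => //; rewrite ltxx andbF.
move=> x; have [x0|x0] := leP 0 x; last first.
  rewrite prim_le0 ?(ltW x0)// p0 addr0; apply: test_out => //.
  by rewrite negb_and -leNgt ltW.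
have [x1|x1] := leP x 1; first by apply: H; rewrite x0.
rewrite prim_ge1 ?(ltW x1)// -prim1 -H ?ler01 ?lexx// p1; apply: test_out => //.
by rewrite negb_and -!leNgt (ltW x1) orbT.
Qed.

Lemma test_L2 phi : test_function phi -> L2 phi.
Proof.
move=> t; apply: (AC_L2 _ (test_AC t)).
have c : continuous (derive1n 1 phi) by exact: smooth_cont (smooth_deriv (test_smooth t)).
have [M HM] : exists M, forall x, I01 x -> `|derive1n 1 phi x| <= M.
  have : bounded_set ((derive1n 1 phi) @` `[0, 1]).
    apply: compact_bounded; apply: continuous_compact; last exact: segment_compact.
    exact: continuous_subspaceT.
  move=> [M [_ HM]]; exists (M + 1) => x Ix; apply: HM; first by rewrite ltrDl.
  by exists x => //=; rewrite in_itv/= I01_01.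
by apply: (L2_bounded _ HM); exact: cont_meas.
Qed.

End TestFunctions.

(** * Fundamental lemma of the calculus of variations *)

Section WeakDerivatives.
Context {R : realType}.
Implicit Types (f g phi : R -> R).
Local Notation mu := (@lebesgue_measure R).

Transparent int01 prim L1.
Lemma prim_def g (s : R) : prim g s = int01 (fun x => ind s x * g x).
Proof. by []. Qed.

Lemma int01_dominated (f_ : nat -> R -> R) (h g : R -> R) : (forall n, measurable_fun I01 (f_ n)) ->
  measurable_fun I01 h -> L1 g -> (forall n x, I01 x -> `|f_ n x| <= g x) ->
  {ae mu, forall x, I01 x -> f_ ^~ x @ \oo --> h x} ->
  int01 (f_ n) @[n --> \oo] --> int01 h.
Proof.
move=> mf mh Lg fg fh.
have [|||||ih _ H] := @dominated_convergence _ _ _ mu I01 mI01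
  (fun n x => (f_ n x)%:E) (fun x => (h x)%:E) (fun x => (g x)%:E) _ _ _ _ _.
- by move=> n; move/measurable_EFinP : (mf n).
- by move/measurable_EFinP : mh.
- apply: aeS fh => x fx Ix; apply: cvg_EFin; first exact: nearW.
  exact: fx.
- exact: Lg.
- by apply: aeI => x n Ix; rewrite /= lee_fin fg.
apply: (fine_cvg (f := fun n => \int[mu]_(x in I01) (f_ n x)%:E)%E).
rewrite fineK; first exact: H.
exact: integrable_fin_num.
Qed.

Lemma primE g (x : R) : L1 g -> prim g x = \int[mu]_(t in `]-oo, x]) (g \_ I01) t.
Proof.
move=> Lg; have iG : mu.-integrable setT (EFin \o (g \_ I01)) by apply/L1_restrict.
rewrite -Rintegral_itv_bndo_bndc; last by apply: integrableS iG.
rewrite /prim /int01 [LHS]Rintegral_mkcond [RHS]Rintegral_mkcond.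
apply: eq_Rintegral => y _; rewrite /ind !patchE.
have -> : (y \in (`]-oo, x[%classic : set R)) = (y < x).
  by apply/idP/idP; rewrite inE/= in_itv.
by case: ifP; case: ifP; rewrite ?mul1r ?mul0r.
Qed.

(** Lebesgue differentiation: an integrable function is almost everywhere the derivative of its
    primitive. *)
Lemma prim_eq0 g : L1 g -> (forall x, prim g x = 0) -> aeq g (fun=> 0).
Proof.
move=> Lg g0; have iG : mu.-integrable setT (EFin \o (g \_ I01)) by apply/L1_restrict.
have li : locally_integrable [set: R] (g \_ I01).
  exact: (integrable_locally mI01 Lg).
have iy y : mu.-integrable `]-oo, y] (EFin \o (g \_ I01)) by apply: integrableS iG.
have := FTC1Ny iy li.
apply: aeS => x [_ Hx] Ix; move: Hx.
rewrite (_ : (fun z => _) = cst 0); last by apply/funext => z; rewrite -primE.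
by rewrite derive1_cst/= patchE mem_set.
Qed.

Lemma prim_derive g (x : R) : continuous g -> (forall y : R, ~~ (0 < y < 1) -> g y = 0) ->
  L1 g -> is_derive x 1 (prim g) (g x).
Proof.
move=> cg g0 Lg.
have gE : g \_ I01 = g.
  apply/funext => y; rewrite patchE; case: ifPn => // /negP yI; rewrite g0//.
  by apply/negP => yI'; apply: yI; rewrite inE /I01/= in_itv.
have iG : mu.-integrable setT (EFin \o g) by rewrite -gE; apply/L1_restrict.
have x1 : x < x + 1 by rewrite ltrDl.
have iG' : mu.-integrable [set` Interval -oo%O (BRight (x + 1))] (EFin \o g).
  exact: integrableS iG.
have [|df dE] := continuous_FTC1 x1 iG' _ (cg x); first by rewrite ltNyr.
have E : prim g = (fun x => \int[mu]_(t in [set` Interval -oo%O (BRight x)]) g t).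
  by apply/funext => y; rewrite primE// gE.
rewrite E; clear -df dE; apply: DeriveDef; first exact: df.
by rewrite -derive1E dE.
Qed.
Opaque int01 prim L1.

Lemma prim_cst1 (s : R) : 0 <= s <= 1 -> int01 (ind s) = s.
Proof.
move=> s01; have := @FTC01 R id (cst 1) (fun x => is_derive_id _ _) (@cst_continuous _ _ _) s s01.
rewrite /= add0r => e; rewrite [RHS]e prim_def.
by apply: eq_int01 => x _ /=; rewrite mulr1.
Qed.

(** The bumps exp(- 1 / ((n + 1) w0)) with w0 = (x - a)(b - x) converge boundedly to the indicator
    of ]a, b[, so [g] has integral 0 over every interval; the primitive of [g] is constant inside,
    and 0 by continuity at 0. *)
Lemma test_ae0 g : L2 g -> (forall phi, test_function phi -> int01 (g \* phi) = 0) ->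
  aeq g (fun=> 0).
Proof.
move=> Lg H.
have key a b : 0 < a -> a < b -> b < 1 -> prim g b = prim g a.
  move=> a0 ab b1.
  pose w0 : {poly R} := ('X - a%:P) * (b%:P - 'X).
  have w0E x : w0.[x] = (x - a) * (b - x) by rewrite /w0 !hornerE.
  have w0p x : 0 < w0.[x] -> a < x < b by rewrite w0E => h; apply/andP; split; nra.
  pose ph n := bmp (n.+1%:R *: w0) 1 0.
  have phE n x : ph n x = if a < x < b then expR (- (n.+1%:R * w0.[x])^-1) else 0.
    rewrite /ph /bmp hornerZ pmulr_rgt0// hornerC expr0 !mul1r.
    case: ifPn => [/w0p ->//|w0x]; case: ifPn => // /andP[ax xb].
    by move: w0x; rewrite w0E mulr_gt0// subr_gt0.
  have tph n : test_function (ph n).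
    apply: (test_of (a := a) (b := b)) => //; first exact: bmp_smooth.
    move=> x; rewrite phE; case: ifP => [/andP[ax xb] _|]; first by rewrite !ltW.
    by rewrite eqxx.
  pose hh x : R := if a < x < b then 1 else 0.
  have c1 : int01 (g \* ph n) @[n --> \oo] --> int01 (g \* hh).
    apply: (@int01_dominated _ _ (fun x => `|g x|)).
    - by move=> n; apply: measurable_funM; [exact: L2_meas|exact: L2_meas (test_L2 (tph n))].
    - apply: measurable_funM; first exact: L2_meas.
      apply: measurable_funTS; apply: measurable_fun_ifT => //.
      by apply: measurable_and; exact: measurable_fun_ltr.
    - exact/L1_abs/L2_L1.
    - move=> n x _; rewrite normrM ler_piMr// phE; case: ifP; rewrite ?normr0//.
      move=> /andP[ax xb]; rewrite ger0_norm ?expR_ge0// expR_le1 oppr_le0 invr_ge0.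
      by rewrite mulr_ge0// w0E mulr_ge0// subr_ge0 ltW.
    - apply: aeI => x _; apply: cvgM; first exact: cvg_cst.
      under eq_fun do rewrite phE; rewrite /hh; case: ifP => [/andP[ax xb]|_]; last exact: cvg_cst.
      have h : (fun n => - (n.+1%:R * w0.[x])^-1) @ \oo --> (0 : R).
        rewrite -oppr0; apply: cvgN.
        rewrite (_ : (fun n => _) = (fun n => w0.[x]^-1 * n.+1%:R^-1)); last first.
          by apply/funext => n; rewrite invfM mulrC.
        rewrite -(mulr0 w0.[x]^-1); apply: cvgM; first exact: cvg_cst.
        exact: cvg_harmonic.
      have := cvg_comp _ _ h (@continuous_expR R 0); rewrite expR0; exact.
  have z : int01 (g \* hh) = 0.
    have E : (fun n => int01 (g \* ph n)) = (fun=> 0).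
      by apply/funext => n; exact: H.
    rewrite E in c1; apply: (cvg_unique _ c1) => //; exact: cvg_cst.
  have mh : measurable_fun I01 hh.
    apply: measurable_funTS; apply: measurable_fun_ifT => //.
    by apply: measurable_and; exact: measurable_fun_ltr.
  apply/eqP; rewrite -subr_eq0 -z; apply/eqP.
  rewrite !prim_def -int01B; [|exact/L1_ind/L2_L1..].
  have mg := L2_meas Lg.
  apply: aeq_int01.
  - by apply: measurable_funB; apply: measurable_funM => //; exact: meas_ind.
  - exact: measurable_funM.
  exists [set a]; split => //; first exact: lebesgue_measure_set1.
  move=> x /= /not_implyP[_]; rewrite /ind /hh.
  have [xa|xa|->//] := ltgtP x a.
    by rewrite (lt_trans xa ab) !mul1r subrr mulr0.
  by case: ltP => _ /=; rewrite ?mul1r ?mul0r ?subr0 ?mulr1 ?mulr0.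
have p0 b : 0 < b -> b < 1 -> prim g b = 0.
  move=> b0 b1; apply/eqP; rewrite -normr_le0; apply/ler_addgt0Pl => e e0; rewrite addr0.
  have [d d0 Hd] := sqrt_small (L2norm_ge0 g) e0.
  pose a := Num.min (d / 2) (b / 2).
  have a0 : 0 < a by rewrite lt_min !divr_gt0.
  have ad : a < d by rewrite gt_min; apply/orP; left; lra.
  have ab : a < b by rewrite gt_min; apply/orP; right; lra.
  rewrite (key a b)//; have := prim_diff 0 a Lg; rewrite prim0 !subr0 => h.
  by apply: (le_trans h); rewrite ltW// Hd// ger0_norm// ltW.
apply: prim_eq0; first exact: L2_L1.
move=> x; have [x0|x0] := leP x 0; first exact: prim_le0.
have [x1|x1] := ltP x 1; first exact: p0.
rewrite prim_ge1// -prim1; apply/eqP; rewrite -normr_le0; apply/ler_addgt0Pl => e e0; rewrite addr0.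
have [d d0 Hd] := sqrt_small (L2norm_ge0 g) e0.
pose b := Num.max (1 - d / 2) (1 / 2).
have b1 : b < 1 by rewrite gt_max; apply/andP; split; lra.
have b0 : 0 < b by rewrite lt_max; apply/orP; right; lra.
have bd : 1 - b < d.
  by rewrite ltrBlDr -ltrBlDl lt_max; apply/orP; left; lra.
have := prim_diff b 1 Lg; rewrite (p0 b)// subr0 => h.
apply: (le_trans h); rewrite ltW// Hd// ger0_norm ?subr_ge0// ltW//.
Qed.

Lemma smooth_lin phi chi (c : R) : smooth phi -> smooth chi ->
  smooth (fun x => phi x - c * chi x) /\ forall n,
  derive1n n (fun x => phi x - c * chi x) = fun x => derive1n n phi x - c * derive1n n chi x.
Proof.
move=> sp sc.
have E n : derive1n n (fun x => phi x - c * chi x) =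
    fun x => derive1n n phi x - c * derive1n n chi x.
  elim: n => [//|n IH]; rewrite !derive1nS IH; apply/funext => x.
  rewrite derive1E.
  have d1 : is_derive x 1 (derive1n n phi) (derive1 (derive1n n phi) x).
    by rewrite derive1E; exact/derivableP/sp.
  have d2 : is_derive x 1 (derive1n n chi) (derive1 (derive1n n chi) x).
    by rewrite derive1E; exact/derivableP/sc.
  have := is_deriveB d1 (is_deriveZ c d2).
  by move=> /@derive_val; apply.
split; last exact: E.
move=> n x; rewrite E; apply: derivableB; first exact: sp.
by apply: derivableZ; exact: sc.
Qed.

(** The zero mean makes the primitive vanish again near 1. *)
Lemma prim_test zeta : smooth zeta -> (forall x : R, ~~ (0 < x < 1) -> zeta x = 0) ->
  (\forall x \near (0:R), zeta x = 0) -> (\forall x \near (1:R), zeta x = 0) -> L1 zeta ->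
  int01 zeta = 0 -> test_function (prim zeta) /\ derive1n 1 (prim zeta) = zeta.
Proof.
move=> sz z0 n0 n1 Lz iz.
have dp (x : R) : is_derive x 1 (prim zeta) (zeta x) by apply: prim_derive => //; exact: smooth_cont.
have E : derive1n 1 (prim zeta) = zeta.
  by apply/funext => x; rewrite derive1n1 derive1E derive_val.
split; last exact: E.
have /nbhs_ballP[a /= a0 Ha] := n0; have /nbhs_ballP[b /= b0 Hb] := n1.
apply: (@test_of _ _ (Num.min a 1) (1 - Num.min b 1)).
- move=> [|n] x; first exact: ex_derive.
  by rewrite derive1Sn -[derive1 _]/(derive1n 1 _) E; exact: sz.
- by rewrite lt_min a0 ltr01.
- by rewrite ltrBlDr ltrDl lt_min b0 ltr01.
- move=> x px; apply/andP; split; rewrite leNgt; apply: contraNN px => hx.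
    apply/eqP; rewrite prim_def -[RHS]int01_0; apply: eq_int01 => y.
    rewrite /I01/= in_itv/= /ind => /andP[y0 y1]; case: ltP => yx; last by rewrite mul0r.
    rewrite mul1r; apply: Ha; rewrite /ball/= sub0r normrN gtr0_norm//.
    by apply: (lt_trans yx); apply: (lt_le_trans hx); rewrite ge_min lexx.
  rewrite prim_def -[X in _ == X]iz; apply/eqP; apply: eq_int01 => y.
  rewrite /I01/= in_itv/= /ind => /andP[y0 y1]; case: ltP => yx; first by rewrite mul1r.
  rewrite mul0r; apply/esym/Hb; rewrite /ball/= gtr0_norm ?subr_gt0//.
  rewrite ltrBlDr -ltrBlDl; apply: (le_lt_trans _ (lt_le_trans hx yx)).
  by rewrite lerD2l lerN2 ge_min lexx.
Qed.

(** Subtracting a multiple of one fixed bump [chi] gives any test function mean 0, hence makes it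
    the derivative of a test function; the constant is the [chi]-average of [f]. *)
Lemma du_Bois_Reymond f : L2 f ->
  (forall phi, test_function phi -> int01 (f \* derive1n 1 phi) = 0) ->
  exists c, aeq f (cst c).
Proof.
move=> Lf H.
pose w0 : {poly R} := ('X - (1 / 4)%:P) * ((3 / 4)%:P - 'X).
have w0E x : w0.[x] = (x - 1 / 4) * (3 / 4 - x) by rewrite /w0 !hornerE.
pose chi := bmp w0 1 0.
have chiE x : chi x = if 0 < w0.[x] then expR (- w0.[x]^-1) else 0.
  by rewrite /chi /bmp hornerC expr0 !mul1r.
have chi0 x : 0 <= chi x by rewrite chiE; case: ifP => // _; exact: expR_ge0.
have tchi : test_function chi.
  apply: (@test_of _ _ (1 / 4) (3 / 4)); [exact: bmp_smooth|lra|lra|].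
  move=> x; rewrite chiE; case: ltP => [h _|]; last by rewrite eqxx.
  by move: h; rewrite w0E => h; apply/andP; split; nra.
have Lchi := test_L2 tchi.
have K0 : 0 < int01 chi.
  (* On [3/8, 5/8[ the polynomial [w0] is at least (1/8)(3/8) = 3/64, which bounds the integral of
     [chi] from below. *)
  pose c := expR (- (3 / 64)^-1) : R.
  have c0 : 0 < c by exact: expR_gt0.
  have LL : L1 (fun x => c * (ind (5/8) x - ind (3/8) x)).
    apply/L1Z/L1B; apply: (L1_bounded (meas_ind _)) => x _; exact: ind_le1.
  have : int01 (fun x => c * (ind (5/8) x - ind (3/8) x)) <= int01 chi.
    apply: le_int01 => //; first exact: L2_L1.
    move=> x _; rewrite /ind; case: (ltP x (3 / 8)) => x2; case: (ltP x (5 / 8)) => x1 /=.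
    - by rewrite subrr mulr0.
    - by exfalso; lra.
    - have w1 : 3 / 64 <= w0.[x] by rewrite w0E; nra.
      have w2 : 0 < w0.[x] by rewrite (lt_le_trans _ w1)// divr_gt0.
      rewrite subr0 mulr1 chiE w2 /c ler_expR lerN2 lef_pV2 ?posrE ?divr_gt0//.
    - by rewrite subrr mulr0.
  have B s : L1 (ind s) by apply: (L1_bounded (meas_ind _)) => x _; exact: ind_le1.
  apply: lt_le_trans; rewrite int01Z; last exact: L1B.
  rewrite int01B// !prim_cst1; [|lra..]; rewrite mulr_gt0//; lra.
set K := int01 chi in K0; pose c := int01 (f \* chi) / K.
exists c.
have Lfc : L2 (f \- cst c) by apply: L2B => //; exact: L2_cst.
suff : aeq (f \- cst c) (fun=> 0).
  by apply: aeS => x h Ix; have := h Ix; rewrite /= => /eqP; rewrite subr_eq0 => /eqP.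
apply: test_ae0 => // phi tphi.
have Lphi := test_L2 tphi.
pose m := int01 phi; pose zeta x := phi x - (m / K) * chi x.
have [sz _] := smooth_lin (m / K) (test_smooth tphi) (test_smooth tchi).
have Lz : L2 zeta by apply: L2B => //; exact: L2Z.
have [||||| tp dp] := @prim_test zeta sz.
- by move=> x xI; rewrite /zeta (test_out tphi xI) (test_out tchi xI) mulr0 subr0.
- have n1 := @test_near0 _ phi 0 tphi; have n2 := @test_near0 _ chi 0 tchi.
  apply: filterS2 (n1 _) (n2 _); rewrite ?ltxx// => x e1 e2.
  by rewrite /zeta e1 e2 mulr0 subr0.
- have n1 := @test_near0 _ phi 1 tphi; have n2 := @test_near0 _ chi 1 tchi.
  apply: filterS2 (n1 _) (n2 _); rewrite ?ltxx ?andbF// => x e1 e2.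
  by rewrite /zeta e1 e2 mulr0 subr0.
- exact: L2_L1.
- rewrite [LHS]int01B ?int01Z; [|exact: L2_L1..|exact/L2_L1/L2Z].
  by rewrite divfK ?subrr// gt_eqF.
have := H _ tp; rewrite dp.
have -> : int01 (f \* zeta) = int01 (f \* phi) - (m / K) * int01 (f \* chi).
  rewrite -int01Z; last exact: L1M.
  rewrite -int01B; [|exact: L1M|exact/L1Z/L1M].
  by apply: eq_int01 => x _; rewrite /zeta /=; ring.
move=> E.
rewrite (eq_int01 (g := (f \* phi) \- (fun x => c * phi x))); last by move=> x _ /=; ring.
rewrite int01B ?int01Z; [|exact: L2_L1..|exact: L1M|exact/L1Z/L2_L1].
by rewrite -[RHS]E /c -/m; congr (_ - _); ring.
Qed.

End WeakDerivatives.

(** * Sobolev functions as tuples of derivatives; Leibniz formula and tame estimates *)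

Section Jets.
Context {R : realType}.
Implicit Types (f g h phi : R -> R) (F G : nat -> R -> R).
Local Notation mu := (@lebesgue_measure R).

Transparent int01.
Lemma is_wderivE k f g : is_wderiv k f g <-> L2 g /\ forall phi, test_function phi ->
  int01 (f \* derive1n k phi) = (-1) ^+ k * int01 (g \* phi).
Proof. by []. Qed.
Opaque int01.

Lemma wderiv_uniq k f g h : is_wderiv k f g -> is_wderiv k f h -> aeq g h.
Proof.
move=> /is_wderivE[Lg Hg] /is_wderivE[Lh Hh].
have : aeq (g \- h) (fun=> 0).
  apply: test_ae0; first exact: L2B.
  move=> phi tphi; have Lp := test_L2 tphi.
  rewrite (eq_int01 (g := (g \* phi) \- (h \* phi))); last by move=> x _ /=; rewrite mulrBl.
  rewrite int01B; [|exact: L1M..].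
  have := Hh phi tphi; rewrite Hg// => /(congr1 (fun z => (-1) ^+ k * z)).
  by rewrite !mulrA -exprMn mulrNN mulr1 expr1n !mul1r => ->; rewrite subrr.
by apply: aeS => x e Ix; have := e Ix; rewrite /= => /eqP; rewrite subr_eq0 => /eqP.
Qed.

Lemma AC_wderiv1 f h g : L2 f -> L2 g -> AC h g -> aeq f h -> is_wderiv 1 f g.
Proof.
move=> Lf Lg Hh fh; apply/is_wderivE; split=> // phi tphi.
have Lh := AC_L2 Lg Hh; have Ld := test_L2 (test_deriv tphi); have Lp := test_L2 tphi.
rewrite (aeq_int01 (g := h \* derive1n 1 phi)); last 3 first.
- by apply: measurable_funM; apply: L2_meas.
- by apply: measurable_funM; apply: L2_meas.
- exact: aeqM fh (aeq_refl _).
have := int01_byparts Lg Ld Hh (test_AC tphi).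
rewrite (test_out (x := 0) tphi) ?ltxx// (test_out (x := 1) tphi) ?ltxx ?andbF// !mulr0 subrr.
by rewrite expr1 mulN1r => /eqP; rewrite addrC addr_eq0 => /eqP.
Qed.

(** The difference of [f] and the primitive of [g] is orthogonal to all derivatives of test
    functions, hence constant almost everywhere. *)
Lemma wderiv1_AC f g : L2 f -> is_wderiv 1 f g -> exists h, AC h g /\ aeq f h.
Proof.
move=> Lf /is_wderivE[Lg Hg].
have LP : L2 (prim g) := AC_L2 Lg (AC_prim g).
have [|c Hc] := @du_Bois_Reymond R (f \- prim g) (L2B Lf LP).
  move=> phi tphi; have Lp := test_L2 tphi; have Ld := test_L2 (test_deriv tphi).
  rewrite (eq_int01 (g := (f \* derive1n 1 phi) \- (prim g \* derive1n 1 phi))); last first.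
    by move=> x _ /=; rewrite mulrBl.
  rewrite int01B; [|exact: L1M..]; rewrite Hg// expr1 mulN1r.
  have := int01_byparts Lg Ld (AC_prim g) (test_AC tphi).
  rewrite (test_out (x := 0) tphi) ?ltxx// (test_out (x := 1) tphi) ?ltxx ?andbF// !mulr0 subrr.
  by move/eqP; rewrite addrC addr_eq0 => /eqP ->; rewrite opprK addNr.
exists (fun s => c + prim g s); split; first by move=> s; rewrite prim0 addr0.
by apply: aeS Hc => x e Ix; have /= <- := e Ix; rewrite subrK.
Qed.

(** Entry i is the i-th derivative: continuous with values at the end points for i < m, only in L^2
    for i = m. Entries beyond m are arbitrary. *)
Definition jet m F := (forall i, (i < m)%N -> AC (F i) (F i.+1)) /\ L2 (F m).

Lemma jet_L2 m F i : jet m F -> (i <= m)%N -> L2 (F i).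
Proof.
move=> [HF LF] im; rewrite -(subKn im); elim: (m - i)%N => [|n IH]; first by rewrite subn0.
have [nm|mn] := ltnP n m; last by rewrite (_ : (m - n.+1 = m - n)%N)//; lia.
have e : (m - n.+1).+1 = (m - n)%N by lia.
apply: (AC_L2 (g := F (m - n)%N)) => //.
by rewrite -e; apply: HF; lia.
Qed.

Lemma jet_AC m F i : jet m F -> (i < m)%N -> AC (F i) (F i.+1).
Proof. by case=> + _; apply. Qed.

Lemma jet_continuous m F i : jet m F -> (i < m)%N -> continuous (F i).
Proof. by move=> jF im; apply: (AC_continuous (jet_L2 jF im) (jet_AC jF im)). Qed.

Lemma jet_le m n F : (n <= m)%N -> jet m F -> jet n F.
Proof.
move=> nm jF; split; last exact: jet_L2 jF nm.
by move=> i ni; apply: (jet_AC jF); exact: leq_trans nm.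
Qed.

Lemma jet_shift m p F : jet (p + m) F -> jet m (fun i => F (p + i)%N).
Proof.
move=> jF; split; last exact: jet_L2 jF _.
by move=> i im; rewrite addnS; apply: (jet_AC jF); rewrite ltn_add2l.
Qed.

Lemma eq_jet m F G : (forall i, (i <= m)%N -> F i = G i) -> jet m F -> jet m G.
Proof.
move=> FG jF; split; last by rewrite -FG//; exact: jet_L2 jF _.
by move=> i im; rewrite -!FG//; [exact: jet_AC jF im|exact: ltnW].
Qed.

Lemma jet_wderiv m F f k : jet m F -> L2 f -> aeq f (F 0%N) -> (k <= m)%N ->
  is_wderiv k f (F k).
Proof.
move=> jF Lf fF km; apply/is_wderivE; split; first exact: jet_L2 jF km.
move=> phi tphi.
have td n : test_function (derive1n n phi).
  by elim: n => // n IH; rewrite derive1nS; exact: test_deriv.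
rewrite (aeq_int01 (g := F 0%N \* derive1n k phi)); last 3 first.
- by apply: measurable_funM; [exact: L2_meas|exact: L2_meas (test_L2 (td k))].
- by apply: measurable_funM; [exact: L2_meas (jet_L2 jF _)|exact: L2_meas (test_L2 (td k))].
- exact: aeqM fF (aeq_refl _).
suff H n : (n <= k)%N ->
    int01 (F 0%N \* derive1n k phi) = (-1) ^+ n * int01 (F n \* derive1n (k - n) phi).
  by rewrite (H k)// subnn.
elim: n => [_|n IH nk]; first by rewrite mul1r subn0.
rewrite IH ?(ltnW nk)//.
have e : (k - n)%N = (k - n.+1).+1 by lia.
have nm : (n < m)%N by exact: leq_trans km.
have := int01_byparts (jet_L2 jF nm) (test_L2 (td (k - n.+1).+1)) (jet_AC jF nm) (test_AC (td (k - n.+1)%N)).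
rewrite (test_out (x := 0) (td _)) ?ltxx// (test_out (x := 1) (td _)) ?ltxx ?andbF// !mulr0 subrr.
move/eqP; rewrite addrC addr_eq0 => /eqP h.
by rewrite e [X in _ * X]h exprS mulN1r mulrN mulNr.
Qed.

(** Testing against derivatives of test functions shows that the weak derivatives [g k] are weak
    derivatives of one another; those below order m are replaced by their absolutely continuous
    representatives. *)
Lemma sobolev1_jet m f : L2 f -> (forall k, (k <= m)%N -> exists g, is_wderiv k f g) ->
  exists F, jet m F /\ aeq f (F 0%N).
Proof.
move=> Lf H.
pose g k := xget (cst 0) [set g | is_wderiv k f g].
have Hg k : (k <= m)%N -> is_wderiv k f (g k).
  by move=> /H[h Hh]; apply: (@xgetPex _ (cst 0) [set g | is_wderiv k f g]); exists h.
have g0 : aeq f (g 0%N).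
  apply: (wderiv_uniq (k := 0) _ (Hg 0%N _)) => //.
  by apply/is_wderivE; split => // phi _; rewrite expr0 mul1r.
have gS k : (k < m)%N -> exists h, AC h (g k.+1) /\ aeq (g k) h.
  move=> km; apply: wderiv1_AC; first by case/is_wderivE: (Hg k (ltnW km)).
  have /is_wderivE[L1' H1] := Hg k (ltnW km); have /is_wderivE[L2' H2] := Hg k.+1 km.
  apply/is_wderivE; split=> // phi tphi.
  have := H1 _ (test_deriv tphi); rewrite -derive1Sn H2// exprS mulN1r.
  have ss : (-1) ^+ k * (-1) ^+ k = 1 :> R by rewrite -exprMn mulrNN mulr1 expr1n.
  move: ((-1) ^+ k : R) ss (int01 _) (int01 _) => z zz X Y e.
  by rewrite expr1 mulN1r -[LHS]mul1r -zz -mulrA -e mulrA mulrN zz mulN1r.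
pose F k := if (k < m)%N then xget (cst 0) [set h | AC h (g k.+1) /\ aeq (g k) h] else g k.
have HF k : (k < m)%N -> AC (F k) (g k.+1) /\ aeq (g k) (F k).
  move=> km; rewrite /F km; have [h Hh] := gS k km.
  by apply: (@xgetPex _ (cst 0) [set h | AC h (g k.+1) /\ aeq (g k) h]); exists h.
have gF k : (k <= m)%N -> aeq (g k) (F k).
  rewrite leq_eqVlt => /predU1P[->|/HF[]//]; rewrite /F ltnn; exact: aeq_refl.
have gL k : (k <= m)%N -> L2 (g k) by move=> /Hg/is_wderivE[].
exists F; split; last exact: aeq_trans g0 (gF 0%N _).
have Fm : L2 (F m) by rewrite /F ltnn; exact: gL.
have FL k : (k <= m)%N -> L2 (F k).
  rewrite leq_eqVlt => /predU1P[->//|km]; exact: (AC_L2 (gL k.+1 km) (HF k km).1).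
split => // i im; apply: (AC_aeq (g := g i.+1)) (HF i im).1; last exact: gF.
- by apply: L2_meas; exact: gL.
- by apply: L2_meas; exact: FL.
Qed.

Lemma wderivP k f g : is_wderiv k f g -> is_wderiv k f (wderiv k f).
Proof. by move=> h; apply: (@xgetPex _ (cst 0) [set g | is_wderiv k f g]); exists g. Qed.

Lemma jet_wderivE m F f k : jet m F -> L2 f -> aeq f (F 0%N) -> (k <= m)%N ->
  L2 (wderiv k f) /\ aeq (wderiv k f) (F k).
Proof.
move=> jF Lf fF km; have h := jet_wderiv jF Lf fF km.
by split; [case/is_wderivE: (wderivP h)|exact: wderiv_uniq (wderivP h) h].
Qed.

(* Leibniz: [PJ F G k p q] is the k-th derivative of F^(p) G^(q). *)
Fixpoint PJ F G (k p q : nat) : R -> R :=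
  match k with
  | 0 => F p \* G q
  | k'.+1 => PJ F G k' p.+1 q \+ PJ F G k' p q.+1
  end.

(** The H^m norm in additive form, equivalent to the usual one. *)
Definition HN m F : R := \sum_(i < m.+1) L2norm (F i).

Lemma HN_ge0 m F : 0 <= HN m F.
Proof. by apply: sumr_ge0 => i _; exact: L2norm_ge0. Qed.

Lemma HN_ge m F i : (i <= m)%N -> L2norm (F i) <= HN m F.
Proof.
rewrite -ltnS => im; rewrite /HN (bigD1 (Ordinal im))//= lerDl.
by apply: sumr_ge0 => j _; exact: L2norm_ge0.
Qed.

Lemma HN_ge2 m F i : (i < m)%N -> L2norm (F i) + L2norm (F i.+1) <= HN m F.
Proof.
move=> im; have i1 : (i < m.+1)%N by exact: ltnW.
rewrite /HN (bigD1 (Ordinal i1))//= lerD2l.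
have i2 : (i.+1 < m.+1)%N by [].
rewrite (bigD1 (Ordinal i2))//=; last by rewrite -val_eqE/= -[X in _ == X]addn0 -addn1 eqn_add2l.
by rewrite lerDl; apply: sumr_ge0 => j _; exact: L2norm_ge0.
Qed.

Lemma HN_mono m n F : (n <= m)%N -> HN n F <= HN m F.
Proof.
move=> nm; rewrite /HN -!(big_mkord xpredT (fun i => L2norm (F i))).
rewrite [leRHS](big_cat_nat (n := n.+1))//= lerDl.
by apply: sumr_ge0 => j _; exact: L2norm_ge0.
Qed.

Lemma jet_sup m F i s : jet m F -> (i < m)%N -> `|F i s| <= HN m F.
Proof.
move=> jF im; apply: le_trans (HN_ge2 F im).
exact: AC_sup (jet_L2 jF im) (jet_AC jF im).
Qed.

Section Product.
Variables (m : nat) (F G : nat -> R -> R).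
Hypotheses (m1 : (1 <= m)%N) (jF : jet m F) (jG : jet m G).

Lemma prod_L2 p q : (p + q <= m)%N -> L2 (F p \* G q).
Proof.
move=> pq; have [pm|mp] := ltnP p m.
  have := L2_AC (jet_L2 jG (i := q) _) (jet_AC jF pm) (jet_L2 jF pm).
  move=> /(_ ltac:(lia)); by apply: eq_L2 => x _ /=; rewrite mulrC.
have qm : (q < m)%N by lia.
by apply: (L2_AC (jet_L2 jF (i := p) _) (jet_AC jG qm) (jet_L2 jG qm)); lia.
Qed.

Lemma PJ_L2 k p q : (k + p + q <= m)%N -> L2 (PJ F G k p q).
Proof.
elim: k p q => [|k IH] p q h /=; first exact: prod_L2.
by apply: L2D; apply: IH; lia.
Qed.

Lemma PJ_AC k p q : (k + p + q < m)%N -> AC (PJ F G k p q) (PJ F G k.+1 p q).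
Proof.
elim: k p q => [|k IH] p q h.
  by apply: ACM; [apply: (jet_L2 jF)|apply: (jet_L2 jG)|apply: (jet_AC jF)|apply: (jet_AC jG)]; lia.
have h1 : (k.+1 + p.+1 + q <= m)%N by lia.
have h2 : (k.+1 + p + q.+1 <= m)%N by lia.
exact: (ACD (PJ_L2 h1) (PJ_L2 h2) (IH p.+1 q ltac:(lia)) (IH p q.+1 ltac:(lia))).
Qed.

Lemma PJ_jet : jet m (fun k => PJ F G k 0 0).
Proof. by split=> [i im|]; [apply: PJ_AC|apply: PJ_L2]; lia. Qed.

(** Tame product estimate. As m <= 2 r, each Leibniz term has a factor of order below r, taken in
    the sup norm and bounded by the low norm, except when both orders equal r. The high norm thus
    enters linearly. *)
Lemma PJ_norm r k p q : (1 <= r <= m)%N -> (m <= 2 * r)%N -> (k + p + q <= m)%N ->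
  L2norm (PJ F G k p q) <= 2 ^+ k * (HN m F * HN r G + HN r F * HN m G).
Proof.
move=> r1 mr; elim: k p q => [|k IH] p q h; last first.
  apply: (le_trans (L2norm_triangle (PJ_L2 _) (PJ_L2 _))); [lia|lia|].
  by rewrite exprS -mulrA [leRHS]mulr_natl mulr2n lerD// IH//; lia.
rewrite expr0 mul1r /=.
have bnd H K i j mm (jH : jet m H) (jK : jet m K) : (i < m)%N -> (j <= m)%N ->
    (forall s, `|H i s| <= mm) -> L2norm (H i \* K j) <= mm * L2norm (K j).
  move=> im jm hm; rewrite (eq_L2norm (g := K j \* H i)); last by move=> x _ /=; rewrite mulrC.
  apply: L2normM_bounded; first exact: jet_L2 jK jm.
    by apply: cont_meas; exact: jet_continuous jH im.
  by move=> x _; exact: hm.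
have N := HN_ge0.
have [pr|rp] := ltnP p r.
  have pm : (p < m)%N by lia.
  apply: (le_trans (bnd _ _ p q (HN r F) jF jG pm _ _)); [lia| |].
    by move=> s; apply: jet_sup pr; apply: jet_le jF; lia.
  rewrite -[leLHS]add0r lerD// ?mulr_ge0// ler_wpM2l// HN_ge//; lia.
have [qr|rq] := ltnP q r.
  have qm : (q < m)%N by lia.
  rewrite (eq_L2norm (g := G q \* F p)); last by move=> x _ /=; rewrite mulrC.
  apply: (le_trans (bnd _ _ q p (HN r G) jG jF qm _ _)); [lia| |].
    by move=> s; apply: jet_sup qr; apply: jet_le jG; lia.
  rewrite -[leLHS]addr0 lerD// ?mulr_ge0// mulrC ler_wpM2r// HN_ge//; lia.
(* Both orders are at least r, so p = q = r and m = 2 r; the second factor is then measured in the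
   low norm. *)
have pm : (p < m)%N by lia.
apply: (le_trans (bnd _ _ p q (HN m F) jF jG pm _ _)); [lia| |].
  by move=> s; exact: jet_sup pm.
rewrite -[leLHS]addr0 lerD// ?mulr_ge0// ler_wpM2l// HN_ge//; lia.
Qed.

Lemma PJ_HN r : (1 <= r <= m)%N -> (m <= 2 * r)%N ->
  HN m (fun k => PJ F G k 0 0) <=
    (m.+1%:R * 2 ^+ m) * (HN m F * HN r G + HN r F * HN m G).
Proof.
move=> r1 mr; rewrite -mulrA mulr_natl -[X in _ *+ X](card_ord m.+1) -sumr_const.
apply: ler_sum => i _; apply: (le_trans (PJ_norm r1 mr _)); first by have := ltn_ord i; lia.
rewrite ler_wpM2r ?addr_ge0 ?mulr_ge0 ?HN_ge0//.
by apply: ler_weXn2l; [rewrite ler1n|rewrite -ltnS ltn_ord].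
Qed.

Lemma PJ_HN_alg : HN m (fun k => PJ F G k 0 0) <=
  (m.+1%:R * 2 ^+ m.+1) * HN m F * HN m G.
Proof.
apply: (le_trans (PJ_HN (r := m) _ _)); [lia|lia|].
by rewrite exprS le_eqVlt; apply/orP; left; apply/eqP; ring.
Qed.

End Product.

(** In each Leibniz term the two orders have odd sum, so one factor is an odd derivative. *)
Lemma PJ_even0 F G m s k p q : (k + p + q <= m)%N -> odd (k + p + q) ->
  (forall i, (i <= m)%N -> odd i -> F i s = 0) ->
  (forall i, (i <= m)%N -> odd i -> G i s = 0) -> PJ F G k p q s = 0.
Proof.
move=> + + F0 G0; elim: k p q => [|k IH] p q h o /=; last by rewrite !IH ?addr0//; lia.
have [op|ep] := boolP (odd p); first by rewrite F0 ?mul0r//; lia.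
by rewrite G0 ?mulr0//; lia.
Qed.

End Jets.

(** * Antiderivatives and mean value inequalities *)

Section Antiderivative.
Context {R : realType}.
Implicit Types f g D H : R -> R.
Local Notation mu := (@lebesgue_measure R).

(** Integrating from -1 gives a two-sided derivative at time 0. *)
Lemma antiderivative f : continuous f ->
  exists G : R -> R, G 0 = 0 /\ forall t : R, -1 < t -> is_derive t 1 G (f t).
Proof.
move=> cf; pose G t := \int[mu]_(x in `[-1, t]) f x.
exists (fun t => G t - G 0); split; first by rewrite subrr.
move=> t t1.
have tt : t < t + 1 by rewrite ltrDl.
have iG : mu.-integrable `[-1, t + 1] (EFin \o f).
  apply: continuous_compact_integrable; first exact: segment_compact.
  exact: continuous_subspaceT.
have [df dE] := continuous_FTC1_closed tt iG t1 (cf t).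
have dG : is_derive t 1 G (f t) by apply: DeriveDef; [exact: df|rewrite -derive1E].
have dc : is_derive t 1 (cst (G 0)) (0 : R) by exact: is_derive_cst.
by have := is_deriveB dG dc; rewrite subr0.
Qed.

Definition adr f : R -> R :=
  xget (cst 0) [set G : R -> R | G 0 = 0 /\ forall t : R, -1 < t -> is_derive t 1 G (f t)].

Lemma adrP f : continuous f ->
  adr f 0 = 0 /\ forall t : R, -1 < t -> is_derive t 1 (adr f) (f t).
Proof.
move=> cf; have [G HG] := antiderivative cf.
by apply: (@xgetPex _ (cst 0) [set G : R -> R | G 0 = 0 /\ forall t : R, -1 < t -> is_derive t 1 G (f t)]); exists G.
Qed.

Lemma derive_mono D f (r t : R) : r <= t ->
  (forall x : R, r <= x <= t -> is_derive x 1 D (f x)) ->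
  (forall x, r <= x <= t -> 0 <= f x) -> D r <= D t.
Proof.
move=> rt dD f0.
have [x|x|x xrt E] := @MVT_segment R D f r t rt.
- by rewrite in_itv/= => /andP[rx xt]; apply: dD; rewrite !ltW.
- apply: continuous_in_subspaceT => y; rewrite inE/= in_itv/= => yrt.
  apply: differentiable_continuous; apply/derivable1_diffP.
  exact: (@ex_derive _ _ _ _ _ _ _ (dD y yrt)).
- by rewrite -subr_ge0 E mulr_ge0 ?subr_ge0//; apply: f0; move: xrt; rewrite in_itv.
Qed.

Lemma derive_cmp D f H h (r t : R) : r <= t ->
  (forall x : R, r <= x <= t -> is_derive x 1 D (f x)) ->
  (forall x : R, r <= x <= t -> is_derive x 1 H (h x)) ->
  (forall x, r <= x <= t -> f x <= h x) -> D t - D r <= H t - H r.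
Proof.
move=> rt dD dH fh.
suff : (H - D) r <= (H - D) t.
  by rewrite !fctE; move: (H r) (H t) (D r) (D t) => a b c d ?; lra.
apply: (@derive_mono _ (fun x => h x - f x)) => // x xrt; last by rewrite subr_ge0 fh.
exact: is_deriveB (dH x xrt) (dD x xrt).
Qed.

Lemma continuous_derive D (df t : R) : is_derive t 1 D df -> {for t, continuous D}.
Proof.
move=> d; apply: differentiable_continuous; apply/derivable1_diffP; exact: ex_derive.
Qed.

Lemma CS_fin (I : finType) (x y : I -> R) :
  (\sum_i x i * y i) ^+ 2 <= (\sum_i x i ^+ 2) * (\sum_i y i ^+ 2).
Proof.
set a := \sum_i x i ^+ 2; set b := \sum_i x i * y i; set c := \sum_i y i ^+ 2.
have key t : 0 <= a + 2 * t * b + t ^+ 2 * c.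
  rewrite /a /b /c !mulr_sumr -!big_split/=; apply: sumr_ge0 => i _.
  rewrite (_ : _ + _ = (x i + t * y i) ^+ 2) ?sqr_ge0//; ring.
have a0 : 0 <= a by apply: sumr_ge0 => i _; exact: sqr_ge0.
have c0 : 0 <= c by apply: sumr_ge0 => i _; exact: sqr_ge0.
have [cE|cN0] := eqVneq c 0.
  have [->|bN0] := eqVneq b 0; first by rewrite expr0n mulr_ge0.
  have := key (- (a + 1) / (2 * b)); rewrite cE mulr0 addr0 mulrAC mulrC divfK; first by lra.
  by rewrite mulf_neq0.
have cp : 0 < c by rewrite lt_def cN0.
have := key (- b / c).
have -> : a + 2 * (- b / c) * b + (- b / c) ^+ 2 * c = (a * c - b ^+ 2) / c by field.
by rewrite pmulr_lge0 ?invr_gt0// subr_ge0.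
Qed.

Lemma Mink_fin (I : finType) (x y : I -> R) (A B : R) : 0 <= A -> 0 <= B ->
  \sum_i x i ^+ 2 <= A ^+ 2 -> \sum_i y i ^+ 2 <= B ^+ 2 ->
  \sum_i (x i + y i) ^+ 2 <= (A + B) ^+ 2.
Proof.
move=> A0 B0 xA yB.
have -> : \sum_i (x i + y i) ^+ 2 = \sum_i x i ^+ 2 + 2 * (\sum_i x i * y i) + \sum_i y i ^+ 2.
  by rewrite mulr_sumr -!big_split/=; apply: eq_bigr => i _; ring.
have h : \sum_i x i * y i <= A * B.
  apply: le_sqr_ge0; first exact: mulr_ge0.
  apply: (le_trans (CS_fin x y)); rewrite exprMn ler_pM// sumr_ge0// => i _; exact: sqr_ge0.
rewrite sqrrD; move: (\sum_i x i * y i) h xA yB => p h.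
move: (\sum_i x i ^+ 2) (\sum_i y i ^+ 2) => q r; rewrite mulr2n; lra.
Qed.

(** Mean value inequality for vectors: project on the increment of [b] and use the scalar case and
    Cauchy-Schwarz. No constant depends on the size of [I], so the bound passes to l^2. *)
Lemma derive_cmp_vec (I : finType) (b : I -> R -> R) (f : I -> R -> R) H h (r t : R) : r <= t ->
  (forall i (x : R), r <= x <= t -> is_derive x 1 (b i) (f i x)) ->
  (forall x : R, r <= x <= t -> is_derive x 1 H (h x)) ->
  (forall x, r <= x <= t -> 0 <= h x) ->
  (forall x, r <= x <= t -> \sum_i f i x ^+ 2 <= h x ^+ 2) ->
  \sum_i (b i t - b i r) ^+ 2 <= (H t - H r) ^+ 2.
Proof.
move=> rt db dH h0 fh.
pose x i := b i t - b i r; pose N := Num.sqrt (\sum_i x i ^+ 2).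
have S0 : 0 <= \sum_i x i ^+ 2 by apply: sumr_ge0 => i _; exact: sqr_ge0.
have N0 : 0 <= N := sqrtr_ge0 _.
have NE : \sum_i (b i t - b i r) ^+ 2 = N ^+ 2 by rewrite sqr_sqrtr.
have dD z : r <= z <= t -> is_derive z 1 (fun s => \sum_i x i * b i s) (\sum_i x i * f i z).
  move=> zrt.
  suff : forall s : seq I, is_derive z 1 (fun u => \sum_(i <- s) x i * b i u) (\sum_(i <- s) x i * f i z).
    by apply.
  elim=> [|i s IH].
    rewrite big_nil (_ : (fun _ => _) = cst 0); last by apply/funext => u; rewrite big_nil.
    exact: is_derive_cst.
  rewrite big_cons (_ : (fun _ => _) = (fun u => x i * b i u) + (fun u => \sum_(i <- s) x i * b i u)).
    by apply: is_deriveD => //; have := is_deriveZ (x i) (db i z zrt); exact.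
  by apply/funext => u; rewrite big_cons.
have dNH z : r <= z <= t -> is_derive z 1 (fun s => N * H s) (N * h z).
  by move=> zrt; have := is_deriveZ N (dH z zrt); exact.
have := derive_cmp rt dD dNH.
have -> : \sum_i x i * b i t - \sum_i x i * b i r = N ^+ 2.
  by rewrite -NE -sumrB; apply: eq_bigr => i _; rewrite -mulrBr.
rewrite -mulrBr NE => key.
have {}key : N ^+ 2 <= N * (H t - H r).
  apply: key => z zrt; apply: le_sqr_ge0; first by rewrite mulr_ge0// h0.
  apply: (le_trans (CS_fin _ _)); rewrite exprMn -NE ler_wpM2l// fh//.
have [->|NN0] := eqVneq N 0; first by rewrite expr0n sqr_ge0.
have Np : 0 < N by rewrite lt_def NN0.
move: key; rewrite expr2 ler_pM2l// => key.
by rewrite -expr2 ler_sqr// nnegrE (le_trans N0).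
Qed.

End Antiderivative.

(** * Square-summable sequences indexed by nat and a finite type *)

Section Ell2.
Context {R : realType} {J : finType}.
Local Notation seqJ := (nat -> J -> R).
Implicit Types a b c : seqJ.

Definition psum K b : R := \sum_(p : 'I_K * J) b p.1 p.2 ^+ 2.
(** Norm bounds are stated on all finite partial sums, so that no series is formed; [nrm] is the
    best such bound. *)
Definition le2 b (B : R) := 0 <= B /\ forall K, psum K b <= B ^+ 2.
Definition ell2 b := exists B, le2 b B.
Definition sub2 a b : seqJ := fun k j => a k j - b k j.
Definition nrm b : R := Num.sqrt (sup (range (fun K => psum K b))).

Lemma psum_ge0 K b : 0 <= psum K b.
Proof. by apply: sumr_ge0 => i _; exact: sqr_ge0. Qed.

Lemma nrm_ge0 b : 0 <= nrm b. Proof. exact: sqrtr_ge0. Qed.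

Lemma nrmP b B : le2 b B -> le2 b (nrm b) /\ nrm b <= B.
Proof.
move=> [B0 HB].
have hs : has_sup (range (fun K => psum K b)).
  by split; [exists (psum 0 b), 0%N|exists (B ^+ 2) => _ [K _ <-]].
have S0 : 0 <= sup (range (fun K => psum K b)).
  by apply: (le_trans (psum_ge0 0 b)); apply: sup_upper_bound => //; exists 0%N.
split; first split; first exact: nrm_ge0.
  by move=> K; rewrite sqr_sqrtr//; apply: sup_upper_bound => //; exists K.
apply: le_sqr_ge0 => //; rewrite sqr_sqrtr//; apply: sup_le_ub; first by case: hs.
by move=> _ [K _ <-].
Qed.

Lemma ell2_nrm b : ell2 b -> le2 b (nrm b).
Proof. by move=> [B /nrmP[]]. Qed.

Lemma le2_nrm b B : le2 b B -> nrm b <= B. Proof. by move=> /nrmP[]. Qed.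

Lemma le2_mono b A B : A <= B -> le2 b A -> le2 b B.
Proof.
move=> AB [A0 H]; split; first exact: le_trans AB.
by move=> K; apply: (le_trans (H K)); rewrite ler_sqr ?nnegrE// (le_trans A0).
Qed.

Lemma eq_le2 a b B : (forall k j, a k j = b k j) -> le2 a B -> le2 b B.
Proof.
move=> ab h; rewrite (_ : b = a)//.
by apply/funext => k; apply/funext => j; rewrite ab.
Qed.

Lemma le2D a b A B : le2 a A -> le2 b B -> le2 (fun k j => a k j + b k j) (A + B).
Proof.
by move=> [A0 HA] [B0 HB]; split; [exact: addr_ge0|move=> K; exact: (Mink_fin A0 B0 (HA K) (HB K))].
Qed.

Lemma le2Z (z : R) a A : le2 a A -> le2 (fun k j => z * a k j) (`|z| * A).
Proof.
move=> [A0 HA]; split; first exact: mulr_ge0.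
move=> K; rewrite /psum; under eq_bigr do rewrite exprMn.
rewrite -mulr_sumr exprMn real_normK ?num_real//.
by apply: ler_wpM2l; [exact: sqr_ge0|exact: HA].
Qed.

Lemma le2N a A : le2 a A -> le2 (fun k j => - a k j) A.
Proof. by move=> /(le2Z (-1)); rewrite normrN1 mul1r; apply: eq_le2 => k j; rewrite mulN1r. Qed.

Lemma le2_sub a b A B : le2 a A -> le2 b B -> le2 (sub2 a b) (A + B).
Proof. by move=> ha hb; exact: le2D ha (le2N hb). Qed.

Lemma le2_subC a b A : le2 (sub2 a b) A -> le2 (sub2 b a) A.
Proof. by move=> /le2N; apply: eq_le2 => k j; rewrite /sub2 opprB. Qed.

Lemma le2_trans a b c A B : le2 (sub2 a b) A -> le2 (sub2 b c) B -> le2 (sub2 a c) (A + B).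
Proof. by move=> h1 h2; apply: eq_le2 (le2D h1 h2) => k j; rewrite /sub2 addrA subrK. Qed.

Lemma le2_add a b A B : le2 (sub2 a b) A -> le2 b B -> le2 a (A + B).
Proof. by move=> h1 h2; apply: eq_le2 (le2D h1 h2) => k j; rewrite /sub2 subrK. Qed.

Lemma ell2_sub a b : ell2 a -> ell2 b -> ell2 (sub2 a b).
Proof. by move=> [A hA] [B hB]; exists (A + B); exact: le2_sub. Qed.

Lemma le2_coord a A k j : le2 a A -> `|a k j| <= A.
Proof.
move=> [A0 H]; apply: le_sqr_ge0 => //; rewrite real_normK ?num_real//.
apply: le_trans (H k.+1); rewrite /psum (bigD1 (ord_max : 'I_k.+1, j))//= lerDl.
by apply: sumr_ge0 => i _; exact: sqr_ge0.
Qed.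

Lemma le2_0 : le2 (fun _ _ => 0) 0.
Proof. by split => // K; rewrite /psum big1 ?expr0n// => i _; rewrite expr0n. Qed.

Lemma le2_refl a : le2 (sub2 a a) 0.
Proof. by apply: eq_le2 le2_0 => k j; rewrite /sub2 subrr. Qed.

(** Bounds pass to coordinatewise limits, one finite partial sum at a time. *)
Lemma le2_lim (an : nat -> seqJ) a B : (forall k j, (an n k j) @[n --> \oo] --> a k j) ->
  (\forall n \near \oo, le2 (an n) B) -> le2 a B.
Proof.
move=> ca hB; split.
  by near (\oo : set_system nat) => n; have [] : le2 (an n) B by near: n.
move=> K.
have c : (fun n => psum K (an n)) @ \oo --> psum K a.
  rewrite /psum; elim: (index_enum _) => [|p s IH].
    rewrite big_nil (_ : (fun _ => _) = cst 0); first exact: cvg_cst.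
    by apply/funext => n; rewrite big_nil.
  rewrite big_cons (_ : (fun _ => _) =
      (fun n => an n p.1 p.2 * an n p.1 p.2 + \sum_(q <- s) an n q.1 q.2 ^+ 2)).
    by apply: cvgD => //; rewrite expr2; apply: cvgM; exact: ca.
  by apply/funext => n; rewrite big_cons expr2.
apply: (closed_cvg (fun x => x <= B ^+ 2)) c; first exact: closed_le.
by apply: filterS hB => n [].
Unshelve. all: by end_near. Qed.

(* curves [0, oo) -> l^2 *)
Definition ccont (c : R -> seqJ) := forall t, 0 <= t -> forall e, 0 < e ->
  exists2 d, 0 < d & forall r, 0 <= r -> `|r - t| < d -> le2 (sub2 (c r) (c t)) e.

Lemma ccont_of_bound (c : R -> seqJ) (G : R -> R) : (forall t : R, 0 <= t -> {for t, continuous G}) ->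
  (forall r t, 0 <= r -> r <= t -> le2 (sub2 (c t) (c r)) (G t - G r)) -> ccont c.
Proof.
move=> cG H t t0 e e0.
have := cG t t0; move/cvgrPdist_lt => /(_ e e0) /nbhs_ballP[d /= d0 Hd].
exists d => // r r0 rt.
have hd : `|G t - G r| < e by apply: Hd; rewrite /ball/= distrC.
have [rt'|rt'] := leP r t.
  apply/le2_subC; apply: le2_mono (H r t r0 rt').
  by rewrite (le_trans (ler_norm _))// ltW.
apply: le2_mono (H t r t0 (ltW rt')).
by rewrite (le_trans (ler_norm _))// distrC ltW.
Qed.

Lemma half_cvg0 (z : R) : z * 2^-1 ^+ n @[n --> \oo] --> (0 : R).
Proof.
rewrite -(mulr0 z); apply: cvgM; first exact: cvg_cst.
by apply: cvg_expr; rewrite ger0_norm ?invr_ge0// invf_lt1 ?ltr1n.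
Qed.

Lemma geom_cvg (u : nat -> R) (C : R) : 0 <= C ->
  (forall n m, (n <= m)%N -> `|u m - u n| <= C * 2^-1 ^+ n) ->
  u n @[n --> \oo] --> lim (u n @[n --> \oo]).
Proof.
move=> C0 H; apply/cvg_ex; suff : cauchy_ex (u @ \oo) by move=> /cauchy_exP/cauchy_cvgP/cvg_ex.
move=> e e0.
have := half_cvg0 C; move/cvgr0Pnorm_lt => /(_ e e0)[N _ HN].
exists (u N); exists N => // n /= Nn; rewrite /ball/= distrC.
apply: le_lt_trans (H N n Nn) _; have := HN N (leqnn N); rewrite ger0_norm//.
by rewrite mulr_ge0// exprn_ge0// invr_ge0.
Qed.

End Ell2.

(** * Picard iteration in l^2 *)

Section CauchyLipschitz.
Context {R : realType} {J : finType}.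
Local Notation seqJ := (nat -> J -> R).
Variables (F : R -> seqJ -> seqJ) (L K : R) (b0 : seqJ).
Hypotheses (L1 : 1 <= L) (eb0 : ell2 b0).
Hypothesis lipF : forall t a b D, 0 <= t -> ell2 a -> ell2 b -> le2 (sub2 a b) D ->
  le2 (sub2 (F t a) (F t b)) (L * D).
Hypothesis bdF : forall t, 0 <= t -> le2 (F t b0) K.
(** Continuity in time is required coordinate by coordinate and for a fixed argument, which is what
    a strongly continuous group provides. *)
Hypothesis contF : forall a k j, ell2 a -> continuous (fun t : R => F (pos t) a k j).

Let pos_ge0 (t : R) : 0 <= pos t. Proof. by rewrite le_max lexx. Qed.
Let posE (t : R) : 0 <= t -> pos t = t. Proof. by move=> t0; apply/max_idPr. Qed.

Let pos_lip (r t : R) : `|pos r - pos t| <= `|r - t|.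
Proof.
have [r0|] := boolP (0 <= r); have [t0|] := boolP (0 <= t); rewrite -?ltNge.
- by rewrite !posE.
- move=> t0; rewrite (posE r0) max_l ?(ltW t0)// subr0 ger0_norm//.
  by apply: (le_trans _ (ler_norm _)); rewrite lerDl oppr_ge0 ltW.
- move=> r0; rewrite (posE t0) max_l ?(ltW r0)// sub0r normrN ger0_norm//.
  apply: (le_trans (y := t - r)); first by rewrite lerDl oppr_ge0 ltW.
  by rewrite distrC ler_norm.
- by move=> t0 r0; rewrite (max_l (ltW r0)) (max_l (ltW t0)) subrr normr0.
Qed.

Lemma contF_curve (c : R -> seqJ) k j : ccont c -> (forall t, 0 <= t -> ell2 (c t)) ->
  continuous (fun t : R => F (pos t) (c (pos t)) k j).
Proof.
move=> cc ec t; apply/cvgrPdist_lt => e e0.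
have L0 : 0 < L by rewrite (lt_le_trans ltr01).
have [d d0 Hd] := cc (pos t) (pos_ge0 t) (e / (2 * L)) (divr_gt0 e0 (mulr_gt0 (ltr0Sn R 1) L0)).
have e2 : 0 < e / 2 by rewrite divr_gt0.
have := @contF (c (pos t)) k j (ec _ (pos_ge0 t)) t.
move/cvgrPdist_lt => /(_ _ e2) h1.
near=> r.
have h2 : `|F (pos r) (c (pos t)) k j - F (pos r) (c (pos r)) k j| <= e / 2.
  rewrite -[X in `|X|]/(sub2 _ _ k j); apply: le2_coord.
  rewrite (_ : e / 2 = L * (e / (2 * L))); last by field; rewrite gt_eqF.
  apply: lipF; [exact: pos_ge0|exact: ec|exact: ec|].
  apply/le2_subC/Hd; first exact: pos_ge0.
  have : `|r - t| < d by near: r; exists d => //= y; rewrite /ball/= distrC.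
  by apply: le_lt_trans; exact: pos_lip.
have h3 : `|F (pos t) (c (pos t)) k j - F (pos r) (c (pos t)) k j| < e / 2 by near: r.
rewrite (le_lt_trans (ler_distD (F (pos r) (c (pos t)) k j) _ _))//.
by rewrite [ltRHS](splitr e) ltr_leD.
Unshelve. all: by end_near. Qed.

Definition picard (c : R -> seqJ) : R -> seqJ := fun t k j =>
  b0 k j + adr (fun r => F (pos r) (c (pos r)) k j) t.

Lemma picard_derive (c : R -> seqJ) k j (t : R) : ccont c -> (forall t, 0 <= t -> ell2 (c t)) ->
  -1 < t -> is_derive t 1 (fun r => picard c r k j) (F (pos t) (c (pos t)) k j).
Proof.
move=> cc ec t1; have [_ H] := adrP (contF_curve (k := k) (j := j) cc ec).
have dc : is_derive t 1 (cst (b0 k j)) (0 : R) by exact: is_derive_cst.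
by have := is_deriveD dc (H t t1); rewrite add0r.
Qed.

Lemma picard0 (c : R -> seqJ) : ccont c -> (forall t, 0 <= t -> ell2 (c t)) ->
  forall k j, picard c 0 k j = b0 k j.
Proof.
by move=> cc ec k j; rewrite /picard; have [-> _] := adrP (contF_curve (k := k) (j := j) cc ec); rewrite addr0.
Qed.

Lemma picard_cmp (c c' : R -> seqJ) (H h : R -> R) r t : 0 <= r -> r <= t ->
  ccont c -> (forall t, 0 <= t -> ell2 (c t)) ->
  ccont c' -> (forall t, 0 <= t -> ell2 (c' t)) ->
  (forall x : R, r <= x <= t -> is_derive x 1 H (h x)) ->
  (forall x, r <= x <= t -> le2 (sub2 (F x (c x)) (F x (c' x))) (h x)) ->
  le2 (sub2 (sub2 (picard c t) (picard c' t)) (sub2 (picard c r) (picard c' r))) (H t - H r).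
Proof.
move=> r0 rt cc ec cc' ec' dH hh; split.
  rewrite subr_ge0; apply: (derive_mono rt dH) => x xrt.
  by case: (hh x xrt).
move=> N; apply: (derive_cmp_vec (b := fun (p : 'I_N * J) s => picard c s p.1 p.2 - picard c' s p.1 p.2)
  (f := fun p x => F x (c x) p.1 p.2 - F x (c' x) p.1 p.2) (h := h)) => //.
- move=> p x /andP[rx xt]; have x0 : 0 <= x by exact: le_trans rx.
  have x1 : -1 < x by rewrite (lt_le_trans _ x0)// ltrN10.
  have := is_deriveB (picard_derive p.1 p.2 cc ec x1) (picard_derive p.1 p.2 cc' ec' x1).
  rewrite (posE x0); exact.
- by move=> x xrt; case: (hh x xrt).
- by move=> x xrt; case: (hh x xrt) => _ /(_ N).
Qed.

Lemma picard_incr (c : R -> seqJ) (H h : R -> R) r t : 0 <= r -> r <= t ->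
  ccont c -> (forall t, 0 <= t -> ell2 (c t)) ->
  (forall x : R, r <= x <= t -> is_derive x 1 H (h x)) ->
  (forall x, r <= x <= t -> le2 (F x (c x)) (h x)) ->
  le2 (sub2 (picard c t) (picard c r)) (H t - H r).
Proof.
move=> r0 rt cc ec dH hh; split.
  rewrite subr_ge0; apply: (derive_mono rt dH) => x xrt.
  by case: (hh x xrt).
move=> N; apply: (derive_cmp_vec (b := fun (p : 'I_N * J) s => picard c s p.1 p.2)
  (f := fun p x => F x (c x) p.1 p.2) (h := h)) => //.
- move=> p x /andP[rx xt]; have x0 : 0 <= x by exact: le_trans rx.
  have x1 : -1 < x by rewrite (lt_le_trans _ x0)// ltrN10.
  have := picard_derive p.1 p.2 cc ec x1; rewrite (posE x0); exact.
- by move=> x xrt; case: (hh x xrt).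
- by move=> x xrt; case: (hh x xrt) => _ /(_ N).
Qed.

(** Exponential weight: if two curves are within C E, their fields are within L C E, which
    integrates to at most C E / 2. The Picard map thus halves weighted distances on the whole
    half-line. *)
Let E (t : R) := expR (2 * L * t).
Let dE (t : R) (z : R) : is_derive t 1 (fun s => z * E s) (z * (2 * L * E t)).
Proof.
have d1 : is_derive t 1 ( *%R (2 * L)) (2 * L).
  have := is_deriveZ (2 * L) (is_derive_id t (1 : R)).
  by rewrite [X in is_derive _ _ _ X -> _](_ : _ = 2 * L)//; exact: mulr1.
have := is_deriveZ z (is_derive1_comp (is_derive_expR (2 * L * t)) d1).
by rewrite [X in is_derive _ _ _ X -> _](_ : _ = z * (2 * L * E t))//; rewrite /GRing.scale/= /E; ring.
Qed.
Let E1 (t : R) : 0 <= t -> 1 <= E t.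
Proof. by move=> t0; rewrite -expR0 ler_expR !mulr_ge0// (le_trans ler01). Qed.
Let Ege (t : R) : 0 <= E t. Proof. exact: expR_ge0. Qed.

Let K0 : 0 <= K. Proof. by case: (bdF (lexx 0)). Qed.

Let it (n : nat) : R -> seqJ := iter n picard (fun=> b0).
(** Its increments bound those of all iterates, hence those of the limit. *)
Let G (t : R) := K * t + K * E t.
Let dG (t : R) : is_derive t 1 G (K + K * (2 * L * E t)).
Proof.
apply: is_deriveD; last exact: dE.
have := is_deriveZ K (is_derive_id t (1 : R)).
by rewrite [X in is_derive _ _ _ X -> _](_ : _ = K)//; exact: mulr1.
Qed.

(** The factor 2 K (1 - 2^-n) is the sum of the first n geometric increments K 2^-k, so the distance
    to [b0] stays below 2 K E, which in turn bounds the speed by the derivative of [G]. *)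
Let hat (n : nat) := [/\ ccont (it n), forall t, 0 <= t -> ell2 (it n t),
  forall t, 0 <= t -> le2 (sub2 (it n t) b0) (2 * K * (1 - 2^-1 ^+ n) * E t),
  (forall r t, 0 <= r -> r <= t -> le2 (sub2 (it n t) (it n r)) (G t - G r)) &
  forall t, 0 <= t -> le2 (sub2 (it n.+1 t) (it n t)) (K * 2^-1 ^+ n * E t)].

Let half_le1 n : 0 <= 1 - 2^-1 ^+ n :> R.
Proof. by rewrite subr_ge0 exprn_ile1 ?invr_ge0// invf_le1 ?ler1n. Qed.

Let itP n : hat n.
Proof.
have L0 : 0 < L by rewrite (lt_le_trans ltr01).
have F_bd (c : seqJ) D t : 0 <= t -> ell2 c -> le2 (sub2 c b0) D -> le2 (F t c) (L * D + K).
  by move=> t0 ec hD; apply: le2_add (bdF t0); exact: lipF.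
elim: n => [|n [cc ec hb hG hd]].
  have cc0 : ccont (it 0).
    by move=> t _ e e0; exists 1 => // r _ _; apply: le2_mono (ltW e0) (le2_refl _).
  split => //; first by move=> t t0; rewrite expr0 subrr mulr0 mul0r; exact: le2_refl.
    move=> r t r0 rt; apply: le2_mono (le2_refl _); rewrite subr_ge0.
    apply: (derive_mono rt (fun x _ => dG x)) => x _.
    by rewrite addr_ge0// !mulr_ge0// ltW.
  move=> t t0.
  have hF x : 0 <= x <= t -> le2 (F x (it 0 x)) (K * (2 * L * E x)).
    move=> /andP[x0 _]; apply: le2_mono (bdF x0); rewrite ler_peMr// -[leLHS]mulr1 ler_pM// ?E1//.
    by move: L1; lra.
  have h := @picard_incr (it 0) (fun s => K * E s) _ 0 t (lexx 0) t0 cc0 (fun _ _ => eb0) (fun x _ => dE x K) hF.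
  apply: eq_le2 (le2_mono _ h).
    by move=> k j; rewrite /sub2 /it/= picard0.
  by rewrite expr0 mulr1 gerBl mulr_ge0.
have cc' : ccont (it n.+1).
  apply: (@ccont_of_bound _ _ _ G); first by move=> t _; exact: (continuous_derive (dG t)).
  move=> r t r0 rt; apply: (@picard_incr (it n) G _ r t r0 rt cc ec (fun x _ => dG x)) => x /andP[rx _].
  have x0 : 0 <= x by exact: le_trans rx.
  apply: le2_mono (F_bd _ _ x x0 (ec x x0) (hb x x0)).
  rewrite [leLHS]addrC lerD2l.
  rewrite (_ : L * _ = K * (2 * L * E x) * (1 - 2^-1 ^+ n)); last by ring.
  apply: ler_piMr; last by rewrite gerBl exprn_ge0// invr_ge0.
  by apply: mulr_ge0 => //; apply: mulr_ge0 => //; rewrite mulr_ge0// (ltW L0).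
have ec' t : 0 <= t -> ell2 (it n.+1 t).
  move=> t0; have [B hB] := ec t t0; have := hd t t0; move=> h.
  by eexists; exact: le2_add h hB.
split => //.
- move=> t t0; apply: le2_mono (le2_trans (hd t t0) (hb t t0)).
  by rewrite exprS le_eqVlt; apply/orP; left; apply/eqP; field.
- move=> r t r0 rt; apply: (@picard_incr (it n) G _ r t r0 rt cc ec (fun x _ => dG x)) => x /andP[rx _].
  have x0 : 0 <= x by exact: le_trans rx.
  apply: le2_mono (F_bd _ _ x x0 (ec x x0) (hb x x0)).
  rewrite [leLHS]addrC lerD2l.
  rewrite (_ : L * _ = K * (2 * L * E x) * (1 - 2^-1 ^+ n)); last by ring.
  apply: ler_piMr; last by rewrite gerBl exprn_ge0// invr_ge0.
  by apply: mulr_ge0 => //; apply: mulr_ge0 => //; rewrite mulr_ge0// (ltW L0).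
move=> t t0.
have hF x : 0 <= x <= t -> le2 (sub2 (F x (it n.+1 x)) (F x (it n x))) (K * 2^-1 ^+ n.+1 * (2 * L * E x)).
  move=> /andP[x0 _]; apply: le2_mono (lipF x0 (ec' x x0) (ec x x0) (hd x x0)).
  by rewrite exprS le_eqVlt; apply/orP; left; apply/eqP; field.
have h := @picard_cmp (it n.+1) (it n) _ _ 0 t (lexx 0) t0 cc' ec' cc ec (fun x _ => dE x (K * 2^-1 ^+ n.+1)) hF.
apply: eq_le2 (le2_mono _ h).
  move=> k j; rewrite /sub2 !picard0// subrr subr0//.
by rewrite gerBl mulr_ge0// mulr_ge0// exprn_ge0// invr_ge0.
Qed.

Let it_dist n m t : 0 <= t -> le2 (sub2 (it (n + m) t) (it n t)) (2 * K * 2^-1 ^+ n * (1 - 2^-1 ^+ m) * E t).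
Proof.
move=> t0; elim: m => [|m IH].
  by rewrite addn0 expr0 subrr mulr0 mul0r; exact: le2_refl.
have [_ _ _ _ hd] := itP (n + m).
rewrite addnS; apply: le2_mono (le2_trans (hd t t0) IH).
by rewrite exprD exprS le_eqVlt; apply/orP; left; apply/eqP; field.
Qed.

Let it_le n m t : 0 <= t -> (n <= m)%N -> le2 (sub2 (it m t) (it n t)) (2 * K * E t * 2^-1 ^+ n).
Proof.
move=> t0 nm; rewrite -(subnKC nm); apply: le2_mono (it_dist n (m - n) t0).
rewrite (_ : _ * (1 - _) * _ = 2 * K * E t * 2^-1 ^+ n * (1 - 2^-1 ^+ (m - n))); last by ring.
have p0 k : 0 <= (2^-1 : R) ^+ k by rewrite exprn_ge0// invr_ge0.
apply: ler_piMr; last by rewrite gerBl.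
by rewrite mulr_ge0// mulr_ge0// mulr_ge0.
Qed.

Let lm (t : R) : seqJ := fun k j => lim (it n t k j @[n --> \oo]).

Let it_lm t k j : 0 <= t -> it n t k j @[n --> \oo] --> lm t k j.
Proof.
move=> t0; apply: (@geom_cvg _ _ (2 * K * E t)); first by rewrite !mulr_ge0.
move=> n m nm; have := le2_coord k j (it_le t0 nm); exact.
Qed.

Let lm_it n t : 0 <= t -> le2 (sub2 (lm t) (it n t)) (2 * K * E t * 2^-1 ^+ n).
Proof.
move=> t0; apply: (@le2_lim _ _ (fun m => sub2 (it m t) (it n t))).
  by move=> k j; rewrite /sub2; apply: cvgB; [exact: it_lm|exact: cvg_cst].
by exists n => // m /= nm; exact: it_le.
Qed.

Let lm_ell2 t : 0 <= t -> ell2 (lm t).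
Proof.
move=> t0; have [_ /(_ t t0)[B hB] _ _ _] := itP 0.
by eexists; exact: le2_add (lm_it 0 t0) hB.
Qed.

Let lm_G r t : 0 <= r -> r <= t -> le2 (sub2 (lm t) (lm r)) (G t - G r).
Proof.
move=> r0 rt; have t0 : 0 <= t by exact: le_trans rt.
apply: (@le2_lim _ _ (fun m => sub2 (it m t) (it m r))).
  by move=> k j; rewrite /sub2; apply: cvgB; exact: it_lm.
by apply: nearW => n; have [_ _ _ + _] := itP n; apply.
Qed.

Let lm_ccont : ccont lm.
Proof.
apply: (@ccont_of_bound _ _ _ G); last exact: lm_G.
by move=> t _; exact: (continuous_derive (dG t)).
Qed.

Let lm_picard t k j : 0 <= t -> picard lm t k j = lm t k j.
Proof.
move=> t0.
have c1 : it n.+1 t k j @[n --> \oo] --> lm t k j.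
  have h : (fun n => it n t k j) @ \oo --> lm t k j by exact: it_lm.
  by rewrite -cvg_shiftS in h.
have c2 : it n.+1 t k j @[n --> \oo] --> picard lm t k j.
  apply/cvgrPdist_lt => e e0.
  have := half_cvg0 (2 * K * E t); move/cvgr0Pnorm_lt => /(_ e e0); apply: filterS => n.
  have [cc ec _ _ _] := itP n.
  have hF x : 0 <= x <= t -> le2 (sub2 (F x (lm x)) (F x (it n x))) (K * 2^-1 ^+ n * (2 * L * E x)).
    move=> /andP[x0 _]; apply: le2_mono (lipF x0 (lm_ell2 x0) (ec x x0) (lm_it n x0)).
    by rewrite le_eqVlt; apply/orP; left; apply/eqP; ring.
  have h := @picard_cmp lm (it n) _ _ 0 t (lexx 0) t0 lm_ccont lm_ell2 cc ec (fun x _ => dE x (K * 2^-1 ^+ n)) hF.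
  apply: le_lt_trans; have := le2_coord k j h.
  rewrite /sub2 !(picard0 lm_ccont lm_ell2) !(picard0 cc ec) subrr subr0 => h'.
  apply: (le_trans h'); rewrite ger0_norm; last by rewrite !mulr_ge0// exprn_ge0// invr_ge0.
  have p0 : 0 <= (2^-1 : R) ^+ n by rewrite exprn_ge0// invr_ge0.
  have q1 := mulr_ge0 (mulr_ge0 K0 p0) (Ege t); have q2 := mulr_ge0 (mulr_ge0 K0 p0) (Ege 0).
  apply: (le_trans (y := K * 2^-1 ^+ n * E t)); first by rewrite gerBl.
  by rewrite (_ : 2 * K * _ * _ = K * 2^-1 ^+ n * E t + K * 2^-1 ^+ n * E t) ?lerDl//; ring.
exact: (cvg_unique _ c2 c1).
Qed.

(** The equation holds coordinatewise on ]-1, oo[; for negative times the field is frozen at its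
    value at time 0, which makes the derivative at 0 two-sided. *)
Theorem Cauchy_Lipschitz : exists b : R -> seqJ,
  [/\ forall k j, b 0 k j = b0 k j, ccont b, forall t, 0 <= t -> ell2 (b t) &
   forall (t : R) k j, -1 < t -> is_derive t 1 (fun r => b r k j) (F (pos t) (b (pos t)) k j)].
Proof.
exists (picard lm); have e t : 0 <= t -> picard lm t = lm t.
  by move=> t0; apply/funext => k; apply/funext => j; exact: lm_picard.
split.
- exact: picard0 lm_ccont lm_ell2.
- by move=> t t0 z z0; have [d d0 H] := lm_ccont t0 z0; exists d => // r r0 rt; rewrite !e//; exact: H.
- by move=> t t0; rewrite e//; exact: lm_ell2.
- by move=> t k j t1; rewrite e//; exact: picard_derive lm_ccont lm_ell2 t1.
Qed.

End CauchyLipschitz.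

(** * Completeness of L^2 *)

Section Completeness.
Context {R : realType}.
Implicit Types (f g h : R -> R).
Local Notation mu := (@lebesgue_measure R).

Transparent int01 L1.
Lemma EFin_int01 f : L1 f -> (int01 f)%:E = (\int[mu]_(x in I01) (f x)%:E)%E.
Proof. by move=> Lf; rewrite /int01 /Rintegral fineK// integrable_fin_num. Qed.

Lemma int01_fatou (g_ : nat -> R -> R) g C : (forall n, L1 (g_ n)) -> measurable_fun I01 g ->
  (forall n x, I01 x -> 0 <= g_ n x) -> (forall n, int01 (g_ n) <= C) ->
  (forall x, I01 x -> g_ ^~ x @ \oo --> g x) -> L1 g /\ int01 g <= C.
Proof.
move=> Lg mg g0 gC gg.
have ge0 x : I01 x -> 0 <= g x.
  by move=> Ix; apply: (cvgr_to_ge (gg x Ix)); apply: nearW => n; exact: g0.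
have F := @fatou _ _ _ mu I01 mI01 (fun n x => (g_ n x)%:E) _ _.
have {}F : (\int[mu]_(x in I01) limn_einf (fun n => (g_ n x)%:E) <=
   limn_einf (fun n => \int[mu]_(x in I01) (g_ n x)%:E))%E.
  apply: F; first by move=> n; have /L1_meas/measurable_EFinP := Lg n.
  by move=> n x Ix; rewrite lee_fin g0.
have E1 : (\int[mu]_(x in I01) limn_einf (fun n => (g_ n x)%:E) =
    \int[mu]_(x in I01) (g x)%:E)%E.
  apply: eq_integral => x; rewrite inE => Ix.
  have c : (fun n => (g_ n x)%:E) @ \oo --> (g x)%:E.
    by apply: cvg_EFin; [exact: nearW|exact: gg].
  by rewrite (cvg_limn_einf_sup c).1.
have E2 : (limn_einf (fun n => \int[mu]_(x in I01) (g_ n x)%:E) <= C%:E)%E.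
  rewrite limn_einf_lim; apply: lime_le; first exact: is_cvg_einfs.
  apply: nearW => n; apply: (@le_trans _ _ (\int[mu]_(x in I01) (g_ n x)%:E)%E).
    by apply: ereal_inf_lbound; exists n => /=.
  by rewrite -EFin_int01// lee_fin.
have E3 : (\int[mu]_(x in I01) (g x)%:E <= C%:E)%E by rewrite -E1; exact: le_trans F E2.
have L : L1 g.
  apply/integrableP; split; first by move/measurable_EFinP : mg.
  have -> : (\int[mu]_(x in I01) `|(g x)%:E| = \int[mu]_(x in I01) (g x)%:E)%E.
    by apply: eq_integral => x; rewrite inE => Ix; rewrite /= ger0_norm// ge0.
  exact: le_lt_trans E3 (ltey _).
by split=> //; rewrite -lee_fin EFin_int01.
Qed.

(** The sum has a finite integral, hence is finite almost everywhere. The set of full measure is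
    returned as a measurable set, so that its indicator can be used as a factor. *)
Lemma ae_summable (d_ : nat -> R -> R) C : (forall n, L1 (d_ n)) ->
  (forall n x, I01 x -> 0 <= d_ n x) -> (forall N, \sum_(n < N) int01 (d_ n) <= C) ->
  exists A : set R, [/\ measurable A, {ae mu, forall x, I01 x -> A x} &
    forall x, I01 x -> A x -> exists M, forall N, \sum_(n < N) d_ n x <= M].
Proof.
move=> Ld d0 dC.
pose h x := (\sum_(n <oo) ((d_ n \_ I01) x)%:E)%E.
have d0' n x : (0 <= ((d_ n \_ I01) x)%:E)%E.
  by rewrite patchE; case: ifP => //; rewrite inE lee_fin => /d0.
have md n : measurable_fun setT (fun x => ((d_ n \_ I01) x)%:E).
  have /L1_meas m := Ld n.
  by move/(measurable_restrictT (d_ n) mI01)/measurable_EFinP : m.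
have mh : measurable_fun setT h.
  by apply: (@ge0_emeasurable_sum _ _ _ setT (fun n x => ((d_ n \_ I01) x)%:E) xpredT).
have ih : (\int[mu]_x h x <= C%:E)%E.
  rewrite integral_nneseries//.
  apply: lime_le; first by apply: is_cvg_nneseries => n _ _; exact: integral_ge0.
  apply: nearW => N; rewrite (_ : (\sum_(0 <= i < N) _)%E = (\sum_(n < N) int01 (d_ n))%:E) ?lee_fin//.
  rewrite big_mkord -sumEFin; apply: eq_bigr => n _.
  rewrite EFin_int01// [RHS]integral_mkcond; apply: eq_integral => x _.
  by rewrite !patchE; case: ifP.
have iih : mu.-integrable setT h.
  apply/integrableP; split => //.
  have -> : (\int[mu]_x `|h x| = \int[mu]_x h x)%E.
    by apply: eq_integral => x _; rewrite gee0_abs//; apply: nneseries_ge0.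
  exact: le_lt_trans ih (ltey _).
exists (h @^-1` [set` `]-oo%E, +oo%E[]); split.
- rewrite -[X in measurable X]setTI; apply: mh => //; exact: emeasurable_itv.
- have := integrable_ae measurableT iih; apply: aeS => x /(_ Logic.I) hx _ /=.
  by rewrite in_itv/= -fin_numElt.
- move=> x Ix /=; rewrite in_itv/= -fin_numElt => hx; exists (fine (h x)) => N; rewrite -lee_fin fineK// -sumEFin.
  rewrite -(big_mkord xpredT (fun n => (d_ n x)%:E)).
  apply: (le_trans _ (@nneseries_lim_ge R (fun n => ((d_ n \_ I01) x)%:E) xpredT 0 N _)) => //.
  by under [leRHS]eq_bigr do rewrite patchE mem_set//.
Qed.
Opaque int01 L1.

(** Riesz-Fischer: increments bounded by a geometric series are summable almost everywhere, which
    gives a pointwise limit. *)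
Lemma L2_complete_fast (f_ : nat -> R -> R) (C : R) : (forall n, L2 (f_ n)) ->
  (forall n m, (n <= m)%N -> L2norm (f_ m \- f_ n) <= C * 2^-1 ^+ n) ->
  exists f, L2 f /\ forall n, L2norm (f_ n \- f) <= C * 2^-1 ^+ n.
Proof.
move=> Lf HC.
have C0 : 0 <= C by have := HC 0%N 0%N (leqnn _); rewrite expr0 mulr1; apply: le_trans (L2norm_ge0 _).
pose d_ n x := `|f_ n.+1 x - f_ n x|.
have Ld n : L1 (d_ n) by apply/L1_abs/L2_L1/L2B.
have [||A [mA aeA HA]] := @ae_summable d_ (C * 2) Ld.
- by move=> n x _; exact: normr_ge0.
- move=> N; apply: (@le_trans _ _ (\sum_(n < N) C * 2^-1 ^+ n)).
    apply: ler_sum => n _; apply: le_trans (HC n n.+1 (leqnSn _)).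
    exact/int01_abs_le/L2B.
  rewrite -mulr_sumr ler_wpM2l//.
  have E : \sum_(n < N) (2^-1 : R) ^+ n = 2 * (1 - 2^-1 ^+ N).
    elim: N => [|N IH]; first by rewrite big_ord0 expr0 subrr mulr0.
    by rewrite big_ord_recr/= IH exprS; field.
  by rewrite E ler_piMr// gerBl exprn_ge0// invr_ge0.
pose fA n x := f_ n x * \1_A x.
have cA x : I01 x -> cvgn (fA^~ x).
  move=> Ix; rewrite /fA; have [Ax|nAx] := pselect (A x); last first.
    by under eq_fun do rewrite indicE memNset// mulr0; exact: is_cvg_cst.
  under eq_fun do rewrite indicE mem_set// mulr1.
  have [M HM] := HA x Ix Ax.
  have c1 : cvgn (series (telescope (fun n => f_ n x))).
    apply: normed_cvg.
    rewrite (_ : [normed series _] = (fun N => \sum_(n < N) d_ n x)); last first.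
      by apply/funext => N; rewrite -(big_mkord xpredT (fun n => d_ n x)).
    apply: nondecreasing_is_cvgn; last by exists M => _ [N _ <-]; exact: HM.
    by apply/nondecreasing_seqP => n; rewrite big_ord_recr/= lerDl normr_ge0.
  have -> : (fun n => f_ n x) = (fun n => f_ 0%N x + series (telescope (fun n => f_ n x)) n).
    by apply/funext => n; rewrite -eq_sum_telescope.
  by apply: is_cvgD => //; exact: is_cvg_cst.
pose f x := limn (fA^~ x).
have mA1 : measurable_fun I01 (\1_A : R -> R) by apply: measurable_funTS; exact: measurable_indic.
have mfA n : measurable_fun I01 (fA n) by apply: measurable_funM => //; exact: L2_meas.
have mf : measurable_fun I01 f by apply: (measurable_fun_cvg mfA).
have fAae n : aeq (fA n) (f_ n).
  by apply: aeS aeA => x Ax Ix; rewrite /fA indicE mem_set ?mulr1//; exact: Ax.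
have LfA n : L2 (fA n).
  apply: (L2M_bounded (M := 1)) => // x _; rewrite indicE; case: (_ \in _); rewrite ?normr1 ?normr0//.
(* Fatou's lemma transfers the Cauchy bound to the limit, with the same rate. *)
have key n : L1 ((f_ n \- f) \* (f_ n \- f)) /\ int01 ((f_ n \- f) \* (f_ n \- f)) <= (C * 2^-1 ^+ n) ^+ 2.
  have Lm m : L2 (f_ n \- fA m) by exact: L2B.
  apply: (@int01_fatou (fun m => (f_ n \- fA (n + m)%N) \* (f_ n \- fA (n + m)%N))).
  - by move=> m; exact: L1M.
  - by apply: measurable_funM; apply: measurable_funB => //; exact: L2_meas.
  - by move=> m x _; rewrite /= -expr2 sqr_ge0.
  - move=> m; rewrite -L2norm_sqr//.
    rewrite (aeq_L2norm (g := f_ n \- f_ (n + m)%N))//; last first.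
    + by apply: aeqB => //; exact: aeq_refl.
    + exact: L2B.
    rewrite (eq_L2norm (g := \- (f_ (n + m)%N \- f_ n))); last by move=> x _; rewrite /= opprB.
    rewrite L2normN; last exact: L2B.
    by rewrite ler_sqr ?nnegrE ?L2norm_ge0 ?mulr_ge0 ?exprn_ge0 ?invr_ge0// HC// leq_addr.
  - move=> x Ix; have h : (fun m => f_ n x - fA (n + m)%N x) @ \oo --> f_ n x - f x.
      apply: cvgB; first exact: cvg_cst.
      have h0 : fA^~ x @ \oo --> f x by exact: cA.
      by under eq_fun do rewrite addnC; rewrite -(cvg_shiftn n) in h0.
    exact: cvgM.
have Lfn n : L2 (f_ n \- f).
  by apply/L2P; split; [apply: measurable_funB => //; exact: L2_meas|case: (key n)].
exists f; split.
  by apply: eq_L2 (L2B (Lf 0%N) (Lfn 0%N)) => x _; rewrite /= opprB addrC subrK.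
move=> n; apply: L2norm_le => //; last by case: (key n).
by rewrite mulr_ge0// exprn_ge0// invr_ge0.
Qed.

End Completeness.

(** * Cosine series and their term-by-term derivatives *)

Section Fourier.
Context {R : realType}.
Implicit Types (f g h : R -> R) (c : nat -> R).
Local Notation mu := (@lebesgue_measure R).

Fixpoint trig (i : nat) : R -> R :=
  match i with 0 => cos | 1 => (fun x => - sin x) | i'.+2 => fun x => - trig i' x end.

Lemma trig_derive i (x : R) : is_derive x 1 (trig i) (trig i.+1 x).
Proof.
suff : is_derive x 1 (trig i) (trig i.+1 x) /\ is_derive x 1 (trig i.+1) (trig i.+2 x) by case.
elim: i => [|i [IH1 IH2]]; split => //.
- exact: is_derive_cos.
- exact: is_deriveN (is_derive_sin x).
- exact: is_deriveN IH1.
Qed.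

Lemma trig_continuous i : continuous (trig i).
Proof. by move=> x; exact: (continuous_derive (trig_derive i x)). Qed.

Lemma trig_bound i x : `|trig i x| <= 1.
Proof.
suff : `|trig i x| <= 1 /\ `|trig i.+1 x| <= 1 by case.
elim: i => [|i [IH1 IH2]]; last by split => //=; rewrite normrN.
by rewrite /= normrN cos_max sin_max.
Qed.

Definition lam (k : nat) : R := pi * k%:R.
Definition nk (k : nat) : R := if k == 0%N then 1 else Num.sqrt 2.
(** The i-th derivative of the normalised cosine nk cos(pi k s), frozen outside [0, 1]; [trig i] is
    the i-th derivative of the cosine. *)
Definition ej (k i : nat) (s : R) : R := nk k * lam k ^+ i * trig i (lam k * clip s).

Lemma lam_ge0 k : 0 <= lam k. Proof. by rewrite mulr_ge0// pi_ge0. Qed.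
Lemma nk_ge0 k : 0 <= nk k. Proof. by rewrite /nk; case: ifP. Qed.
Lemma nk_le k : nk k <= 2.
Proof.
rewrite /nk; case: ifP => _; first by rewrite ler1n.
by apply: le_sqr_ge0 => //; rewrite sqr_sqrtr// expr2; lra.
Qed.

Lemma eq_prim f g s : (forall x, I01 x -> f x = g x) -> prim f s = prim g s.
Proof. by move=> fg; rewrite !prim_def; apply: eq_int01 => x /fg ->. Qed.

Lemma ej_AC k i : AC (ej k i) (ej k i.+1).
Proof.
pose g (s : R) := nk k * lam k ^+ i.+1 * trig i.+1 (lam k * s).
have cl : continuous (fun s : R => lam k * s).
  by move=> s; apply: cvgM; [exact: cvg_cst|exact: cvg_id].
have dl (s : R) : is_derive s 1 (fun s : R => lam k * s) (lam k).
  by have := is_deriveZ (lam k) (is_derive_id s (1 : R)); rewrite [X in is_derive _ _ _ X -> _](_ : _ = lam k)//; exact: mulr1.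
have H : forall s, 0 <= s <= 1 -> nk k * lam k ^+ i * trig i (lam k * s) =
    nk k * lam k ^+ i * trig i (lam k * 0) + prim g s.
  apply: (@FTC01 _ (fun s => nk k * lam k ^+ i * trig i (lam k * s))) => [x|x].
    have := is_deriveZ (nk k * lam k ^+ i) (is_derive1_comp (trig_derive i (lam k * x)) (dl x)).
    by rewrite [X in is_derive _ _ _ X -> _](_ : _ = g x)//; rewrite /g /GRing.scale/= exprS; ring.
  apply: cvgM; first exact: cvg_cst.
  exact: (continuous_comp (cl x) (@trig_continuous i.+1 _)).
move=> s; have /(_ s) := AC_of_01 H; rewrite /ej => E.
rewrite [LHS]E; congr (_ + _).
apply: eq_prim => x Ix; rewrite /g clipE//; exact: I01_01.
Qed.

Lemma ej_continuous k i : continuous (ej k i).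
Proof.
have cc : continuous (@clip R).
  have H := @FTC01 R id (cst 1) (fun x => is_derive_id _ _) (@cst_continuous _ _ _).
  exact: (AC_continuous (L2_cst 1) (AC_of_01 H)).
move=> s; apply: cvgM; first exact: cvg_cst.
apply: (@continuous_comp _ _ _ (fun s => lam k * clip s) (trig i)).
  by apply: cvgM; [exact: cvg_cst|exact: cc].
exact: trig_continuous.
Qed.

Lemma ej_L2 k i : L2 (ej k i).
Proof.
apply: (@L2_bounded _ _ (nk k * lam k ^+ i)); first by apply: cont_meas; exact: ej_continuous.
move=> x _; rewrite /ej normrM ger0_norm ?mulr_ge0 ?nk_ge0 ?exprn_ge0 ?lam_ge0//.
by rewrite ler_piMr ?trig_bound// mulr_ge0 ?nk_ge0 ?exprn_ge0 ?lam_ge0.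
Qed.

Lemma ej2 k i s : ej k i.+2 s = - (lam k ^+ 2 * ej k i s).
Proof. by rewrite /ej /= !exprS; ring. Qed.

Lemma sin_lam k : sin (lam k) = 0.
Proof.
suff : sin (lam k) = 0 /\ `|cos (lam k)| = 1 by case.
elim: k => [|k [IH1 IH2]]; first by rewrite /lam mulr0 sin0 cos0 normr1.
have e : lam k.+1 = lam k + pi by rewrite /lam -addn1 natrD mulrDr mulr1.
split; first by rewrite e sinD IH1 mul0r sinpi mulr0 addr0.
by rewrite e cosD IH1 mul0r subr0 cospi mulrN1 normrN.
Qed.

Lemma ej_odd k i : odd i -> ej k i 0 = 0 /\ ej k i 1 = 0.
Proof.
have z x : sin x = 0 -> odd i -> trig i x = 0.
  move=> sx; suff : (odd i -> trig i x = 0) /\ (odd i.+1 -> trig i.+1 x = 0) by case.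
  elim: i => [|i [IH1 IH2]]; first by split => //= _; rewrite sx oppr0.
  by split => // h; rewrite /= IH1 ?oppr0//; move: h; rewrite /= negbK.
move=> oi; rewrite /ej !clipE ?lexx ?ler01// mulr0 mulr1 !z ?mulr0//; [exact: sin_lam|exact: sin0].
Qed.

(** No boundary terms: the odd derivative of a cosine mode vanishes at both ends. *)
Lemma ej_parts k l i j : ~~ odd j ->
  int01 (ej k i.+1 \* ej l j.+1) = lam l ^+ 2 * int01 (ej k i \* ej l j).
Proof.
move=> ej'; have oj : odd j.+1 by [].
have := int01_byparts (ej_L2 k i.+1) (ej_L2 l j.+2) (@ej_AC k i) (@ej_AC l j.+1).
have [-> ->] := @ej_odd l j.+1 oj; rewrite !mulr0 subrr => /eqP; rewrite addr_eq0 => /eqP ->.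
rewrite (eq_int01 (g := fun x => - (lam l ^+ 2) * (ej k i \* ej l j) x)); last first.
  by move=> x _; rewrite /= ej2; ring.
by rewrite int01Z ?mulNr ?opprK//; apply: L1M; exact: ej_L2.
Qed.

Lemma int01_mulC f g : int01 (f \* g) = int01 (g \* f).
Proof. by apply: eq_int01 => x _ /=; rewrite mulrC. Qed.

(** For k = l > 0, (ej k 1)^2 + lam^2 (ej k 0)^2 is the constant 2 lam^2, and by parts both terms
    have the same integral. For k <> l, integrating by parts in both directions gives two different
    eigenvalues. *)
Lemma ej_orth0 k l : int01 (ej k 0 \* ej l 0) = (k == l)%:R.
Proof.
have [<-|kl] := eqVneq k l.
  have [->|k0] := eqVneq k 0%N.
    rewrite (eq_int01 (g := cst 1)) ?int01_cst//.
    by move=> x _; rewrite /= /ej /lam /nk/= mulr0 mul0r expr0 cos0 !mulr1.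
  have lN0 : lam k ^+ 2 != 0.
    by rewrite sqrf_eq0 /lam mulf_eq0 negb_or pnatr_eq0 k0 gt_eqF ?pi_gt0.
  have e1 := @ej_parts k k 0 0 isT.
  have E : int01 ((ej k 1 \* ej k 1) \+ (fun x => lam k ^+ 2 * (ej k 0 \* ej k 0) x)) = 2 * lam k ^+ 2.
    rewrite -[RHS]int01_cst; apply: eq_int01 => x _ /=.
    rewrite /ej /nk (negbTE k0) /= expr0 expr1.
    set u := lam k * clip x; have := cos2Dsin2 u => e.
    have q : Num.sqrt 2 * Num.sqrt 2 = 2 :> R by rewrite -expr2 sqr_sqrtr.
    have -> : Num.sqrt 2 * lam k * - sin u * (Num.sqrt 2 * lam k * - sin u) +
      lam k ^+ 2 * (Num.sqrt 2 * 1 * cos u * (Num.sqrt 2 * 1 * cos u)) =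
      (Num.sqrt 2 * Num.sqrt 2) * lam k ^+ 2 * (cos u ^+ 2 + sin u ^+ 2) by ring.
    by rewrite q e mulr1.
  have L0 : L1 (ej k 0 \* ej k 0) by apply: L1M; exact: ej_L2.
  move: E; rewrite int01D ?int01Z//; [|apply: L1M; exact: ej_L2|exact: L1Z].
  rewrite e1 -mulrDr mulrC => /(mulIf lN0) h.
  suff -> : int01 (ej k 0 \* ej k 0) = 1 by [].
  by move: (int01 _) h => z h; lra.
have e1 := @ej_parts k l 0 0 isT; have e2 := @ej_parts l k 0 0 isT.
have : (lam k ^+ 2 - lam l ^+ 2) * int01 (ej k 0 \* ej l 0) = 0.
  by rewrite mulrBl -e1 [in X in X - _]int01_mulC -e2 int01_mulC subrr.
move/eqP; rewrite mulf_eq0 subr_eq0 => /orP[|/eqP //].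
rewrite eqrXn2 ?lam_ge0// /lam => /eqP/(mulfI (negbT (gt_eqF (pi_gt0 R))))/eqP.
by rewrite eqr_nat (negbTE kl).
Qed.

Lemma ej_orth i k l : int01 (ej k i \* ej l i) = (k == l)%:R * (lam k ^+ i) ^+ 2.
Proof.
have even j : int01 (ej k j.*2 \* ej l j.*2) = (k == l)%:R * (lam k ^+ j.*2) ^+ 2.
  elim: j => [|j IH]; first by rewrite ej_orth0 expr0 expr1n mulr1.
  rewrite doubleS (eq_int01 (g := fun x => (lam k ^+ 2 * lam l ^+ 2) * (ej k j.*2 \* ej l j.*2) x)); last first.
    by move=> x _; rewrite /= !ej2; ring.
  rewrite int01Z; last by apply: L1M; exact: ej_L2.
  rewrite IH; have [<-|_] := eqVneq k l; last by rewrite !mul0r mulr0.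
  by rewrite !exprS; ring.
rewrite -(odd_double_half i); case: (odd i); last exact: even.
rewrite add1n ej_parts ?odd_double// even.
by have [<-|_] := eqVneq k l; rewrite ?mul0r ?mulr0// !exprS; ring.
Qed.

Definition coef f k := int01 (f \* ej k 0).
Definition Sf c i n (s : R) : R := \sum_(k < n) c k * ej k i s.

Lemma Sf_S c i n : Sf c i n.+1 = fun s => Sf c i n s + c n * ej n i s.
Proof. by apply/funext => s; rewrite /Sf big_ord_recr. Qed.
Lemma Sf_0 c i : Sf c i 0 = fun=> 0.
Proof. by apply/funext => s; rewrite /Sf big_ord0. Qed.

Lemma Sf_L2 c i n : L2 (Sf c i n).
Proof.
elim: n => [|n IH]; first by rewrite Sf_0; exact: L2_cst.
by rewrite Sf_S; apply: L2D => //; apply/L2Z/ej_L2.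
Qed.

Lemma Sf_AC c i n : AC (Sf c i n) (Sf c i.+1 n).
Proof.
elim: n => [|n IH]; first by rewrite !Sf_0; exact: AC_cst.
rewrite !Sf_S; apply: ACD => //; [exact: Sf_L2|exact/L2Z/ej_L2|].
by apply: ACZ; [exact: ej_L2|exact: ej_AC].
Qed.

Lemma Sf_jet c N n : jet N (fun i => Sf c i n).
Proof. by split=> [i _|]; [exact: Sf_AC|exact: Sf_L2]. Qed.

Lemma Sf_odd c i n : odd i -> Sf c i n 0 = 0 /\ Sf c i n 1 = 0.
Proof. by move=> oi; split; apply: big1 => k _; have [e0 e1] := ej_odd k oi; rewrite ?e0 ?e1 mulr0. Qed.

Lemma int01_Sf c i n g : L2 g -> int01 (Sf c i n \* g) = \sum_(k < n) c k * int01 (ej k i \* g).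
Proof.
move=> Lg; elim: n => [|n IH].
  by rewrite big_ord0 Sf_0 -[RHS]int01_0; apply: eq_int01 => x _; rewrite /= mul0r.
rewrite big_ord_recr/= -IH -int01Z; last by apply: L1M => //; exact: ej_L2.
rewrite -int01D; [|apply: L1M => //; exact: Sf_L2|by apply/L1Z/L1M => //; exact: ej_L2].
by apply: eq_int01 => x _; rewrite Sf_S/=; ring.
Qed.

Lemma Sf_ip a b i n : int01 (Sf a i n \* Sf b i n) = \sum_(k < n) a k * b k * (lam k ^+ i) ^+ 2.
Proof.
rewrite int01_Sf; last exact: Sf_L2.
apply: eq_bigr => k _; rewrite int01_mulC int01_Sf; last exact: ej_L2.
rewrite (bigD1 k)//= ej_orth eqxx mul1r big1 ?addr0 ?mulrA// => l lk.
by rewrite ej_orth val_eqE (negbTE lk) mul0r mulr0.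
Qed.

Lemma Sf_norm a i n : L2norm (Sf a i n) ^+ 2 = \sum_(k < n) (a k * lam k ^+ i) ^+ 2.
Proof.
rewrite L2norm_sqr; last exact: Sf_L2.
by rewrite Sf_ip; apply: eq_bigr => k _; rewrite [RHS]exprMn; congr (_ * _).
Qed.

Lemma Sf_B a b i n s : Sf a i n s - Sf b i n s = Sf (fun k => a k - b k) i n s.
Proof. by rewrite /Sf -sumrB; apply: eq_bigr => k _; rewrite mulrBl. Qed.

Lemma bessel f n : L2 f -> \sum_(k < n) coef f k ^+ 2 <= L2norm f ^+ 2.
Proof.
move=> Lf; set S := Sf (coef f) 0 n; have LS : L2 S := Sf_L2 _ _ _.
have : 0 <= int01 ((f \- S) \* (f \- S)) by apply: int01_ge0 => x _; rewrite /= -expr2 sqr_ge0.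
have E1 : int01 (S \* f) = \sum_(k < n) coef f k ^+ 2.
  by rewrite int01_Sf//; apply: eq_bigr => k _; rewrite int01_mulC -/(coef f k) expr2.
have E2 : int01 (S \* S) = \sum_(k < n) coef f k ^+ 2.
  by rewrite Sf_ip; apply: eq_bigr => k _; rewrite expr0 expr1n mulr1 expr2.
rewrite (eq_int01 (g := (f \* f) \- (fun x => 2 * (S \* f) x) \+ (S \* S))); last by move=> x _ /=; ring.
have L := L1M Lf Lf; have L' := L1Z 2 (L1M LS Lf); have L'' := L1M LS LS.
rewrite int01D//; last exact: L1B.
rewrite int01B// int01Z; last exact: L1M.
rewrite E1 E2 L2norm_sqr//; move: (int01 _) (\sum_(k < n) _) => x y; lra.
Qed.

Definition cvL2 (f_ : nat -> R -> R) f := L2norm (f_ n \- f) @[n --> \oo] --> (0 : R).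

(* monotone bounded partial sums of the coefficients make [Sf c i] fast Cauchy along a subsequence *)
Lemma Sf_cvL2 c i B : (forall n, \sum_(k < n) (c k * lam k ^+ i) ^+ 2 <= B) ->
  exists g, L2 g /\ cvL2 (Sf c i) g.
Proof.
move=> HB; pose t n := \sum_(k < n) (c k * lam k ^+ i) ^+ 2.
have tm n m : (n <= m)%N -> t n <= t m.
  move=> nm; rewrite /t -!(big_mkord xpredT (fun k => (c k * lam k ^+ i) ^+ 2)).
  by rewrite [leRHS](big_cat_nat (n := n))//= lerDl; apply: sumr_ge0 => k _; exact: sqr_ge0.
have ct : cvgn t.
  apply: nondecreasing_is_cvgn => //; exists B => _ [n _ <-]; exact: HB.
have tl n : t n <= limn t.
  by apply: (cvgr_to_ge ct); exists n => // m /= nm; exact: tm.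
have dist n m : (n <= m)%N -> L2norm (Sf c i m \- Sf c i n) ^+ 2 = t m - t n.
  move=> nm; pose c' k := if (n <= k)%N then c k else 0.
  have -> : Sf c i m \- Sf c i n = Sf c' i m.
    apply/funext => s; rewrite /= /Sf -!(big_mkord xpredT (fun k => c k * ej k i s)).
    rewrite -(big_mkord xpredT (fun k => c' k * ej k i s)).
    rewrite [X in X - _](big_cat_nat (n := n))//= [RHS](big_cat_nat (n := n))//=.
    rewrite addrAC subrr add0r [X in _ = X + _]big1_seq ?add0r; last first.
      by move=> k /andP[_]; rewrite mem_index_iota => /andP[_ kn]; rewrite /c' leqNgt kn mul0r.
    by apply: eq_big_nat => k /andP[nk _]; rewrite /c' nk.
  rewrite Sf_norm /t -!(big_mkord xpredT (fun k => (c k * lam k ^+ i) ^+ 2)).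
  rewrite -(big_mkord xpredT (fun k => (c' k * lam k ^+ i) ^+ 2)).
  rewrite [LHS](big_cat_nat (n := n))//= [X in _ = X - _](big_cat_nat (n := n))//=.
  rewrite [in RHS]addrAC subrr add0r [X in X + _ = _]big1_seq ?add0r; last first.
    by move=> k /andP[_]; rewrite mem_index_iota => /andP[_ kn]; rewrite /c' leqNgt kn mul0r expr0n.
  by apply: eq_big_nat => k /andP[nk _]; rewrite /c' nk.
have tail j : exists N, forall n, (N <= n)%N -> limn t - t n <= ((2^-1 : R) ^+ j) ^+ 2.
  have e0 : 0 < ((2^-1 : R) ^+ j) ^+ 2 by rewrite !exprn_gt0// invr_gt0.
  move: ct => /cvgrPdist_lt /(_ _ e0)[N _ HN]; exists N => n Nn.
  by apply: le_trans (ler_norm _) _; rewrite ltW// HN.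
have /choice[N0 HN0] := tail.
pose N j := (\sum_(k < j.+1) N0 k)%N.
have N0N j : (N0 j <= N j)%N by rewrite /N big_ord_recr/= leq_addl.
have Nm j j' : (j <= j')%N -> (N j <= N j')%N.
  move=> /subnKC <-; elim: (j' - j)%N => [|d IH]; first by rewrite addn0.
  by rewrite addnS; apply: (leq_trans IH); rewrite /N [X in (_ <= X)%N]big_ord_recr leq_addr.
have fast j n : (N j <= n)%N -> L2norm (Sf c i n \- Sf c i (N j)) <= 2^-1 ^+ j.
  move=> Nn; apply: le_sqr_ge0; first by rewrite exprn_ge0// invr_ge0.
  rewrite dist//; apply: le_trans (HN0 j (N j) (N0N j)).
  by rewrite lerD2r.
have [||g [Lg Hg]] := @L2_complete_fast R (fun j => Sf c i (N j)) 1.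
- by move=> j; exact: Sf_L2.
- by move=> j j' jj; rewrite mul1r fast// Nm.
exists g; split => //; apply/cvgr0Pnorm_lt => e e0.
have := @half_cvg0 R 2; move/cvgr0Pnorm_lt => /(_ e e0)[j _ Hj].
exists (N j) => // n /= Nn; rewrite ger0_norm ?L2norm_ge0//.
have := Hj j (leqnn j); rewrite ger0_norm; last by rewrite mulr_ge0// exprn_ge0// invr_ge0.
apply: le_lt_trans.
apply: (le_trans (L2norm_leD (g := Sf c i (N j)) _ _ _)); [exact: Sf_L2|exact: Sf_L2|exact: Lg|].
by rewrite mulr_natl mulr2n lerD ?fast// (le_trans (Hg j))// mul1r.
Qed.

Lemma cvg_of_eps (u e : nat -> R) : e n @[n --> \oo] --> (0 : R) ->
  (forall n m, `|u n - u m| <= e n + e m) ->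
  exists l, u n @[n --> \oo] --> l /\ forall n, `|u n - l| <= e n.
Proof.
move=> ce H.
have cu : cvgn u.
  apply/cauchy_cvgP/cauchy_exP => d d0.
  have d2 : 0 < d / 2 by rewrite divr_gt0.
  move/cvgr0Pnorm_lt : (ce) => /(_ _ d2)[N _ HN].
  exists (u N); exists N => // n /= Nn; rewrite /ball/=.
  apply: (le_lt_trans (H N n)); rewrite (splitr d) ltrD//.
    exact: le_lt_trans (ler_norm _) (HN N (leqnn N)).
  exact: le_lt_trans (ler_norm _) (HN n Nn).
exists (limn u); split => // n.
have c1 : (fun m => e n + e m) @ \oo --> e n + 0 by apply: cvgD => //; exact: cvg_cst.
have c2 : (fun m => `|u n - u m|) @ \oo --> `|u n - limn u|.
  by apply: cvg_norm; apply: cvgB => //; exact: cvg_cst.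
by rewrite -[leRHS]addr0; apply: (ler_cvg_to c2 c1); apply: nearW => m; exact: H.
Qed.

Lemma L2norm_near f g h : L2 f -> L2 g -> L2 h ->
  L2norm (f \- g) <= L2norm (f \- h) + L2norm (g \- h).
Proof.
move=> Lf Lg Lh; apply: (le_trans (L2norm_leD Lf Lh Lg)); rewrite lerD2l.
rewrite (eq_L2norm (g := \- (g \- h))) ?L2normN//; first exact: L2B.
by move=> x _; rewrite /= opprB.
Qed.

(** The differentiated partial sums converge in L^2 up to order N, hence uniformly below order N by
    the sup bound of [AC_sup]; the relation [AC] passes to the limit. *)
Theorem synth N c (B : R) : (forall i n, (i <= N)%N -> \sum_(k < n) (c k * lam k ^+ i) ^+ 2 <= B) ->
  exists Q, [/\ jet N Q, forall i, (i <= N)%N -> cvL2 (Sf c i) (Q i) &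
   forall i s, (i < N)%N -> Sf c i n s @[n --> \oo] --> Q i s].
Proof.
move=> HB.
have ex i : exists g, (i <= N)%N -> L2 g /\ cvL2 (Sf c i) g.
  have [iN|_] := boolP (i <= N)%N; last by exists (cst 0).
  by have [g Hg] := Sf_cvL2 (fun n => HB i n iN); exists g.
have /choice[g Hg] := ex.
pose e i n := L2norm (Sf c i n \- g i) + L2norm (Sf c i.+1 n \- g i.+1).
have ce i : (i < N)%N -> e i n @[n --> \oo] --> (0 : R).
  move=> iN; rewrite -[0](addr0 0); apply: cvgD.
    by have [_] := Hg i (ltnW iN).
  by have [_] := Hg i.+1 iN.
have H i s n m : (i < N)%N -> `|Sf c i n s - Sf c i m s| <= e i n + e i m.
  move=> iN; have [Lg _] := Hg i (ltnW iN); have [Lg' _] := Hg i.+1 iN.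
  have L0 := @Sf_L2 c i; have L1' := @Sf_L2 c i.+1.
  have A1 : AC (Sf c i n \- Sf c i m) (Sf c i.+1 n \- Sf c i.+1 m).
    by apply: ACB => //; exact: Sf_AC.
  apply: (le_trans (AC_sup s (L2B (L1' n) (L1' m)) A1)).
  have := L2norm_near (L0 n) (L0 m) Lg; have := L2norm_near (L1' n) (L1' m) Lg'.
  rewrite /e; move: (L2norm _) (L2norm _) (L2norm _) (L2norm _) (L2norm _) (L2norm _).
  by move=> x1 x2 x3 x4 x5 x6; lra.
(* Below order N the pointwise limit is the right representative; at order N only the L^2 limit is
   available. *)
pose Q i s := if (i < N)%N then limn (fun n => Sf c i n s) else g i s.
have QN : Q N = g N by apply/funext => s; rewrite /Q ltnn.
have cQ i s : (i < N)%N -> Sf c i n s @[n --> \oo] --> Q i s.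
  move=> iN; rewrite /Q iN; have [l [cl _]] := cvg_of_eps (ce i iN) (fun n m => H i s n m iN).
  by apply/cvg_ex; exists l.
have dQ i s n : (i < N)%N -> `|Sf c i n s - Q i s| <= e i n.
  move=> iN; have [l [cl Hl]] := cvg_of_eps (ce i iN) (fun n m => H i s n m iN).
  by have -> : Q i s = l by exact: (cvg_unique _ (cQ i s iN) cl).
have key j : (j <= N)%N -> [/\ L2 (Q (N - j)%N), cvL2 (Sf c (N - j)) (Q (N - j)%N) &
    forall i, (N - j <= i < N)%N -> AC (Q i) (Q i.+1)].
  elim: j => [_|j IH jN].
    rewrite subn0 QN; have [L cv] := Hg N (leqnn N); split => // i; lia.
  have [L cv A] := IH (ltnW jN); set i := (N - j.+1)%N.
  have iN : (i < N)%N by rewrite /i; lia.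
  have e1 : (N - j)%N = i.+1 by rewrite /i; lia.
  rewrite e1 in L cv A.
  have AQ : AC (Q i) (Q i.+1).
    move=> s.
    have c1 : (fun n => Sf c i n 0 + prim (Sf c i.+1 n) s) @ \oo --> Q i 0 + prim (Q i.+1) s.
      apply: cvgD; first exact: cQ.
      apply/cvgrPdist_lt => d d0; move/cvgr0Pnorm_lt : cv => /(_ d d0); apply: filterS => n.
      rewrite ger0_norm ?L2norm_ge0// => hd; rewrite distrC -primB; [|exact/L2_L1/Sf_L2|exact: L2_L1].
      by apply: le_lt_trans hd; apply: prim_bound; apply: L2B => //; exact: Sf_L2.
    have c2 : (fun n => Sf c i n 0 + prim (Sf c i.+1 n) s) @ \oo --> Q i s.
      rewrite (_ : (fun n => _) = (fun n => Sf c i n s)); first exact: cQ.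
      by apply/funext => n; rewrite -(Sf_AC c i n s).
    exact: (cvg_unique _ c2 c1).
  have LQ : L2 (Q i) := AC_L2 L AQ.
  split => //.
    apply/cvgr0Pnorm_lt => d d0; move/cvgr0Pnorm_lt : (ce i iN) => /(_ d d0); apply: filterS => n hd.
    rewrite ger0_norm ?L2norm_ge0//; apply: le_lt_trans hd; apply: le_trans (ler_norm _).
    apply: L2norm_bounded; first by apply: measurable_funB; apply: L2_meas => //; exact: Sf_L2.
    by move=> x _; exact: dQ.
  move=> i' /andP[i1 i2]; have [<-//|ne] := eqVneq i i'.
  by apply: A; lia.
exists Q; split.
- have [_ _ A] := key N (leqnn N); rewrite subnn in A.
  split=> [i iN|]; first exact: A.
  by have [] := key 0%N (leq0n _); rewrite subn0.
- by move=> i iN; have [_ + _] := key (N - i)%N (leq_subr _ _); rewrite subKn.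
- exact: cQ.
Qed.

End Fourier.

(** * Completeness of the cosines *)

Section CosComplete.
Context {R : realType}.
Implicit Types (f g h u : R -> R) (c : nat -> R).

Definition ck (k : nat) (s : R) : R := cos (lam k * clip s).

Lemma ej_ck k s : ej k 0 s = nk k * ck k s.
Proof. by rewrite /ej expr0 mulr1. Qed.

Lemma cont_bounded01 h : continuous h -> exists M, forall x : R, 0 <= x <= 1 -> `|h x| <= M.
Proof.
move=> ch; have : bounded_set (h @` `[0, 1]).
  apply: compact_bounded; apply: continuous_compact; last exact: segment_compact.
  exact: continuous_subspaceT.
move=> [M [_ HM]]; exists (M + 1) => x x01; apply: HM; first by rewrite ltrDl.
by exists x => //=; rewrite in_itv.
Qed.

Lemma cont_L2 h : continuous h -> L2 h.
Proof.
move=> ch; have [M HM] := cont_bounded01 ch.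
by apply: (L2_bounded (M := M)) => [|x /I01_01 /HM//]; exact: cont_meas.
Qed.

Lemma contM (f g : R -> R) : continuous f -> continuous g -> continuous (f \* g).
Proof. by move=> cf cg x; apply: cvgM; [exact: cf|exact: cg]. Qed.

Lemma ck_continuous k : continuous (ck k).
Proof.
have n0 : (nk k : R) != 0 by rewrite /nk; case: ifP => _; rewrite ?oner_eq0// gt_eqF// sqrtr_gt0.
rewrite (_ : ck k = (fun s => (nk k)^-1 * ej k 0 s)); last first.
  by apply/funext => s; rewrite ej_ck mulKf.
by move=> s; apply: cvgM; [exact: cvg_cst|exact: ej_continuous].
Qed.

Lemma ck_mul k s : ck 1 s * ck k.+1 s = 2^-1 * (ck k.+2 s + ck k s).
Proof.
rewrite /ck; set x := pi * clip s.
have e n : lam n * clip s = n%:R * x by rewrite /lam /x mulrAC mulrC mulrA.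
rewrite !e; have -> : k.+2%:R * x = k.+1%:R * x + 1%:R * x by rewrite -mulrDl -natrD addn1.
have -> : k%:R * x = k.+1%:R * x - 1%:R * x.
  by rewrite -mulrBl -addn1 natrD mulr1n addrK.
rewrite cosD cosB mul1r; move: (cos _) (sin _) (cos _) (sin _) => p q r t; by field.
Qed.

(** Outside ]z, x[ the product (x - y)(y - z) is non-positive, and its factors have absolute value
    at most 2. *)
Lemma quad_bound (x y z : R) : z < x -> x <= y \/ y <= z -> -1 <= y -> y <= 1 ->
  -1 <= x -> x <= 1 -> -1 <= z -> z <= 1 -> `|1 + (x - y) * (y - z) / 4| <= 1.
Proof. by move=> zx [h|h] b1 b2 b3 b4 b5 b6; rewrite ler_norml; apply/andP; split; nra. Qed.

Section Vanishing.
Variable h : R -> R.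
Hypothesis ch : continuous h.
Hypothesis h0 : forall k, coef h k = 0.

(** Contains the constants, is linear, and is stable under multiplication by cos(pi s) through
    [ck_mul]; hence it contains every polynomial in cos(pi s). *)
Let P u := continuous u /\ forall k, int01 ((h \* u) \* ck k) = 0.

Let P1 : P (cst 1).
Proof.
split; first exact: cst_continuous.
move=> k; have n0 : (nk k : R) != 0 by rewrite /nk; case: ifP => _; rewrite ?oner_eq0// gt_eqF// sqrtr_gt0.
apply: (mulfI n0); rewrite mulr0 -[RHS](h0 k) -int01Z; last first.
  by apply/L2_L1/cont_L2/contM; [apply: contM => //; exact: cst_continuous|exact: ck_continuous].
by apply: eq_int01 => x _; rewrite /= ej_ck mulr1; ring.
Qed.

Let L1P u k : continuous u -> L1 ((h \* u) \* ck k).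
Proof. by move=> cu; apply/L2_L1/cont_L2/contM; [exact: contM|exact: ck_continuous]. Qed.

Let Plin u v (a b : R) : P u -> P v -> P (fun s => a * u s + b * v s).
Proof.
move=> [cu Hu] [cv Hv]; split.
  by move=> s; apply: cvgD; apply: cvgM; [exact: cvg_cst|exact: cu|exact: cvg_cst|exact: cv].
move=> k; rewrite (eq_int01 (g := (fun x => a * ((h \* u) \* ck k) x) \+ (fun x => b * ((h \* v) \* ck k) x))).
  by rewrite int01D ?int01Z ?Hu ?Hv ?mulr0 ?addr0//; [exact: L1P|exact: L1P|apply: L1Z; exact: L1P|apply: L1Z; exact: L1P].
by move=> x _ /=; ring.
Qed.

Let PX u : P u -> P (ck 1 \* u).
Proof.
move=> [cu Hu]; split; first by apply: contM => //; exact: ck_continuous.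
case=> [|k].
  rewrite (eq_int01 (g := (h \* u) \* ck 1)) ?Hu// => x _.
  by rewrite /= {2}/ck /lam mulr0 mul0r cos0; ring.
rewrite (eq_int01 (g := (fun x => 2^-1 * ((h \* u) \* ck k.+2) x) \+ (fun x => 2^-1 * ((h \* u) \* ck k) x))).
  by rewrite int01D ?int01Z ?Hu ?mulr0 ?addr0//; [exact: L1P|exact: L1P|apply: L1Z; exact: L1P|apply: L1Z; exact: L1P].
move=> x _ /=; transitivity (h x * u x * (ck 1 x * ck k.+1 x)); [by ring|by rewrite ck_mul; ring].
Qed.

Let cos_lt (x y : R) : 0 <= x -> x < y -> y <= 1 -> cos (pi * y) < cos (pi * x).
Proof.
move=> x0 xy y1; have p0 := pi_gt0 R.
have b z : 0 <= z -> z <= 1 -> pi * z \in `[0, pi]%R.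
  move=> z0 z1; rewrite in_itv/=; apply/andP; split; first by rewrite mulr_ge0 ?pi_ge0.
  by rewrite ler_piMr ?pi_ge0.
rewrite ltr_cos; [by rewrite ltr_pM2l|apply: b; lra|apply: b; lra].
Qed.

Let cos_le (x y : R) : 0 <= x -> x <= y -> y <= 1 -> cos (pi * y) <= cos (pi * x).
Proof. by move=> x0; rewrite le_eqVlt => /predU1P[->//|xy] y1; rewrite ltW// cos_lt. Qed.

(** Lebesgue's argument: powers of a cosine polynomial that exceeds 1 only near [s0] make the
    integral against [h] grow without bound, although it is 0. *)
Let vanish_pos s0 : 0 <= s0 <= 1 -> ~ 0 < h s0.
Proof.
move=> /andP[s00 s01] hs0.
have [M HM] := cont_bounded01 ch.
have e0 : 0 < h s0 / 2 by rewrite divr_gt0.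
have := @ch s0; move/cvgrPdist_lt => /(_ _ e0)/nbhs_ballP[d /= d0 Hd].
pose a := Num.max 0 (s0 - d / 2); pose b := Num.min 1 (s0 + d / 2).
have a0 : 0 <= a by rewrite le_max lexx.
have b1 : b <= 1 by rewrite ge_min lexx.
have ab : a < b by rewrite gt_max !lt_min ltr01/=; apply/and3P; split; lra.
have hab s : a <= s <= b -> h s0 / 2 <= h s.
  rewrite ge_max le_min => /andP[/andP[_ h1] /andP[_ h2]].
  have : `|h s0 - h s| < h s0 / 2 by apply: Hd; rewrite /ball/= ltr_norml; apply/andP; split; lra.
  by rewrite ltr_norml => /andP[_]; lra.
pose a' := (2 * a + b) / 3; pose b' := (a + 2 * b) / 3.
have aa' : a < a' by rewrite /a'; lra.
have a'b' : a' < b' by rewrite /a' /b'; lra.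
have b'b : b' < b by rewrite /b'; lra.
pose xa := cos (pi * a); pose xb := cos (pi * b).
(* Since cos(pi s) decreases, [Q] is at least 1 on [a, b], at least 1 + dl on the middle third, and
   has absolute value at most 1 elsewhere. *)
pose Q s := 1 + (xa - ck 1 s) * (ck 1 s - xb) / 4.
pose dl := (xa - cos (pi * a')) * (cos (pi * b') - xb) / 4.
have ckE s : 0 <= s <= 1 -> ck 1 s = cos (pi * s).
  by move=> s'; rewrite /ck clipE// /lam mulr1.
have dl0 : 0 < dl.
  have := cos_lt a0 aa' _; have := @cos_lt b' b _ b'b b1.
  move=> /(_ _) h1 /(_ _) h2; rewrite divr_gt0// mulr_gt0// subr_gt0; [apply: h2|apply: h1]; lra.
have Q1 s : 0 <= s <= 1 -> a' <= s <= b' -> 1 + dl <= Q s.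
  move=> s' /andP[h1 h2]; rewrite /Q ckE// lerD2l /dl ler_pM2r ?invr_gt0//.
  have q1 := @cos_le a' s _ h1 _; have q2 := @cos_le s b' _ h2 _.
  have q3 := cos_lt a0 aa' _; have q4 := @cos_lt b' b _ b'b b1.
  have {}q1 : cos (pi * s) <= cos (pi * a') by apply: q1; lra.
  have {}q2 : cos (pi * b') <= cos (pi * s) by apply: q2; lra.
  have {}q3 : cos (pi * a') < xa by apply: q3; lra.
  have {}q4 : xb < cos (pi * b') by apply: q4; lra.
  by apply: ler_pM; lra.
have Q2 s : 0 <= s <= 1 -> a <= s <= b -> 0 <= Q s.
  move=> s' /andP[h1 h2]; rewrite /Q ckE//.
  have q1 : cos (pi * s) <= xa by apply: cos_le => //; lra.
  have q2 : xb <= cos (pi * s) by apply: cos_le => //; lra.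
  by rewrite addr_ge0// divr_ge0// mulr_ge0// subr_ge0.
have Q3 s : 0 <= s <= 1 -> ~~ (a <= s <= b) -> `|Q s| <= 1.
  move=> s' ns; have s'' := s'; move: s'' => /andP[s1 s2]; rewrite /Q ckE//.
  apply: quad_bound; rewrite ?cos_le1 ?cos_geN1//; first exact: cos_lt.
  move: ns; rewrite negb_and -!ltNge => /orP[sa|bs]; [left|right]; apply: cos_le; lra.
have PQ n : P (fun s => Q s ^+ n).
  elim: n => [|n IH]; first by under eq_fun do rewrite expr0; exact: P1.
  have PXn := PX IH; have PXX := PX PXn.
  have := Plin 1 (- 4^-1) (Plin (1 - xa * xb / 4) ((xa + xb) / 4) IH PXn) PXX.
  rewrite (_ : (fun s => _ ) = (fun s => Q s ^+ n.+1)) //.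
  apply/funext => s; rewrite exprS /= /Q; by field.
have Z n : int01 (h \* (fun s => Q s ^+ n)) = 0.
  have [_ /(_ 0%N) <-] := PQ n; apply: eq_int01 => x _.
  by rewrite /= /ck /lam mulr0 mul0r cos0 mulr1.
have M0 : 0 <= M by apply: le_trans (HM 0 _) => //; rewrite lexx ler01.
pose e := h s0 / 2.
(* The integral of h Q^n is 0: the middle third contributes at least the left-hand side, the rest at
   least - M. *)
have key n : e * (1 + dl) ^+ n * (b' - a') <= M.
  have LL : L1 (fun x => - M + e * (1 + dl) ^+ n * (ind b' x - ind a' x)).
    apply: L1D; first exact: L1_cst.
    by apply/L1Z/L1B; apply: (L1_bounded (meas_ind _)) => x _; exact: ind_le1.
  have Lh : L1 (h \* (fun s => Q s ^+ n)) by apply/L2_L1/cont_L2/contM => //; case: (PQ n).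
  have := le_int01 LL Lh; rewrite Z.
  have Bi s : L1 (ind s) by apply: (L1_bounded (meas_ind _)) => x _; exact: ind_le1.
  rewrite int01D; [|exact: L1_cst|exact/L1Z/L1B].
  rewrite int01_cst int01Z; last exact: L1B.
  rewrite int01B// !prim_cst1; [|lra..] => H.
  rewrite -subr_le0 addrC; apply: H => x /I01_01 x01.
  have dn : 0 <= (1 + dl) ^+ n by rewrite exprn_ge0// addr_ge0// ltW.
  have [xab|xab] := boolP (a <= x <= b); last first.
    have : `|h x * Q x ^+ n| <= M.
      by rewrite normrM -[M]mulr1 ler_pM ?HM// normrX exprn_ile1 ?Q3.
    rewrite ler_norml => /andP[h1 _].
    suff -> : ind b' x - ind a' x = 0 by rewrite mulr0 addr0.
    move: xab; rewrite negb_and -!ltNge /ind => /orP[xa1|bx].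
      by rewrite (lt_trans xa1 aa') (lt_trans xa1 (lt_trans aa' a'b')) subrr.
    by rewrite ltNge (ltW (lt_trans b'b bx)) ltNge (ltW (lt_trans (lt_trans a'b' b'b) bx)) subrr.
  have hx := hab x xab; have q2 := Q2 x x01 xab.
  have hq : 0 <= h x * Q x ^+ n by rewrite mulr_ge0 ?exprn_ge0// (le_trans (ltW e0)).
  rewrite /ind; case: (ltP x b') => xb'; case: (ltP x a') => xa' /=.
  - by rewrite subrr mulr0 addr0 (le_trans _ hq)// oppr_le0.
  - rewrite subr0 mulr1; apply: (@le_trans _ _ (e * (1 + dl) ^+ n)); first by rewrite gerDr oppr_le0.
    rewrite ler_pM// ?(ltW e0)// lerXn2r ?nnegrE// ?addr_ge0 ?(ltW dl0)//.
    by apply: Q1 => //; rewrite xa' ltW.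
  - by exfalso; lra.
  - by rewrite subrr mulr0 addr0 (le_trans _ hq)// oppr_le0.
have bern n : 1 + n%:R * dl <= (1 + dl) ^+ n.
  elim: n => [|n IH]; first by rewrite expr0 mul0r addr0.
  rewrite exprS; apply: (@le_trans _ _ ((1 + dl) * (1 + n%:R * dl))); last first.
    by rewrite ler_wpM2l// addr_ge0// ltW.
  rewrite -addn1 natrD; have : 0 <= n%:R * dl * dl by exact: mulr_ge0 (mulr_ge0 (ler0n _ _) (ltW dl0)) (ltW dl0).
  by rewrite mulrDl mul1r; lra.
pose K := e * dl * (b' - a').
have ba0 : 0 < b' - a' by rewrite subr_gt0.
have K0 : 0 < K := mulr_gt0 (mulr_gt0 e0 dl0) ba0.
have [n Hn] : exists n : nat, M < n%:R * K.
  exists (Num.bound (M / K)).+1; rewrite -ltr_pdivrMr//.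
  apply: (lt_trans (archi_boundP _)); first by rewrite divr_ge0// ltW.
  by rewrite ltr_nat.
have k1 : e * (1 + n%:R * dl) * (b' - a') <= M.
  apply: le_trans (key n); rewrite ler_pM2r// ler_pM2l//; exact: bern.
have k2 : n%:R * K <= e * (1 + n%:R * dl) * (b' - a').
  have -> : e * (1 + n%:R * dl) * (b' - a') = e * (b' - a') + n%:R * K by rewrite /K; ring.
  by rewrite lerDr; exact: mulr_ge0 (ltW e0) (ltW ba0).
by have := lt_le_trans Hn (le_trans k2 k1); rewrite ltxx.
Qed.

Lemma vanish_le s0 : 0 <= s0 <= 1 -> h s0 <= 0.
Proof. by move=> s01; rewrite leNgt; apply/negP; exact: vanish_pos. Qed.

End Vanishing.

Lemma cos_complete h : continuous h -> (forall k, coef h k = 0) ->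
  forall s, 0 <= s <= 1 -> h s = 0.
Proof.
move=> ch h0 s s01; apply/eqP; rewrite eq_le vanish_le//= -oppr_le0.
apply: (@vanish_le (\- h)) => //; first by move=> x; apply: cvgN; exact: ch.
move=> k; rewrite /coef (eq_int01 (g := \- (h \* ej k 0))); last by move=> x _ /=; rewrite mulNr.
by rewrite int01N -/(coef h k) ?h0 ?oppr0//; apply: L1M; [exact: cont_L2|exact: ej_L2].
Qed.

End CosComplete.

(** * H^(2m) with Neumann conditions, through weighted cosine coefficients *)

Section EvenJets.
Context {R : realType}.
Implicit Types (f g h u : R -> R) (c : nat -> R) (F Q : nat -> R -> R).

Definition bd c B := 0 <= B /\ forall n, \sum_(k < n) c k ^+ 2 <= B ^+ 2.
Definition Wt m (k : nat) : R := 1 + lam k ^+ (2 * m).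
(** The weight 1 + lam^(2m) makes this l^2 bound equivalent to an H^(2m) bound on the cosine series,
    and it dominates lam^i for all i <= 2m. *)
Definition Xm m c B := bd (fun k => Wt m k * c k) B.
(** Functions of H^(2m) whose even reflections across both ends remain in H^(2m). *)
Definition evenjet m F := jet (2 * m) F /\
  forall i, (i < 2 * m)%N -> odd i -> F i 0 = 0 /\ F i 1 = 0.

Lemma Wt_ge m i k : (i <= 2 * m)%N -> lam k ^+ i <= Wt m k.
Proof.
move=> im; rewrite /Wt; have l0 := @lam_ge0 R k; have [l1|l1] := leP (lam k : R) 1.
  by rewrite ler_wpDr ?exprn_ge0// exprn_ile1.
by rewrite ler_wpDl// ler_weXn2l// ltW.
Qed.

Lemma Xm_lam m c B i n : Xm m c B -> (i <= 2 * m)%N -> \sum_(k < n) (c k * lam k ^+ i) ^+ 2 <= B ^+ 2.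
Proof.
move=> [_ H] im; apply: le_trans (H n); apply: ler_sum => k _.
rewrite mulrC (exprMn 2 (lam k ^+ i) (c k)) (exprMn 2 (Wt m k) (c k)) ler_wpM2r ?sqr_ge0// ler_sqr ?nnegrE ?exprn_ge0 ?lam_ge0 ?Wt_ge//.
by rewrite addr_ge0// exprn_ge0// lam_ge0.
Qed.

Lemma cvL2_le (f_ : nat -> R -> R) f M : (forall n, L2 (f_ n)) -> L2 f -> cvL2 f_ f ->
  (forall n, L2norm (f_ n) <= M) -> L2norm f <= M.
Proof.
move=> Lf_ Lf cv HM; apply/ler_addgt0Pl => e e0.
move/cvgr0Pnorm_lt : cv => /(_ e e0)[n _ Hn].
have h := Hn n (leqnn n); rewrite ger0_norm ?L2norm_ge0// in h.
rewrite (eq_L2norm (g := f_ n \- (f_ n \- f))); last by move=> x _ /=; rewrite opprB addrC subrK.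
apply: (le_trans (L2norm_triangleB (Lf_ n) (L2B (Lf_ n) Lf))).
by rewrite addrC lerD// ltW.
Qed.

Lemma cvL2_ip (f_ : nat -> R -> R) f g : (forall n, L2 (f_ n)) -> L2 f -> L2 g -> cvL2 f_ f ->
  int01 (f_ n \* g) @[n --> \oo] --> int01 (f \* g).
Proof.
move=> Lf_ Lf Lg cv; apply/cvgrPdist_lt => e e0.
have c : L2norm (f_ n \- f) * L2norm g @[n --> \oo] --> 0 * L2norm g.
  by apply: cvgM => //; exact: cvg_cst.
rewrite mul0r in c; move/cvgr0Pnorm_lt : c => /(_ e e0); apply: filterS => n.
rewrite ger0_norm ?mulr_ge0 ?L2norm_ge0//; apply: le_lt_trans.
rewrite distrC -int01B; [|exact: L1M..].
rewrite (eq_int01 (g := (f_ n \- f) \* g)); last by move=> x _ /=; ring.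
by apply: int01_CS => //; exact: L2B.
Qed.

(** Two integrations by parts per step; the boundary terms carry an odd derivative, once of [F] and
    once of the cosine. *)
Lemma ana_coef m F j k : evenjet m F -> (j <= m)%N ->
  coef (F (2 * j)%N) k = (-1) ^+ j * lam k ^+ (2 * j) * coef (F 0%N) k.
Proof.
move=> [jF oF]; elim: j => [_|j IH jm]; first by rewrite muln0 !expr0 !mul1r.
have i1 : (2 * j < 2 * m)%N by lia.
have i2 : ((2 * j).+1 < 2 * m)%N by lia.
have e : (2 * j.+1)%N = (2 * j).+2 by lia.
rewrite e /coef.
have p1 := int01_byparts (jet_L2 jF (i := (2 * j).+2) i2) (ej_L2 k 1) (jet_AC jF i2) (@ej_AC R k 0).
have [z0 z1] := oF _ i2 ltac:(lia); rewrite z0 z1 !mul0r subrr in p1.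
have p2 := int01_byparts (jet_L2 jF (i := (2 * j).+1) (ltnW i2)) (ej_L2 k 2) (jet_AC jF i1) (@ej_AC R k 1).
have [z2 z3] := @ej_odd R k 1 isT; rewrite z2 z3 !mulr0 subrr in p2.
have p3 : int01 (F (2 * j)%N \* ej k 2) = - (lam k ^+ 2 * coef (F (2 * j)%N) k).
  rewrite /coef -int01Z; last by apply: L1M; [apply: (jet_L2 jF); lia|exact: ej_L2].
  rewrite -int01N; last by apply/L1Z/L1M; [apply: (jet_L2 jF); lia|exact: ej_L2].
  by apply: eq_int01 => x _; rewrite /= ej2; ring.
move: p1 p2; rewrite p3 IH; last by lia.
rewrite !exprS; set y := coef _ _; move: (int01 _) (int01 _) => x1 x2.
move=> h1 h2; have -> : x2 = - x1 by lra.
have -> : x1 = lam k ^+ 2 * ((-1) ^+ j * lam k ^+ (2 * j) * y) by lra.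
by rewrite /y /coef; ring.
Qed.

(** The weighted coefficients are the coefficients of F + (-1)^m F^(2m), to which Bessel's
    inequality applies. *)
Lemma ana m F : (1 <= m)%N -> evenjet m F -> Xm m (coef (F 0%N)) (L2norm (F 0%N) + L2norm (F (2 * m)%N)).
Proof.
move=> m1 eF; have [jF _] := eF.
have L0 : L2 (F 0%N) by exact: jet_L2 jF _.
have Lm : L2 (F (2 * m)%N) by exact: jet_L2 jF _.
split; first by rewrite addr_ge0 ?L2norm_ge0.
move=> n; pose G := F 0%N \+ (fun x => (-1) ^+ m * F (2 * m)%N x).
have LG : L2 G by apply: L2D => //; exact: L2Z.
apply: (@le_trans _ _ (L2norm G ^+ 2)).
  apply: le_trans (bessel n LG); apply: ler_sum => k _; rewrite le_eqVlt; apply/orP; left; apply/eqP.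
  congr (_ ^+ 2); rewrite /Wt mulrDl mul1r /coef.
  rewrite (eq_int01 (f := G \* ej k 0) (g := (F 0%N \* ej k 0) \+ (fun x => (-1) ^+ m * (F (2 * m)%N \* ej k 0) x))); last first.
    by move=> x _; rewrite /G /=; ring.
  have LL i : (i <= 2 * m)%N -> L1 (F i \* ej k 0).
    by move=> im; apply: L1M; [exact: jet_L2 jF im|exact: ej_L2].
  rewrite int01D ?int01Z; [|exact: LL|exact: LL|exact/L1Z/LL].
  rewrite -/(coef (F (2 * m)%N) k) (ana_coef k eF (leqnn m)) !mulrA -exprMn mulrNN mulr1 expr1n mul1r.
  by [].
rewrite ler_sqr ?nnegrE ?addr_ge0 ?L2norm_ge0//.
apply: (le_trans (L2norm_triangle L0 (L2Z _ Lm))).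
by rewrite L2normZ// normrX normrN1 expr1n mul1r.
Qed.

Definition is_syn m c Q := [/\ evenjet m Q, forall i, (i <= 2 * m)%N -> cvL2 (Sf c i) (Q i) &
  forall k, coef (Q 0%N) k = c k].

Lemma is_syn_ex m c B : (1 <= m)%N -> Xm m c B -> exists Q, is_syn m c Q.
Proof.
move=> m1 X; have [i n im|Q [jQ cvQ ptQ]] := @synth R (2 * m) c (B ^+ 2).
  exact: Xm_lam X im.
exists Q; split => //.
  split=> // i im oi; split.
    have := ptQ i 0 im; rewrite (_ : (fun n => _) = (fun=> 0)).
      by move=> cv; apply: (cvg_unique _ cv) => //; exact: cvg_cst.
    by apply/funext => n; have [] := @Sf_odd R c i n oi.
  have := ptQ i 1 im; rewrite (_ : (fun n => _) = (fun=> 0)).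
    by move=> cv; apply: (cvg_unique _ cv) => //; exact: cvg_cst.
  by apply/funext => n; have [] := @Sf_odd R c i n oi.
move=> k; have LS := @Sf_L2 R c 0.
have c1 := cvL2_ip LS (jet_L2 jQ (leq0n _)) (ej_L2 k 0) (cvQ 0%N (leq0n _)).
apply: (cvg_unique _ c1) => //.
apply: cvg_near_cst; exists k.+1 => // n /= kn.
rewrite int01_Sf; last exact: ej_L2.
rewrite (bigD1 (Ordinal kn))//= ej_orth0 eqxx mulr1 big1 ?addr0// => l lk.
by rewrite ej_orth0 (_ : (nat_of_ord l == k) = false) ?mulr0//; apply/negbTE; rewrite -val_eqE in lk.
Qed.

(** A jet with the given coefficients; the default 0 is taken when they are not weighted
    square-summable. *)
Definition syn m c : nat -> R -> R := xget (fun _ _ => 0) [set Q | is_syn m c Q].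

Lemma synP m c B : (1 <= m)%N -> Xm m c B -> is_syn m c (syn m c).
Proof.
by move=> m1 X; have [Q HQ] := is_syn_ex m1 X; apply: (@xgetPex _ _ [set Q | is_syn m c Q]); exists Q.
Qed.

(** Derivatives of low order are controlled by the coefficients with the low weight, as the
    estimates level by level require. *)
Lemma syn_norm m c B j D i : (1 <= m)%N -> Xm m c B -> (j <= m)%N -> Xm j c D -> (i <= 2 * j)%N ->
  L2norm (syn m c i) <= D.
Proof.
move=> m1 X jm XD ij; have [[jQ _] cv _] := synP m1 X.
have im : (i <= 2 * m)%N by lia.
apply: (cvL2_le _ (jet_L2 jQ im) (cv i im)); first by move=> n; exact: Sf_L2.
move=> n; case: (XD) => D0 _; apply: le_sqr_ge0 => //; rewrite Sf_norm; exact: Xm_lam XD ij.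
Qed.

Lemma syn_diff m c c' B B' D i : (1 <= m)%N -> Xm m c B -> Xm m c' B' ->
  Xm m (fun k => c k - c' k) D -> (i <= 2 * m)%N ->
  L2norm (syn m c i \- syn m c' i) <= D.
Proof.
move=> m1 X X' XD im; have [[jQ _] cv _] := synP m1 X; have [[jQ' _] cv' _] := synP m1 X'.
have [LQ LQ'] := (jet_L2 jQ im, jet_L2 jQ' im).
apply: (@cvL2_le (fun n => Sf c i n \- Sf c' i n)).
- by move=> n; apply: L2B; exact: Sf_L2.
- exact: L2B.
- have h : L2norm (Sf c i n \- syn m c i) + L2norm (Sf c' i n \- syn m c' i) @[n --> \oo] --> (0 : R).
    by rewrite -(addr0 (0 : R)); apply: cvgD; [exact: cv|exact: cv'].
  apply/cvgr0Pnorm_lt => e e0; move/cvgr0Pnorm_lt : h => /(_ e e0); apply: filterS => n.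
  rewrite !ger0_norm ?L2norm_ge0 ?addr_ge0 ?L2norm_ge0//; apply: le_lt_trans.
  rewrite (eq_L2norm (g := (Sf c i n \- syn m c i) \- (Sf c' i n \- syn m c' i))); last by move=> x _ /=; ring.
  by apply: L2norm_triangleB; apply: L2B => //; exact: Sf_L2.
- move=> n; case: (XD) => D0 _; apply: le_sqr_ge0 => //.
  rewrite (eq_L2norm (g := Sf (fun k => c k - c' k) i n)); last by move=> x _; rewrite /= Sf_B.
  rewrite Sf_norm; exact: Xm_lam XD im.
Qed.

(** Two continuous functions with the same cosine coefficients agree on [0, 1] by [cos_complete],
    and both are frozen outside. *)
Lemma syn_unique m F s : (1 <= m)%N -> evenjet m F -> syn m (coef (F 0%N)) 0 s = F 0%N s.
Proof.
move=> m1 eF; have [[jQ _] _ cQ] := synP m1 (ana m1 eF); have [jF _] := eF.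
set Q := syn _ _ in jQ cQ *; have m2 : (0 < 2 * m)%N by lia.
have cj G : jet (2 * m) G -> continuous (G 0%N) by move=> j; exact: jet_continuous j m2.
have z s' : 0 <= s' <= 1 -> Q 0%N s' - F 0%N s' = 0.
  apply: (@cos_complete R (Q 0%N \- F 0%N)).
    by move=> x; apply: cvgB; exact: cj.
  move=> k; rewrite /coef (eq_int01 (g := (Q 0%N \* ej k 0) \- (F 0%N \* ej k 0))); last by move=> x _ /=; ring.
  rewrite int01B; [|by apply: L1M; [exact: jet_L2 jQ _|exact: ej_L2]|by apply: L1M; [exact: jet_L2 jF _|exact: ej_L2]].
  by rewrite -!/(coef _ _) cQ subrr.
have AQ := jet_AC jQ m2; have AF := jet_AC jF m2.
apply/eqP; rewrite -subr_eq0; apply/eqP.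
have [s0|s0] := leP s 0; first by rewrite (AC_clip_le0 AQ s0) (AC_clip_le0 AF s0) z// lexx ler01.
have [s1|s1] := leP 1 s; first by rewrite (AC_clip_ge1 AQ s1) (AC_clip_ge1 AF s1) z// lexx ler01.
by rewrite z// !ltW.
Qed.

End EvenJets.

(** * Continuity argument and Gronwall inequality for curves in l^2 *)

Section Gronwall.
Context {R : realType}.

Lemma pos_ge0 (t : R) : 0 <= pos t. Proof. by rewrite le_max lexx. Qed.
Lemma posE (t : R) : 0 <= t -> pos t = t. Proof. by move=> t0; apply/max_idPr. Qed.

Lemma pos_continuous : continuous (fun t : R => pos t).
Proof.
rewrite (_ : (fun t : R => pos t) = (fun t => 2^-1 * (t + `|t|))); last first.
  by apply/funext => t; rewrite maxr_absE add0r sub0r normrN mulrC.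
move=> t; apply: cvgM; first exact: cvg_cst.
by apply: cvgD; [exact: cvg_id|apply: cvg_norm; exact: cvg_id].
Qed.

(** At the infimum t0 of the times where y >= M, continuity gives y t0 = M and y <= M on [0, t0];
    the hypothesis then says y t0 < M. *)
Lemma bootstrap (y : R -> R) (M T : R) : continuous y -> y 0 < M ->
  (forall t, 0 <= t <= T -> (forall r, 0 <= r <= t -> y r <= M) -> y t < M) ->
  forall t, 0 <= t <= T -> y t < M.
Proof.
move=> cy y0 H t1 t1T; rewrite ltNge; apply/negP => yt1.
pose E := [set t | 0 <= t <= T /\ M <= y t].
have Et1 : E t1 by [].
have hE : has_inf E by split; [exists t1|exists 0 => z [/andP[]]].
set t0 := inf E.
have t0le z : E z -> t0 <= z by move=> Ez; apply: ge_inf => //; case: hE.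
have t00 : 0 <= t0 by apply: lb_le_inf; [case: hE|move=> z [/andP[]]].
have t0T : t0 <= T by apply: (le_trans (t0le t1 Et1)); case/andP: t1T.
have nE r : 0 <= r < t0 -> y r < M.
  move=> /andP[r0 rt]; rewrite ltNge; apply/negP => h.
  have /t0le : E r by split=> //; rewrite r0 (le_trans (ltW rt)).
  by rewrite leNgt rt.
have ge : M <= y t0.
  rewrite leNgt; apply/negP => lt; have e0 : 0 < M - y t0 by rewrite subr_gt0.
  have := cy t0; move/cvgrPdist_lt => /(_ _ e0)/nbhs_ballP[d /= d0 Hd].
  have [z Ez zd] := inf_adherent d0 hE.
  have : `|y t0 - y z| < M - y t0.
    apply: Hd; rewrite /ball/= ltr_norml; have := t0le z Ez; rewrite -/t0 in zd; move: d0 zd => d0 zd h.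
    by apply/andP; split; lra.
  by rewrite ltr_norml => /andP[h _]; case: Ez => _ h2; lra.
have le : y t0 <= M.
  rewrite leNgt; apply/negP => lt; have e0 : 0 < y t0 - M by rewrite subr_gt0.
  have := cy t0; move/cvgrPdist_lt => /(_ _ e0)/nbhs_ballP[d /= d0 Hd].
  have tp : 0 < t0.
    by rewrite lt_neqAle t00 andbT; apply/eqP => h; rewrite -h in lt; have := lt_trans lt y0; rewrite ltxx.
  pose r := Num.max 0 (t0 - d / 2).
  have r0 : 0 <= r by rewrite le_max lexx.
  have rt : r < t0 by rewrite gt_max tp/=; lra.
  have rd : t0 - d / 2 <= r by rewrite le_max lexx orbT.
  have : `|y t0 - y r| < y t0 - M.
    by apply: Hd; rewrite /ball/= ger0_norm; lra.
  rewrite ltr_norml => /andP[_ h]; have := nE r; rewrite r0 rt => /(_ isT); lra.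
suff : y t0 < M by rewrite ltNge ge.
apply: H => [|r /andP[r0]]; first by rewrite t00.
by rewrite le_eqVlt => /predU1P[->//|rt]; apply/ltW/nE; rewrite r0.
Qed.

Context {J : finType}.
Local Notation sq := (nat -> J -> R).
Implicit Types (a b : sq).

Lemma nrm_dist a b D : ell2 a -> ell2 b -> le2 (sub2 a b) D -> `|nrm a - nrm b| <= D.
Proof.
move=> ea eb h; rewrite ler_norml; apply/andP; split.
  rewrite lerNl opprB lerBlDr; apply: le2_nrm; apply: le2_add (ell2_nrm ea); exact: le2_subC.
by rewrite lerBlDr; apply: le2_nrm; exact: le2_add h (ell2_nrm eb).
Qed.

Lemma nrm_continuous (c : R -> sq) : ccont c -> (forall t, 0 <= t -> ell2 (c t)) ->
  continuous (fun t : R => nrm (c (pos t))).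
Proof.
move=> cc ec t; apply/cvgrPdist_lt => e e0.
have e2 : 0 < e / 2 by rewrite divr_gt0.
have [d d0 Hd] := cc (pos t) (pos_ge0 t) _ e2.
have := @pos_continuous t; move/cvgrPdist_lt => /(_ _ d0); apply: filterS => r h.
apply: (le_lt_trans (y := e / 2)); last by rewrite ltr_pdivrMr// ltr_pMr// ltr1n.
apply: nrm_dist; [exact/ec/pos_ge0|exact/ec/pos_ge0|].
by apply/le2_subC/Hd; [exact: pos_ge0|rewrite distrC].
Qed.

Lemma le2_derive (b f : R -> sq) (H h : R -> R) (r t : R) : r <= t ->
  (forall k j (x : R), r <= x <= t -> is_derive x 1 (fun z => b z k j) (f x k j)) ->
  (forall x : R, r <= x <= t -> is_derive x 1 H (h x)) ->
  (forall x, r <= x <= t -> le2 (f x) (h x)) ->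
  le2 (sub2 (b t) (b r)) (H t - H r).
Proof.
move=> rt db dH fh; split.
  rewrite subr_ge0; apply: (derive_mono rt dH) => x xx; by case: (fh x xx).
move=> K; rewrite /psum /sub2.
apply: (@derive_cmp_vec _ ('I_K * J)%type (fun p z => b z p.1 p.2) (fun p z => f z p.1 p.2) H h) => //.
- by move=> x xx; case: (fh x xx).
- by move=> x xx; case: (fh x xx) => _ /(_ K).
Qed.

(** The norm need not be differentiable in time. Its majorant nrm (b 0) + g times the integral of
    the norm is, and the exponential factor is applied to that majorant. *)
Lemma gronwall (b f : R -> sq) (g T : R) : 0 <= g -> ccont b ->
  (forall t, 0 <= t -> ell2 (b t)) ->
  (forall k j (t : R), 0 <= t <= T -> is_derive t 1 (fun r => b r k j) (f t k j)) ->
  (forall t, 0 <= t <= T -> le2 (f t) (g * nrm (b t))) ->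
  forall t, 0 <= t <= T -> nrm (b t) <= nrm (b 0) * expR (g * t).
Proof.
move=> g0 cb eb db fb t /andP[t0 tT].
pose y t := nrm (b (pos t)).
have cy : continuous (fun t : R => g * y t).
  by move=> z; apply: cvgM; [exact: cvg_cst|exact: (nrm_continuous cb eb)].
have [G0 dG] := adrP cy; set G := adr _ in G0 dG.
have yG r : 0 <= r <= T -> nrm (b r) <= nrm (b 0) + G r.
  move=> /andP[r0 rT]; apply: (le_trans (y := (G r - G 0) + nrm (b 0))); last by rewrite G0 subr0 addrC.
  apply: le2_nrm.
  apply: le2_add (ell2_nrm (eb 0 (lexx 0))).
  apply: (le2_derive (f := f) (h := fun t => g * y t)) => //.
  - by move=> k j x /andP[x0 xr]; apply: db; rewrite x0 (le_trans xr).
  - by move=> x /andP[x0 _]; apply: dG; apply: lt_le_trans x0; rewrite ltrN10.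
  - by move=> x /andP[x0 xr]; rewrite /y posE//; apply: fb; rewrite x0 (le_trans xr).
pose Y r := nrm (b 0) + G r.
have tT' : 0 <= t <= T by rewrite t0.
have : - (Y 0 * expR (- g * 0)) <= - (Y t * expR (- g * t)).
  apply: (@derive_mono R (fun r => - (Y r * expR (- g * r))) (fun r => - ((g * y r) * expR (- g * r) + Y r * (expR (- g * r) * - g)))) => //.
    move=> x /andP[x0 xt]; apply: is_deriveN.
    have x1 : -1 < x by apply: lt_le_trans x0; rewrite ltrN10.
    have d1 : is_derive (x : R) 1 Y (g * y x).
      have := is_deriveD (is_derive_cst (nrm (b 0)) x 1) (dG x x1); rewrite add0r; exact.
    have d2 : is_derive (x : R) 1 (fun r : R => expR (- g * r)) (expR (- g * x) * - g).
      have d3 : is_derive (x : R) 1 (fun r : R => - g * r) (- g).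
        have := is_deriveZ (- g) (is_derive_id x (1 : R)); rewrite [X in is_derive _ _ _ X -> _](_ : _ = - g)//; exact: mulr1.
      have := @is_derive1_comp R expR (fun r : R => - g * r) x _ _ (is_derive_expR _) d3; exact.
    have := is_deriveM d1 d2; rewrite /GRing.scale/= => h.
    by apply: is_derive_eq h _; rewrite addrC mulrC.
  move=> x /andP[x0 xt].
  have : y x <= Y x by rewrite /y posE//; apply: yG; rewrite x0 (le_trans xt).
  have := expR_ge0 (- g * x); move: (y x) (Y x) (expR _) => p q e e0 pq.
  have : 0 <= g * e * (q - p) by rewrite !mulr_ge0// subr_ge0.
  lra.
rewrite lerN2 mulr0 expR0 mulr1 {2}/Y G0 addr0 => h.
apply: (le_trans (yG t tT')); rewrite -/(Y t).
have -> : Y t = Y t * expR (- g * t) * expR (g * t).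
  by rewrite -mulrA -expRD mulNr addNr expR0 mulr1.
by rewrite ler_wpM2r ?expR_ge0.
Qed.

End Gronwall.

(** * The free Schroedinger group and semilinear perturbations *)

Section Rotation.
Context {R : realType}.
Local Notation sq := (nat -> bool -> R).
Implicit Types (a b : sq).

(** Multiplication of the mode a_k false + i a_k true by exp(i lam_k^2 t), that is, the inverse of
    the free flow u_t = i u_ss on cosine coefficients. *)
Definition Rt (t : R) a : sq := fun k j => let th := lam k ^+ 2 * t in
  if j then sin th * a k false + cos th * a k true
  else cos th * a k false - sin th * a k true.

Lemma psum_bool K b : psum K b = \sum_(k < K) (b k false ^+ 2 + b k true ^+ 2).
Proof.
rewrite /psum -(pair_bigA _ (fun (k : 'I_K) j => b k j ^+ 2))/=.
by apply: eq_bigr => k _; rewrite big_bool /= addrC.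
Qed.

Lemma psum_Rt t K a : psum K (Rt t a) = psum K a.
Proof.
rewrite !psum_bool; apply: eq_bigr => k _; rewrite /Rt /=.
have := cos2Dsin2 (lam k ^+ 2 * t); move: (cos _) (sin _) (a k false) (a k true) => c s x y h.
transitivity ((c ^+ 2 + s ^+ 2) * (x ^+ 2 + y ^+ 2)); first by ring.
by rewrite h mul1r.
Qed.

Lemma Rt_le2 t a B : le2 a B -> le2 (Rt t a) B.
Proof. by move=> [B0 h]; split => // K; rewrite psum_Rt. Qed.

Lemma Rt_ell2 t a : ell2 a -> ell2 (Rt t a).
Proof. by move=> [B h]; exists B; exact: Rt_le2. Qed.

Lemma RtB t a b : sub2 (Rt t a) (Rt t b) = Rt t (sub2 a b).
Proof. by apply/funext => k; apply/funext => -[]; rewrite /sub2 /Rt /=; ring. Qed.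

Lemma RtK t a : Rt (- t) (Rt t a) = a.
Proof.
apply/funext => k; apply/funext => j; rewrite /Rt /= mulrN cosN sinN.
have := cos2Dsin2 (lam k ^+ 2 * t); move: (cos _) (sin _) => c s h.
case: j; [rewrite -[RHS]mul1r -h|rewrite -[RHS]mul1r -h]; ring.
Qed.

Lemma RtNK t a : Rt t (Rt (- t) a) = a.
Proof. by have := RtK (- t) a; rewrite opprK. Qed.

Lemma Rt0 a : Rt 0 a = a.
Proof.
by apply/funext => k; apply/funext => -[]; rewrite /Rt mulr0 cos0 sin0 ?mul0r ?mul1r ?add0r ?subr0.
Qed.

Lemma Rt_nrm t a : nrm (Rt t a) = nrm a.
Proof. rewrite /nrm (_ : (fun K => psum K (Rt t a)) = (fun K => psum K a))//; by apply/funext => K; rewrite psum_Rt. Qed.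

Lemma trig_lip (x y : R) : (cos y - cos x) ^+ 2 + (sin y - sin x) ^+ 2 <= (y - x) ^+ 2.
Proof.
wlog xy : x y / x <= y.
  move=> H; have [/H//|yx] := leP x y.
  have := H y x (ltW yx); rewrite -(sqrrN (x - y)) -(sqrrN (cos x - _)) -(sqrrN (sin x - _)) !opprB; exact.
have := @derive_cmp_vec R bool (fun i => if i then cos else sin) (fun i z => if i then - sin z else cos z) id (fun=> 1) x y xy.
rewrite !big_bool /=; apply => //.
- by move=> [] z _; [exact: is_derive_cos|exact: is_derive_sin].
- by move=> z _; rewrite big_bool /= sqrrN expr1n addrC cos2Dsin2.
Qed.

Lemma trig_diff4 (x y : R) : (cos y - cos x) ^+ 2 + (sin y - sin x) ^+ 2 <= 4.
Proof.
have := cos2Dsin2 x; have := cos2Dsin2 y.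
move: (cos x) (sin x) (cos y) (sin y) => c s c' s'.
have := sqr_ge0 (c + c'); have := sqr_ge0 (s + s'); rewrite !expr2; lra.
Qed.

Lemma psum_RtB (r t : R) a K : psum K (sub2 (Rt r a) (Rt t a)) =
  \sum_(k < K) ((cos (lam k ^+ 2 * r) - cos (lam k ^+ 2 * t)) ^+ 2 +
     (sin (lam k ^+ 2 * r) - sin (lam k ^+ 2 * t)) ^+ 2) * (a k false ^+ 2 + a k true ^+ 2).
Proof. by rewrite psum_bool; apply: eq_bigr => k _; rewrite /sub2 /Rt /=; ring. Qed.

Lemma lam_mono k l : (k <= l)%N -> (lam k : R) <= lam l.
Proof. by move=> kl; rewrite /lam ler_wpM2l ?pi_ge0// ler_nat. Qed.

Lemma psum_mono K L' b : (K <= L')%N -> psum K b <= psum L' b.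
Proof.
move=> KL; rewrite !psum_bool -!(big_mkord xpredT (fun k => b k false ^+ 2 + b k true ^+ 2)).
rewrite [leRHS](big_cat_nat (n := K))//= lerDl; apply: sumr_ge0 => k _.
by apply: addr_ge0; exact: sqr_ge0.
Qed.

Lemma psum_tail a e : ell2 a -> 0 < e -> exists K, forall n, psum n a <= psum K a + e.
Proof.
move=> [B [B0 HB]] e0.
have hs : has_sup (range (fun K => psum K a)).
  by split; [exists (psum 0 a), 0%N|exists (B ^+ 2) => _ [K _ <-]].
have [_ [K _ <-] HK] := sup_adherent e0 hs.
exists K => n; apply: (le_trans (y := sup (range (fun K => psum K a)))).
  by apply: sup_upper_bound => //; exists n.
by rewrite -lerBlDr ltW.
Qed.

(* strong continuity of the group *)
Lemma Rt_strong a (t e : R) : ell2 a -> 0 < e ->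
  exists2 d, 0 < d & forall r, `|r - t| < d -> le2 (sub2 (Rt r a) (Rt t a)) e.
Proof.
(* The modes beyond [K] contribute at most 4 times their mass, that is e^2 / 2; the first [K] modes
   contribute at most (e / 2)^2 for r close to t. *)
move=> ea e0; have e8 : 0 < e ^+ 2 / 8 by rewrite divr_gt0// exprn_gt0.
have [K HK] := psum_tail ea e8.
have [A0 HA] := ell2_nrm ea; set A := nrm a in A0 HA.
pose l : R := lam K ^+ 2 * A; have l0 : 0 <= l by rewrite mulr_ge0// exprn_ge0// lam_ge0.
exists (e / (2 * (l + 1))) => [|r rt].
  by rewrite divr_gt0// mulr_gt0// ltr_wpDl.
have lr : l * `|r - t| <= e / 2.
  apply: (le_trans (y := (l + 1) * (e / (2 * (l + 1))))).
    by apply: ler_pM => //; [rewrite lerDl|exact: ltW].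
  rewrite (_ : (l + 1) * _ = e / 2)//; field; by rewrite gt_eqF// ltr_wpDl.
split; first exact: ltW.
have base : psum K (sub2 (Rt r a) (Rt t a)) <= (lam K ^+ 2 * (r - t)) ^+ 2 * psum K a.
  rewrite psum_RtB psum_bool mulr_sumr; apply: ler_sum => k _.
  rewrite ler_wpM2r ?addr_ge0 ?sqr_ge0//; apply: (le_trans (trig_lip _ _)).
  rewrite -mulrBr (exprMn 2 (lam k ^+ 2)) (exprMn 2 (lam K ^+ 2)) ler_wpM2r ?sqr_ge0//.
  have l1 : (lam k : R) <= lam K by apply: lam_mono; exact: ltnW.
  by rewrite -!exprM lerXn2r// nnegrE lam_ge0.
have step n : psum (K + n) (sub2 (Rt r a) (Rt t a)) <=
    (lam K ^+ 2 * (r - t)) ^+ 2 * psum K a + 4 * (psum (K + n) a - psum K a).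
  elim: n => [|n IH]; first by rewrite addn0 subrr mulr0 addr0.
  rewrite addnS psum_RtB (psum_bool (K + n).+1) !big_ord_recr /= -psum_RtB -psum_bool.
  have := trig_diff4 (lam (K + n) ^+ 2 * t) (lam (K + n) ^+ 2 * r).
  have : 0 <= a (K + n)%N false ^+ 2 + a (K + n)%N true ^+ 2 by rewrite addr_ge0// sqr_ge0.
  set u := (cos _ - cos _) ^+ 2 + _; set v := a _ _ ^+ 2 + _; move: IH.
  set w := _ * psum K a; set p := psum _ (sub2 _ _); move=> IH v0 u4.
  have h : u * v <= 4 * v by rewrite ler_wpM2r.
  move: p w u v (psum (K + n) a) (psum K a) IH v0 u4 h => p w u v q s; lra.
move=> n; apply: (le_trans (psum_mono _ (leq_addl K n))); apply: (le_trans (step n)).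
have h1 := HK (K + n)%N.
have h2 : (lam K ^+ 2 * (r - t)) ^+ 2 * psum K a <= (e / 2) ^+ 2.
  apply: (le_trans (y := (l * `|r - t|) ^+ 2)).
    rewrite (_ : (l * _) ^+ 2 = (lam K ^+ 2 * (r - t)) ^+ 2 * A ^+ 2).
      by rewrite ler_wpM2l ?sqr_ge0 ?HA.
    rewrite /l; have := real_normK (num_real (r - t)).
    move=> h; rewrite (exprMn 2 (lam K ^+ 2 * A)) h; move: (lam K ^+ 2) (r - t) => X y; ring.
  by rewrite ler_sqr//; rewrite nnegrE; [exact: mulr_ge0|rewrite divr_ge0// ltW].
move: (psum (K + n) a) (psum K a) h1 h2 => p q; move: (_ * q) => w h1.
rewrite expr_div_n; move: (e ^+ 2) e8 h1 => z; lra.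
Qed.

Section Semilinear.
Variables (Nn : sq -> sq) (L : R).
Hypotheses (L1 : 1 <= L).
Hypothesis lipN : forall a b D, ell2 a -> ell2 b -> le2 (sub2 a b) D ->
  le2 (sub2 (Nn a) (Nn b)) (L * D).
Hypothesis N0 : ell2 (Nn (fun _ _ => 0)).

Lemma Nn_ell2 a : ell2 a -> ell2 (Nn a).
Proof.
move=> ea; have [B HB] := ea; have [K HK] := N0.
have h : le2 (sub2 a (fun _ _ => 0)) B by apply: eq_le2 HB => k j; rewrite /sub2 subr0.
exists (L * B + K); apply: le2_add HK; apply: lipN => //; exists 0; exact: le2_0.
Qed.

(** The group is not continuous in operator norm; strong continuity at a fixed [a] is enough. *)
Lemma Nn_strong a k j : ell2 a -> continuous (fun t : R => Nn (Rt (- t) a) k j).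
Proof.
move=> ea t; apply/cvgrPdist_lt => e e0.
have L0 : 0 < L by apply: lt_le_trans L1.
have eL : 0 < e / (2 * L) by rewrite divr_gt0// mulr_gt0.
have [d d0 Hd] := Rt_strong (- t) ea eL.
apply/nbhs_ballP; exists d => //= r rt.
have h : le2 (sub2 (Rt (- r) a) (Rt (- t) a)) (e / (2 * L)).
  by apply: Hd; rewrite opprK addrC; exact: rt.
have := le2_coord k j (lipN (Rt_ell2 _ ea) (Rt_ell2 _ ea) h); rewrite /sub2 distrC => h2.
apply: (le_lt_trans h2); rewrite (_ : L * _ = e / 2); last by field; rewrite gt_eqF.
by rewrite ltr_pdivrMr// ltr_pMr// ltr1n.
Qed.

(** Interaction picture: for b = Rt t u the unbounded linear part disappears and the field Rt t (Nn
    (Rt (- t) b)) keeps the Lipschitz constant of [Nn], since the rotations are isometries. *)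
Theorem semilinear u0 : ell2 u0 -> exists u : R -> sq,
  [/\ u 0 = u0, ccont u, forall t, 0 <= t -> ell2 (u t) &
   forall (t : R) k j, -1 < t ->
     is_derive t 1 (fun r => Rt r (u r) k j) (Rt (pos t) (Nn (u (pos t))) k j)].
Proof.
move=> e0; pose F t a := Rt t (Nn (Rt (- t) a)).
have L0 : 0 <= L by apply: le_trans L1.
have [|||b [b0 cb eb db]] := @Cauchy_Lipschitz R bool F L (nrm (Nn (fun _ _ => 0)) + L * nrm u0) u0 L1 e0.
- move=> t a b D t0 ea eb h; rewrite /F RtB; apply: Rt_le2.
  by apply: lipN; [exact: Rt_ell2|exact: Rt_ell2|rewrite RtB; exact: Rt_le2].
- move=> t t0; apply: Rt_le2; rewrite addrC; apply: le2_add (ell2_nrm N0).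
  apply: lipN; [exact: Rt_ell2|by exists 0; exact: le2_0|].
  apply: (@eq_le2 _ _ (Rt (- t) u0)) => [k j|]; first by rewrite /sub2 subr0.
  exact/Rt_le2/ell2_nrm.
- move=> a k j ea t; apply: (@continuous_comp _ _ _ (fun t : R => pos t) (fun t => F t a k j)).
    exact: pos_continuous.
  have cth : {for pos t, continuous (fun r : R => lam k ^+ 2 * r)}.
    by apply: cvgM; [exact: cvg_cst|exact: cvg_id].
  have cs : {for pos t, continuous (fun r : R => sin (lam k ^+ 2 * r))}.
    by apply: (@continuous_comp _ _ _ (fun r : R => lam k ^+ 2 * r) sin) => //; exact: continuous_sin.
  have cc : {for pos t, continuous (fun r : R => cos (lam k ^+ 2 * r))}.
    by apply: (@continuous_comp _ _ _ (fun r : R => lam k ^+ 2 * r) cos) => //; exact: continuous_cos.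
  have cN i : {for pos t, continuous (fun r : R => Nn (Rt (- r) a) k i)} by exact: Nn_strong.
  by rewrite /F /Rt; case: j; [apply: cvgD|apply: cvgB]; apply: cvgM => //; exact: cN.
exists (fun t => Rt (- t) (b t)); split.
- rewrite oppr0 Rt0; apply/funext => k; apply/funext => j; exact: b0.
- move=> t t0 e ep; have e2 : 0 < e / 2 by rewrite divr_gt0.
  have [d1 d10 H1] := cb t t0 _ e2; have [d2 d20 H2] := Rt_strong (- t) (eb t t0) e2.
  exists (Num.min d1 d2) => [|r r0]; first by rewrite lt_min d10.
  rewrite lt_min => /andP[r1 r2]; rewrite [e]splitr.
  apply: (@le2_trans _ _ _ (Rt (- r) (b t))); first by rewrite RtB; apply: Rt_le2; exact: H1.
  by apply: H2; rewrite -opprD normrN.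
- by move=> t t0; apply: Rt_ell2; exact: eb.
- move=> t k j t1; have := db t k j t1; rewrite /F.
  by under [X in _ -> is_derive _ _ X _]eq_fun do rewrite RtNK.
Qed.

End Semilinear.
End Rotation.

(** * Algebra of even jets and estimates for the cubic term *)

Section JetAlgebra.
Context {R : realType}.
Implicit Types (F G K : nat -> R -> R).

Definition jD F G : nat -> R -> R := fun i s => F i s + G i s.
Definition jZ (a : R) F : nat -> R -> R := fun i s => a * F i s.
Definition jC (a : R) : nat -> R -> R := fun i s => if i == 0%N then a else 0.
Definition jM F G : nat -> R -> R := fun k => PJ F G k 0 0.

Lemma jet_D m F G : jet m F -> jet m G -> jet m (jD F G).
Proof.
move=> [aF lF] [aG lG]; split; last exact: L2D.
move=> i im; have h1 : (i <= m)%N by exact: ltnW.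
by apply: ACD; [exact: jet_L2 (conj aF lF) _|exact: jet_L2 (conj aG lG) _|exact: aF|exact: aG].
Qed.

Lemma jet_Z m a F : jet m F -> jet m (jZ a F).
Proof.
move=> [aF lF]; split; last exact: L2Z.
by move=> i im; apply: ACZ; [exact: jet_L2 (conj aF lF) _|exact: aF].
Qed.

Lemma jet_C m a : jet m (jC a).
Proof.
have h : jC a = fun i => if i == 0%N then cst a else cst 0 :> (R -> R).
  by apply/funext => -[].
split; last by rewrite h; case: eqP => _; exact: L2_cst.
by rewrite h => -[|i] _; exact: AC_cst.
Qed.

Lemma jet_M m F G : (1 <= m)%N -> jet m F -> jet m G -> jet m (jM F G).
Proof. by move=> m1 jF jG; exact: PJ_jet. Qed.

Lemma HN_D m F G : jet m F -> jet m G -> HN m (jD F G) <= HN m F + HN m G.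
Proof.
move=> jF jG; rewrite /HN -big_split/=; apply: ler_sum => i _.
have im : (i <= m)%N by rewrite -ltnS.
exact: L2norm_triangle (jet_L2 jF im) (jet_L2 jG im).
Qed.

Lemma HN_Z m a F : jet m F -> HN m (jZ a F) = `|a| * HN m F.
Proof.
move=> jF; rewrite /HN mulr_sumr; apply: eq_bigr => i _.
have im : (i <= m)%N by rewrite -ltnS.
by rewrite -(L2normZ a (jet_L2 jF im)).
Qed.

Lemma HN_C m a : HN m (jC a) = `|a|.
Proof.
rewrite /HN big_ord_recl big1 ?addr0; last by move=> i _; exact: L2norm0.
exact: L2norm_cst.
Qed.

Lemma evenjet_D m F G : evenjet m F -> evenjet m G -> evenjet m (jD F G).
Proof.
move=> [jF oF] [jG oG]; split; first exact: jet_D.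
by move=> i im oi; rewrite /jD; have [-> ->] := oF i im oi; have [-> ->] := oG i im oi; rewrite addr0.
Qed.

Lemma evenjet_Z m a F : evenjet m F -> evenjet m (jZ a F).
Proof.
move=> [jF oF]; split; first exact: jet_Z.
by move=> i im oi; rewrite /jZ; have [-> ->] := oF i im oi; rewrite mulr0.
Qed.

Lemma evenjet_C m a : evenjet m (jC a).
Proof. by split; [exact: jet_C|move=> -[]]. Qed.

Lemma evenjet_M m F G : (1 <= m)%N -> evenjet m F -> evenjet m G -> evenjet m (jM F G).
Proof.
move=> m1 [jF oF] [jG oG]; split; first by apply: jet_M => //; lia.
have od H s : (forall i, (i < 2 * m)%N -> odd i -> H i s = 0 :> R) ->
    forall i, (i <= 2 * m)%N -> odd i -> H i s = 0.
  move=> h i; rewrite leq_eqVlt => /predU1P[->|]; last exact: h.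
  by rewrite mul2n odd_double.
by move=> i im oi; split; apply: (@PJ_even0 R F G (2 * m)); rewrite ?addn0 ?(ltnW im)//; apply: od => j jm oj; [case: (oF j jm oj)|case: (oG j jm oj)|case: (oF j jm oj)|case: (oG j jm oj)].
Qed.

Lemma evenjet_le m n F : (n <= m)%N -> evenjet m F -> evenjet n F.
Proof.
move=> nm [jF oF]; split; first by apply: jet_le jF; lia.
by move=> i im; apply: oF; lia.
Qed.

(** Polarised form of the potential - (|q|^2 - |q(0)|^2) / 2. It vanishes at s = 0, which keeps the
    frame fixed there; [jT] is the resulting cubic term. *)
Definition jA F G := jD (jZ (- 2^-1) (jM F G)) (jC (2^-1 * (F 0%N 0 * G 0%N 0))).
Definition jT F G K := jM (jA F G) K.

Lemma jA0 F G s : jA F G 0%N s = - 2^-1 * (F 0%N s * G 0%N s - F 0%N 0 * G 0%N 0).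
Proof. by rewrite /jA /jD /jZ /jC /jM /=; ring. Qed.

Lemma jT0 F G K s : jT F G K 0%N s = - 2^-1 * (F 0%N s * G 0%N s - F 0%N 0 * G 0%N 0) * K 0%N s.
Proof. by rewrite /jT {1}/jM /= jA0. Qed.

Lemma evenjet_A m F G : (1 <= m)%N -> evenjet m F -> evenjet m G -> evenjet m (jA F G).
Proof. by move=> m1 eF eG; apply: evenjet_D; [apply/evenjet_Z/evenjet_M|exact: evenjet_C]. Qed.

Lemma evenjet_T m F G K : (1 <= m)%N -> evenjet m F -> evenjet m G -> evenjet m K -> evenjet m (jT F G K).
Proof. by move=> m1 eF eG eK; apply: evenjet_M => //; exact: evenjet_A. Qed.

Lemma jet_A m F G : (1 <= m)%N -> jet m F -> jet m G -> jet m (jA F G).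
Proof. by move=> m1 eF eG; apply: jet_D; [apply/jet_Z/jet_M|exact: jet_C]. Qed.

Definition cM (m : nat) : R := m.+1%:R * 2 ^+ m.+1.
Lemma cM_ge1 m : 1 <= cM m.
Proof.
rewrite -[1]mulr1; apply: ler_pM => //; first by rewrite ler1n.
by apply: exprn_ege1; rewrite ler1n.
Qed.

(** Linear in the high norm [A]: a linear Gronwall inequality at order m will need only a bound on
    the norm of order r. *)
Lemma HN_A_tame m r F G A B : (1 <= r <= m)%N -> (m <= 2 * r)%N -> jet m F -> jet m G ->
  HN m F <= A -> HN m G <= A -> HN r F <= B -> HN r G <= B -> HN m (jA F G) <= 2 * cM m * A * B.
Proof.
move=> rm m2 jF jG FA GA FB GB; have m1 : (1 <= m)%N by lia.
have r0 : (0 < r)%N by lia.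
have rm' : (r <= m)%N by lia.
have jM1 := jet_M m1 jF jG.
apply: (le_trans (HN_D (jet_Z _ jM1) (jet_C _ _))); rewrite HN_Z// HN_C.
have h1 := PJ_HN m1 jF jG rm m2.
have A0 : 0 <= A := le_trans (HN_ge0 _ _) FA.
have B0 : 0 <= B := le_trans (HN_ge0 _ _) FB.
have p1 : HN m F * HN r G <= A * B by apply: ler_pM => //; exact: HN_ge0.
have p2 : HN r F * HN m G <= A * B by rewrite mulrC; apply: ler_pM => //; exact: HN_ge0.
have p3 : `|F 0%N 0 * G 0%N 0| <= A * B.
  rewrite normrM; apply: ler_pM => //; first exact: le_trans (jet_sup 0 jF m1) FA.
  exact: le_trans (jet_sup 0 (jet_le rm' jG) r0) GB.
have c1 := cM_ge1 m; have e : cM m = 2 * (m.+1%:R * 2 ^+ m) by rewrite /cM exprS; ring.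
have AB : 0 <= A * B := mulr_ge0 A0 B0.
rewrite normrN (normrM 2^-1) (@ger0_norm _ 2^-1) ?invr_ge0//.
have h2 : HN m (jM F G) <= cM m * (A * B).
  apply: (le_trans h1); rewrite (_ : cM m * (A * B) = (m.+1%:R * 2 ^+ m) * (A * B + A * B)); last by rewrite e; ring.
  by rewrite ler_wpM2l ?mulr_ge0 ?exprn_ge0// lerD.
have h3 : A * B <= cM m * (A * B) by rewrite ler_peMl.
rewrite (_ : 2 * cM m * A * B = 2 * (cM m * (A * B))); last by ring.
move: (HN m (jM F G)) `|F 0%N 0 * G 0%N 0| h2 p3 => x w h2 p3; move: (cM m * (A * B)) (A * B) AB h2 h3 p3 => y z; lra.
Qed.

Lemma HN_T_tame m r F G K A B : (1 <= r <= m)%N -> (m <= 2 * r)%N -> jet m F -> jet m G -> jet m K ->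
  HN m F <= A -> HN m G <= A -> HN m K <= A -> HN r F <= B -> HN r G <= B -> HN r K <= B ->
  HN m (jT F G K) <= 4 * cM m ^+ 2 * A * B ^+ 2.
Proof.
move=> rm m2 jF jG jK FA GA KA FB GB KB; have m1 : (1 <= m)%N by lia.
have rm' : (r <= m)%N by lia.
have h1 := PJ_HN m1 (jet_A m1 jF jG) jK rm m2.
have hA := HN_A_tame rm m2 jF jG FA GA FB GB.
have hB : HN r (jA F G) <= 2 * cM r * B * B.
  by apply: (HN_A_tame (r := r)) => //; [lia|lia|exact: jet_le jF|exact: jet_le jG].
have cr : cM r <= cM m.
  apply: ler_pM; rewrite ?exprn_ge0//.
    by rewrite ler_nat.
  by apply: ler_weXn2l => //; rewrite ler1n.
have A0 : 0 <= A := le_trans (HN_ge0 _ _) FA.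
have B0 : 0 <= B := le_trans (HN_ge0 _ _) FB.
have c1 := cM_ge1 m.
have hB' : HN r (jA F G) <= 2 * cM m * B * B.
  apply: (le_trans hB); rewrite -(mulrA _ B B) -(mulrA (2 * cM m)); apply: ler_wpM2r; [exact: mulr_ge0|by rewrite ler_pM2l].
apply: (le_trans h1).
have p1 : HN m (jA F G) * HN r K <= 2 * cM m * A * B * B.
  by apply: ler_pM => //; exact: HN_ge0.
have p2 : HN r (jA F G) * HN m K <= 2 * cM m * B * B * A.
  by apply: ler_pM => //; exact: HN_ge0.
have e : cM m = 2 * (m.+1%:R * 2 ^+ m) by rewrite /cM exprS; ring.
set X := m.+1%:R * 2 ^+ m in h1 e *; have X0 : 0 <= X by rewrite mulr_ge0 ?exprn_ge0.
apply: (@le_trans _ _ (X * (2 * cM m * A * B * B + 2 * cM m * B * B * A))).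
  by rewrite ler_wpM2l// lerD.
rewrite (_ : X * _ = cM m * (2 * cM m * A * B * B)); last by rewrite {3}e; ring.
rewrite (_ : 4 * cM m ^+ 2 * A * B ^+ 2 = cM m * (2 * cM m * A * B * B) + cM m * (2 * cM m * A * B * B)); last by ring.
have c0 : 0 <= cM m :> R by apply: le_trans c1.
by rewrite lerDl; apply: mulr_ge0 => //; apply: le_trans p1; rewrite mulr_ge0 ?HN_ge0.
Qed.

Lemma HN_A_alg m F G : (1 <= m)%N -> jet m F -> jet m G -> HN m (jA F G) <= cM m * HN m F * HN m G.
Proof.
move=> m1 jF jG; have jM1 := jet_M m1 jF jG.
apply: (le_trans (HN_D (jet_Z _ jM1) (jet_C _ _))); rewrite HN_Z// HN_C.
have h1 : HN m (jM F G) <= cM m * HN m F * HN m G := PJ_HN_alg m1 jF jG.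
have p3 : `|F 0%N 0 * G 0%N 0| <= HN m F * HN m G.
  by rewrite normrM; apply: ler_pM => //; [exact: (jet_sup 0 jF m1)|exact: (jet_sup 0 jG m1)].
rewrite normrN (normrM 2^-1) (@ger0_norm _ 2^-1) ?invr_ge0//.
have c1 := cM_ge1 m.
have h3 : HN m F * HN m G <= cM m * HN m F * HN m G.
  by rewrite -mulrA ler_peMl// mulr_ge0 ?HN_ge0.
move: (HN m (jM F G)) `|F 0%N 0 * G 0%N 0| h1 p3 => z w h1 p3; move: (cM m * _ * _) (HN m F * HN m G) h1 h3 p3 => x y; lra.
Qed.

Lemma HN_T_alg m F G K : (1 <= m)%N -> jet m F -> jet m G -> jet m K ->
  HN m (jT F G K) <= cM m ^+ 2 * HN m F * HN m G * HN m K.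
Proof.
move=> m1 jF jG jK; apply: (le_trans (PJ_HN_alg m1 (jet_A m1 jF jG) jK)); rewrite -/(cM m).
have c1 := cM_ge1 m; have c0 : 0 <= cM m by apply: le_trans c1.
rewrite ler_wpM2r ?HN_ge0// expr2 -2!mulrA (mulrA (cM m) (cM m)) -(mulrA (cM m)) ler_wpM2l// mulrA.
exact: HN_A_alg.
Qed.

Lemma ana_HN m F : (1 <= m)%N -> evenjet m F -> Xm m (coef (F 0%N)) (2 * HN (2 * m) F).
Proof.
move=> m1 eF; have [h0 h] := ana m1 eF.
have hle : L2norm (F 0%N) + L2norm (F (2 * m)%N) <= 2 * HN (2 * m) F.
  rewrite mulr2n mulrDl mul1r; apply: lerD; exact: HN_ge.
split; first exact: le_trans hle.
by move=> n; apply: (le_trans (h n)); rewrite ler_sqr ?nnegrE// (le_trans h0).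
Qed.

End JetAlgebra.

(** * Retraction on a ball of l^2 *)

Section Truncation.
Context {R : realType} {J : finType}.
Local Notation sq := (nat -> J -> R).
Implicit Types (a b : sq).

Lemma max_lip (M x y D : R) : `|x - y| <= D -> `|Num.max M y - Num.max M x| <= D.
Proof.
rewrite ler_norml => /andP[h1 h2].
by case: (leP M x) => p; case: (leP M y) => q; rewrite ler_norml; apply/andP; split; lra.
Qed.

(** Radial retraction on the ball of radius [M]: composed with it, a nonlinearity Lipschitz on balls
    becomes globally Lipschitz, and nothing changes while the norm stays below [M]. *)
Definition Pr (M : R) a : sq := fun k j => M / Num.max M (nrm a) * a k j.

Lemma Pr_id M a : 0 < M -> nrm a <= M -> Pr M a = a.
Proof.
move=> M0 h; apply/funext => k; apply/funext => j.
by rewrite /Pr max_l// divff ?mul1r// gt_eqF.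
Qed.

Lemma Pr_le2 M a : 0 < M -> ell2 a -> le2 (Pr M a) M.
Proof.
move=> M0 ea; have m0 : 0 < Num.max M (nrm a) by rewrite lt_max M0.
have := le2Z (M / Num.max M (nrm a)) (ell2_nrm ea); apply: le2_mono.
rewrite ger0_norm; last by rewrite divr_ge0// ltW.
rewrite mulrAC ler_pdivrMr// ler_pM2l// le_max lexx orbT//.
Qed.

(** Moving the vector and changing the scaling factor contribute [D] each. *)
Lemma Pr_lip M a b D : 0 < M -> ell2 a -> ell2 b -> le2 (sub2 a b) D ->
  le2 (sub2 (Pr M a) (Pr M b)) (2 * D).
Proof.
move=> M0 ea eb h; have D0 : 0 <= D by case: h.
have hd := nrm_dist ea eb h.
set x := nrm a in hd *; set y := nrm b in hd *.
have y0 : 0 <= y := nrm_ge0 _.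
pose X := Num.max M x; pose Y := Num.max M y.
have X0 : 0 < X by rewrite lt_max M0.
have Y0 : 0 < Y by rewrite lt_max M0.
have MX : M <= X by rewrite le_max lexx.
have yY : y <= Y by rewrite le_max lexx orbT.
have XY : `|Y - X| <= D.
  exact: max_lip.
have h1 := le2Z (M / X) h; have h2 := le2Z (M / X - M / Y) (ell2_nrm eb).
have h3 := le2D h1 h2.
apply: (@eq_le2 _ _ (fun k j => M / X * sub2 a b k j + (M / X - M / Y) * b k j)) => [k j|].
  by rewrite /sub2 /Pr -/x -/y -/X -/Y; ring.
have z0 : 0 <= M / X by rewrite divr_ge0// ltW.
have z1 : M / X <= 1 by rewrite ler_pdivrMr// mul1r.
apply: le2_mono h3; rewrite mulr2n mulrDl mul1r; apply: lerD.
  by rewrite (ger0_norm z0) ler_piMl.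
rewrite -/y (_ : M / X - M / Y = (Y - X) * (M / X) / Y); last by field; rewrite !gt_eqF.
rewrite normrM normrM (ger0_norm z0) (@ger0_norm _ Y^-1) ?invr_ge0 ?(ltW Y0)//.
rewrite (_ : `|Y - X| * (M / X) / Y * y = `|Y - X| * ((M / X) * (y / Y))); last by ring.
have w0 : 0 <= y / Y by rewrite divr_ge0// ltW.
have w1 : y / Y <= 1 by rewrite ler_pdivrMr// mul1r.
rewrite -[leRHS]mulr1; apply: ler_pM => //; first exact: mulr_ge0.
by rewrite -[leRHS]mulr1; apply: ler_pM.
Qed.

End Truncation.

(** * The nonlinearity on weighted coefficients *)

Section Nonlinearity.
Context {R : realType}.
Local Notation sq := (nat -> bool -> R).
Implicit Types (a b : sq) (F G K : nat -> R -> R).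
Variable m : nat.
Hypothesis m1 : (1 <= m)%N.

Definition jB F G := jD F (jZ (- 1) G).

Lemma jBE F G i s : jB F G i s = F i s - G i s.
Proof. by rewrite /jB /jD /jZ mulN1r. Qed.

Lemma evenjet_B n F G : evenjet n F -> evenjet n G -> evenjet n (jB F G).
Proof. by move=> eF eG; apply: evenjet_D => //; exact: evenjet_Z. Qed.

(** The factors are replaced one at a time. The difference is given as a jet [E] with the right
    entry of order 0, since cosine coefficients only see that entry. *)
Lemma dT F G K F' G' K' N D : evenjet m F -> evenjet m G -> evenjet m K ->
  evenjet m F' -> evenjet m G' -> evenjet m K' ->
  HN (2 * m) G <= N -> HN (2 * m) K <= N -> HN (2 * m) F' <= N -> HN (2 * m) K <= N ->
  HN (2 * m) G' <= N ->
  HN (2 * m) (jB F F') <= D -> HN (2 * m) (jB G G') <= D -> HN (2 * m) (jB K K') <= D ->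
  exists2 E, evenjet m E & (forall s, E 0%N s = jT F G K 0%N s - jT F' G' K' 0%N s) /\
    HN (2 * m) E <= 3 * cM (2 * m) ^+ 2 * N ^+ 2 * D.
Proof.
move=> eF eG eK eF' eG' eK' GN KN FN' _ GN' dF dG dK.
have m2 : (1 <= 2 * m)%N by lia.
have eA : evenjet m (jT (jB F F') G K) by apply: evenjet_T => //; exact: evenjet_B.
have eB : evenjet m (jT F' (jB G G') K) by apply: evenjet_T => //; exact: evenjet_B.
have eC : evenjet m (jT F' G' (jB K K')) by apply: evenjet_T => //; exact: evenjet_B.
exists (jD (jT (jB F F') G K) (jD (jT F' (jB G G') K) (jT F' G' (jB K K')))).
  by do 2 apply: evenjet_D => //.
split; first by move=> s; rewrite /jD !jT0 !jBE; ring.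
have j1 n (H : nat -> R -> R) : evenjet n H -> jet (2 * n) H by case.
have N0 : 0 <= N := le_trans (HN_ge0 _ _) GN.
have D0 : 0 <= D := le_trans (HN_ge0 _ _) dF.
have c0 : 0 <= cM (2 * m) ^+ 2 :> R by rewrite sqr_ge0.
have key H1 H2 H3 (x y z : R) : evenjet m H1 -> evenjet m H2 -> evenjet m H3 ->
    HN (2 * m) H1 <= x -> HN (2 * m) H2 <= y -> HN (2 * m) H3 <= z ->
    HN (2 * m) (jT H1 H2 H3) <= cM (2 * m) ^+ 2 * (x * y * z).
  move=> e1 e2 e3 h1 h2 h3; apply: (le_trans (HN_T_alg m2 (j1 _ _ e1) (j1 _ _ e2) (j1 _ _ e3))).
  rewrite (_ : _ * HN _ H1 * _ * _ = cM (2 * m) ^+ 2 * (HN (2 * m) H1 * HN (2 * m) H2 * HN (2 * m) H3)); last by ring.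
  rewrite ler_wpM2l//; apply: ler_pM => //; [by apply: mulr_ge0; exact: HN_ge0|exact: HN_ge0|].
  by apply: ler_pM => //; exact: HN_ge0.
have k1 := key _ _ _ _ _ _ (evenjet_B eF eF') eG eK dF GN KN.
have k2 := key _ _ _ _ _ _ eF' (evenjet_B eG eG') eK FN' dG KN.
have k3 := key _ _ _ _ _ _ eF' eG' (evenjet_B eK eK') FN' GN' dK.
apply: (le_trans (HN_D (j1 _ _ eA) (j1 _ _ (evenjet_D eB eC)))).
apply: (@le_trans _ _ (HN (2 * m) (jT (jB F F') G K) + (HN (2 * m) (jT F' (jB G G') K) + HN (2 * m) (jT F' G' (jB K K'))))).
  by rewrite lerD2l; exact: HN_D (j1 _ _ eB) (j1 _ _ eC).
move: k1 k2 k3; rewrite (_ : D * N * N = N ^+ 2 * D); last by ring.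
rewrite (_ : N * D * N = N ^+ 2 * D); last by ring.
rewrite (_ : N * N * D = N ^+ 2 * D); last by ring.
rewrite (_ : 3 * _ * _ * D = 3 * (cM (2 * m) ^+ 2 * (N ^+ 2 * D))); last by ring.
move: (HN _ _) (HN _ _) (HN _ _) (_ * (_ * D)) => x y z w; lra.
Qed.

Lemma Wt_gt0 i k : 0 < Wt i k :> R.
Proof. by rewrite /Wt ltr_wpDr// exprn_ge0// lam_ge0. Qed.

(** The unknown [a] is the pair of sequences of cosine coefficients of (q1, q2) already multiplied
    by the H^(2m) weight, so that plain l^2 is the state space; here the weight is removed. *)
Definition cf a j : nat -> R := fun k => a k j / Wt m k.
Definition qj a j := syn m (cf a j).
Definition nlj a (j : bool) : nat -> R -> R :=
  if j then jZ (- 1) (jD (jT (qj a false) (qj a false) (qj a false)) (jT (qj a true) (qj a true) (qj a false)))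
  else jD (jT (qj a false) (qj a false) (qj a true)) (jT (qj a true) (qj a true) (qj a true)).
Definition Nn a : sq := fun k j => Wt m k * coef (nlj a j 0%N) k.
(** The same function measured with the H^(2i) weight. *)
Definition lev i a : sq := fun k j => Wt i k / Wt m k * a k j.

Lemma lev_m a : lev m a = a.
Proof. by apply/funext => k; apply/funext => j; rewrite /lev divff ?mul1r// gt_eqF// Wt_gt0. Qed.

Lemma lev_Nn i a k j : lev i (Nn a) k j = Wt i k * coef (nlj a j 0%N) k.
Proof. by rewrite /lev /Nn mulrA mulfVK// gt_eqF// Wt_gt0. Qed.

Lemma sum_le_psum (K : nat) b j : \sum_(k < K) b k j ^+ 2 <= psum K b.
Proof.
rewrite psum_bool; apply: ler_sum => k _.
by case: j; rewrite ?lerDl ?lerDr sqr_ge0.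
Qed.

Lemma le2_Xm i a B j : le2 (lev i a) B -> Xm i (cf a j) B.
Proof.
move=> [B0 h]; split => // n; apply: le_trans (h n).
rewrite (eq_bigr (fun k : 'I_n => lev i a k j ^+ 2)); first exact: sum_le_psum.
by move=> k _; rewrite /lev /cf mulrAC mulrA.
Qed.

Lemma Xm_le2 i (c : bool -> nat -> R) B : (forall j, Xm i (c j) B) ->
  le2 (fun k j => Wt i k * c j k) (2 * B).
Proof.
move=> h; have B0 : 0 <= B by case: (h true).
split=> [|K]; first exact: mulr_ge0.
rewrite psum_bool big_split/=; have [_ /(_ K)] := h true; have [_ /(_ K)] := h false.
have := sqr_ge0 B; rewrite exprMn; move: (B ^+ 2) (\sum_(_ < _) _) (\sum_(_ < _) _) => x y z; lra.
Qed.

Lemma Xm_mono i (c : nat -> R) B B' : B <= B' -> Xm i c B -> Xm i c B'.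
Proof.
move=> BB [B0 h]; have B0' := le_trans B0 BB; split=> // n; apply: (le_trans (h n)).
by rewrite ler_sqr ?nnegrE.
Qed.

Lemma ell2_lev a : ell2 a -> le2 (lev m a) (nrm a).
Proof. by move=> ea; rewrite lev_m; exact: ell2_nrm. Qed.

Lemma qj_even a j : ell2 a -> evenjet m (qj a j).
Proof. by move=> ea; have [] := synP m1 (le2_Xm j (ell2_lev ea)). Qed.

Lemma qj_HN i a A j : ell2 a -> (i <= m)%N -> le2 (lev i a) A -> HN (2 * i) (qj a j) <= (2 * i).+1%:R * A.
Proof.
move=> ea im h; rewrite /HN -[X in X%:R](card_ord (2 * i).+1) mulr_natl -sumr_const; apply: ler_sum => l _.
apply: (syn_norm m1 (le2_Xm j (ell2_lev ea)) im (le2_Xm j h)).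
by rewrite -ltnS.
Qed.

Lemma qj_HNB a b D j : ell2 a -> ell2 b -> le2 (sub2 a b) D ->
  HN (2 * m) (jB (qj a j) (qj b j)) <= (2 * m).+1%:R * D.
Proof.
move=> ea eb h; rewrite /HN -[X in X%:R](card_ord (2 * m).+1) mulr_natl -sumr_const; apply: ler_sum => l _.
rewrite (eq_L2norm (g := qj a j l \- qj b j l)); last by move=> s _; rewrite jBE.
apply: (syn_diff m1 (le2_Xm j (ell2_lev ea)) (le2_Xm j (ell2_lev eb))); last by rewrite -ltnS.
have h' : le2 (lev m (sub2 a b)) D by rewrite lev_m.
have [D0 h2] := le2_Xm j h'; split => // n; move: (h2 n).
by under eq_bigr do rewrite /cf /sub2 mulrBl.
Qed.

Lemma nlj_even a j : ell2 a -> evenjet m (nlj a j).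
Proof.
move=> ea; have e i := qj_even i ea.
by case: j; [apply/evenjet_Z|]; apply: evenjet_D; apply: evenjet_T.
Qed.

Definition Ct i : R := 32 * cM (2 * i) ^+ 2 * (2 * i).+1%:R.

(** Growth at level 2i, linear in the norm of that level, with a factor depending on order r only.
    It serves for i = r = 1, where the H^1 bound controls H^2, and for level i + 1 with r = 2 i. *)
Lemma Nn_tame i r a A B : (1 <= i <= m)%N -> (1 <= r <= 2 * i)%N -> (i <= r)%N -> ell2 a ->
  le2 (lev i a) A -> (forall j, HN r (qj a j) <= B) ->
  le2 (lev i (Nn a)) (Ct i * A * B ^+ 2).
Proof.
move=> im ri ir ea hA hB; have im' : (i <= m)%N by lia.
have eq j := evenjet_le im' (qj_even j ea).
have jq j : jet (2 * i) (qj a j) by case: (eq j).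
have i1 : (1 <= i)%N by lia.
have i2 : (1 <= 2 * i)%N by lia.
have i2r : (2 * i <= 2 * r)%N by lia.
have hq j := qj_HN j ea im' hA.
have hT x y z := HN_T_tame ri i2r (jq x) (jq y) (jq z) (hq x) (hq y) (hq z) (hB x) (hB y) (hB z).
have jTq x y z : jet (2 * i) (jT (qj a x) (qj a y) (qj a z)) by case: (evenjet_T i1 (eq x) (eq y) (eq z)).
have hN j : HN (2 * i) (nlj a j) <= Ct i / 4 * A * B ^+ 2.
  rewrite (_ : Ct i / 4 * A * B ^+ 2 = 4 * cM (2 * i) ^+ 2 * ((2 * i).+1%:R * A) * B ^+ 2 + 4 * cM (2 * i) ^+ 2 * ((2 * i).+1%:R * A) * B ^+ 2); last by rewrite /Ct; field.
  by case: j; rewrite /nlj ?HN_Z ?normrN1 ?mul1r; try exact: jet_D; apply: (le_trans (HN_D _ _)) => //; exact: lerD.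
apply: (@eq_le2 _ _ (fun k j => Wt i k * coef (nlj a j 0%N) k)) => [k j|]; first by rewrite lev_Nn.
rewrite (_ : Ct i * A * B ^+ 2 = 2 * (2 * (Ct i / 4 * A * B ^+ 2))); last by field.
apply: Xm_le2 => j; apply: Xm_mono (ana_HN i1 (evenjet_le im' (nlj_even j ea))).
by rewrite ler_pM2l.
Qed.

Lemma Nn_ell2' a : ell2 a -> ell2 (Nn a).
Proof.
move=> ea; have h := ell2_lev ea.
eexists; rewrite -(lev_m (Nn a)).
apply: (@Nn_tame m (2 * m) a (nrm a) ((2 * m).+1%:R * nrm a)) => //; rewrite ?m1 ?leqnn//; try lia.
by move=> j; exact: qj_HN.
Qed.

Definition Cl : R := 24 * cM (2 * m) ^+ 2 * (2 * m).+1%:R ^+ 3.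

Lemma Nn_lip a b M D : ell2 a -> ell2 b -> le2 a M -> le2 b M -> le2 (sub2 a b) D ->
  le2 (sub2 (Nn a) (Nn b)) (Cl * M ^+ 2 * D).
Proof.
move=> ea eb ha hb h.
have hqa j : HN (2 * m) (qj a j) <= (2 * m).+1%:R * M by apply: qj_HN => //; rewrite lev_m.
have hqb j : HN (2 * m) (qj b j) <= (2 * m).+1%:R * M by apply: qj_HN => //; rewrite lev_m.
have hd j := qj_HNB j ea eb h.
have eqa j := qj_even j ea; have eqb j := qj_even j eb.
have HT x y z := dT (eqa x) (eqa y) (eqa z) (eqb x) (eqb y) (eqb z) (hqa y) (hqa z) (hqb x) (hqa z) (hqb y) (hd x) (hd y) (hd z).
set B := 3 * _ * _ * _ in HT.
have B0 : 0 <= B by have [E _ [_ h2]] := HT true true true; exact: le_trans (HN_ge0 _ _) h2.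
have HE j : exists2 E, evenjet m E & (forall s, E 0%N s = nlj a j 0%N s - nlj b j 0%N s) /\
    HN (2 * m) E <= 2 * B.
  have jj n (H : nat -> R -> R) : evenjet n H -> jet (2 * n) H by case.
  case: j.
    have [E1 e1 [d1 h1]] := HT false false false; have [E2 e2 [d2 h2]] := HT true true false.
    exists (jZ (- 1) (jD E1 E2)); first by apply/evenjet_Z/evenjet_D.
    split; first by move=> s; rewrite /nlj /jZ /jD d1 d2; ring.
    rewrite HN_Z ?normrN1 ?mul1r; last by apply: jet_D; exact: jj.
    by apply: (le_trans (HN_D (jj _ _ e1) (jj _ _ e2))); rewrite mulr2n mulrDl mul1r lerD.
  have [E1 e1 [d1 h1]] := HT false false true; have [E2 e2 [d2 h2]] := HT true true true.
  exists (jD E1 E2); first by apply/evenjet_D.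
  split; first by move=> s; rewrite /nlj /jD d1 d2; ring.
  by apply: (le_trans (HN_D (jj _ _ e1) (jj _ _ e2))); rewrite mulr2n mulrDl mul1r lerD.
apply: (@eq_le2 _ _ (fun k j => Wt m k * (coef (nlj a j 0%N) k - coef (nlj b j 0%N) k))) => [k j|].
  by rewrite /sub2 /Nn mulrBr.
rewrite (_ : Cl * M ^+ 2 * D = 2 * (4 * B)); last by rewrite /Cl /B; ring.
apply: (@Xm_le2 m (fun j k => coef (nlj a j 0%N) k - coef (nlj b j 0%N) k)) => j.
have [E eE [dE hE]] := HE j.
have := ana_HN m1 eE; rewrite (_ : coef (E 0%N) = fun k => coef (nlj a j 0%N) k - coef (nlj b j 0%N) k).
  by apply: Xm_mono; lra.
apply/funext => k; rewrite /coef.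
have L c : ell2 c -> L1 (nlj c j 0%N \* ej k 0).
  by move=> ec; apply: L1M; [have [jn _] := nlj_even j ec; exact: jet_L2 jn _|exact: ej_L2].
rewrite -int01B; [|exact: L|exact: L].
by apply: eq_int01 => s _; rewrite /= dE mulrBl.
Qed.

Theorem truncated_solution M u0 : 0 < M -> ell2 u0 -> exists u : R -> sq,
  [/\ u 0 = u0, ccont u, forall t, 0 <= t -> ell2 (u t) &
   forall (t : R) k j, -1 < t ->
     is_derive t 1 (fun r => Rt r (u r) k j) (Rt (pos t) (Nn (Pr M (u (pos t)))) k j)].
Proof.
move=> M0 e0.
have eP a : ell2 a -> ell2 (Pr M a) by move=> ea; exists M; exact: Pr_le2.
have C0 : 0 <= Cl by rewrite /Cl !mulr_ge0 ?sqr_ge0// exprn_ge0.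
have e00 : ell2 (fun (_ : nat) (_ : bool) => 0 : R) by exists 0; exact: le2_0.
apply: (@semilinear R (fun a => Nn (Pr M a)) (1 + Cl * M ^+ 2 * 2)) => //.
- by rewrite lerDl; apply: mulr_ge0 => //; apply: mulr_ge0 => //; exact: sqr_ge0.
- move=> a b D ea eb h; have D0 : 0 <= D by case: h.
  have := Nn_lip (eP a ea) (eP b eb) (Pr_le2 M0 ea) (Pr_le2 M0 eb) (Pr_lip M0 ea eb h).
  by apply: le2_mono; rewrite mulrA mulrDl mul1r lerDr.
- exact/Nn_ell2'/eP.
Qed.

End Nonlinearity.

(** * Limits and derivatives relative to the half-line of times *)

Local Notation N0 t := (within [set r | 0 <= r] (nbhs t)).
Local Notation N1 t := (within [set r | 0 <= r] t^').

Section Filters.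
Context {R : realType}.
Implicit Types (f g : R -> R) (t : R).

Lemma cvgN0P f t : f r @[r --> N0 t] --> (0 : R) <->
  forall e, 0 < e -> exists2 d, 0 < d & forall r, 0 <= r -> `|r - t| < d -> `|f r| < e.
Proof.
split=> [/cvgr0Pnorm_lt H e e0|H].
  have /nbhs_ballP[d /= d0 Hd] := H e e0.
  by exists d => // r r0 rt; apply: Hd => //; rewrite /ball/= distrC.
apply/cvgr0Pnorm_lt => e e0; have [d d0 Hd] := H e e0.
apply/nbhs_ballP; exists d => //= r rt r0; apply: Hd => //; by rewrite distrC.
Qed.

Lemma cvgN1P f t : f r @[r --> N1 t] --> (0 : R) <->
  forall e, 0 < e -> exists2 d, 0 < d &
    forall r, 0 <= r -> r != t -> `|r - t| < d -> `|f r| < e.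
Proof.
split=> [/cvgr0Pnorm_lt H e e0|H].
  have /nbhs_ballP[d /= d0 Hd] := H e e0.
  by exists d => // r r0 nrt rt; apply: Hd => //; rewrite /ball/= distrC.
apply/cvgr0Pnorm_lt => e e0; have [d d0 Hd] := H e e0.
apply/nbhs_ballP; exists d => //= r rt nrt r0; apply: Hd => //; by rewrite distrC.
Qed.

Lemma cvg_N1 f t : f r @[r --> N0 t] --> (0 : R) -> f r @[r --> N1 t] --> (0 : R).
Proof.
move=> /cvgN0P H; apply/cvgN1P => e e0; have [d d0 Hd] := H e e0.
by exists d => // r r0 _; exact: Hd.
Qed.

Lemma cvg0_le (T : Type) (F : set_system T) {FF : Filter F} (f g : T -> R) :
  (forall r, `|f r| <= g r) -> g r @[r --> F] --> (0 : R) -> f r @[r --> F] --> (0 : R).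
Proof.
move=> h /cvgr0Pnorm_lt H; apply/cvgr0Pnorm_lt => e e0; have := H e e0; apply: filterS => r.
exact/le_lt_trans/(le_trans (h r))/ler_norm.
Qed.

Lemma cvg0_nearle (T : Type) (F : set_system T) {FF : Filter F} (f g : T -> R) :
  (\forall r \near F, `|f r| <= g r) -> g r @[r --> F] --> (0 : R) -> f r @[r --> F] --> (0 : R).
Proof.
move=> h /cvgr0Pnorm_lt H; apply/cvgr0Pnorm_lt => e e0.
by have := H e e0; apply: filterS2 h => r h1 h2; exact: le_lt_trans (le_trans h1 (ler_norm _)) h2.
Qed.

Lemma near_N1_neq t : \forall r \near N1 t, r != t.
Proof. by apply/nbhs_ballP; exists 1 => //= r _ + _. Qed.

Lemma near_N1_ge0 t : \forall r \near N1 t, 0 <= r.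
Proof. by apply/nbhs_ballP; exists 1 => //= r _ _. Qed.

Lemma int01_cvg (F : set_system R) {FF : Filter F} (f_ g_ : R -> R -> R) (f g : R -> R) :
  (\forall r \near F, L2 (f_ r)) -> (\forall r \near F, L2 (g_ r)) -> L2 f -> L2 g ->
  L2norm (f_ r \- f) @[r --> F] --> (0 : R) -> L2norm (g_ r \- g) @[r --> F] --> (0 : R) ->
  int01 (f_ r \* g_ r) @[r --> F] --> int01 (f \* g).
Proof.
move=> Lf_ Lg_ Lf Lg cf cg; apply/subr_cvg0.
have c : L2norm (f_ r \- f) * L2norm (g_ r \- g) + L2norm (f_ r \- f) * L2norm g + L2norm f * L2norm (g_ r \- g) @[r --> F] --> (0 : R).
  rewrite (_ : (0 : R) = 0 * 0 + 0 * L2norm g + L2norm f * 0); last by rewrite !mul0r mulr0 !addr0.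
  by apply: cvgD; [apply: cvgD|]; apply: cvgM => //; exact: cvg_cst.
apply: cvg0_nearle c; apply: filterS2 Lf_ Lg_ => r L1' L2'.
have Ld := L2B L1' Lf; have Le := L2B L2' Lg.
rewrite -int01B; [|exact: L1M|exact: L1M].
rewrite (eq_int01 (g := ((f_ r \- f) \* (g_ r \- g) \+ (f_ r \- f) \* g) \+ f \* (g_ r \- g))); last first.
  by move=> s _ /=; ring.
rewrite int01D; [|by apply: L1D; exact: L1M|exact: L1M].
rewrite int01D; [|exact: L1M|exact: L1M].
apply: (le_trans (ler_normD _ _)); apply: lerD; last exact: int01_CS.
by apply: (le_trans (ler_normD _ _)); apply: lerD; exact: int01_CS.
Qed.

Lemma min_lip (T x y : R) : `|Num.min x T - Num.min y T| <= `|x - y|.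
Proof.
have : `|x - y| <= `|x - y| by []; have := normr_ge0 (x - y).
rewrite ler_norml; move: `|x - y| => z z0 /andP[h1 h2].
by case: (leP x T) => p; case: (leP y T) => q; rewrite ler_norml; apply/andP; split; lra.
Qed.

(** Clamping time to [0, T] turns the derivative relative to the half-line into a two-sided
    derivative equal to 0, because the clamp is 1-Lipschitz. *)
Lemma const_of_o (E : R -> R) (T : R) :
  (forall t, 0 <= t <= T -> (r - t)^-1 * (E r - E t) @[r --> N1 t] --> (0 : R)) ->
  forall t, 0 <= t <= T -> E t = E 0.
Proof.
move=> H t /andP[t0 tT]; have T0 : 0 <= T := le_trans t0 tT.
pose c (x : R) := Num.max 0 (Num.min x T).
have cE x : 0 <= x <= T -> c x = x.
  by move=> /andP[x0 xT]; rewrite /c (min_l xT) max_r.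
have c01 x : 0 <= c x <= T by rewrite /c le_max lexx/= ge_max T0 ge_min lexx orbT.
have clip_le x y : `|c x - c y| <= `|x - y|.
  by apply: max_lip; rewrite distrC; apply: min_lip.
have dg x : 0 <= x <= T -> is_derive (x : R) 1 (fun r => E (c r)) (0 : R).
  move=> x01; have := H x x01 => /cvgN1P Hx.
  have lim : (h^-1 *: (E (c (h *: 1 + x)) - E (c x))) @[h --> (0 : R)^'] --> (0 : R).
    apply/cvgr0Pnorm_lt => e e0; have [d d0 Hd] := Hx e e0.
    apply/nbhs_ballP; exists d => //= h; rewrite /ball/= sub0r normrN => hd h0.
    have e1 : h *: (1 : R) = h by exact: mulr1.
    rewrite e1; have cl := clip_le (h + x) x; rewrite (cE x x01) addrK in cl *.
    have [->|ne] := eqVneq (c (h + x)) x; first by rewrite subrr scaler0 normr0.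
    have n0 : c (h + x) - x != 0 by rewrite subr_eq0.
    have c0 : 0 <= c (h + x) by case/andP: (c01 (h + x)).
    have := Hd (c (h + x)) c0 ne (le_lt_trans cl hd); rewrite !normrM !normfV.
    apply: le_lt_trans; rewrite ler_wpM2r// lef_pV2// posrE normr_gt0//.
  apply: DeriveDef; first by apply/cvg_ex; exists 0; exact: lim.
  exact/cvg_lim.
have gt := @derive_mono R (fun r => E (c r)) (fun=> 0) 0 t t0.
have gt2 := @derive_mono R (fun r => - E (c r)) (fun=> 0) 0 t t0.
have Ec x : 0 <= x <= t -> 0 <= x <= T by move=> /andP[-> /le_trans]; apply.
have e0 : c 0 = 0 by apply: cE; rewrite lexx.
have et : c t = t by apply: cE; rewrite t0.
rewrite e0 et in gt gt2; apply/eqP; rewrite eq_le; apply/andP; split.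
  rewrite -lerN2; apply: gt2 => // x /Ec x01.
  by have := is_deriveN (dg x x01); rewrite oppr0; exact.
by apply: gt => // x /Ec x01; exact: dg.
Qed.

End Filters.

(** * Functions given by L^2-convergent cosine series *)

Section Parseval.
Context {R : realType}.
Implicit Types (f g : R -> R) (c d : nat -> R).

Definition isF f c := L2 f /\ cvL2 (Sf c 0) f.

Lemma isF_norm f c D : 0 <= D -> isF f c -> (forall n, \sum_(k < n) c k ^+ 2 <= D ^+ 2) ->
  L2norm f <= D.
Proof.
move=> D0 [Lf cv] H; apply: (cvL2_le _ Lf cv); first by move=> n; exact: Sf_L2.
move=> n; apply: le_sqr_ge0 => //; rewrite Sf_norm; apply: le_trans (H n).
by apply: ler_sum => k _; rewrite expr0 mulr1.
Qed.

Lemma isF_D f g c d : isF f c -> isF g d -> isF (f \+ g) (fun k => c k + d k).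
Proof.
move=> [Lf cf] [Lg cg]; split; first exact: L2D.
have h : L2norm (Sf c 0 n \- f) + L2norm (Sf d 0 n \- g) @[n --> \oo] --> (0 : R).
  by rewrite -(addr0 (0 : R)); apply: cvgD; [exact: cf|exact: cg].
apply: (cvg0_le _ h) => n; rewrite ger0_norm ?L2norm_ge0//.
rewrite (eq_L2norm (g := (Sf c 0 n \- f) \+ (Sf d 0 n \- g))).
  by apply: L2norm_triangle; apply: L2B => //; exact: Sf_L2.
move=> s _; rewrite /= /Sf; under eq_bigr do rewrite mulrDl.
by rewrite big_split/=; ring.
Qed.

Lemma isF_Z (a : R) f c : isF f c -> isF (fun s => a * f s) (fun k => a * c k).
Proof.
move=> [Lf cf]; split; first exact: L2Z.
have h : `|a| * L2norm (Sf c 0 n \- f) @[n --> \oo] --> (0 : R).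
  by rewrite -(mulr0 `|a|); apply: cvgM; [exact: cvg_cst|exact: cf].
apply: (cvg0_le _ h) => n; rewrite ger0_norm ?L2norm_ge0//.
rewrite -L2normZ; last by apply: L2B => //; exact: Sf_L2.
rewrite le_eqVlt; apply/orP; left; apply/eqP; apply: eq_L2norm => s _; rewrite /= /Sf mulrBr mulr_sumr.
by congr (_ - _); apply: eq_bigr => k _; ring.
Qed.

Lemma eq_isF f g c d : (forall s, f s = g s) -> (forall k, c k = d k) -> isF f c -> isF g d.
Proof.
move=> fg cd; have -> : f = g by exact/funext.
by have -> : c = d by exact/funext.
Qed.

Lemma isF_syn m c B : (1 <= m)%N -> Xm m c B -> isF (syn m c 0%N) c.
Proof.
move=> m1 X; have [[jQ _] cv _] := synP m1 X.
by split; [exact: jet_L2 jQ _|exact: cv].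
Qed.

Lemma isF_syn2 m c B : (1 <= m)%N -> Xm m c B ->
  isF (syn m c 2) (fun k => - (lam k ^+ 2 * c k)).
Proof.
move=> m1 X; have [[jQ _] cv _] := synP m1 X; have i2 : (2 <= 2 * m)%N by lia.
split; first exact: jet_L2 jQ i2.
rewrite (_ : Sf _ 0 = Sf c 2); first exact: cv.
apply/funext => n; apply/funext => s; apply: eq_bigr => k _; rewrite ej2; ring.
Qed.

Lemma isF_evenjet m F : (1 <= m)%N -> evenjet m F -> isF (F 0%N) (coef (F 0%N)).
Proof.
move=> m1 eF; apply: (@eq_isF (syn m (coef (F 0%N)) 0%N) _ (coef (F 0%N))) => [s|//|].
  exact: syn_unique.
exact: isF_syn (ana m1 eF).
Qed.

End Parseval.

(** * From curves of coefficients to curves of functions *)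

Section CurveDerivative.
Context {R : realType}.
Local Notation sq := (nat -> bool -> R).
Variable m : nat.
Hypothesis m1 : (1 <= m)%N.
Variables (u p : R -> sq).
Hypothesis cu : ccont u.
Hypothesis eu : forall t, 0 <= t -> ell2 (u t).
Hypothesis ep : forall t, 0 <= t -> ell2 (p t).
Hypothesis cn : ccont (fun t => Nn m (p t)).
Hypothesis du : forall (t : R) k j, 0 <= t ->
  is_derive t 1 (fun r => Rt r (u r) k j) (Rt t (Nn m (p t)) k j).

Local Notation Q t j := (qj m (u t) j).

(** Right-hand side of the Schroedinger equation, with the nonlinearity taken at [p]: the truncated
    state in the a priori estimates, the state [u] itself at the end. [wc] gives its
    coefficients. *)
Definition Pf (t : R) (j : bool) (s : R) : R :=
  (if j then Q t false 2 s else - Q t true 2 s) + nlj m (p t) j 0%N s.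

Definition wc (t : R) : sq := fun k j =>
  (if j then - (lam k ^+ 2 * cf m (u t) false k) else lam k ^+ 2 * cf m (u t) true k) + Nn m (p t) k j / Wt m k.

Lemma wc_derive (t : R) k j : 0 <= t -> is_derive t 1 (fun r : R => cf m (u r) j k) (wc t k j).
Proof.
move=> t0; pose l : R := lam k ^+ 2.
pose b r i := Rt r (u r) k i.
have db i : is_derive (t : R) 1 (fun r : R => b r i) (Rt t (Nn m (p t)) k i) by exact: du.
have dl : is_derive (t : R) 1 (fun r : R => l * r) l.
  have := is_deriveZ l (is_derive_id t (1 : R)); rewrite [X in is_derive _ _ _ X -> _](_ : _ = l)//; exact: mulr1.
have dc : is_derive (t : R) 1 (fun r : R => cos (l * r)) (- sin (l * t) * l).
  have := @is_derive1_comp R cos (fun r : R => l * r) t _ _ (is_derive_cos _) dl; exact.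
have ds : is_derive (t : R) 1 (fun r : R => sin (l * r)) (cos (l * t) * l).
  have := @is_derive1_comp R sin (fun r : R => l * r) t _ _ (is_derive_sin _) dl; exact.
have e (r : R) : u r k j = if j then - (sin (l * r) * b r false) + cos (l * r) * b r true
    else cos (l * r) * b r false + sin (l * r) * b r true.
  by rewrite -{1}(RtK r (u r)) /Rt mulrN cosN sinN /b /Rt -/l /=; case: j; ring.
have := cos2Dsin2 (l * t).
have et := e t; rewrite /b /Rt -/l /= in et.
have dWt (f : R -> R) d : is_derive (t : R) 1 f d -> is_derive (t : R) 1 (fun r : R => f r / Wt m k) (d / Wt m k).
  move=> df; have := is_deriveZ (Wt m k)^-1 df.
  by rewrite (_ : _ \*: f = (fun r : R => f r / Wt m k)) ?(mulrC d)//; apply/funext => r; rewrite mulrC.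
have key : is_derive (t : R) 1 (fun r : R => u r k j)
   ((if j then - (l * u t k false) else l * u t k true) + Nn m (p t) k j).
  rewrite (_ : (fun r => u r k j) = (fun r => if j then - (sin (l * r) * b r false) + cos (l * r) * b r true
    else cos (l * r) * b r false + sin (l * r) * b r true)); last by apply/funext => r; exact: e.
  have h := cos2Dsin2 (l * t).
  clear et e; case: j.
    have d1 := is_deriveD (is_deriveN (is_deriveM ds (db false))) (is_deriveM dc (db true)).
    apply: is_derive_eq d1 _; rewrite /b /Rt -/l /= /GRing.scale/=.
    move: h; move: (cos _) (sin _) (u t k false) (u t k true) (Nn m (p t) k false) (Nn m (p t) k true) => c s x y z w h.
    by transitivity ((c ^+ 2 + s ^+ 2) * (- (l * x) + w)); [ring|rewrite h mul1r].
  have d1 := is_deriveD (is_deriveM dc (db false)) (is_deriveM ds (db true)).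
  apply: is_derive_eq d1 _; rewrite /b /Rt -/l /= /GRing.scale/=.
  move: h; move: (cos _) (sin _) (u t k false) (u t k true) (Nn m (p t) k false) (Nn m (p t) k true) => c s x y z w h.
  rewrite -[in RHS](mul1r y) -[in RHS](mul1r z) -h; ring.
move=> _; have := dWt _ _ key; rewrite /wc /cf -/l; move=> h; apply: is_derive_eq h _.
by case: (j); rewrite mulrDl; congr (_ + _); rewrite ?mulNr mulrA.
Qed.

Lemma Wt_ge1 k : 1 <= Wt m k :> R.
Proof. by rewrite /Wt lerDl exprn_ge0// lam_ge0. Qed.

(** As m >= 1, the weight dominates lam^2, which pays for the two derivatives of the linear part. *)
Lemma le2_wc (a a' n n' : sq) A B : le2 (sub2 a a') A -> le2 (sub2 n n') B ->
  le2 (sub2 (fun k j => (if j then - (lam k ^+ 2 * cf m a false k) else lam k ^+ 2 * cf m a true k) + n k j / Wt m k)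
            (fun k j => (if j then - (lam k ^+ 2 * cf m a' false k) else lam k ^+ 2 * cf m a' true k) + n' k j / Wt m k)) (A + B).
Proof.
move=> [A0 ha] [B0 hb].
pose x : sq := fun k j => if j then - (lam k ^+ 2 / Wt m k * sub2 a a' k false) else lam k ^+ 2 / Wt m k * sub2 a a' k true.
pose y : sq := fun k j => (Wt m k)^-1 * sub2 n n' k j.
apply: (@eq_le2 _ _ (fun k j => x k j + y k j)) => [k [] |].
- by rewrite /x /y /sub2 /cf; ring.
- by rewrite /x /y /sub2 /cf; ring.
have sq1 (z v : R) : 0 <= z -> z <= 1 -> (z * v) ^+ 2 <= v ^+ 2.
  move=> z0 z1; rewrite exprMn -[leRHS]mul1r ler_wpM2r ?sqr_ge0//.
  by rewrite exprn_ile1.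
have W0 k : 0 < Wt m k :> R := Wt_gt0 m k.
apply: le2D; split => // K.
  apply: le_trans (ha K); rewrite !psum_bool; apply: ler_sum => k _.
  rewrite /x sqrrN addrC; apply: lerD; apply: sq1.
  - by rewrite divr_ge0 ?exprn_ge0 ?lam_ge0// ltW.
  - by rewrite ler_pdivrMr// mul1r Wt_ge//; lia.
  - by rewrite divr_ge0 ?exprn_ge0 ?lam_ge0// ltW.
  - by rewrite ler_pdivrMr// mul1r Wt_ge//; lia.
apply: le_trans (hb K); rewrite !psum_bool; apply: ler_sum => k _.
by apply: lerD; apply: sq1; rewrite ?invr_ge0 ?(ltW (W0 k))// invf_le1// Wt_ge1.
Qed.

Lemma wc_ccont : ccont wc.
Proof.
move=> t t0 e e0; have e2 : 0 < e / 2 by rewrite divr_gt0.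
have [d1 d10 H1] := cu t0 e2; have [d2 d20 H2] := cn t0 e2.
exists (Num.min d1 d2) => [|r r0]; first by rewrite lt_min d10.
rewrite lt_min => /andP[r1 r2]; rewrite [e]splitr.
exact: le2_wc (H1 r r0 r1) (H2 r r0 r2).
Qed.

Lemma Q_cont j t : 0 <= t -> HN (2 * m) (jB (Q r j) (Q t j)) @[r --> N0 t] --> (0 : R).
Proof.
move=> t0; apply/cvgN0P => e e0.
pose c : R := (2 * m).+1%:R; have c0 : 0 < c by rewrite ltr0n.
have e2 : 0 < e / (2 * c) by rewrite divr_gt0// mulr_gt0.
have [d d0 H] := cu t0 e2; exists d => // r r0 rt.
rewrite ger0_norm ?HN_ge0//; apply: (le_lt_trans (qj_HNB m1 j (eu r0) (eu t0) (H r r0 rt))).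
rewrite -/c (_ : c * _ = e / 2); last by field; rewrite gt_eqF.
by rewrite ltr_pdivrMr// ltr_pMr// ltr1n.
Qed.

Lemma isF_Q t j : 0 <= t -> isF (Q t j 0%N) (cf m (u t) j).
Proof. by move=> t0; exact: isF_syn m1 (le2_Xm j (ell2_lev m (eu t0))). Qed.

Lemma isF_Pf t j : 0 <= t -> isF (Pf t j) (fun k => wc t k j).
Proof.
move=> t0; have h i := isF_syn2 m1 (le2_Xm i (ell2_lev m (eu t0))).
have hn := isF_evenjet m1 (nlj_even m1 j (ep t0)).
have cN k : Nn m (p t) k j / Wt m k = coef (nlj m (p t) j 0%N) k.
  by rewrite /Nn mulrAC divff ?mul1r// gt_eqF// Wt_gt0.
rewrite /Pf /wc; case: j hn cN => hn cN.
  by apply: eq_isF (isF_D (h false) hn) => [s|k]; rewrite ?cN.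
by apply: eq_isF (isF_D (isF_Z (- 1) (h true)) hn) => [s|k]; rewrite ?cN /= ?mulN1r ?opprK.
Qed.

(** The mean value inequality in l^2 bounds the error of the difference quotient on coefficients,
    and [isF_norm] carries the bound to L^2. *)
Lemma Q_der j t : 0 <= t ->
  L2norm (fun s => (r - t)^-1 * (Q r j 0%N s - Q t j 0%N s) - Pf t j s) @[r --> N1 t] --> (0 : R).
Proof.
move=> t0; apply/cvgN1P => e e0; have e2 : 0 < e / 2 by rewrite divr_gt0.
have [d d0 H] := wc_ccont t0 e2.
exists d => // r r0 nrt rt; rewrite ger0_norm ?L2norm_ge0//.
apply: (le_lt_trans (y := e / 2)); last by rewrite ltr_pdivrMr// ltr_pMr// ltr1n.
pose g k := (r - t)^-1 * (cf m (u r) j k + -1 * cf m (u t) j k) + -1 * wc t k j.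
apply: (@isF_norm _ _ g); first exact: ltW.
  apply: eq_isF (isF_D (isF_Z (r - t)^-1 (isF_D (isF_Q j r0) (isF_Z (- 1) (isF_Q j t0)))) (isF_Z (- 1) (isF_Pf j t0))) => // s.
  by rewrite /= !mulN1r.
have key (x y : R) : 0 <= x -> x <= y -> (forall z, x <= z <= y -> `|z - t| < d) ->
    le2 (sub2 (fun k j => cf m (u y) j k - y * wc t k j) (fun k j => cf m (u x) j k - x * wc t k j)) (e / 2 * y - e / 2 * x).
  move=> x0 xy hz; apply: (@le2_derive R bool (fun z k j => cf m (u z) j k - z * wc t k j) (fun z => sub2 (wc z) (wc t)) (fun z => e / 2 * z) (fun=> e / 2)) => //.
  - move=> k i z /andP[xz zy]; have dz := wc_derive k i (le_trans x0 xz).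
    have d1 : is_derive (z : R) 1 (fun z : R => wc t k i * z) (wc t k i).
      have := is_deriveZ (wc t k i) (is_derive_id z (1 : R)); rewrite [X in is_derive _ _ _ X -> _](_ : _ = wc t k i)//; exact: mulr1.
    have := is_deriveB dz d1.
    rewrite (_ : _ - _ = (fun z => cf m (u z) i k - z * wc t k i)) //.
    by apply/funext => z'; rewrite mulrC.
  - move=> z _; have := is_deriveZ (e / 2) (is_derive_id z (1 : R)); rewrite [X in is_derive _ _ _ X -> _](_ : _ = e / 2)//; exact: mulr1.
  - by move=> z /[dup] zz /andP[xz _]; apply: H; [exact: le_trans xz|exact: hz].
have fin : le2 (fun k j => cf m (u r) j k - cf m (u t) j k - (r - t) * wc t k j) (e / 2 * `|r - t|).
  have [tr|tr] := leP t r.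
    rewrite ger0_norm ?subr_ge0// mulrBr.
    apply: eq_le2 (key t r t0 tr _) => [k i|z /andP[tz zr]]; first by rewrite /sub2; ring.
    by apply: le_lt_trans rt; rewrite !ger0_norm ?subr_ge0// lerB.
  rewrite distrC ger0_norm ?subr_ge0 ?(ltW tr)// mulrBr.
  apply: eq_le2 (le2N (key r t r0 (ltW tr) _)) => [k i|z /andP[tz zr]]; first by rewrite /sub2; ring.
  by apply: le_lt_trans rt; rewrite distrC (distrC r) !ger0_norm ?subr_ge0 ?(ltW tr)// lerB.
move=> n; have n0 : `|r - t| != 0 by rewrite normr_eq0 subr_eq0.
have := le2Z (r - t)^-1 fin; rewrite normfV (_ : _^-1 * (e / 2 * _) = e / 2); last by rewrite mulrCA mulVf// mulr1.
move=> [_ /(_ n)]; apply: le_trans; apply: le_trans (sum_le_psum _ _ j).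
rewrite le_eqVlt; apply/orP; left; apply/eqP; apply: eq_bigr => k _; congr (_ ^+ 2).
by rewrite /g; field; rewrite subr_eq0.
Qed.

End CurveDerivative.

(** * Mass, energy and the H^1 bound *)

Section Conservation.
Context {R : realType}.
Implicit Types (Q : R -> bool -> nat -> R -> R) (F G : nat -> R -> R).

Lemma cvg0Ml (T : Type) (F : set_system T) {FF : Filter F} (a : R) (g : T -> R) :
  g x @[x --> F] --> (0 : R) -> a * g x @[x --> F] --> (0 : R).
Proof. by move=> h; rewrite -(mulr0 a); apply: cvgM => //; exact: cvg_cst. Qed.

Lemma cvg0D (T : Type) (F : set_system T) {FF : Filter F} (f g : T -> R) :
  f x @[x --> F] --> (0 : R) -> g x @[x --> F] --> (0 : R) -> f x + g x @[x --> F] --> (0 : R).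
Proof. by move=> hf hg; rewrite -(addr0 (0 : R)); exact: cvgD. Qed.

Definition rho Q (t s : R) : R := Q t false 0%N s ^+ 2 + Q t true 0%N s ^+ 2.
Definition al Q (t s : R) : R := - 2^-1 * (rho Q t s - rho Q t 0).
(** Real and imaginary parts of i (q_ss + (|q|^2 - |q(0)|^2) q / 2), with q = q1 + i q2, q1 at
    [false] and q2 at [true]. *)
Definition NP Q (t : R) (j : bool) (s : R) : R :=
  if j then Q t false 2 s - al Q t s * Q t false 0%N s
  else - Q t true 2 s + al Q t s * Q t true 0%N s.

Definition mass Q t : R := \sum_(j : bool) int01 (Q t j 0%N \* Q t j 0%N).
(** Hamiltonian of the focusing cubic equation. It has no sign, so the quartic term must be absorbed
    to bound the gradient. *)
Definition energy Q t : R :=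
  2^-1 * (\sum_(j : bool) int01 (Q t j 1%N \* Q t j 1%N)) - 8^-1 * int01 (rho Q t \* rho Q t).

Lemma evenjet_parts m F G : (1 <= m)%N -> evenjet m F -> evenjet m G ->
  int01 (F 1%N \* G 1%N) = - int01 (F 0%N \* G 2%N).
Proof.
move=> m1 [jF oF] [jG oG]; have i0 : (0 < 2 * m)%N by lia. have i1 : (1 < 2 * m)%N by lia.
have := int01_byparts (jet_L2 jF i0) (jet_L2 jG i1) (jet_AC jF i0) (jet_AC jG i1).
by have [-> ->] := oG 1%N i1 isT; rewrite !mulr0 subrr => /eqP; rewrite addr_eq0 => /eqP.
Qed.

Lemma evenjet_sym m F G : (1 <= m)%N -> evenjet m F -> evenjet m G ->
  int01 (F 2%N \* G 0%N) = int01 (F 0%N \* G 2%N).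
Proof.
move=> m1 eF eG; rewrite int01_mulC; apply: oppr_inj.
by rewrite -(evenjet_parts m1 eG eF) -(evenjet_parts m1 eF eG) int01_mulC.
Qed.

(** The increment of |q|^4 between two times is the pairing of the increment of q with (q +
    q')(|q|^2 + |q'|^2); this bounds the distance of that factor from its limit 4 q |q|^2. *)
Lemma quartic_aux (B e qf qt df dt x dx : R) : 0 <= B -> 0 <= e -> e <= 1 ->
  `|qf| <= B -> `|qt| <= B -> `|x| <= B -> `|df| <= e -> `|dt| <= e -> `|dx| <= e ->
  `|(2 * x + dx) * ((qf + df) ^+ 2 + (qt + dt) ^+ 2 + (qf ^+ 2 + qt ^+ 2)) - 4 * x * (qf ^+ 2 + qt ^+ 2)|
   <= (12 * B ^+ 2 + 8 * B + 2) * e.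
Proof.
move=> B0 e0 e1 hqf hqt hx hdf hdt hdx.
pose Y := 2 * (qf * df + qt * dt) + (df ^+ 2 + dt ^+ 2).
pose r := qf ^+ 2 + qt ^+ 2.
rewrite (_ : _ - _ = 2 * (x * Y) + dx * (2 * r + Y)); last by rewrite /Y /r; ring.
have m2 (a b A D : R) : 0 <= A -> 0 <= D -> `|a| <= A -> `|b| <= D -> `|a * b| <= A * D.
  by move=> A0 D0 h1 h2; rewrite normrM ler_pM.
have n2 (a : R) : `|2 * a| = 2 * `|a| by rewrite normrM ger0_norm.
have hY : `|Y| <= (4 * B + 2) * e.
  have h1 := m2 _ _ _ _ B0 e0 hqf hdf; have h2 := m2 _ _ _ _ B0 e0 hqt hdt.
  have h3 := m2 _ _ _ _ e0 e0 hdf hdf; have h4 := m2 _ _ _ _ e0 e0 hdt hdt.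
  have h5 : e ^+ 2 <= e by rewrite expr2 -[leRHS]mul1r ler_wpM2r.
  rewrite -!expr2 in h3 h4; apply: (le_trans (ler_normD _ _)).
  have := ler_normD (qf * df) (qt * dt); have := ler_normD (df ^+ 2) (dt ^+ 2); rewrite n2.
  have -> : (4 * B + 2) * e = 4 * (B * e) + 2 * e by ring.
  move: `|qf * df + qt * dt| `|df ^+ 2 + dt ^+ 2| => f g.
  move: `|qf * df| `|qt * dt| `|df ^+ 2| `|dt ^+ 2| (B * e) (e ^+ 2) h1 h2 h3 h4 h5 => a b c d h i; lra.
have hr : `|r| <= 2 * B ^+ 2.
  have h1 := m2 _ _ _ _ B0 B0 hqf hqf; have h2 := m2 _ _ _ _ B0 B0 hqt hqt.
  rewrite -!expr2 in h1 h2; have := ler_normD (qf ^+ 2) (qt ^+ 2); rewrite -/r.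
  move: `|r| `|_| `|_| (B ^+ 2) h1 h2 => a b c d; lra.
have Y0 : 0 <= (4 * B + 2) * e by rewrite mulr_ge0// addr_ge0// mulr_ge0.
have Y1 : (4 * B + 2) * e <= 4 * B + 2 by rewrite ler_piMr// addr_ge0// mulr_ge0.
have h1 := m2 _ _ _ _ B0 Y0 hx hY.
have h2 : `|2 * r + Y| <= 4 * B ^+ 2 + 4 * B + 2.
  apply: (le_trans (ler_normD _ _)); rewrite n2.
  move: `|r| `|Y| (B ^+ 2) hr hY Y1 => a b c; move: (_ * e) => d; lra.
have P0 : 0 <= 4 * B ^+ 2 + 4 * B + 2 by rewrite !addr_ge0 ?mulr_ge0 ?sqr_ge0.
have h3 := m2 _ _ _ _ e0 P0 hdx h2.
apply: (le_trans (ler_normD _ _)); rewrite n2.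
rewrite (_ : (12 * _ + _ + _) * e = 2 * (B * ((4 * B + 2) * e)) + e * (4 * B ^+ 2 + 4 * B + 2)); last by ring.
by rewrite lerD// ler_pM2l.
Qed.

Section AtTime.
Variables (m : nat) (Q : R -> bool -> nat -> R -> R) (t : R).
Hypothesis m1 : (1 <= m)%N.
Hypothesis t0 : 0 <= t.
Hypothesis eQ : forall r j, 0 <= r -> evenjet m (Q r j).
Hypothesis cQ : forall j, HN (2 * m) (jB (Q r j) (Q t j)) @[r --> N0 t] --> (0 : R).
Hypothesis dQ : forall j, L2norm (fun s => (r - t)^-1 * (Q r j 0%N s - Q t j 0%N s) - NP Q t j s) @[r --> N1 t] --> (0 : R).

Let m20 : (0 < 2 * m)%N. Proof. by lia. Qed.
Let m22 : (2 <= 2 * m)%N. Proof. by lia. Qed.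
Let jQ r j : 0 <= r -> jet (2 * m) (Q r j). Proof. by move=> r0; case: (eQ j r0). Qed.
Let LQ r j i : 0 <= r -> (i <= 2 * m)%N -> L2 (Q r j i).
Proof. by move=> r0; apply: jet_L2; exact: jQ. Qed.
Let contQ r j : 0 <= r -> continuous (Q r j 0%N).
Proof. by move=> r0; apply: jet_continuous m20; exact: jQ. Qed.
Let supQ r j s : 0 <= r -> `|Q r j 0%N s| <= HN (2 * m) (Q r j).
Proof. by move=> r0; exact: jet_sup s (jQ j r0) m20. Qed.

Let cont_rho r : 0 <= r -> continuous (rho Q r).
Proof.
move=> r0 s; rewrite /rho; apply: cvgD; (under eq_fun do rewrite expr2; apply: cvgM; exact: contQ).
Qed.

Lemma al_continuous r : 0 <= r -> continuous (al Q r).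
Proof.
by move=> r0 s; apply: cvgM; [exact: cvg_cst|apply: cvgB; [exact: cont_rho|exact: cvg_cst]].
Qed.

Lemma L2_NP j : L2 (NP Q t j).
Proof.
have h i : L2 (al Q t \* Q t i 0%N).
  apply: cont_L2; apply: contM; [exact: al_continuous|exact: contQ].
rewrite /NP; case: j; first by apply: L2B; [exact: LQ|exact: h].
by apply: L2D; [apply: L2N; exact: LQ|exact: h].
Qed.

(** Increments of mass and energy are pairings of Q r - Q t with some [G_ r] converging in L^2 to
    the gradient [G]; so L^2 differentiability of [Q] in time is all that is used. *)
Lemma quad_der (G_ : R -> bool -> R -> R) (G : bool -> R -> R) :
  (forall r j, 0 <= r -> L2 (G_ r j)) -> (forall j, L2 (G j)) ->
  (forall j, L2norm (G_ r j \- G j) @[r --> N0 t] --> (0 : R)) ->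
  (r - t)^-1 * (\sum_(j : bool) int01 ((fun s => Q r j 0%N s - Q t j 0%N s) \* G_ r j)) @[r --> N1 t] -->
    \sum_(j : bool) int01 (NP Q t j \* G j).
Proof.
move=> L_ L' cG.
have h j : (r - t)^-1 * int01 ((fun s => Q r j 0%N s - Q t j 0%N s) \* G_ r j) @[r --> N1 t] --> int01 (NP Q t j \* G j).
  have n0 := near_N1_ge0 t.
  have Ld r : 0 <= r -> L2 (fun s => (r - t)^-1 * (Q r j 0%N s - Q t j 0%N s)).
    by move=> r0; apply/L2Z/L2B; apply: LQ.
  have f1 : \forall r \near N1 t, L2 (fun s => (r - t)^-1 * (Q r j 0%N s - Q t j 0%N s)) by apply: filterS n0 => r; exact: Ld.
  have f2 : \forall r \near N1 t, L2 (G_ r j) by apply: filterS n0 => r; exact: L_.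
  have : int01 ((fun s => (r - t)^-1 * (Q r j 0%N s - Q t j 0%N s)) \* G_ r j) @[r --> N1 t] --> int01 (NP Q t j \* G j).
    exact: int01_cvg f1 f2 (L2_NP j) (L' j) (dQ j) (cvg_N1 (cG j)).
  apply: cvg_trans; apply: near_eq_cvg; apply: filterS n0 => r r0.
  rewrite -int01Z; last by apply: L1M; [apply: L2B; exact: LQ|exact: L_].
  by apply: eq_int01 => s _; rewrite /= mulrA.
under eq_fun do rewrite big_bool mulrDr; rewrite big_bool.
by apply: cvgD; exact: h.
Qed.

(** The potential terms cancel pointwise, and the second derivatives cancel because they are
    symmetric under Neumann conditions. *)
Lemma NP_orth : \sum_(j : bool) int01 (NP Q t j \* Q t j 0%N) = 0.
Proof.
rewrite big_bool /= -int01D; [|by apply: L1M; [exact: L2_NP|exact: LQ]..].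
rewrite (eq_int01 (g := (Q t false 2 \* Q t true 0%N) \- (Q t false 0%N \* Q t true 2))); last first.
  by move=> s _; rewrite /NP /=; ring.
rewrite int01B; [|by apply: L1M; exact: LQ..].
by rewrite (evenjet_sym m1 (eQ _ t0) (eQ _ t0)) subrr.
Qed.

Let eps r : R := HN (2 * m) (jB (Q r false) (Q t false)) + HN (2 * m) (jB (Q r true) (Q t true)).
Let eps0 : eps r @[r --> N0 t] --> (0 : R).
Proof. by have := cvgD (cQ false) (cQ true); rewrite addr0; exact. Qed.
Let eps_ge r j s : 0 <= r -> `|Q r j 0%N s - Q t j 0%N s| <= eps r.
Proof.
move=> r0; rewrite -(jBE (Q r j) (Q t j)).
have jB' : jet (2 * m) (jB (Q r j) (Q t j)) by case: (evenjet_B (eQ j r0) (eQ j t0)).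
apply: (le_trans (jet_sup s jB' m20)); rewrite /eps.
by case: (j); rewrite ?lerDl ?lerDr HN_ge0.
Qed.

Lemma near_N0_ge0 (x : R) : \forall r \near N0 x, 0 <= r.
Proof. by apply/nbhs_ballP; exists 1 => //= r _. Qed.

Lemma mass_der : (r - t)^-1 * (mass Q r - mass Q t) @[r --> N1 t] --> (0 : R).
Proof.
pose G_ r j s := Q r j 0%N s + Q t j 0%N s; pose G j s := 2 * Q t j 0%N s.
have := @quad_der G_ G; have -> : \sum_(j : bool) int01 (NP Q t j \* G j) = 0.
  transitivity (2 * \sum_(j : bool) int01 (NP Q t j \* Q t j 0%N)); last by rewrite NP_orth mulr0.
  rewrite mulr_sumr; apply: eq_bigr => j _.
  rewrite -int01Z; last by apply: L1M; [exact: L2_NP|exact: LQ].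
  by apply: eq_int01 => s _; rewrite /G /=; ring.
move=> H; have {}H := H _ _ _.
have : (r - t)^-1 * (\sum_(j : bool) int01 ((fun s => Q r j 0%N s - Q t j 0%N s) \* G_ r j)) @[r --> N1 t] --> (0 : R).
  apply: H => [r j r0|j|j].
  - by apply: L2D; exact: LQ.
  - by apply: L2Z; exact: LQ.
  - apply: cvg0_nearle (@cQ j); apply: filterS (near_N0_ge0 t) => r r0.
    rewrite ger0_norm ?L2norm_ge0//; apply: le_trans (HN_ge _ (leq0n _)).
    rewrite le_eqVlt; apply/orP; left; apply/eqP; apply: eq_L2norm => s _.
    by rewrite /= /G_ /G jBE; ring.
apply: cvg_trans; apply: near_eq_cvg; apply: filterS (near_N1_ge0 t) => r r0.
congr (_ * _); rewrite /mass -sumrB; apply: eq_bigr => j _.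
rewrite -int01B; [|by apply: L1M; exact: LQ..].
by apply: eq_int01 => s _; rewrite /G_ /=; ring.
Qed.

(** Paired with the gradient - q_ss - |q|^2 q / 2, the field leaves |q(0)|^2 / 2 times the integral
    of q1 q2_ss - q2 q1_ss, which is 0 by symmetry of the second derivative. *)
Lemma energy_der : (r - t)^-1 * (energy Q r - energy Q t) @[r --> N1 t] --> (0 : R).
Proof.
pose G_ r j s := - 2^-1 * (Q r j 2 s + Q t j 2 s) - 8^-1 * ((Q r j 0%N s + Q t j 0%N s) * (rho Q r s + rho Q t s)).
pose G j s := - Q t j 2 s - 2^-1 * (Q t j 0%N s * rho Q t s).
have LG_ r j : 0 <= r -> L2 (G_ r j).
  move=> r0; apply: L2B; first by apply/L2Z/L2D; exact: LQ.
  apply/L2Z/cont_L2/contM.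
    by move=> x; apply: cvgD; exact: contQ.
  by move=> x; apply: cvgD; exact: cont_rho.
have LG j : L2 (G j).
  apply: L2B; first by apply: L2N; exact: LQ.
  by apply/L2Z/cont_L2/contM; [exact: contQ|exact: cont_rho].
have Z : \sum_(j : bool) int01 (NP Q t j \* G j) = 0.
  rewrite big_bool /= -int01D; [|by apply: L1M; [exact: L2_NP|exact: LG]..].
  rewrite (eq_int01 (g := fun s => (2^-1 * rho Q t 0) * ((Q t true 2 \* Q t false 0%N) \- (Q t true 0%N \* Q t false 2)) s)); last first.
    by move=> s _; rewrite /NP /G /al /=; field.
  rewrite int01Z; last by apply: L1B; apply: L1M; exact: LQ.
  rewrite int01B; [|by apply: L1M; exact: LQ..].
  by rewrite (evenjet_sym m1 (eQ _ t0) (eQ _ t0)) subrr mulr0.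
have cG j : L2norm (G_ r j \- G j) @[r --> N0 t] --> (0 : R).
  pose B : R := HN (2 * m) (Q t false) + HN (2 * m) (Q t true).
  have B0 : 0 <= B by rewrite addr_ge0 ?HN_ge0.
  have hB i s : `|Q t i 0%N s| <= B.
    by apply: (le_trans (supQ i s t0)); rewrite /B; case: i; rewrite ?lerDl ?lerDr HN_ge0.
  pose K : R := 12 * B ^+ 2 + 8 * B + 2.
  have c : 2^-1 * HN (2 * m) (jB (Q r j) (Q t j)) + 8^-1 * (K * eps r) @[r --> N0 t] --> (0 : R).
    by apply: cvg0D; apply: cvg0Ml; [exact: cQ|apply: cvg0Ml; exact: eps0].
  apply: cvg0_nearle c.
  have e1 : \forall r \near N0 t, eps r <= 1.
    by apply: cvgr_le eps0 _ _; exact: ltr01.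
  apply: filterS2 (near_N0_ge0 t) e1 => r r0 er1.
  rewrite ger0_norm ?L2norm_ge0//.
  pose X s := - 2^-1 * jB (Q r j) (Q t j) 2 s.
  pose Z' s := - 8^-1 * ((Q r j 0%N s + Q t j 0%N s) * (rho Q r s + rho Q t s) - 4 * Q t j 0%N s * rho Q t s).
  have cZ : continuous Z'.
    move=> x; apply: cvgM; first exact: cvg_cst.
    apply: cvgB; apply: cvgM; [apply: cvgD; exact: contQ|apply: cvgD; exact: cont_rho| |exact: cont_rho].
    by apply: cvgM; [exact: cvg_cst|exact: contQ].
  have LB : L2 (jB (Q r j) (Q t j) 2%N).
    by have [jb _] := evenjet_B (eQ j r0) (eQ j t0); exact: jet_L2 jb _.
  rewrite (eq_L2norm (g := X \+ Z')); last by move=> s _; rewrite /G_ /G /X /Z' /= jBE; field.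
  apply: (le_trans (L2norm_triangle (L2Z _ LB) (cont_L2 cZ))).
  apply: lerD.
    rewrite L2normZ// normrN ger0_norm ?invr_ge0// ler_wpM2l ?invr_ge0//; exact: HN_ge.
  apply: L2norm_bounded; first exact: cont_meas.
  move=> s _; rewrite /Z' normrM normrN (@ger0_norm _ 8^-1) ?invr_ge0//; apply: ler_wpM2l; first by rewrite invr_ge0.
  have e0 : 0 <= eps r by rewrite addr_ge0 ?HN_ge0.
  have := quartic_aux B0 e0 er1 (hB false s) (hB true s) (hB j s) (eps_ge false s r0) (eps_ge true s r0) (eps_ge j s r0).
  apply: le_trans; rewrite le_eqVlt; apply/orP; left; apply/eqP; congr (`|_|); rewrite /rho; ring.
have := @quad_der G_ G LG_ LG cG; rewrite Z.
apply: cvg_trans; apply: near_eq_cvg; apply: filterS (near_N1_ge0 t) => r r0.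
congr (_ * _).
have Lrho r' : 0 <= r' -> L2 (rho Q r') by move=> r0'; exact/cont_L2/cont_rho.
have e1 : int01 (rho Q r \* rho Q r) - int01 (rho Q t \* rho Q t) =
   \sum_(j : bool) int01 ((fun s => Q r j 0%N s - Q t j 0%N s) \* (fun s => (Q r j 0%N s + Q t j 0%N s) * (rho Q r s + rho Q t s))).
  have Lx j : L2 (fun s => (Q r j 0%N s + Q t j 0%N s) * (rho Q r s + rho Q t s)).
    apply/cont_L2/contM; [by move=> x; apply: cvgD; exact: contQ|by move=> x; apply: cvgD; exact: cont_rho].
  rewrite -int01B; [|by apply: L1M; exact: Lrho..].
  rewrite big_bool /= -int01D; [|by apply: L1M => //; apply: L2B; exact: LQ..].
  by apply: eq_int01 => s _; rewrite /rho /=; ring.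
have e2 j : int01 (Q r j 1%N \* Q r j 1%N) - int01 (Q t j 1%N \* Q t j 1%N) =
    - int01 ((fun s => Q r j 0%N s - Q t j 0%N s) \* (fun s => Q r j 2 s + Q t j 2 s)).
  have L1' r' : 0 <= r' -> L2 (Q r' j 1%N) by move=> r0'; apply: LQ => //; lia.
  rewrite -int01B; [|by apply: L1M; exact: L1'..].
  have := evenjet_parts m1 (evenjet_B (eQ j r0) (eQ j t0)) (evenjet_D (eQ j r0) (eQ j t0)).
  rewrite (eq_int01 (g := (Q r j 1%N \* Q r j 1%N) \- (Q t j 1%N \* Q t j 1%N))); last by move=> s _; rewrite /= jBE /jD; ring.
  by move=> ->; congr (- _); apply: eq_int01 => s _; rewrite /= jBE.
have -> : energy Q r - energy Q t = 2^-1 * (\sum_(j : bool) (int01 (Q r j 1%N \* Q r j 1%N) - int01 (Q t j 1%N \* Q t j 1%N)))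
   - 8^-1 * (int01 (rho Q r \* rho Q r) - int01 (rho Q t \* rho Q t)).
  by rewrite /energy sumrB; ring.
rewrite e1 !mulr_sumr -sumrB; apply: eq_bigr => j _; rewrite e2.
have Lx : L2 (fun s => (Q r j 0%N s + Q t j 0%N s) * (rho Q r s + rho Q t s)).
  apply/cont_L2/contM; [by move=> x; apply: cvgD; exact: contQ|by move=> x; apply: cvgD; exact: cont_rho].
have Ld : L2 (fun s => Q r j 0%N s - Q t j 0%N s) by apply: L2B; exact: LQ.
have Ls : L2 (fun s => Q r j 2 s + Q t j 2 s) by apply: L2D; exact: LQ.
set d := (fun s => Q r j 0%N s - _) in Ld *; set S := (fun s => Q r j 2 s + _) in Ls *.
set X := (fun s => _ * (rho Q r s + _)) in Lx *.
have dS := L1M Ld Ls; have dX := L1M Ld Lx.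
rewrite (eq_int01 (f := d \* G_ r j) (g := (fun x => - 2^-1 * (d \* S) x) \+ (fun x => - 8^-1 * (d \* X) x))); last first.
  by move=> s _; rewrite /G_ /d /S /X /=; ring.
rewrite int01D; [|exact: L1Z|exact: L1Z].
by rewrite (int01Z _ dS) (int01Z _ dX); ring.
Qed.

End AtTime.

(** The square of [f] differs from its values elsewhere by at most 4 |f| |f'| in L^2 norms;
    averaging over these values gives the claim. *)
Lemma AC_interp f g (s : R) : L2 f -> L2 g -> AC f g -> f s ^+ 2 <= L2norm f ^+ 2 + 4 * (L2norm f * L2norm g).
Proof.
move=> Lf Lg H; have A2 := ACM Lg Lg H H.
have pb r : `|prim ((g \* f) \+ (f \* g)) r| <= 2 * (L2norm f * L2norm g).
  rewrite prim_def (eq_int01 (g := fun x => 2 * ((f \* ind r) \* g) x)); last by move=> x _ /=; ring.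
  have b1 x : I01 x -> `|ind r x| <= 1 by move=> _; exact: ind_le1.
  have Li := L2M_bounded Lf (meas_ind r) b1.
  rewrite int01Z; last exact: L1M.
  rewrite normrM ger0_norm// ler_pM2l//; apply: (le_trans (int01_CS Li Lg)).
  rewrite ler_wpM2r ?L2norm_ge0//; have := L2normM_bounded Lf (meas_ind r) b1; by rewrite mul1r.
have Lff : L1 (f \* f) by exact: L1M.
have h r : f s ^+ 2 - 4 * (L2norm f * L2norm g) <= (f \* f) r.
  have e1 := A2 s; have e2 := A2 r; rewrite /= -!expr2 in e1 e2 *.
  have := pb s; have := pb r; rewrite !ler_norml => /andP[p1 p2] /andP[p3 p4].
  rewrite e1 e2; move: (prim _ _) (prim _ _) (_ * L2norm g) p1 p2 p3 p4 => x y z; lra.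
have := le_int01 (L1_cst _) Lff; move=> /(_ (f s ^+ 2 - 4 * (L2norm f * L2norm g)) (fun r _ => h r)).
by rewrite int01_cst -L2norm_sqr// lerBlDr.
Qed.

Definition H1b (mu E : R) : R :=
  Num.sqrt mu + (2 * `|E| + mu ^+ 2 / 4 + 2 * (mu * Num.sqrt mu) + 1).

(** With z the L^2 norm of q_s, [AC_interp] bounds the integral of |q|^4 by mu^2 + 8 mu^(3/2) z.
    This is linear in z while the energy contains z^2 / 2, so z is bounded by mass and energy. *)
Lemma H1_bound m Q t j : (1 <= m)%N -> (forall j, evenjet m (Q t j)) ->
  HN 1 (Q t j) <= H1b (mass Q t) (energy Q t).
Proof.
move=> m1 eQ.
have m20 : (0 < 2 * m)%N by lia. have m21 : (1 <= 2 * m)%N by lia.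
have L0 i : L2 (Q t i 0%N) by case: (eQ i) => jq _; exact: jet_L2 jq _.
have L1' i : L2 (Q t i 1%N) by case: (eQ i) => jq _; exact: jet_L2 jq _.
have A0 i : AC (Q t i 0%N) (Q t i 1%N) by case: (eQ i) => jq _; exact: jet_AC jq _.
set mu := mass Q t; pose y := \sum_(j : bool) int01 (Q t j 1%N \* Q t j 1%N).
have muE : mu = L2norm (Q t false 0%N) ^+ 2 + L2norm (Q t true 0%N) ^+ 2.
  by rewrite /mu /mass big_bool !L2norm_sqr// addrC.
have yE : y = L2norm (Q t false 1%N) ^+ 2 + L2norm (Q t true 1%N) ^+ 2.
  by rewrite /y big_bool !L2norm_sqr// addrC.
have mu0 : 0 <= mu by rewrite muE addr_ge0 ?sqr_ge0.
have y0 : 0 <= y by rewrite yE addr_ge0 ?sqr_ge0.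
pose a := Num.sqrt mu; pose z := Num.sqrt y.
have a0 : 0 <= a := sqrtr_ge0 _. have z0 : 0 <= z := sqrtr_ge0 _.
have aa : a ^+ 2 = mu by rewrite sqr_sqrtr. have zz : z ^+ 2 = y by rewrite sqr_sqrtr.
have n0 i : L2norm (Q t i 0%N) <= a.
  by apply: le_sqr_ge0 => //; rewrite aa muE; case: i; rewrite ?lerDl ?lerDr sqr_ge0.
have n1 i : L2norm (Q t i 1%N) <= z.
  by apply: le_sqr_ge0 => //; rewrite zz yE; case: i; rewrite ?lerDl ?lerDr sqr_ge0.
have rb s : 0 <= rho Q t s <= mu + 8 * (a * z).
  rewrite /rho addr_ge0 ?sqr_ge0//=.
  have h1 := AC_interp s (L0 false) (L1' false) (A0 false).
  have h2 := AC_interp s (L0 true) (L1' true) (A0 true).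
  have h3 i : L2norm (Q t i 0%N) * L2norm (Q t i 1%N) <= a * z by apply: ler_pM; rewrite ?L2norm_ge0.
  have h4 := h3 false; have h5 := h3 true.
  rewrite muE; move: (_ * L2norm (Q t false 1%N)) (_ * L2norm (Q t true 1%N)) h1 h2 h4 h5 => p q.
  move: (_ ^+ 2) (_ ^+ 2) (_ ^+ 2) (_ ^+ 2) (a * z) => *; lra.
have cr : continuous (rho Q t).
  move=> s; have cq i : continuous (Q t i 0%N) by exact: AC_continuous (L1' i) (A0 i).
  by apply: cvgD; (under eq_fun do rewrite expr2; apply: cvgM; exact: cq).
have Lr := cont_L2 cr.
have mur : int01 (rho Q t) = mu.
  rewrite /mu /mass big_bool /= -int01D; [|by apply: L1M..].
  by apply: eq_int01 => s _; rewrite /rho /= addrC !expr2.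
have q4 : int01 (rho Q t \* rho Q t) <= (mu + 8 * (a * z)) * mu.
  rewrite -{2}mur -int01Z; last exact: L2_L1.
  apply: le_int01; [exact: L1M|exact/L1Z/L2_L1|].
  move=> s _ /=; have /andP[h1 h2] := rb s; exact: ler_wpM2r.
have en : energy Q t = 2^-1 * z ^+ 2 - 8^-1 * int01 (rho Q t \* rho Q t) by rewrite zz.
have zb : z ^+ 2 <= (2 * `|energy Q t| + mu ^+ 2 / 4) + (2 * (mu * a)) * z.
  have := ler_norm (energy Q t); move: q4 en; move: (energy Q t) `|_| (int01 _) => e e' i q4 -> h.
  have q4' : i <= mu ^+ 2 + 8 * (mu * a * z) by apply: (le_trans q4); rewrite le_eqVlt; apply/orP; left; apply/eqP; ring.
  move: h q4'; rewrite -(mulrA 2); move: (mu * a * z) (mu ^+ 2) (z ^+ 2) => p q r; lra.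
have zf : z <= 2 * `|energy Q t| + mu ^+ 2 / 4 + 2 * (mu * a) + 1.
  have c1 : 0 <= 2 * `|energy Q t| + mu ^+ 2 / 4 by rewrite addr_ge0 ?mulr_ge0 ?divr_ge0 ?sqr_ge0.
  have c2 : 0 <= 2 * (mu * a) by rewrite !mulr_ge0.
  move: zb c1 c2; move: (_ + mu ^+ 2 / 4) (2 * (mu * a)) => p q zb p0 q0.
  rewrite leNgt; apply/negP => h; move: zb; apply/negP; rewrite -ltNge.
  have z1 : 1 <= z by apply: ltW; apply: le_lt_trans h; rewrite lerDr addr_ge0.
  have : (p + q + 1) * z < z * z by rewrite ltr_pM2r// (lt_le_trans ltr01).
  rewrite -expr2; apply: le_lt_trans.
  have : p <= p * z by rewrite ler_peMr.
  rewrite !mulrDl mul1r; lra.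
rewrite /HN big_ord_recr big_ord1 /= /H1b -/a; apply: lerD; first exact: n0.
exact: le_trans (n1 j) zf.
Qed.

End Conservation.

(** * Global solutions of the cubic Schroedinger equation *)

Section GlobalNLS.
Context {R : realType}.
Local Notation sq := (nat -> bool -> R).
Variable m : nat.
Hypothesis m1 : (1 <= m)%N.
Implicit Types (a : sq) (u : R -> sq).

Lemma lev_Rt i t a : lev m i (Rt t a) = Rt t (lev m i a).
Proof. by apply/funext => k; apply/funext => -[]; rewrite /lev /Rt; ring. Qed.

Lemma lev_le2 i a B : (i <= m)%N -> le2 a B -> le2 (lev m i a) (2 * B).
Proof.
move=> im [B0 h]; split=> [|K]; first exact: mulr_ge0.
rewrite exprMn; apply: (@le_trans _ _ (2 ^+ 2 * psum K a)); last by rewrite ler_wpM2l// exprn_ge0.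
rewrite /psum mulr_sumr; apply: ler_sum => -[k j] _; rewrite /lev /= exprMn ler_wpM2r ?sqr_ge0//.
have W0 := Wt_gt0 (R := R) m k; have W1 := @Wt_ge1 R m k.
rewrite ler_sqr ?nnegrE// ?divr_ge0// ?(ltW (Wt_gt0 _ _))//.
rewrite ler_pdivrMr// {1}/Wt; have := @Wt_ge R m (2 * i) k ltac:(lia); lra.
Qed.

Lemma sub2_lev i a b : sub2 (lev m i a) (lev m i b) = lev m i (sub2 a b).
Proof. by apply/funext => k; apply/funext => j; rewrite /sub2 /lev mulrBr. Qed.

Lemma ccont_Rt u : ccont u -> (forall t, 0 <= t -> ell2 (u t)) -> ccont (fun r => Rt r (u r)).
Proof.
move=> cu eu t t0 e e0; have e2 : 0 < e / 2 by rewrite divr_gt0.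
have [d1 d10 H1] := cu t t0 _ e2; have [d2 d20 H2] := Rt_strong t (eu t t0) e2.
exists (Num.min d1 d2) => [|r r0]; first by rewrite lt_min d10.
rewrite lt_min => /andP[r1 r2]; rewrite [e]splitr.
apply: (@le2_trans _ _ _ (Rt r (u t))); last exact: H2.
by rewrite RtB; apply: Rt_le2; exact: H1.
Qed.

Lemma ccont_lev i u : (i <= m)%N -> ccont u -> ccont (fun r => lev m i (u r)).
Proof.
move=> im cu t t0 e e0; have e2 : 0 < e / 2 by rewrite divr_gt0.
have [d d0 H] := cu t t0 _ e2; exists d => // r r0 rt.
rewrite sub2_lev (_ : e = 2 * (e / 2)); last by field.
exact: lev_le2 (H r r0 rt).
Qed.

Lemma ccont_Nn u : ccont u -> (forall t, 0 <= t -> ell2 (u t)) -> ccont (fun t => Nn m (u t)).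
Proof.
move=> cu eu t t0 e e0; set M := nrm (u t) + 1.
have M1 : 1 <= M by rewrite lerDr nrm_ge0.
have C0 : 0 <= Cl m :> R by rewrite /Cl !mulr_ge0 ?sqr_ge0// exprn_ge0.
pose K : R := Cl m * M ^+ 2 + 1; have K0 : 0 < K by rewrite ltr_wpDl// mulr_ge0// sqr_ge0.
have e2 : 0 < Num.min 1 (e / K) by rewrite lt_min ltr01 divr_gt0.
have [d d0 H] := cu t t0 _ e2; exists d => // r r0 rt.
have h := H r r0 rt.
have h1 : le2 (sub2 (u r) (u t)) 1 by apply: le2_mono h; rewrite ge_min lexx.
have h2 : le2 (sub2 (u r) (u t)) (e / K) by apply: le2_mono h; rewrite ge_min lexx orbT.
have ht := ell2_nrm (eu t t0).
have hr : le2 (u r) M by rewrite /M addrC; exact: le2_add h1 ht.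
have ht' : le2 (u t) M by apply: le2_mono ht; rewrite lerDl.
apply: le2_mono (Nn_lip m1 (eu r r0) (eu t t0) hr ht' h2).
rewrite mulrA ler_pdivrMr// mulrC ler_wpM2l ?(ltW e0)// /K lerDl//.
Qed.

Lemma ccont_Pr (M : R) u : 0 < M -> ccont u -> (forall t, 0 <= t -> ell2 (u t)) -> ccont (fun t => Pr M (u t)).
Proof.
move=> M0 cu eu t t0 e e0; have e2 : 0 < e / 2 by rewrite divr_gt0.
have [d d0 H] := cu t t0 _ e2; exists d => // r r0 rt.
rewrite (_ : e = 2 * (e / 2)); last by field.
exact: Pr_lip M0 (eu r r0) (eu t t0) (H r r0 rt).
Qed.

Lemma Pf_NP u p t j s : p t = u t -> Pf m u p t j s = NP (fun t j => qj m (u t) j) t j s.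
Proof.
move=> pu; rewrite /Pf /NP pu /al /rho; case: j; rewrite /nlj /jZ /jD !jT0; ring.
Qed.

Lemma H1b_ge0 (mu E : R) : 0 <= mu -> 0 <= H1b mu E.
Proof.
move=> mu0; have s0 := sqrtr_ge0 mu; rewrite /H1b; apply: addr_ge0 => //; apply: addr_ge0 => //.
apply: addr_ge0; last by apply: mulr_ge0 => //; exact: mulr_ge0.
by apply: addr_ge0; [exact: mulr_ge0|rewrite divr_ge0// sqr_ge0].
Qed.

Section Apriori.
Variable u0 : sq.
Hypothesis eu0 : ell2 u0.

Let Q0 (t : R) j := qj m u0 j.
Let B1 : R := H1b (mass Q0 0) (energy Q0 0).

(** Successive Gronwall bounds in H^(2i): level 1 uses the conserved H^1 bound, level i + 1 the
    bound of level i. The truncation radius does not enter. *)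
Fixpoint BB (T : R) (i : nat) : R :=
  match i with
  | 0 => 0
  | i'.+1 => nrm (lev m i u0) * expR (Ct i * (if i' == 0%N then B1 else (2 * i').+1%:R * BB T i') ^+ 2 * T)
  end.

Lemma Ct_ge0 i : 0 <= Ct i :> R.
Proof. by rewrite /Ct !mulr_ge0// sqr_ge0. Qed.

(** While the norm stays below [M] the truncation is inactive, so mass and energy are conserved and
    the levels can be climbed one by one. *)
Lemma apriori M T u (t : R) : 0 < M -> u 0 = u0 -> ccont u -> (forall t, 0 <= t -> ell2 (u t)) ->
  (forall (t : R) k j, -1 < t ->
     is_derive t 1 (fun r => Rt r (u r) k j) (Rt (pos t) (Nn m (Pr M (u (pos t)))) k j)) ->
  0 <= t <= T -> (forall r, 0 <= r <= t -> nrm (u r) <= M) ->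
  forall i, (1 <= i <= m)%N -> forall r, 0 <= r <= t -> nrm (lev m i (u r)) <= BB T i.
Proof.
move=> M0 ui cu eu du /andP[t0 tT] hM.
pose p t := Pr M (u t).
have ep r : 0 <= r -> ell2 (p r) by move=> r0; exists M; exact: Pr_le2 M0 (eu r r0).
have cn := ccont_Nn (ccont_Pr M0 cu eu) ep.
have pu r : 0 <= r <= t -> p r = u r by move=> rt; apply: Pr_id => //; exact: hM.
have du' (r : R) k j : 0 <= r -> is_derive r 1 (fun x => Rt x (u x) k j) (Rt r (Nn m (p r)) k j).
  move=> r0; have := du r k j; rewrite posE//; apply; apply: lt_le_trans r0; exact: ltrN10.
pose Q t j := qj m (u t) j.
have eQ r j : 0 <= r -> evenjet m (Q r j) by move=> r0; apply: qj_even => //; exact: eu.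
have cQ r j : 0 <= r -> HN (2 * m) (jB (Q x j) (Q r j)) @[x --> N0 r] --> (0 : R).
  by move=> r0; exact: (Q_cont m1 cu eu j r0).
have dQ r j : 0 <= r <= t -> L2norm (fun s => (x - r)^-1 * (Q x j 0%N s - Q r j 0%N s) - NP Q r j s) @[x --> N1 r] --> (0 : R).
  move=> /[dup] rt /andP[r0 _]; have := Q_der m1 cu eu ep cn du' j r0.
  rewrite (_ : (fun x => L2norm _) = (fun x => L2norm (fun s => (x - r)^-1 * (Q x j 0%N s - Q r j 0%N s) - NP Q r j s)))//.
  apply/funext => x; congr (L2norm _); apply/funext => s; rewrite Pf_NP//; exact: pu.
have hmass r : 0 <= r <= t -> mass Q r = mass Q 0.
  apply: const_of_o => x /[dup] xt /andP[x0 _].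
  exact: (mass_der m1 x0 (fun r j => eQ r j) (fun j => cQ x j x0) (fun j => dQ x j xt)).
have hen r : 0 <= r <= t -> energy Q r = energy Q 0.
  apply: const_of_o => x /[dup] xt /andP[x0 _].
  exact: (energy_der m1 x0 (fun r j => eQ r j) (fun j => cQ x j x0) (fun j => dQ x j xt)).
have hB1 r j : 0 <= r <= t -> HN 1 (Q r j) <= B1.
  move=> /[dup] rt /andP[r0 _]; have := H1_bound j m1 (fun j => eQ r j r0).
  rewrite hmass// hen// /B1; congr (_ <= H1b _ _).
    by rewrite /mass /Q ui.
  by rewrite /energy /rho /Q ui.
(* The rotation commutes with [lev] and preserves norms, so only the nonlinearity feeds the Gronwall
   inequality. *)
have grow i (B : R) : (1 <= i <= m)%N -> 0 <= B ->
    (forall r, 0 <= r <= t -> le2 (lev m i (Nn m (u r))) (Ct i * nrm (lev m i (u r)) * B ^+ 2)) ->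
    forall r, 0 <= r <= t -> nrm (lev m i (u r)) <= nrm (lev m i u0) * expR (Ct i * B ^+ 2 * T).
  move=> /andP[i1 im] B0 hN r rt.
  pose b x := lev m i (Rt x (u x)); pose f x := lev m i (Rt x (Nn m (p x))).
  have nb x : nrm (b x) = nrm (lev m i (u x)) by rewrite /b lev_Rt Rt_nrm.
  have CB : 0 <= Ct i * B ^+ 2 by rewrite mulr_ge0 ?Ct_ge0 ?sqr_ge0.
  have cb : ccont b by apply: ccont_lev => //; exact: ccont_Rt.
  have eb x : 0 <= x -> ell2 (b x).
    by move=> x0; have [B' h] := Rt_ell2 x (eu x x0); exists (2 * B'); exact: lev_le2.
  have db k j (x : R) : 0 <= x <= t -> is_derive x 1 (fun r => b r k j) (f x k j).
    by move=> /andP[x0 _]; have := is_deriveZ (Wt i k / Wt m k) (du' x k j x0); exact.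
  have fb x : 0 <= x <= t -> le2 (f x) (Ct i * B ^+ 2 * nrm (b x)).
    move=> xt; rewrite /f lev_Rt; apply: Rt_le2; rewrite pu// nb mulrAC; exact: hN.
  have := gronwall CB cb eb db fb rt; rewrite !nb ui => h.
  apply: (le_trans h); rewrite ler_wpM2l ?nrm_ge0// ler_expR ler_wpM2l//.
  by case/andP: rt => _ /le_trans; apply.
elim=> [//|i IH] im r rt.
have [i0|i0] := eqVneq i 0%N.
  move: im; rewrite i0 /= => im; apply: (grow 1%N) => //.
    apply: H1b_ge0; rewrite /mass sumr_ge0// => j _; rewrite -L2norm_sqr ?sqr_ge0//.
    by have [jq _] := qj_even m1 j eu0; exact: jet_L2 jq _.
  move=> x /[dup] xt /andP[x0 _]; have ex := eu x x0; apply: (Nn_tame m1 (r := 1%N)) => //.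
    apply: ell2_nrm; have [B' h] := ex; exists (2 * B').
    by apply: lev_le2 h; lia.
  by move=> j; exact: hB1.
have iim : (1 <= i <= m)%N by lia.
rewrite /= (negbTE i0); apply: (grow i.+1) => //.
  rewrite mulr_ge0//; apply: le_trans (IH iim 0 _); first exact: nrm_ge0.
  by rewrite lexx t0.
move=> x /[dup] xt /andP[x0 _].
have ex := eu x x0; have [B' hB'] := ex.
apply: (Nn_tame m1 (r := (2 * i)%N)) => //; [lia|lia| |].
  by apply: ell2_nrm; exists (2 * B'); apply: lev_le2 hB'; lia.
move=> j; have := qj_HN m1 j ex (i := i) (A := nrm (lev m i (u x))) ltac:(lia).
move=> H; apply: (le_trans (H _)).
  by apply: ell2_nrm; exists (2 * B'); apply: lev_le2 hB'; lia.
by rewrite ler_wpM2l//; exact: IH.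
Qed.

Definition is_sol (T : R) u := [/\ u 0 = u0, ccont u, (forall t, 0 <= t -> ell2 (u t)),
   (exists M, forall t, 0 <= t <= T -> nrm (u t) <= M) &
   forall (t : R) k j, -1 < t -> t <= T ->
     is_derive t 1 (fun r => Rt r (u r) k j) (Rt (pos t) (Nn m (u (pos t))) k j)].

(** Truncate at one more than the a priori bound; by [bootstrap] the norm never reaches the
    truncation radius on [0, T]. *)
Lemma sol_ex (T : R) : 0 <= T -> exists u, is_sol T u.
Proof.
move=> T0; pose M := BB T m + 1.
have hb : nrm u0 <= BB T m.
  have -> : m = m.-1.+1 by lia.
  rewrite /=; have -> : m.-1.+1 = m by lia.
  rewrite lev_m ler_peMr ?nrm_ge0//.
  by rewrite -[1]expR0 ler_expR mulr_ge0// mulr_ge0 ?Ct_ge0 ?sqr_ge0.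
have M0 : 0 < M by rewrite ltr_wpDl// (le_trans _ hb)// nrm_ge0.
have [u [ui cu eu du]] := truncated_solution m1 M0 eu0.
have yM : forall t, 0 <= t <= T -> nrm (u (pos t)) < M.
  apply: (bootstrap (nrm_continuous cu eu)).
    by rewrite posE// ui /M; apply: (le_lt_trans hb); rewrite ltrDl.
  move=> t /[dup] tT /andP[t0 _] hr; rewrite posE//.
  have hM r : 0 <= r <= t -> nrm (u r) <= M.
    by move=> /[dup] rt /andP[r0 _]; have := hr r rt; rewrite posE.
  have := apriori M0 ui cu eu du tT hM (i := m); rewrite m1 leqnn => /(_ isT t).
  rewrite t0 lexx lev_m => /(_ isT) h; apply: (le_lt_trans h); by rewrite ltrDl.
exists u; split => //.
  by exists M => t /[dup] tT /andP[t0 _]; have := yM t tT; rewrite posE// => /ltW.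
move=> t k j t1 tT; have := du t k j t1; rewrite Pr_id//; apply: ltW.
have := yM (pos t); rewrite (posE (pos_ge0 t)); apply.
by rewrite pos_ge0/= ge_max T0.
Qed.

Lemma sol_uniq T u v : is_sol T u -> is_sol T v -> forall t, 0 <= t <= T -> u t = v t.
Proof.
move=> [ui cu eu [M hM] du] [vi cv ev [M' hM'] dv] t tT.
pose K := Num.max M M'.
pose b x := sub2 (Rt x (u x)) (Rt x (v x)); pose f x := sub2 (Rt x (Nn m (u x))) (Rt x (Nn m (v x))).
have C0 : 0 <= Cl m :> R by rewrite /Cl !mulr_ge0 ?sqr_ge0// exprn_ge0.
have g0 : 0 <= Cl m * K ^+ 2 by rewrite mulr_ge0// sqr_ge0.
have cb : ccont b.
  move=> x x0 e e0; have e2 : 0 < e / 2 by rewrite divr_gt0.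
  have [d1 d10 H1] := ccont_Rt cu eu x0 e2; have [d2 d20 H2] := ccont_Rt cv ev x0 e2.
  exists (Num.min d1 d2) => [|r r0]; first by rewrite lt_min d10.
  rewrite lt_min => /andP[r1 r2]; rewrite [e]splitr.
  apply: eq_le2 (le2_sub (H1 r r0 r1) (H2 r r0 r2)) => k j; rewrite /b /sub2; ring.
have eb x : 0 <= x -> ell2 (b x) by move=> x0; apply: ell2_sub; apply: Rt_ell2; [exact: eu|exact: ev].
have db k j (x : R) : 0 <= x <= T -> is_derive x 1 (fun r => b r k j) (f x k j).
  move=> /andP[x0 xT]; have x1 : -1 < x by apply: lt_le_trans x0; exact: ltrN10.
  by have := is_deriveB (du x k j x1 xT) (dv x k j x1 xT); rewrite posE//; exact.
have fb x : 0 <= x <= T -> le2 (f x) (Cl m * K ^+ 2 * nrm (b x)).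
  move=> /[dup] xT /andP[x0 _]; rewrite /f /b !RtB Rt_nrm; apply: Rt_le2.
  apply: Nn_lip => //; [exact: eu|exact: ev| | |].
  - by apply: le2_mono (ell2_nrm (eu x x0)); rewrite le_max hM.
  - by apply: le2_mono (ell2_nrm (ev x x0)); rewrite le_max hM' ?orbT.
  - by apply: ell2_nrm; apply: ell2_sub; [exact: eu|exact: ev].
have := gronwall g0 cb eb db fb tT.
have b0 : nrm (b 0) = 0.
  apply/eqP; rewrite eq_le nrm_ge0 andbT; apply: le2_nrm.
  by rewrite /b ui vi; exact: le2_refl.
rewrite b0 mul0r => h.
have t0 : 0 <= t by case/andP: tT.
have h2 : le2 (sub2 (u t) (v t)) 0.
  have := le2_mono h (ell2_nrm (eb t t0)); rewrite /b RtB => /(Rt_le2 (- t)); by rewrite RtK.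
apply/funext => k; apply/funext => j; apply/eqP; rewrite -subr_eq0 -normr_le0.
exact: le2_coord h2.
Qed.

Lemma sol_le (T T' : R) u : T' <= T -> is_sol T u -> is_sol T' u.
Proof.
move=> TT [ui cu eu [M hM] du]; split => //.
  by exists M => t /andP[t0 tT]; apply: hM; rewrite t0 (le_trans tT).
by move=> t k j t1 tT; apply: du => //; exact: le_trans TT.
Qed.

(** Solutions on the intervals [0, n] agree by [sol_uniq] and are glued. *)
Theorem global_sol : exists u, [/\ u 0 = u0, ccont u, (forall t, 0 <= t -> ell2 (u t)) &
   forall (t : R) k j, 0 <= t ->
     is_derive t 1 (fun r => Rt r (u r) k j) (Rt t (Nn m (u t)) k j)].
Proof.
have [U HU] := choice (fun n : nat => sol_ex (ler0n R n)).
pose ix (t : R) := (Num.truncn (pos t)).+2.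
have ixP t : pos t <= (ix t)%:R.
  have /andP[_ h] := truncn_itv (pos_ge0 t); apply: (le_trans (ltW h)).
  by rewrite ler_nat /ix.
pose u t := U (ix t) t.
have UU n n' t : 0 <= t -> t <= n%:R -> t <= n'%:R -> U n t = U n' t.
  move=> t0 tn tn'; wlog nn : n n' tn tn' / (n <= n')%N.
    by move=> H; have [/H|/ltnW/H] := leqP n n'; [exact|move=> ->].
  have hle : (n%:R : R) <= n'%:R by rewrite ler_nat.
  by apply: (sol_uniq (HU n) (sol_le hle (HU n'))); rewrite t0.
have loc t : 0 <= t -> exists N, exists2 d, 0 < d & t + d <= N%:R /\
    forall r, -1 < r -> `|r - t| < d -> u r = U N r.
  move=> t0; have [t1|t1] := ltP t 1.
    exists 2%N, (1 - t); first by rewrite subr_gt0.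
    split; first by rewrite addrC subrK ler1n.
    move=> r r1; rewrite ltr_norml => /andP[_ rt].
    have r1' : pos r < 1 by rewrite gt_max ltr01/=; lra.
    rewrite /u /ix; suff -> : Num.truncn (pos r) = 0%N by [].
    have /andP[h _] := truncn_itv (pos_ge0 r); have : (Num.truncn (pos r) < 1)%N by rewrite -(ltr_nat R); exact: le_lt_trans h r1'.
    by rewrite ltnS leqn0 => /eqP.
  exists (ix t).+1, 2^-1 => //; split.
    have := ixP t; rewrite posE// => h; rewrite -(natr1 (ix t)); move: ((ix t)%:R) h => z h; lra.
  move=> r r1; rewrite ltr_norml => /andP[h1 h2].
  have r0 : 0 <= r by lra.
  apply: UU => //; first by have := ixP r; rewrite posE.
  have := ixP t; rewrite posE// => h; rewrite -(natr1 (ix t)); move: ((ix t)%:R) h => z h; lra.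
have u0E t : 0 <= t -> exists N, t <= N%:R /\ u t = U N t.
  move=> t0; exists (ix t); split => //; by have := ixP t; rewrite posE.
exists u; split.
- by rewrite /u; have [] := HU (ix 0).
- move=> t t0 e e0; have [N [d d0 [tN H]]] := loc t t0.
  have [_ cU _ _ _] := HU N; have [d' d'0 H'] := cU t t0 e e0.
  exists (Num.min d d') => [|r r0]; first by rewrite lt_min d0.
  have gtN (x : R) : 0 <= x -> -1 < x by apply: lt_le_trans; exact: ltrN10.
  rewrite lt_min => /andP[rd rd']; rewrite (H r (gtN _ r0) rd) (H t (gtN _ t0)) ?subrr ?normr0//.
  exact: H'.
- by move=> t t0; rewrite /u; have [_ _ eU _ _] := HU (ix t); exact: eU.
- move=> t k j t0; have [N [d d0 [tN H]]] := loc t t0.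
  have [_ _ _ _ dU] := HU N.
  have t1 : -1 < t by apply: lt_le_trans t0; exact: ltrN10.
  have tN' : t <= N%:R by apply: le_trans tN; rewrite lerDl ltW.
  have := dU t k j t1 tN'; rewrite posE// (H t t1) ?subrr ?normr0//.
  apply: near_eq_is_derive.
  apply/nbhs_ballP; exists (Num.min d 1); first by rewrite /= lt_min d0 ltr01.
  move=> r; rewrite /ball/= lt_min => /andP[rd r1].
  rewrite (H r) ?(distrC r)//; move: r1; rewrite ltr_norml => /andP[_]; lra.
Qed.

End Apriori.

Theorem NLS_global (F : bool -> nat -> R -> R) : (forall j, evenjet m (F j)) ->
  exists Q : R -> bool -> nat -> R -> R,
  [/\ forall r j, 0 <= r -> evenjet m (Q r j),
      forall j s, Q 0 j 0%N s = F j 0%N s,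
      forall t j, 0 <= t -> HN (2 * m) (jB (Q r j) (Q t j)) @[r --> N0 t] --> (0 : R) &
      forall t j, 0 <= t ->
        L2norm (fun s => (r - t)^-1 * (Q r j 0%N s - Q t j 0%N s) - NP Q t j s) @[r --> N1 t] --> (0 : R)].
Proof.
move=> eF; pose u0 : sq := fun k j => Wt m k * coef (F j 0%N) k.
have e0 : ell2 u0.
  pose B := \sum_(j : bool) (L2norm (F j 0%N) + L2norm (F j (2 * m)%N)).
  exists (2 * B); apply: (@Xm_le2 R m (fun j => coef (F j 0%N))) => j.
  apply: Xm_mono (ana m1 (eF j)); rewrite /B big_bool /=.
  by case: j; rewrite ?lerDl ?lerDr addr_ge0 ?L2norm_ge0.
have [u [ui cu eu du]] := global_sol e0.
exists (fun t j => qj m (u t) j); split.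
- by move=> r j r0; apply: qj_even => //; exact: eu.
- move=> j s; rewrite ui /qj (_ : cf m u0 j = coef (F j 0%N)); first exact: syn_unique.
  apply/funext => k; rewrite /cf /u0 mulrAC divff ?mul1r// gt_eqF//; exact: Wt_gt0.
- by move=> t j t0; exact: (Q_cont m1 cu eu j t0).
- move=> t j t0; have := Q_der m1 cu eu eu (ccont_Nn cu eu) du j t0.
  rewrite (_ : (fun x => L2norm _) = (fun x => L2norm (fun s => (x - t)^-1 * (qj m (u x) j 0%N s - qj m (u t) j 0%N s) - NP (fun t j => qj m (u t) j) t j s)))//.
  by apply/funext => x; congr (L2norm _); apply/funext => s; rewrite Pf_NP.
Qed.

End GlobalNLS.

(** * Linear systems on [0, 1] *)

Section LinearODE.
Context {R : realType} {J : finType}.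

Lemma clip_continuous : continuous (fun s : R => clip s).
Proof.
have H := @FTC01 R id (cst 1) (fun x => is_derive_id _ _) (@cst_continuous _ _ _).
exact: (AC_continuous (L2_cst 1) (AC_of_01 H)).
Qed.

(** [Cauchy_Lipschitz] for sequences supported at index 0, with the coefficients frozen outside
    [0, 1]. *)
Theorem lin_ode (A : J -> J -> R -> R) (x0 : J -> R) : (forall j k, continuous (A j k)) ->
  exists x : J -> R -> R, [/\ forall j, x j 0 = x0 j, forall j, continuous (x j) &
    forall j, AC (x j) (fun s => \sum_k A j k s * x k s)].
Proof.
move=> cA.
have [Mf HM] : exists M : J -> J -> R, forall j k (s : R), 0 <= s <= 1 -> `|A j k s| <= M j k.
  have h j : exists M : J -> R, forall k (s : R), 0 <= s <= 1 -> `|A j k s| <= M k.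
    by have [M HM] := choice (fun k => cont_bounded01 (cA j k)); exists M.
  by have [M HM] := choice h; exists M.
pose M := \sum_j \sum_k `|Mf j k|.
have M0 : 0 <= M by apply: sumr_ge0 => j _; apply: sumr_ge0 => k _.
have AM j k t : `|A j k (clip t)| <= M.
  apply: (le_trans (HM j k _ (clip01 t))); apply: (le_trans (ler_norm _)).
  rewrite /M (bigD1 j)//= (bigD1 k)//= -addrA lerDl; apply: addr_ge0; apply: sumr_ge0 => // i _.
  by apply: sumr_ge0.
pose F (t : R) (b : nat -> J -> R) (n : nat) (j : J) : R :=
  if n == 0%N then \sum_k A j k (clip t) * b 0%N k else 0.
pose b0 : nat -> J -> R := fun n j => if n == 0%N then x0 j else 0.
have psum0 (b : nat -> J -> R) K : (forall n j, (0 < n)%N -> b n j = 0) -> psum K b <= \sum_j b 0%N j ^+ 2.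
  move=> hb; rewrite /psum -(pair_bigA _ (fun (k : 'I_K) j => b k j ^+ 2))/=.
  case: K => [|K]; first by rewrite big_ord0; apply: sumr_ge0 => j _; exact: sqr_ge0.
  rewrite big_ord_recl /= [X in _ + X]big1 ?addr0// => i _; apply: big1 => j _.
  by rewrite hb ?expr0n//= /bump.
have le20 (b : nat -> J -> R) B : 0 <= B -> (forall n j, (0 < n)%N -> b n j = 0) ->
    (forall j, `|b 0%N j| <= B) -> le2 b (#|J|%:R * B).
  move=> B0 hb hB; split=> [|K]; first by rewrite mulr_ge0.
  apply: (le_trans (psum0 b K hb)); apply: (@le_trans _ _ (\sum_(j : J) B ^+ 2)).
    apply: ler_sum => j _; rewrite -[leLHS]real_normK ?num_real// ler_sqr ?nnegrE//.
  rewrite sumr_const exprMn -[leLHS]mulr_natl ler_wpM2r ?sqr_ge0// -natrX ler_nat.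
  by case: #|J| => // n; rewrite expnS leq_pmulr// expn_gt0.
have eb0 : ell2 b0.
  exists (#|J|%:R * \sum_j `|x0 j|); apply: le20.
  - by apply: sumr_ge0.
  - by move=> [].
  - by move=> j; rewrite /b0 /= (bigD1 j)//= lerDl sumr_ge0.
pose L : R := 1 + #|J|%:R * (#|J|%:R * M).
have sumle (b : nat -> J -> R) D j t : le2 b D -> `|\sum_k A j k (clip t) * b 0%N k| <= #|J|%:R * M * D.
  move=> hb; apply: (le_trans (ler_norm_sum _ _ _)).
  rewrite -mulrA mulr_natl -sumr_const; apply: ler_sum => k _.
  rewrite normrM; apply: ler_pM => //; exact: le2_coord hb.
have L1' : 1 <= L by rewrite lerDl !mulr_ge0.
have [|||b [bi cb eb db]] := @Cauchy_Lipschitz R J F L (#|J|%:R * (#|J|%:R * M * nrm b0)) b0 L1' eb0.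
- move=> t a b D t0 ea eb h; have D0 : 0 <= D by case: h.
  apply: (@le2_mono _ _ _ (#|J|%:R * (#|J|%:R * M * D))).
    by rewrite /L mulrDl mul1r !mulrA lerDr.
  apply: le20; first by rewrite !mulr_ge0.
    by move=> [//|n] j _; rewrite /sub2 /F /= subrr.
  move=> j; rewrite /sub2 /F /= -sumrB; under eq_bigr do rewrite -mulrBr.
  exact: (sumle (sub2 a b)).
- move=> t t0; apply: le20; first by rewrite !mulr_ge0 ?nrm_ge0.
    by move=> [].
  by move=> j; rewrite /F /=; apply: sumle; exact: ell2_nrm.
- move=> a n j ea; rewrite /F; case: eqP => _; last exact: cst_continuous.
  move=> t; apply: cvg_big; first by apply: add_continuous.
  move=> k _; apply: cvgM; last exact: cvg_cst.
  apply: (@continuous_comp _ _ _ (fun t : R => clip (pos t)) (A j k)); last exact: cA.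
  apply: (@continuous_comp _ _ _ (fun t : R => pos t) (fun t => clip t)); first exact: pos_continuous.
  exact: clip_continuous.
pose g j (s : R) := \sum_k A j k (clip s) * b (clip s) 0%N k.
have cbk k : continuous (fun s : R => b (clip s) 0%N k).
  move=> s; apply: (@continuous_comp _ _ _ (fun s : R => clip s) (fun s => b s 0%N k)); first exact: clip_continuous.
  have c1 : -1 < clip s by apply: lt_le_trans (ltrN10 _) _; case/andP: (clip01 s).
  exact: continuous_derive (db (clip s) 0%N k c1).
have FE (t : R) j : 0 <= t <= 1 -> F (pos t) (b (pos t)) 0%N j = g j t.
  by move=> t01; rewrite /F /g /= posE ?clipE//; case/andP: t01.
exists (fun j s => b (clip s) 0%N j); split.
  by move=> j; rewrite clipE ?lexx ?ler01// bi.
  by move=> j; exact: cbk.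
move=> j; rewrite (_ : (fun s => _) = (fun s => b s 0%N j) \o clip)//.
have h : forall s, 0 <= s <= 1 -> b s 0%N j = b 0 0%N j + prim (fun s => F (pos s) (b (pos s)) 0%N j) s.
  apply: (@FTC01_gt R _ _ (fun x x1 => db x 0%N j x1)).
  move=> s; rewrite /F /=; apply: cvg_big; first by apply: add_continuous.
  move=> k _; apply: cvgM.
    apply: (@continuous_comp _ _ _ (fun t : R => clip (pos t)) (A j k)); last exact: cA.
    apply: (@continuous_comp _ _ _ (fun t : R => pos t) (fun t => clip t)); first exact: pos_continuous.
    exact: clip_continuous.
  apply: (@continuous_comp _ _ _ (fun s : R => pos s) (fun s => b s 0%N k)); first exact: pos_continuous.
  by apply: continuous_derive (db (pos s) 0%N k _); apply: lt_le_trans (ltrN10 _) (pos_ge0 s).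
have h' := AC_of_01 h; move=> s; rewrite h'; congr (_ + _); apply: eq_prim => x /I01_01 x01.
by rewrite FE// /g clipE.
Qed.

End LinearODE.

Definition o0 : 'I_3 := @Ordinal 3 0 isT.
Definition o1 : 'I_3 := @Ordinal 3 1 isT.
Definition o2 : 'I_3 := @Ordinal 3 2 isT.

Lemma sum3 (V : nmodType) (F : 'I_3 -> V) : \sum_i F i = F o0 + F o1 + F o2.
Proof. by rewrite !big_ord_recr big_ord0 /= add0r; congr (F _ + F _ + F _); apply/val_inj. Qed.

(** * The frame equations in s *)

Section KSystem.
Context {R : realType}.

(* rows of the frame: [x' = q1 y + q2 z, y' = - q1 x, z' = - q2 x] *)
Definition Ksys q1 q2 (rx ry rz : R -> R) x y z :=
  [/\ AC x (fun s => q1 s * y s + q2 s * z s + rx s), AC y (fun s => - (q1 s * x s) + ry s) &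
      AC z (fun s => - (q2 s * x s) + rz s)].

Local Notation zf := (fun _ : R => 0 : R).

Lemma Ksys_ex q1 q2 (a b c : R) : continuous q1 -> continuous q2 ->
  exists x y z, [/\ Ksys q1 q2 zf zf zf x y z, [/\ continuous x, continuous y & continuous z] & [/\ x 0 = a, y 0 = b & z 0 = c]].
Proof.
move=> c1 c2.
pose A (j k : 'I_3) : R -> R := match (j : nat), (k : nat) with
  | 0, 1 => q1 | 0, 2 => q2 | 1, 0 => (fun s => - q1 s) | 2, 0 => (fun s => - q2 s) | _, _ => cst 0 end.
pose x0 (j : 'I_3) : R := match (j : nat) with 0 => a | 1 => b | _ => c end.
have [j k|X [Xi cX AX]] := @lin_ode R 'I_3 A x0.
  have n1 : continuous (fun s => - q1 s) by move=> s; apply: cvgN; exact: c1.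
  have n2 : continuous (fun s => - q2 s) by move=> s; apply: cvgN; exact: c2.
  have n0 := @cst_continuous R R 0.
  by rewrite /A; case: (nat_of_ord j) => [|[|[|n]]]; case: (nat_of_ord k) => [|[|[|n']]].
exists (X o0), (X o1), (X o2); split; [|by split; exact: cX|by rewrite !Xi].
by split=> s; rewrite AX; congr (_ + _); apply: eq_prim => r _; rewrite sum3 /A /=; ring.
Qed.

Lemma AC_eq (f g g' : R -> R) : (forall s, g s = g' s) -> AC f g -> AC f g'.
Proof. by move=> e H s; rewrite H; congr (_ + _); apply: eq_prim. Qed.

Section Props.
Variables (q1 q2 : R -> R).
Hypotheses (c1 : continuous q1) (c2 : continuous q2).

Lemma Ksys_L2 (rx ry rz x y z : R -> R) : L2 rx -> L2 ry -> L2 rz -> 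
  continuous x -> continuous y -> continuous z ->
  [/\ L2 (fun s => q1 s * y s + q2 s * z s + rx s), L2 (fun s => - (q1 s * x s) + ry s) &
      L2 (fun s => - (q2 s * x s) + rz s)].
Proof.
move=> Lx Ly Lz cx cy cz; split; apply: L2D => //.
- by apply: L2D; apply: cont_L2; exact: contM.
- by apply: L2N; apply: cont_L2; exact: contM.
- by apply: L2N; apply: cont_L2; exact: contM.
Qed.

(* the flow is by rotations *)
Lemma Ksys_inner (rx ry rz x y z x' y' z' : R -> R) : L2 rx -> L2 ry -> L2 rz -> 
  continuous x -> continuous y -> continuous z ->
  continuous x' -> continuous y' -> continuous z' ->
  Ksys q1 q2 rx ry rz x y z -> Ksys q1 q2 rx ry rz x' y' z' ->
  forall s, x s * x' s + y s * y' s + z s * z' s = x 0 * x' 0 + y 0 * y' 0 + z 0 * z' 0 +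
    prim (fun s => rx s * (x s + x' s) + ry s * (y s + y' s) + rz s * (z s + z' s)) s.
Proof.
move=> Lx Ly Lz cx cy cz cx' cy' cz' [ax ay az] [ax' ay' az'].
have [l1 l2 l3] := Ksys_L2 Lx Ly Lz cx cy cz; have [l1' l2' l3'] := Ksys_L2 Lx Ly Lz cx' cy' cz'.
have Lxx := ACM_L2 l1 l1' ax ax'; have Lyy := ACM_L2 l2 l2' ay ay'; have Lzz := ACM_L2 l3 l3' az az'.
have H := ACD (L2D Lxx Lyy) Lzz (ACD Lxx Lyy (ACM l1 l1' ax ax') (ACM l2 l2' ay ay')) (ACM l3 l3' az az').
move=> s; have := H s; rewrite /= => ->; congr (_ + _).
by apply: eq_prim => r _ /=; ring.
Qed.

(* Gronwall-free sup bound: the homogeneous part does not change the norm *)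
Lemma Ksys_sup (rx ry rz x y z : R -> R) : L2 rx -> L2 ry -> L2 rz -> 
  continuous x -> continuous y -> continuous z ->
  Ksys q1 q2 rx ry rz x y z -> x 0 = 0 -> y 0 = 0 -> z 0 = 0 ->
  forall s, [/\ `|x s| <= 2 * (L2norm rx + L2norm ry + L2norm rz),
     `|y s| <= 2 * (L2norm rx + L2norm ry + L2norm rz) &
     `|z s| <= 2 * (L2norm rx + L2norm ry + L2norm rz)].
Proof.
move=> Lx Ly Lz cx cy cz K x0 y0 z0.
set S := L2norm rx + _ + _; have S0 : 0 <= S by rewrite !addr_ge0 ?L2norm_ge0.
pose N s := x s * x s + y s * y s + z s * z s.
have NE s : N s = prim (fun s => rx s * (x s + x s) + ry s * (y s + y s) + rz s * (z s + z s)) s.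
  by rewrite /N (Ksys_inner Lx Ly Lz cx cy cz cx cy cz K K) x0 y0 z0 !mulr0 !addr0 add0r.
have cN : continuous N.
  move=> s; rewrite /N; apply: cvgD; first apply: cvgD; apply: cvgM; try exact: cx; try exact: cy; exact: cz.
have [s1 s101 HN] : exists2 s1, 0 <= s1 <= 1 & forall s, 0 <= s <= 1 -> N s <= N s1.
  have [s1 + h] := @EVT_max R N 0 1 ler01 (continuous_subspaceT cN).
  by rewrite in_itv/= => ?; exists s1 => // s s01; apply: h; rewrite in_itv.
have N0 s : 0 <= N s by rewrite /N -!expr2 !addr_ge0 ?sqr_ge0.
pose B := Num.sqrt (N s1); have B0 : 0 <= B := sqrtr_ge0 _.
have BB : B ^+ 2 = N s1 by rewrite sqr_sqrtr.
have bnd s : 0 <= s <= 1 -> [/\ `|x s| <= B, `|y s| <= B & `|z s| <= B].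
  move=> s01; have h := HN s s01; rewrite -BB /N -!expr2 in h.
  have := sqr_ge0 (x s); have := sqr_ge0 (y s); have := sqr_ge0 (z s) => hz hy hx.
  by split; apply: le_sqr_ge0 => //; rewrite real_normK ?num_real//; move: (_ ^+ 2) (_ ^+ 2) (_ ^+ 2) (_ ^+ 2) h hz hy hx => *; lra.
have BS : B <= 2 * S.
  have h : B ^+ 2 <= 2 * B * S.
    rewrite BB NE (eq_prim (g := ((fun s => 2 * (rx \* x) s) \+ (fun s => 2 * (ry \* y) s)) \+ (fun s => 2 * (rz \* z) s))); last first.
      by move=> r _ /=; ring.
    have Lm (r w : R -> R) : L2 r -> continuous w -> L2 (r \* w).
      move=> Lr cw; have [M HM] := cont_bounded01 cw.
      by apply: (L2M_bounded Lr (cont_meas cw)) => v /I01_01; exact: HM.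
    have mm (r w : R -> R) : L2 r -> continuous w -> (forall s, 0 <= s <= 1 -> `|w s| <= B) ->
        L2 (fun s => 2 * (r \* w) s) /\ L2norm (fun s => 2 * (r \* w) s) <= 2 * (B * L2norm r).
      move=> Lr cw hw; split; first exact/L2Z/Lm.
      rewrite L2normZ; last exact: Lm.
      rewrite ger0_norm// ler_pM2l//; apply: (L2normM_bounded Lr (cont_meas cw)) => v /I01_01; exact: hw.
    have [m1 n1] := mm rx x Lx cx (fun s s01 => let: And3 h _ _ := bnd s s01 in h).
    have [m2 n2] := mm ry y Ly cy (fun s s01 => let: And3 _ h _ := bnd s s01 in h).
    have [m3 n3] := mm rz z Lz cz (fun s s01 => let: And3 _ _ h := bnd s s01 in h).
    apply: (le_trans (ler_norm _)); apply: (le_trans (prim_bound s1 (L2D (L2D m1 m2) m3))).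
    apply: (le_trans (L2norm_triangle (L2D m1 m2) m3)).
    apply: (@le_trans _ _ (2 * (B * L2norm rx) + 2 * (B * L2norm ry) + 2 * (B * L2norm rz))); last first.
      by rewrite le_eqVlt; apply/orP; left; apply/eqP; rewrite /S; ring.
    by apply: lerD => //; apply: (le_trans (L2norm_triangle m1 m2)); exact: lerD.
  have [->|Bn] := eqVneq B 0; first exact: mulr_ge0.
  have Bp : 0 < B by rewrite lt_def Bn.
  by rewrite -(ler_pM2l Bp) -expr2 mulrA (mulrC B 2).
have [ax ay az] := K.
have [l1 l2 l3] := Ksys_L2 Lx Ly Lz cx cy cz.
have cl (f g : R -> R) s : AC f g -> f s = f (clip s).
  move=> h; have [s0|s0] := leP s 0; first by rewrite (AC_clip_le0 h s0) /clip min_l ?(le_trans s0 ler01)// max_l.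
  have [s1'|s1'] := leP 1 s; first by rewrite (AC_clip_ge1 h s1') /clip min_r// max_r.
  by rewrite clipE// !ltW.
move=> s; rewrite (cl x _ s ax) (cl y _ s ay) (cl z _ s az).
by have [h1 h2 h3] := bnd _ (clip01 s); split; exact: le_trans BS.
Qed.

End Props.
End KSystem.

(** * Continuous curves with values in H^k *)

Section JetCurves.
Context {R : realType}.
Implicit Types (F G : R -> nat -> R -> R) (K H : nat -> R -> R).

Definition CJ k F := forall t, 0 <= t -> jet k (F t) /\
  HN k (jB (F r) (F t)) @[r --> N0 t] --> (0 : R).

Lemma PJ_B1 K K' H k p q s : PJ (jB K K') H k p q s = PJ K H k p q s - PJ K' H k p q s.
Proof.
elim: k p q => [|k IH] p q /=; first by rewrite jBE mulrBl.
by rewrite !IH; ring.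
Qed.

Lemma PJ_B2 K H H' k p q s : PJ K (jB H H') k p q s = PJ K H k p q s - PJ K H' k p q s.
Proof.
elim: k p q => [|k IH] p q /=; first by rewrite jBE mulrBr.
by rewrite !IH; ring.
Qed.

Lemma jet_B n K H : jet n K -> jet n H -> jet n (jB K H).
Proof. by move=> jK jH; apply: jet_D => //; exact: jet_Z. Qed.

Lemma eq_HN n K H : (forall i s, K i s = H i s) -> HN n K = HN n H.
Proof. by move=> e; apply: eq_bigr => i _; apply: eq_L2norm => s _. Qed.

Lemma eq_jet' n K H : (forall i s, K i s = H i s) -> jet n K -> jet n H.
Proof. by move=> e; apply: eq_jet => i _; apply/funext. Qed.

Lemma HN_M_diff n K H K' H' : (1 <= n)%N -> jet n K -> jet n H -> jet n K' -> jet n H' ->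
  HN n (jB (jM K H) (jM K' H')) <= cM n * (HN n (jB K K') * HN n H + HN n K' * HN n (jB H H')).
Proof.
move=> n1 jK jH jK' jH'.
rewrite (@eq_HN _ _ (jD (jM (jB K K') H) (jM K' (jB H H')))); last first.
  by move=> i s; rewrite jBE /jD /jM PJ_B1 PJ_B2; ring.
have j1 := jet_B jK jK'; have j2 := jet_B jH jH'.
apply: (le_trans (HN_D (jet_M n1 j1 jH) (jet_M n1 jK' j2))); rewrite mulrDr !mulrA.
by apply: lerD; exact: PJ_HN_alg.
Qed.

Lemma HN_bd n K H : jet n K -> jet n H -> HN n K <= HN n H + HN n (jB K H).
Proof.
move=> jK jH; rewrite (@eq_HN _ _ (jD H (jB K H))); last by move=> i s; rewrite /jD jBE; ring.
exact: HN_D jH (jet_B jK jH).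
Qed.

Lemma CJ_M k F G : (1 <= k)%N -> CJ k F -> CJ k G -> CJ k (fun t => jM (F t) (G t)).
Proof.
move=> k1 cF cG t t0; have [jF hF] := cF t t0; have [jG hG] := cG t t0.
split; first exact: jet_M.
have c : cM k * (HN k (jB (F r) (F t)) * (HN k (G t) + HN k (jB (G r) (G t))) + HN k (F t) * HN k (jB (G r) (G t))) @[r --> N0 t] --> (0 : R).
  apply: cvg0Ml; apply: cvg0D; last exact: cvg0Ml.
  have := cvgM hF (cvgD (cvg_cst (HN k (G t))) hG); rewrite mul0r; exact.
apply: cvg0_nearle c; apply: filterS (near_N0_ge0 t) => r r0.
have [jF' _] := cF r r0; have [jG' _] := cG r r0.
rewrite ger0_norm ?HN_ge0//; apply: (le_trans (HN_M_diff k1 jF' jG' jF jG)).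
have c0 : 0 <= cM k :> R by apply: le_trans (cM_ge1 k).
rewrite ler_wpM2l// lerD2r ler_wpM2l ?HN_ge0//; exact: HN_bd.
Qed.

Lemma CJ_D k F G : CJ k F -> CJ k G -> CJ k (fun t => jD (F t) (G t)).
Proof.
move=> cF cG t t0; have [jF hF] := cF t t0; have [jG hG] := cG t t0.
split; first exact: jet_D.
apply: cvg0_nearle (cvg0D hF hG); apply: filterS (near_N0_ge0 t) => r r0.
have [jF' _] := cF r r0; have [jG' _] := cG r r0.
rewrite ger0_norm ?HN_ge0//.
rewrite (@eq_HN _ _ (jD (jB (F r) (F t)) (jB (G r) (G t)))); last by move=> i s; rewrite /jD !jBE /jD; ring.
by apply: HN_D; exact: jet_B.
Qed.

Lemma CJ_Z k a F : CJ k F -> CJ k (fun t => jZ a (F t)).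
Proof.
move=> cF t t0; have [jF hF] := cF t t0; split; first exact: jet_Z.
apply: cvg0_nearle (cvg0Ml `|a| hF); apply: filterS (near_N0_ge0 t) => r r0.
have [jF' _] := cF r r0; rewrite ger0_norm ?HN_ge0//.
rewrite (@eq_HN _ _ (jZ a (jB (F r) (F t)))); last by move=> i s; rewrite /jZ !jBE /jZ; ring.
by rewrite HN_Z//; exact: jet_B.
Qed.

Lemma CJ_le k n F : (n <= k)%N -> CJ k F -> CJ n F.
Proof.
move=> nk cF t t0; have [jF hF] := cF t t0; split; first exact: jet_le jF.
apply: cvg0_le hF => r; rewrite ger0_norm ?HN_ge0//; exact: HN_mono.
Qed.

Lemma CJ_shift p k F : CJ (p + k) F -> CJ k (fun t i => F t (p + i)%N).
Proof.
move=> cF t t0; have [jF hF] := cF t t0; split; first exact: jet_shift jF.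
apply: cvg0_le hF => r; rewrite ger0_norm ?HN_ge0// /HN.
rewrite -!(big_mkord xpredT (fun i => L2norm (_ i))).
rewrite [leRHS](big_cat_nat (n := p))//=; last by lia.
rewrite (_ : (p + k).+1 = (k.+1 + p)%N); last by lia.
rewrite [X in _ <= _ + X](big_addn 0 _ p) addnK ler_wpDl//.
  by apply: sumr_ge0 => i _; exact: L2norm_ge0.
by apply: ler_sum => i _; rewrite addnC.
Qed.

Definition jcons (f : R -> R) K : nat -> R -> R := fun i => if i is i'.+1 then K i' else f.

Lemma jet_cons k f K : AC f (K 0%N) -> jet k K -> jet k.+1 (jcons f K).
Proof. by move=> a [aK lK]; split => // -[|i] //; rewrite ltnS; exact: aK. Qed.

Lemma HN_cons k f f' K K' : HN k.+1 (jB (jcons f K) (jcons f' K')) = L2norm (f \- f') + HN k (jB K K').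
Proof.
rewrite /HN big_ord_recl; congr (_ + _); by apply: eq_L2norm => s _; rewrite jBE.
Qed.

End JetCurves.

(** * Superposition for the frame equations *)

Section KLinear.
Context {R : realType}.
Variables (q1 q2 : R -> R).
Hypotheses (c1 : continuous q1) (c2 : continuous q2).

Lemma Ksys_lin (a : R) (rx ry rz x y z rx' ry' rz' x' y' z' : R -> R) :
  L2 rx -> L2 ry -> L2 rz -> continuous x -> continuous y -> continuous z ->
  L2 rx' -> L2 ry' -> L2 rz' -> continuous x' -> continuous y' -> continuous z' ->
  Ksys q1 q2 rx ry rz x y z -> Ksys q1 q2 rx' ry' rz' x' y' z' ->
  Ksys q1 q2 (fun s => a * rx s + rx' s) (fun s => a * ry s + ry' s) (fun s => a * rz s + rz' s)
    (fun s => a * x s + x' s) (fun s => a * y s + y' s) (fun s => a * z s + z' s).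
Proof.
move=> Lx Ly Lz cx cy cz Lx' Ly' Lz' cx' cy' cz' [ax ay az] [ax' ay' az'].
have [l1 l2 l3] := Ksys_L2 c1 c2 Lx Ly Lz cx cy cz; have [l1' l2' l3'] := Ksys_L2 c1 c2 Lx' Ly' Lz' cx' cy' cz'.
split.
- by apply: AC_eq (ACD (L2Z a l1) l1' (ACZ a l1 ax) ax') => s /=; ring.
- by apply: AC_eq (ACD (L2Z a l2) l2' (ACZ a l2 ay) ay') => s /=; ring.
- by apply: AC_eq (ACD (L2Z a l3) l3' (ACZ a l3 az) az') => s /=; ring.
Qed.

(** A change of coefficients is read as a source, so that [Ksys_sup] can compare frames built from
    different q. *)
Lemma Ksys_change p1 p2 x y z : Ksys p1 p2 (fun=> 0) (fun=> 0) (fun=> 0) x y z ->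
  Ksys q1 q2 (fun s => (p1 s - q1 s) * y s + (p2 s - q2 s) * z s)
    (fun s => - ((p1 s - q1 s) * x s)) (fun s => - ((p2 s - q2 s) * x s)) x y z.
Proof. by move=> [ax ay az]; split; [apply: AC_eq ax|apply: AC_eq ay|apply: AC_eq az] => s; ring. Qed.

End KLinear.

(** * Time evolution of the frame *)

Section FrameEvolution.
Context {R : realType}.
Variables (m : nat) (Q : R -> bool -> nat -> R -> R).
Hypothesis m1 : (1 <= m)%N.
Hypothesis eQ : forall t j, 0 <= t -> evenjet m (Q t j).
Hypothesis cQ : forall t j, 0 <= t -> HN (2 * m) (jB (Q r j) (Q t j)) @[r --> N0 t] --> (0 : R).
Hypothesis dQ : forall t j, 0 <= t ->
  L2norm (fun s => (r - t)^-1 * (Q r j 0%N s - Q t j 0%N s) - NP Q t j s) @[r --> N1 t] --> (0 : R).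
Local Notation zf := (fun _ : R => 0 : R).
(** One Cartesian component of the frame (v, e1, e2); its value at s = 0 is the same at all
    times. *)
Variables (x y z : R -> R -> R) (a b c : R).
Hypothesis KX : forall t, 0 <= t -> Ksys (Q t false 0%N) (Q t true 0%N) zf zf zf (x t) (y t) (z t).
Hypothesis cX : forall t, 0 <= t -> [/\ continuous (x t), continuous (y t) & continuous (z t)].
Hypothesis iX : forall t, 0 <= t -> [/\ x t 0 = a, y t 0 = b & z t 0 = c].

Let m20 : (0 < 2 * m)%N. Proof. by lia. Qed.
Let m21 : (1 < 2 * m)%N. Proof. by lia. Qed.
Let jQ t j : 0 <= t -> jet (2 * m) (Q t j). Proof. by move=> t0; case: (eQ j t0). Qed.
Let qc t j : 0 <= t -> continuous (Q t j 0%N).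
Proof. by move=> t0; exact: jet_continuous (jQ j t0) m20. Qed.
Let LQ t j i : 0 <= t -> (i <= 2 * m)%N -> L2 (Q t j i).
Proof. by move=> t0; exact: jet_L2 (jQ j t0). Qed.
Let L20 : L2 zf. Proof. exact: L2_cst. Qed.

Let Cb : R := Num.sqrt (a ^+ 2 + b ^+ 2 + c ^+ 2).
Let Cb0 : 0 <= Cb. Proof. exact: sqrtr_ge0. Qed.

Let Xb t s : 0 <= t -> [/\ `|x t s| <= Cb, `|y t s| <= Cb & `|z t s| <= Cb].
Proof.
move=> t0; have [h1 h2 h3] := cX t0; have [ix iy iz] := iX t0.
have h := Ksys_inner (@qc t false t0) (@qc t true t0) L20 L20 L20 h1 h2 h3 h1 h2 h3 (KX t0) (KX t0) s.
have z0 : prim (fun s => 0 * (x t s + x t s) + 0 * (y t s + y t s) + 0 * (z t s + z t s)) s = 0.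
  rewrite prim_def -[RHS]int01_0; apply: eq_int01 => r _; rewrite /=; ring.
rewrite z0 addr0 ix iy iz -!expr2 in h.
have s0 : 0 <= a ^+ 2 + b ^+ 2 + c ^+ 2 by rewrite !addr_ge0 ?sqr_ge0.
have := sqr_ge0 (x t s); have := sqr_ge0 (y t s); have := sqr_ge0 (z t s) => hz hy hx.
by split; apply: le_sqr_ge0 => //; rewrite real_normK ?num_real// sqr_sqrtr// -h; move: (_ ^+ 2) (_ ^+ 2) (_ ^+ 2) hz hy hx => *; lra.
Qed.

Let dl t r j (s : R) := Q r j 0%N s - Q t j 0%N s.
Let dl_c t r j : 0 <= t -> 0 <= r -> continuous (dl t r j).
Proof. by move=> t0 r0 s; apply: cvgB; exact: qc. Qed.

Let mulb (g w : R -> R) M : L2 g -> continuous w -> (forall s, `|w s| <= M) ->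
  L2 (g \* w) /\ L2norm (g \* w) <= M * L2norm g.
Proof.
move=> Lg cw hw; split; first by apply: (L2M_bounded Lg (cont_meas cw)) => s _; exact: hw.
by apply: (L2normM_bounded Lg (cont_meas cw)) => s _; exact: hw.
Qed.

Let eta t r := 8 * Cb * (L2norm (dl t r false) + L2norm (dl t r true)).

(** The difference of the frames at two times vanishes at s = 0 and solves the system with a source
    of size |q(r) - q(t)|. *)
Let DX t r s : 0 <= t -> 0 <= r ->
  [/\ `|x r s - x t s| <= eta t r, `|y r s - y t s| <= eta t r & `|z r s - z t s| <= eta t r].
Proof.
move=> t0 r0; have [h1 h2 h3] := cX t0; have [k1 k2 k3] := cX r0.
have Kr := Ksys_change (Q t false 0%N) (Q t true 0%N) (KX r0).
have Ld j : L2 (dl t r j) by exact/cont_L2/dl_c.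
have hx u := let: And3 h _ _ := Xb u r0 in h.
have hy u := let: And3 _ h _ := Xb u r0 in h.
have hz u := let: And3 _ _ h := Xb u r0 in h.
have [y1 y1'] := mulb (Ld false) k2 hy; have [z2 z2'] := mulb (Ld true) k3 hz.
have [x1 x1'] := mulb (Ld false) k1 hx; have [x2 x2'] := mulb (Ld true) k1 hx.
have Lrx := L2D y1 z2; have Lry := L2N x1; have Lrz := L2N x2.
have Kd := Ksys_lin (@qc t false t0) (@qc t true t0) (-1) L20 L20 L20 h1 h2 h3 Lrx Lry Lrz k1 k2 k3 (KX t0) Kr.
have [ix iy iz] := iX t0; have [ix' iy' iz'] := iX r0.
have cc (f g : R -> R) : continuous f -> continuous g -> continuous (fun s => -1 * f s + g s).
  by move=> cf cg u; apply: cvgD; [apply: cvgM; [exact: cvg_cst|exact: cf]|exact: cg].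
have zl (f : R -> R) : L2 f -> L2 (fun s => -1 * 0 + f s).
  by move=> Lf; apply: eq_L2 Lf => u _; rewrite mulr0 add0r.
have := Ksys_sup (@qc t false t0) (@qc t true t0) (zl _ Lrx) (zl _ Lry) (zl _ Lrz) (cc _ _ h1 k1) (cc _ _ h2 k2) (cc _ _ h3 k3) Kd.
rewrite ix ix' iy iy' iz iz' => /(_ ltac:(ring) ltac:(ring) ltac:(ring) s).
have n0 (f : R -> R) : L2norm (fun s => -1 * 0 + f s) = L2norm f by apply: eq_L2norm => u _; rewrite mulr0 add0r.
rewrite !n0 => -[g1 g2 g3].
have le : 2 * (L2norm ((dl t r false \* y r) \+ (dl t r true \* z r)) + L2norm (\- (dl t r false \* x r)) + L2norm (\- (dl t r true \* x r))) <= eta t r.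
  rewrite !L2normN//.
  have tr := L2norm_triangle y1 z2; rewrite /eta.
  rewrite (_ : 8 * Cb * _ = 2 * (2 * (Cb * L2norm (dl t r false) + Cb * L2norm (dl t r true)) + 2 * (Cb * L2norm (dl t r false) + Cb * L2norm (dl t r true)))); last by ring.
  have p1 := mulr_ge0 Cb0 (L2norm_ge0 (dl t r false)); have p2 := mulr_ge0 Cb0 (L2norm_ge0 (dl t r true)).
  rewrite ler_pM2l//; move: (L2norm (_ \+ _)) (L2norm _) (L2norm _) (L2norm _) (L2norm _) y1' z2' x1' x2' tr p1 p2 => n1 n2 n3 n4 n5.
  move: (Cb * _) (Cb * _) => p q; lra.
have e1 (p q : R) : `|p - q| = `|-1 * q + p| by congr (`|_|); ring.
by rewrite !e1; split; [exact: le_trans g1 le|exact: le_trans g2 le|exact: le_trans g3 le].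
Qed.

Lemma dl_cvg t j : 0 <= t -> L2norm (dl t r j) @[r --> N0 t] --> (0 : R).
Proof.
move=> t0; apply: cvg0_le (cQ j t0) => r; rewrite ger0_norm ?L2norm_ge0//.
apply: le_trans (HN_ge _ (leq0n _)); rewrite le_eqVlt; apply/orP; left; apply/eqP.
by apply: eq_L2norm => s _; rewrite jBE.
Qed.

Lemma eta_cvg t : 0 <= t -> eta t r @[r --> N0 t] --> (0 : R).
Proof. by move=> t0; apply: cvg0Ml; apply: cvg0D; exact: dl_cvg. Qed.

(** With [gy] and [gz], the expected time derivative of the frame; for the whole vector this one is
    q1_s e2 - q2_s e1 = v x v_ss. *)
Definition gx t (s : R) := - Q t true 1%N s * y t s + Q t false 1%N s * z t s.
Let gy t (s : R) := Q t true 1%N s * x t s + al Q t s * z t s.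
Let gz t (s : R) := - Q t false 1%N s * x t s - al Q t s * y t s.

(** Compatibility of the equations in s and in t: the expected time derivative solves the frame
    system differentiated in time exactly because q_t is given by [NP]. *)
Let KG t : 0 <= t -> Ksys (Q t false 0%N) (Q t true 0%N)
  (fun s => NP Q t false s * y t s + NP Q t true s * z t s)
  (fun s => - (NP Q t false s * x t s)) (fun s => - (NP Q t true s * x t s)) (gx t) (gy t) (gz t) /\
  [/\ continuous (gx t), continuous (gy t) & continuous (gz t)].
Proof.
move=> t0; have [h1 h2 h3] := cX t0; have [ax ay az] := KX t0.
have [lx ly lz] := Ksys_L2 (@qc t false t0) (@qc t true t0) L20 L20 L20 h1 h2 h3.
have A1 j := jet_AC (jQ j t0) m21; have L2' j : L2 (Q t j 2%N) by exact: LQ.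
have A0 j := jet_AC (jQ j t0) m20; have L1' j : L2 (Q t j 1%N) by apply: LQ => //; exact: ltnW.
have Aal : AC (al Q t) (fun s => - (Q t false 0%N s * Q t false 1%N s + Q t true 0%N s * Q t true 1%N s)).
  have Lm j := ACM_L2 (L1' j) (L1' j) (A0 j) (A0 j).
  have h := ACD (Lm false) (Lm true) (ACM (L1' false) (L1' false) (A0 false) (A0 false)) (ACM (L1' true) (L1' true) (A0 true) (A0 true)).
  have h' := ACZ (- 2^-1) (L2D (Lm false) (Lm true)) h.
  move=> s; rewrite /al subrr mulr0 add0r.
  have := h' s; rewrite /= /rho -!expr2 => e.
  transitivity (prim (fun s0 => - 2^-1 * (((Q t false 1%N \* Q t false 0%N) \+ (Q t false 0%N \* Q t false 1%N)) \+ ((Q t true 1%N \* Q t true 0%N) \+ (Q t true 0%N \* Q t true 1%N))) s0) s).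
    rewrite mulrBr e; ring.
  by apply: eq_prim => r _ /=; field.
have Lal : L2 (fun s => - (Q t false 0%N s * Q t false 1%N s + Q t true 0%N s * Q t true 1%N s)).
  have Lq j : L2 (Q t j 0%N \* Q t j 1%N).
    apply: cont_L2; apply: contM; first exact: qc.
    exact: jet_continuous (jQ j t0) m21.
  exact: L2N (L2D (Lq false) (Lq true)).
have c1' j : continuous (Q t j 1%N) by exact: jet_continuous (jQ j t0) m21.
have cal : continuous (al Q t) by apply: (al_continuous m1) => //; exact: eQ.
have M1 j w w' (Lw : L2 w') (aw : AC w w') := ACM (L2' j) Lw (A1 j) aw.
have M1L j w w' (Lw : L2 w') (aw : AC w w') := ACM_L2 (L2' j) Lw (A1 j) aw.
have Ma w w' (Lw : L2 w') (aw : AC w w') := ACM Lal Lw Aal aw.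
have MaL w w' (Lw : L2 w') (aw : AC w w') := ACM_L2 Lal Lw Aal aw.
split; last first.
  split => s.
  - by apply: cvgD; apply: cvgM; [apply: cvgN; exact: c1'|exact: h2|exact: c1'|exact: h3].
  - by apply: cvgD; apply: cvgM; [exact: c1'|exact: h1|exact: cal|exact: h3].
  - by apply: cvgB; apply: cvgM; [apply: cvgN; exact: c1'|exact: h1|exact: cal|exact: h2].
split.
- have h := ACB (M1L false _ _ lz az) (M1L true _ _ ly ay) (M1 false _ _ lz az) (M1 true _ _ ly ay).
  have e : (Q t false 1%N \* z t) \- (Q t true 1%N \* y t) = gx t by apply/funext => s; rewrite /gx /=; ring.
  rewrite e in h; apply: AC_eq h => s; rewrite /NP /gy /gz /=; ring.
- have h := ACD (M1L true _ _ lx ax) (MaL _ _ lz az) (M1 true _ _ lx ax) (Ma _ _ lz az).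
  by apply: AC_eq h => s; rewrite /NP /gx /=; ring.
- have h := ACN (L2D (M1L false _ _ lx ax) (MaL _ _ ly ay)) (ACD (M1L false _ _ lx ax) (MaL _ _ ly ay) (M1 false _ _ lx ax) (Ma _ _ ly ay)).
  have e : \- ((Q t false 1%N \* x t) \+ (al Q t \* y t)) = gz t by apply/funext => s; rewrite /gz /=; ring.
  rewrite e in h; apply: AC_eq h => s; rewrite /NP /gx /=; ring.
Qed.

Let Er t r j (s : R) := (r - t)^-1 * (Q r j 0%N s - Q t j 0%N s) - NP Q t j s.
Definition ex_err t r := 8 * (Cb * (L2norm (Er t r false) + L2norm (Er t r true)) +
  eta t r * (L2norm (NP Q t false) + L2norm (NP Q t true))).

(** The error of the difference quotient solves the frame system with value 0 at s = 0 and a source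
    made of the error for q and of the increment of the frame; [Ksys_sup] concludes. *)
Lemma x_derive t r s : 0 <= t -> 0 <= r -> r != t ->
  `|(r - t)^-1 * (x r s - x t s) - gx t s| <= ex_err t r.
Proof.
move=> t0 r0 rt; have [h1 h2 h3] := cX t0; have [k1 k2 k3] := cX r0.
have [KGt [g1 g2 g3]] := KG t0.
have Kr := Ksys_change (Q t false 0%N) (Q t true 0%N) (KX r0).
have Ld j : L2 (dl t r j) by exact/cont_L2/dl_c.
have LP j : L2 (NP Q t j) by exact: L2_NP m1 t0 eQ j.
have LE j : L2 (Er t r j) by apply: L2B => //; apply: L2Z; exact: Ld.
have hx u := let: And3 h _ _ := Xb u r0 in h.
have hy u := let: And3 _ h _ := Xb u r0 in h.
have hz u := let: And3 _ _ h := Xb u r0 in h.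
have hx' u := let: And3 h _ _ := Xb u t0 in h.
have hy' u := let: And3 _ h _ := Xb u t0 in h.
have hz' u := let: And3 _ _ h := Xb u t0 in h.
have [y1 _] := mulb (Ld false) k2 hy; have [z2 _] := mulb (Ld true) k3 hz.
have [x1 _] := mulb (Ld false) k1 hx; have [x2 _] := mulb (Ld true) k1 hx.
have Lrx := L2D y1 z2; have Lry := L2N x1; have Lrz := L2N x2.
have [py _] := mulb (LP false) h2 hy'; have [pz _] := mulb (LP true) h3 hz'.
have [px1 _] := mulb (LP false) h1 hx'; have [px2 _] := mulb (LP true) h1 hx'.
have LPx := L2D py pz; have LPy := L2N px1; have LPz := L2N px2.
have cc d (f g : R -> R) : continuous f -> continuous g -> continuous (fun s => d * f s + g s).
  by move=> cf cg u; apply: cvgD; [apply: cvgM; [exact: cvg_cst|exact: cf]|exact: cg].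
have lc d (f g : R -> R) : L2 f -> L2 g -> L2 (fun s => d * f s + g s).
  by move=> Lf Lg; exact: L2D (L2Z d Lf) Lg.
have cf0 := @cst_continuous R R 0.
have K0 : Ksys (Q t false 0%N) (Q t true 0%N) zf zf zf zf zf zf.
  by split => u; rewrite prim_def -[LHS]addr0; congr (_ + _); rewrite -[LHS]int01_0; apply: eq_int01 => w _; rewrite /=; ring.
have Kd := Ksys_lin (@qc t false t0) (@qc t true t0) (-1) L20 L20 L20 h1 h2 h3 Lrx Lry Lrz k1 k2 k3 (KX t0) Kr.
have KGn := Ksys_lin (@qc t false t0) (@qc t true t0) (-1) LPx LPy LPz g1 g2 g3 L20 L20 L20 cf0 cf0 cf0 KGt K0.
have KY := Ksys_lin (@qc t false t0) (@qc t true t0) (r - t)^-1 (lc _ _ _ L20 Lrx) (lc _ _ _ L20 Lry) (lc _ _ _ L20 Lrz)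
  (cc _ _ _ h1 k1) (cc _ _ _ h2 k2) (cc _ _ _ h3 k3)
  (lc (-1) _ _ LPx L20) (lc (-1) _ _ LPy L20) (lc (-1) _ _ LPz L20)
  (cc (-1) _ _ g1 cf0) (cc (-1) _ _ g2 cf0) (cc (-1) _ _ g3 cf0) Kd KGn.
have [ix iy iz] := iX t0; have [ix' iy' iz'] := iX r0.
(* The Neumann condition and [al Q t 0 = 0] make the expected derivative vanish at s = 0, where the
   frame does not move. *)
have q0 j : Q t j 1%N 0 = 0 by have [_ o] := eQ j t0; have [-> _] := o 1%N m21 isT.
have al0 : al Q t 0 = 0 by rewrite /al subrr mulr0.
have := Ksys_sup (@qc t false t0) (@qc t true t0) (lc (r - t)^-1 _ _ (lc (-1) _ _ L20 Lrx) (lc (-1) _ _ LPx L20))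
  (lc (r - t)^-1 _ _ (lc (-1) _ _ L20 Lry) (lc (-1) _ _ LPy L20)) (lc (r - t)^-1 _ _ (lc (-1) _ _ L20 Lrz) (lc (-1) _ _ LPz L20))
  (cc _ _ _ (cc _ _ _ h1 k1) (cc (-1) _ _ g1 cf0)) (cc _ _ _ (cc _ _ _ h2 k2) (cc (-1) _ _ g2 cf0)) (cc _ _ _ (cc _ _ _ h3 k3) (cc (-1) _ _ g3 cf0)) KY.
rewrite ix ix' iy iy' iz iz' /gx /gy /gz !q0 al0.
move=> /(_ ltac:(ring) ltac:(ring) ltac:(ring) s) [bx _ _].
rewrite (_ : (r - t)^-1 * (x r s - x t s) - _ = (r - t)^-1 * (-1 * x t s + x r s) + (-1 * (- Q t true 1%N s * y t s + Q t false 1%N s * z t s) + 0)); last by ring.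
apply: (le_trans bx) => {bx}.
have bD (w : R -> R -> R) j : continuous (w r) -> continuous (w t) -> (forall u, `|w r u| <= Cb) -> (forall u, `|w r u - w t u| <= eta t r) ->
    L2 ((Er t r j \* w r) \+ (NP Q t j \* (fun u => w r u - w t u))) /\
    L2norm ((Er t r j \* w r) \+ (NP Q t j \* (fun u => w r u - w t u))) <= Cb * L2norm (Er t r j) + eta t r * L2norm (NP Q t j).
  move=> cwr cwt hw hd; have [l1 n1] := mulb (LE j) cwr hw.
  have cd : continuous (fun u => w r u - w t u) by move=> u; apply: cvgB; [exact: cwr|exact: cwt].
  have [l2 n2] := mulb (LP j) cd hd.
  by split; [exact: L2D|apply: (le_trans (L2norm_triangle l1 l2)); exact: lerD].
have dx u := let: And3 h _ _ := DX u t0 r0 in h.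
have dy u := let: And3 _ h _ := DX u t0 r0 in h.
have dz u := let: And3 _ _ h := DX u t0 r0 in h.
have [Lyf nyf] := bD y false k2 h2 hy dy; have [Lzt nzt] := bD z true k3 h3 hz dz.
have [Lxf nxf] := bD x false k1 h1 hx dx; have [Lxt nxt] := bD x true k1 h1 hx dx.
set nx := L2norm (fun s => _ + _ : R); set ny := L2norm (fun s => _ + _ : R); set nz := L2norm (fun s => _ + _ : R).
have ex : nx <= Cb * (L2norm (Er t r false) + L2norm (Er t r true)) + eta t r * (L2norm (NP Q t false) + L2norm (NP Q t true)).
  rewrite (_ : nx = L2norm (((Er t r false \* y r) \+ (NP Q t false \* (fun u => y r u - y t u))) \+ ((Er t r true \* z r) \+ (NP Q t true \* (fun u => z r u - z t u))))).
    apply: (le_trans (L2norm_triangle Lyf Lzt)).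
    apply: (@le_trans _ _ (Cb * L2norm (Er t r false) + eta t r * L2norm (NP Q t false) + (Cb * L2norm (Er t r true) + eta t r * L2norm (NP Q t true)))).
      exact: lerD.
    by rewrite le_eqVlt; apply/orP; left; apply/eqP; ring.
  by apply: eq_L2norm => u _; rewrite /Er /dl /=; ring.
have ey : ny <= Cb * L2norm (Er t r false) + eta t r * L2norm (NP Q t false).
  rewrite (_ : ny = L2norm (\- ((Er t r false \* x r) \+ (NP Q t false \* (fun u => x r u - x t u))))); first by rewrite L2normN.
  by apply: eq_L2norm => u _; rewrite /Er /dl /=; ring.
have ez : nz <= Cb * L2norm (Er t r true) + eta t r * L2norm (NP Q t true).
  rewrite (_ : nz = L2norm (\- ((Er t r true \* x r) \+ (NP Q t true \* (fun u => x r u - x t u))))); first by rewrite L2normN.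
  by apply: eq_L2norm => u _; rewrite /Er /dl /=; ring.
rewrite /ex_err (_ : 8 * _ = 2 * ((Cb * (L2norm (Er t r false) + L2norm (Er t r true)) + eta t r * (L2norm (NP Q t false) + L2norm (NP Q t true))) +
   (Cb * (L2norm (Er t r false) + L2norm (Er t r true)) + eta t r * (L2norm (NP Q t false) + L2norm (NP Q t true))) *+ 3)); last by ring.
have e0 : 0 <= eta t r by rewrite !mulr_ge0 ?addr_ge0 ?L2norm_ge0.
have p1 := mulr_ge0 Cb0 (L2norm_ge0 (Er t r false)); have p2 := mulr_ge0 Cb0 (L2norm_ge0 (Er t r true)).
have p3 := mulr_ge0 e0 (L2norm_ge0 (NP Q t false)); have p4 := mulr_ge0 e0 (L2norm_ge0 (NP Q t true)).
rewrite ler_pM2l//; move: ex; rewrite (mulrDr Cb) (mulrDr (eta t r)).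
move: nx ny nz (Cb * _) (Cb * _) (eta t r * _) (eta t r * _) ey ez p1 p2 p3 p4 => n1 n2 n3 w1 w2 w3 w4 ey ez p1 p2 p3 p4 ex.
rewrite mulrS mulr2n; lra.
Qed.

Lemma ex_err_cvg t : 0 <= t -> ex_err t r @[r --> N1 t] --> (0 : R).
Proof.
move=> t0; apply: cvg0Ml; apply: cvg0D; first by apply: cvg0Ml; apply: cvg0D; exact: dQ.
have h := cvg_N1 (eta_cvg t0).
by under eq_fun do rewrite mulrC; exact: cvg0Ml.
Qed.

(** The s-derivative of the frame is a product of q and the frame, so each step gains one
    derivative, up to one more than q has. *)
Lemma frame_jets k : (k <= 2 * m)%N -> exists JX JY JZ : R -> nat -> R -> R,
  [/\ CJ k.+1 JX, CJ k.+1 JY & CJ k.+1 JZ] /\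
  forall t, [/\ JX t 0%N = x t, JY t 0%N = y t & JZ t 0%N = z t].
Proof.
have CQ k' j : (k' <= 2 * m)%N -> CJ k' (fun t => Q t j).
  move=> km; apply: (CJ_le km) => t t0; split; first exact: jQ.
  exact: cQ.
have cw (w : R -> R -> R) : (forall t r s, 0 <= t -> 0 <= r -> `|w r s - w t s| <= eta t r) ->
    (forall t, 0 <= t -> continuous (w t)) -> forall t, 0 <= t ->
    L2norm (w r \- w t) @[r --> N0 t] --> (0 : R).
  move=> hw cw t t0; apply: cvg0_nearle (eta_cvg t0); apply: filterS (near_N0_ge0 t) => r r0.
  rewrite ger0_norm ?L2norm_ge0//; apply: L2norm_bounded.
    by apply: cont_meas => s; apply: cvgB; exact: cw.
  by move=> s _; exact: hw.
have dx t r s (t0 : 0 <= t) (r0 : 0 <= r) := let: And3 h _ _ := DX s t0 r0 in h.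
have dy t r s (t0 : 0 <= t) (r0 : 0 <= r) := let: And3 _ h _ := DX s t0 r0 in h.
have dz t r s (t0 : 0 <= t) (r0 : 0 <= r) := let: And3 _ _ h := DX s t0 r0 in h.
have kx t (t0 : 0 <= t) := let: And3 h _ _ := cX t0 in h.
have ky t (t0 : 0 <= t) := let: And3 _ h _ := cX t0 in h.
have kz t (t0 : 0 <= t) := let: And3 _ _ h := cX t0 in h.
have step (w : R -> R -> R) (G : R -> nat -> R -> R) k' : 
    (forall t r s, 0 <= t -> 0 <= r -> `|w r s - w t s| <= eta t r) ->
    (forall t, 0 <= t -> continuous (w t)) -> (forall t, 0 <= t -> AC (w t) (G t 0%N)) ->
    CJ k' G -> CJ k'.+1 (fun t => jcons (w t) (G t)).
  move=> hw kw aw cG t t0; have [jG hG] := cG t t0; split; first by apply: jet_cons => //; exact: aw.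
  by under eq_fun do rewrite HN_cons; apply: cvg0D => //; exact: cw.
elim: k => [_|k IH km].
  pose GX t (_ : nat) (s : R) := Q t false 0%N s * y t s + Q t true 0%N s * z t s.
  pose GY t (_ : nat) (s : R) := - (Q t false 0%N s * x t s).
  pose GZ t (_ : nat) (s : R) := - (Q t true 0%N s * x t s).
  have base (w : R -> R -> R) j : (forall t r s, 0 <= t -> 0 <= r -> `|w r s - w t s| <= eta t r) ->
      (forall t, 0 <= t -> continuous (w t)) -> (forall t s, 0 <= t -> `|w t s| <= Cb) -> 
      CJ 0 (fun t (_ : nat) s => Q t j 0%N s * w t s).
    move=> hw kw bw t t0; split; first by split => //; apply: cont_L2; apply: contM; [exact: qc|exact: kw].
    have [M HM] := cont_bounded01 (@qc t j t0).
    have c0 : Cb * L2norm (dl t r j) + `|M| * eta t r @[r --> N0 t] --> (0 : R).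
      by apply: cvg0D; apply: cvg0Ml; [exact: dl_cvg|exact: eta_cvg].
    apply: cvg0_nearle c0; apply: filterS (near_N0_ge0 t) => r r0.
    rewrite ger0_norm ?HN_ge0// /HN big_ord1.
    rewrite (eq_L2norm (g := (dl t r j \* w r) \+ (Q t j 0%N \* (w r \- w t)))); last by move=> s _; rewrite jBE /dl /=; ring.
    have [l1 n1] := mulb (cont_L2 (@dl_c t r j t0 r0)) (kw r r0) (fun s => bw r s r0).
    have cd : continuous (w r \- w t) by move=> s; apply: cvgB; exact: kw.
    have c2 : continuous (Q t j 0%N \* (w r \- w t)) by apply: contM => //; exact: qc.
    apply: (le_trans (L2norm_triangle l1 (cont_L2 c2))); apply: lerD => //.
    apply: L2norm_bounded; first exact: cont_meas.
    move=> s s01; rewrite /= normrM; apply: ler_pM => //; last exact: hw.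
    by apply: (le_trans (HM s _)); [exact: I01_01|exact: ler_norm].
  have bx t s (t0 : 0 <= t) := let: And3 h _ _ := Xb s t0 in h.
  have by' t s (t0 : 0 <= t) := let: And3 _ h _ := Xb s t0 in h.
  have bz t s (t0 : 0 <= t) := let: And3 _ _ h := Xb s t0 in h.
  have CX : CJ 0 GX by apply: CJ_D; exact: base.
  have eqCJ k' (F G : R -> nat -> R -> R) : (forall t i s, F t i s = G t i s) -> CJ k' F -> CJ k' G.
    by move=> e; rewrite (_ : F = G)//; do 3 apply/funext => ?; exact: e.
  have CY : CJ 0 GY by apply: eqCJ (CJ_Z (-1) (base x false dx kx bx)) => t i s; rewrite /jZ mulN1r.
  have CZ : CJ 0 GZ by apply: eqCJ (CJ_Z (-1) (base x true dx kx bx)) => t i s; rewrite /jZ mulN1r.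
  exists (fun t => jcons (x t) (GX t)), (fun t => jcons (y t) (GY t)), (fun t => jcons (z t) (GZ t)).
  split=> //; split; apply: step => // t t0; have [ax ay az] := KX t0.
  - by apply: AC_eq ax => s; rewrite addr0.
  - by apply: AC_eq ay => s; rewrite addr0.
  - by apply: AC_eq az => s; rewrite addr0.
have [JX [JY [JZ [[cx cy cz] e]]]] := IH (ltnW km).
have M j J : CJ k.+1 J -> CJ k.+1 (fun t => jM (Q t j) (J t)) by move=> cJ; apply: CJ_M => //; exact: CQ.
exists (fun t => jcons (x t) (jD (jM (Q t false) (JY t)) (jM (Q t true) (JZ t)))),
  (fun t => jcons (y t) (jZ (-1) (jM (Q t false) (JX t)))), (fun t => jcons (z t) (jZ (-1) (jM (Q t true) (JX t)))).
split=> //; split; apply: step => //.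
- move=> t t0; have [ax _ _] := KX t0; have [ex ey ez] := e t.
  by apply: AC_eq ax => s; rewrite /jD /jM /= ey ez addr0.
- by apply: CJ_D; exact: M.
- move=> t t0; have [_ ay _] := KX t0; have [ex ey ez] := e t.
  by apply: AC_eq ay => s; rewrite /jZ /jM /= ex mulN1r addr0.
- by apply: CJ_Z; exact: M.
- move=> t t0; have [_ _ az] := KX t0; have [ex ey ez] := e t.
  by apply: AC_eq az => s; rewrite /jZ /jM /= ex mulN1r addr0.
- by apply: CJ_Z; exact: M.
Qed.

End FrameEvolution.

Lemma ord3P (P : 'I_3 -> Prop) : P o0 -> P o1 -> P o2 -> forall i, P i.
Proof.
move=> h0 h1 h2 [[|[|[|n]]] hn] //.
- by rewrite (_ : Ordinal hn = o0)//; apply/val_inj.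
- by rewrite (_ : Ordinal hn = o1)//; apply/val_inj.
- by rewrite (_ : Ordinal hn = o2)//; apply/val_inj.
Qed.

(** * Cross products, and parity of derivatives at an end point *)

Section Vec3.
Context {R : realType}.
Implicit Types u v w b : 'I_3 -> R.

Definition crs u w : 'I_3 -> R := fun k => u (k + 1) * w (k + 2%:R) - u (k + 2%:R) * w (k + 1).
Definition dt u w : R := \sum_i u i * w i.

Lemma crs0 u w : crs u w o0 = u o1 * w o2 - u o2 * w o1.
Proof. by rewrite /crs; congr (u _ * w _ - u _ * w _); apply/val_inj. Qed.
Lemma crs1 u w : crs u w o1 = u o2 * w o0 - u o0 * w o2.
Proof. by rewrite /crs; congr (u _ * w _ - u _ * w _); apply/val_inj. Qed.
Lemma crs2 u w : crs u w o2 = u o0 * w o1 - u o1 * w o0.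
Proof. by rewrite /crs; congr (u _ * w _ - u _ * w _); apply/val_inj. Qed.
Definition crsE := (crs0, crs1, crs2).
Lemma dtE u w : dt u w = u o0 * w o0 + u o1 * w o1 + u o2 * w o2.
Proof. exact: sum3. Qed.

Lemma dtC u w : dt u w = dt w u. Proof. by rewrite !dtE; ring. Qed.

(* behaviour of an [n]-th derivative at a point around which the reflection of the curve is its
   rotation by the angle pi about [b] *)
Definition par b (o : bool) u : Prop := if o then dt b u = 0 else forall k, crs b u k = 0.

Lemma par_D b o u w : par b o u -> par b o w -> par b o (fun i => u i + w i).
Proof.
case: o => /= hu hw; first by move: hu hw; rewrite !dtE => hu hw; rewrite -[RHS](addr0 0) -{1}hu -hw; ring.
by move=> k; rewrite -[RHS](addr0 0) -{1}(hu k) -(hw k) /crs; ring.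
Qed.

Lemma par_Z b o (a : R) u : par b o u -> par b o (fun i => a * u i).
Proof.
case: o => /= hu; first by move: hu; rewrite !dtE => hu; rewrite -[RHS](mulr0 a) -hu; ring.
by move=> k; rewrite -[RHS](mulr0 a) -(hu k) /crs; ring.
Qed.

Lemma par_0 b o : par b o (fun=> 0).
Proof. by case: o => /= [|k]; rewrite /dt ?big1 /crs// => *; rewrite ?mulr0 ?subrr. Qed.

Lemma eq_par b o u w : (forall i, u i = w i) -> par b o u -> par b o w.
Proof. by move=> /funext ->. Qed.

Section Unit.
Variable b : 'I_3 -> R.
Hypothesis b1 : dt b b = 1.

Lemma par_even u : par b false u -> forall i, u i = dt b u * b i.
Proof.
move=> /= h; have h0 := h o0; have h1 := h o1; have h2 := h o2.
move: b1; rewrite crsE in h0; rewrite crsE in h1; rewrite crsE in h2; rewrite !dtE => bb.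
apply: ord3P; rewrite -[LHS]mul1r -bb.
- transitivity ((b o0 * u o0 + b o1 * u o1 + b o2 * u o2) * b o0 + (b o2 * (b o2 * u o0 - b o0 * u o2) - b o1 * (b o0 * u o1 - b o1 * u o0))); first by ring.
  by rewrite h1 h2 !mulr0 subrr addr0.
- transitivity ((b o0 * u o0 + b o1 * u o1 + b o2 * u o2) * b o1 + (b o0 * (b o0 * u o1 - b o1 * u o0) - b o2 * (b o1 * u o2 - b o2 * u o1))); first by ring.
  by rewrite h0 h2 !mulr0 subrr addr0.
- transitivity ((b o0 * u o0 + b o1 * u o1 + b o2 * u o2) * b o2 + (b o1 * (b o1 * u o2 - b o2 * u o1) - b o0 * (b o2 * u o0 - b o0 * u o2))); first by ring.
  by rewrite h0 h1 !mulr0 subrr addr0.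
Qed.

Lemma par_crs o o' u w : par b o u -> par b o' w -> par b (o (+) o') (crs u w).
Proof.
case: o; case: o' => hu hw.
- move: hu hw => /=; rewrite !dtE => hu hw; apply: ord3P; rewrite !crsE.
  + by transitivity (u o0 * (b o0 * w o0 + b o1 * w o1 + b o2 * w o2) - w o0 * (b o0 * u o0 + b o1 * u o1 + b o2 * u o2)); [ring|rewrite hu hw !mulr0 subrr].
  + by transitivity (u o1 * (b o0 * w o0 + b o1 * w o1 + b o2 * w o2) - w o1 * (b o0 * u o0 + b o1 * u o1 + b o2 * u o2)); [ring|rewrite hu hw !mulr0 subrr].
  + by transitivity (u o2 * (b o0 * w o0 + b o1 * w o1 + b o2 * w o2) - w o2 * (b o0 * u o0 + b o1 * u o1 + b o2 * u o2)); [ring|rewrite hu hw !mulr0 subrr].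
- have e := par_even hw; rewrite /= dtE !crsE !e; ring.
- have e := par_even hu; rewrite /= dtE !crsE !e; ring.
- have e := par_even hw; have e' := par_even hu; apply: ord3P; rewrite !crsE !e !e'; ring.
Qed.

(** One of the two vectors is parallel to [b], the other orthogonal. *)
Lemma par_dot o u w : par b o u -> par b (~~ o) w -> dt u w = 0.
Proof.
case: o => /= hu hw.
  have e := par_even hw; move: hu; rewrite !dtE !e => hu.
  by transitivity ((b o0 * u o0 + b o1 * u o1 + b o2 * u o2) * dt b w); [ring|rewrite hu mul0r].
have e := par_even hu; move: hw; rewrite !dtE !e => hw.
by transitivity ((b o0 * w o0 + b o1 * w o1 + b o2 * w o2) * dt b u); [ring|rewrite hw mul0r].
Qed.

Lemma crs3 u i : crs b (crs b (crs b u)) i = - crs b u i.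
Proof.
move: b1; rewrite dtE => bb; move: i; apply: ord3P; rewrite !crsE.
all: rewrite -[RHS]mul1r -bb; ring.
Qed.

(** The cube of b x is - (b x), so higher powers kill no more than the first. *)
Lemma iter_crs_inj k w : (forall i, iter k.+1 (crs b) w i = 0) -> forall i, crs b w i = 0.
Proof.
elim: k => [//|k IH] h; apply: IH => i.
have -> : iter k.+1 (crs b) w i = - crs b (iter k.+2 (crs b) w) i.
  by rewrite /= crs3 opprK.
by rewrite /crs !h !mulr0 subrr oppr0.
Qed.

End Unit.

(** Induction on Leibniz expansions: a property stable under addition holds for the n-th derivative
    of a product if it holds for every product of derivatives that occurs. *)
Lemma leib (X : Type) (add : X -> X -> X) (f : nat -> nat -> nat -> X) (P : X -> Prop) :
  (forall n p q, f n.+1 p q = add (f n p.+1 q) (f n p q.+1)) ->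
  (forall x y, P x -> P y -> P (add x y)) ->
  forall n p q, (forall p' q', (p <= p')%N -> (q <= q')%N -> (p' + q' = n + p + q)%N -> P (f 0%N p' q')) ->
  P (f n p q).
Proof.
move=> fS Padd; elim=> [|n IH] p q h; first by apply: h; rewrite ?leqnn//.
rewrite fS; apply: Padd; apply: IH => p' q' pp qq e; apply: h; lia.
Qed.

Definition at_ (U : 'I_3 -> nat -> R -> R) (n : nat) (x : R) : 'I_3 -> R := fun i => U i n x.

Definition cj (U V : 'I_3 -> nat -> R -> R) : 'I_3 -> nat -> R -> R := fun i =>
  jB (jM (U (i + 1)) (V (i + 2%:R))) (jM (U (i + 2%:R)) (V (i + 1))).

Definition CP (U V : 'I_3 -> nat -> R -> R) x n p q : 'I_3 -> R := fun i =>
  PJ (U (i + 1)) (V (i + 2%:R)) n p q x - PJ (U (i + 2%:R)) (V (i + 1)) n p q x.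

Lemma cj_CP U V n x i : at_ (cj U V) n x i = CP U V x n 0 0 i.
Proof. by rewrite /at_ /cj jBE. Qed.

Lemma CP0 U V x p q : CP U V x 0 p q = crs (at_ U p x) (at_ V q x).
Proof. by []. Qed.

Lemma CPS U V x n p q : CP U V x n.+1 p q = (fun i => CP U V x n p.+1 q i + CP U V x n p q.+1 i).
Proof. by apply/funext => i; rewrite /CP /=; ring. Qed.

Lemma CP_par b o U V x n p q :
  (forall p' q', (p <= p')%N -> (q <= q')%N -> (p' + q' = n + p + q)%N -> par b o (crs (at_ U p' x) (at_ V q' x))) ->
  par b o (CP U V x n p q).
Proof.
move=> h; apply: (@leib _ (fun u w i => u i + w i) (CP U V x) (par b o)) => //.
- exact: CPS.
- by move=> u w; exact: par_D.
Qed.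

(** Isolates the extreme Leibniz term, in which no derivative falls on [U]. *)
Lemma CP_top b o U V x n q :
  (forall p' q', (1 <= p')%N -> (q <= q')%N -> (p' + q' = n + q)%N -> par b o (crs (at_ U p' x) (at_ V q' x))) ->
  par b o (fun i => CP U V x n 0 q i - crs (at_ U 0 x) (at_ V (n + q) x) i).
Proof.
elim: n q => [|n IH] q h.
  by apply: eq_par (par_0 b o) => i; rewrite CP0 subrr.
rewrite CPS; apply: (@eq_par _ _ (fun i => CP U V x n 1 q i + (CP U V x n 0 q.+1 i - crs (at_ U 0 x) (at_ V (n + q.+1) x) i))).
  by move=> i; rewrite addnS addSn; ring.
apply: par_D; first by apply: CP_par => p' q' pp qq e; apply: h; lia.
by apply: IH => p' q' pp qq e; apply: h; lia.
Qed.

(** The recursion of [Ptab] carried out on jets, so that all derivatives of P_k have values at the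
    end points. *)
Fixpoint PTJ (W : 'I_3 -> nat -> R -> R) (n : nat) : nat -> 'I_3 -> nat -> R -> R :=
  match n with
  | 0%N => fun _ => W
  | n'.+1 => fun k =>
      if (k <= n')%N then PTJ W n' k else
      fun i m s => \sum_(j < n'.+1) 'C(n', j)%:R *
         cj (PTJ W n' j) (fun i m => PTJ W n' (n' - j) i (2 + m)%N) i m s
  end.
Definition PK k W := PTJ W k k.

Lemma PTJ_le W n k : (k <= n)%N -> PTJ W n k = PK k W.
Proof.
elim: n => [|n IH]; first by rewrite leqn0 => /eqP ->.
by rewrite leq_eqVlt => /orP[/eqP -> //|]; rewrite ltnS /= => mn; rewrite mn IH.
Qed.

Lemma PKS W n i m s : PK n.+1 W i m s =
  \sum_(j < n.+1) 'C(n, j)%:R * cj (PK j W) (fun i m => PK (n - j) W i (2 + m)%N) i m s.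
Proof.
rewrite {1}/PK /= ltnn; apply: eq_bigr => j _.
by rewrite !PTJ_le ?leq_subr // -ltnS.
Qed.

Lemma par_sum b o (I : finType) (c : I -> R) (U : I -> 'I_3 -> R) :
  (forall j, par b o (U j)) -> par b o (fun i => \sum_j c j * U j i).
Proof.
move=> h; have : forall r : seq I, par b o (fun i => \sum_(j <- r) c j * U j i).
  elim=> [|j r IH]; first by apply: eq_par (par_0 b o) => i; rewrite big_nil.
  by apply: eq_par (par_D (par_Z (c j) (h j)) IH) => i; rewrite big_cons.
exact.
Qed.

(* the top order part of the n-th derivative of P_j is (b x)^j applied to the (2j+n)-th derivative of v *)
Lemma PK_par W b x k : dt b b = 1 -> (forall i, at_ W 0 x i = b i) ->
  (forall i, (i < 2 * k)%N -> par b (odd i) (at_ W i x)) ->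
  forall j, (j <= k)%N ->
   (forall n, (2 * j + n < 2 * k)%N -> par b (odd n) (at_ (PK j W) n x)) /\
   (forall n, (2 * j + n = 2 * k)%N ->
      par b false (fun i => at_ (PK j W) n x i - iter j (crs b) (at_ W (2 * k) x) i)).
Proof.
move=> b1 W0 h; elim/ltn_ind => -[|j] IH jk.
  split=> [n nk|n nk]; first exact: h.
  apply: eq_par (par_0 b false) => i /=; rewrite (_ : n = 2 * k)%N ?subrr//; lia.
have jk' : (j <= k)%N by lia.
pose V a : 'I_3 -> nat -> R -> R := fun i m => PK (j - a) W i (2 + m)%N.
have E n i : at_ (PK j.+1 W) n x i = \sum_(a < j.+1) 'C(j, a)%:R * CP (PK a W) (V a) x n 0 0 i.
  by rewrite /at_ PKS; apply: eq_bigr => a _; rewrite -cj_CP.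
have parc a p q : (a <= j)%N -> (2 * a + p < 2 * k)%N -> (2 * (j - a) + (2 + q) < 2 * k)%N ->
    par b (odd (p + q)) (crs (at_ (PK a W) p x) (at_ (V a) q x)).
  move=> aj pk qk; rewrite oddD; apply: par_crs => //.
    have [h1 _] := IH a ltac:(lia) ltac:(lia); exact: h1.
  have [h1 _] := IH (j - a)%N ltac:(lia) ltac:(lia); have := h1 (2 + q)%N qk; rewrite (_ : odd (2 + q) = odd q)//; by rewrite oddD.
split=> n nk.
  apply: eq_par (fun i => esym (E n i)) _; apply: par_sum => a; have aj : (a <= j)%N by have := ltn_ord a; lia.
  by apply: CP_par => p' q' _ _ e; rewrite (_ : n = p' + q')%N; [apply: parc; lia|lia].
have oe : odd n = false by apply: negbTE; lia.
apply: (@eq_par _ _ (fun i => \sum_(a < j.+1) 'C(j, a)%:R * (CP (PK a W) (V a) x n 0 0 i -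
    (if a == ord0 then crs b (at_ (PK j W) (2 + n) x) i else 0)))).
  move=> i; rewrite E; under eq_bigr do rewrite mulrBr; rewrite sumrB; congr (_ - _).
  rewrite big_ord_recl big1 ?addr0; last by move=> a _; rewrite mulr0.
  rewrite bin0 mul1r /=.
  have [_ h2] := IH j ltac:(lia) jk'.
  have := h2 (2 + n)%N ltac:(lia); move=> /(_ i); rewrite /crs => e.
  by apply/eqP; rewrite -subr_eq0; apply/eqP; rewrite -[RHS]e; ring.
apply: par_sum => a; have aj : (a <= j)%N by have := ltn_ord a; lia.
case: eqP => [a0|a0].
  have := @CP_top b false (PK a W) (V a) x n 0; rewrite addn0 => H.
  apply: eq_par (H _) => [i|p' q' pp _ e].
    rewrite a0 /V /= subn0; congr (_ - _); congr (crs _ _ _).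
    by apply/funext => i'; rewrite /PK /= W0.
  have := parc a p' q' aj; rewrite (_ : odd (p' + q') = false); last by rewrite e.
  by apply; lia.
have a1 : (1 <= a)%N by rewrite lt0n; apply/eqP => h0; apply: a0; exact: val_inj.
apply: (@eq_par _ _ (CP (PK a W) (V a) x n 0 0)) => [i|]; first by rewrite subr0.
apply: CP_par => p' q' _ _ e; have := parc a p' q' aj.
rewrite (_ : odd (p' + q') = false); last by rewrite e !addn0.
by apply; lia.
Qed.

Definition DP (U V : 'I_3 -> nat -> R -> R) x n p q : R := \sum_i PJ (U i) (V i) n p q x.
Lemma DPS U V x n p q : DP U V x n.+1 p q = DP U V x n p.+1 q + DP U V x n p q.+1.
Proof. by rewrite /DP -big_split. Qed.
Lemma DP0 U V x p q : DP U V x 0 p q = dt (at_ U p x) (at_ V q x).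
Proof. by []. Qed.

Lemma DP_0 U V x n p q :
  (forall p' q', (p <= p')%N -> (q <= q')%N -> (p' + q' = n + p + q)%N -> dt (at_ U p' x) (at_ V q' x) = 0) ->
  DP U V x n p q = 0.
Proof.
move=> h; apply: (@leib R +%R (DP U V x) (fun z => z = 0)) => //.
- exact: DPS.
- by move=> y z -> ->; rewrite addr0.
Qed.

(* differentiating |v|^2 = 1 an odd number of times *)
Lemma odd_par W b x n : dt b b = 1 -> (forall i, at_ W 0 x i = b i) -> odd n ->
  (forall i, (i < n)%N -> par b (odd i) (at_ W i x)) ->
  DP W W x n 0 0 = 0 -> par b true (at_ W n x).
Proof.
move=> b1 W0 on h D0.
have z k p q : (1 <= p)%N -> (1 <= q)%N -> (k + p + q = n)%N -> DP W W x k p q = 0.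
  move=> p1 q1 e; apply: DP_0 => p' q' pp qq e'; apply: (par_dot b1 (o := odd p')); first by apply: h; lia.
  rewrite (_ : ~~ odd p' = odd q'); first by apply: h; lia.
  have opq : odd (p' + q') by rewrite e' e.
  by move: opq; rewrite oddD; case: (odd p'); case: (odd q').
have r k p : (1 <= p)%N -> (k + p = n)%N -> DP W W x k p 0 = dt (at_ W n x) (at_ W 0 x).
  elim: k p => [|k IH] p p1 e; first by rewrite DP0 -e.
  by rewrite DPS (z k p 1%N)// ?addr0 ?IH//; lia.
have l k p : (1 <= p)%N -> (k + p = n)%N -> DP W W x k 0 p = dt (at_ W 0 x) (at_ W n x).
  elim: k p => [|k IH] p p1 e; first by rewrite DP0 -e.
  by rewrite DPS (z k 1%N p)// ?add0r ?IH//; lia.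
have n1 : n = n.-1.+1 by case: n on {h D0 z r l}.
have e1 : (n.-1 + 1)%N = n by rewrite addn1 -n1.
have D1 : DP W W x n.-1.+1 0 0 = 0 by rewrite -n1.
move: D1; rewrite DPS (r n.-1 1%N)// (l n.-1 1%N)//.
rewrite dtC (_ : at_ W 0 x = b); last exact/funext.
rewrite /par; move: (dt b _) => y h2; lra.
Qed.

Definition SP (f : nat -> R -> R) (V : 'I_3 -> nat -> R -> R) x n p q : 'I_3 -> R :=
  fun i => PJ f (V i) n p q x.

Lemma SP_par b o f V x n p q :
  (forall p' q', (p <= p')%N -> (q <= q')%N -> (p' + q' = n + p + q)%N -> par b o (fun i => f p' x * V i q' x)) ->
  par b o (SP f V x n p q).
Proof.
move=> h; apply: (@leib _ (fun u w i => u i + w i) (SP f V x) (par b o)) => //.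
by move=> u w; exact: par_D.
Qed.

(** Strong induction on the order. Odd orders come from |v|^2 = 1. At order 2k, P_k = 0 says that (b
    x)^k of the derivative is parallel to b, so that (b x)^(k+1) kills it, and [iter_crs_inj]
    applies. *)
Lemma parity W b x m : dt b b = 1 -> (forall i, at_ W 0 x i = b i) ->
  (forall n, odd n -> (n <= 2 * m)%N -> DP W W x n 0 0 = 0) ->
  (forall k, (1 <= k <= m)%N -> forall i, at_ (PK k W) 0 x i = 0) ->
  forall n, (n <= 2 * m)%N -> par b (odd n) (at_ W n x).
Proof.
move=> b1 W0 hD hP; elim/ltn_ind => n IH nm.
have IH' i : (i < n)%N -> par b (odd i) (at_ W i x) by move=> i_n; apply: IH => //; lia.
have [on|en] := boolP (odd n); first exact: (odd_par b1 W0 on IH' (hD n on nm)).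
have [->|n0] := eqVneq n 0%N.
  by rewrite (_ : at_ W 0 x = b); [move=> k; rewrite /crs; ring|exact/funext].
pose k := n./2; have ek : n = (2 * k)%N by rewrite /k mul2n even_halfK.
have k1 : (1 <= k <= m)%N by lia.
rewrite ek in IH'; have [_ h] := PK_par b1 W0 IH' (leqnn k).
have := h 0%N ltac:(lia); rewrite ek; set w := at_ W (2 * k) x => h'.
apply: (iter_crs_inj b1 (k := k)) => i /=; have := h' i; rewrite /crs !(hP k k1).
move=> e; rewrite -[RHS]oppr0 -e; ring.
Qed.

End Vec3.

(** * Orthonormal bases of the three-dimensional space *)

Section Orthonormal.
Context {R : realType}.
Implicit Types (u v b : 'I_3 -> R).

Definition onb (v e1 e2 : 'I_3 -> R) := [/\ dt v v = 1, dt e1 e1 = 1 & dt e2 e2 = 1] /\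
  [/\ dt v e1 = 0, dt v e2 = 0 & dt e1 e2 = 0].

Definition rows (v e1 e2 : 'I_3 -> R) : 'M[R]_3 := \matrix_(r, i) (if r == o0 then v i else if r == o1 then e1 i else e2 i).

(** A left inverse of a square matrix is a right inverse: orthonormal rows have orthonormal columns.
    The frame equations act on columns. *)
Lemma onb_col (v e1 e2 : 'I_3 -> R) : onb v e1 e2 ->
  forall i k, v i * v k + e1 i * e1 k + e2 i * e2 k = (i == k)%:R.
Proof.
move=> [[vv aa bb] [va vb ab]] i k.
have MM : rows v e1 e2 *m (rows v e1 e2)^T = 1%:M.
  apply/matrixP => r; have H (f g : 'I_3 -> R) : dt f g = \sum_j f j * g j by [].
  move: r; apply: ord3P; apply: ord3P; rewrite !mxE; under eq_bigr do rewrite !mxE /=; rewrite -H //.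
  - by rewrite dtC.
  - by rewrite dtC.
  - by rewrite dtC.
have /matrixP/(_ i k) := mulmx1C MM; rewrite !mxE sum3 !mxE /= => <-; ring.
Qed.

Lemma col_onb (v e1 e2 : 'I_3 -> R) : (forall i k, v i * v k + e1 i * e1 k + e2 i * e2 k = (i == k)%:R) -> onb v e1 e2.
Proof.
move=> h.
have MM : (rows v e1 e2)^T *m rows v e1 e2 = 1%:M.
  apply/matrixP => i k; rewrite !mxE sum3 !mxE /= -h; ring.
have /matrixP E := mulmx1C MM.
have H r r' : dt (rows v e1 e2 r) (rows v e1 e2 r') = (r == r')%:R.
  by have := E r r'; rewrite !mxE => <-; apply: eq_bigr => j _; rewrite !mxE.
have r0 : rows v e1 e2 o0 = v by apply/funext => j; rewrite mxE.
have r1 : rows v e1 e2 o1 = e1 by apply/funext => j; rewrite mxE.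
have r2 : rows v e1 e2 o2 = e2 by apply/funext => j; rewrite mxE.
have h00 := H o0 o0; have h11 := H o1 o1; have h22 := H o2 o2.
have h01 := H o0 o1; have h02 := H o0 o2; have h12 := H o1 o2.
rewrite r0 in h00; rewrite r1 in h11; rewrite r2 in h22.
rewrite r0 r1 in h01; rewrite r0 r2 in h02; rewrite r1 r2 in h12.
by split; split.
Qed.

Lemma onb_expand (v e1 e2 : 'I_3 -> R) u i : onb v e1 e2 -> u i = dt v u * v i + dt e1 u * e1 i + dt e2 u * e2 i.
Proof.
move=> o; have h := onb_col o.
transitivity (\sum_k (i == k)%:R * u k).
  by rewrite (bigD1 i)//= eqxx mul1r big1 ?addr0// => k ki; rewrite eq_sym (negbTE ki) mul0r.
under eq_bigr do rewrite -h; rewrite sum3 !dtE; ring.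
Qed.

Lemma perp_ex b : dt b b = 1 -> exists e, dt e e = 1 /\ dt b e = 0.
Proof.
move=> bb; have [z|z] := eqVneq (b o0 ^+ 2 + b o1 ^+ 2) 0.
  have b0 : b o0 = 0.
    apply/eqP; rewrite -sqrf_eq0 eq_le sqr_ge0 andbT -z lerDl sqr_ge0//.
  exists (fun i => (i == o0)%:R); rewrite !dtE b0 /=; split; ring.
have p : 0 < b o0 ^+ 2 + b o1 ^+ 2 by rewrite lt_def z addr_ge0 ?sqr_ge0.
pose c := Num.sqrt (b o0 ^+ 2 + b o1 ^+ 2).
have c0 : c != 0 by rewrite gt_eqF// sqrtr_gt0.
have cc : c ^+ 2 = b o0 ^+ 2 + b o1 ^+ 2 by rewrite sqr_sqrtr// ltW.
exists (fun i => if i == o0 then - b o1 / c else if i == o1 then b o0 / c else 0); rewrite !dtE /=; split.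
  by transitivity ((b o0 ^+ 2 + b o1 ^+ 2) / c ^+ 2); [field|rewrite -cc divff// expf_neq0].
by ring.
Qed.

Lemma crs_dt b e : dt b b = 1 -> dt e e = 1 -> dt b e = 0 ->
  [/\ dt b (crs b e) = 0, dt e (crs b e) = 0 & dt (crs b e) (crs b e) = 1].
Proof.
rewrite !dtE !crsE => bb ee be; split; [ring|ring|].
transitivity ((b o0 * b o0 + b o1 * b o1 + b o2 * b o2) * (e o0 * e o0 + e o1 * e o1 + e o2 * e o2)
   - (b o0 * e o0 + b o1 * e o1 + b o2 * e o2) ^+ 2); first by ring.
by rewrite bb ee be expr0n subr0 mulr1.
Qed.

(* an orthonormal basis with triple product one is right-handed: |v x e1 - e2|^2 = 1 - 2 + 1 *)
Lemma onb_crs (v e1 e2 : 'I_3 -> R) : onb v e1 e2 -> dt (crs v e1) e2 = 1 -> forall i, crs v e1 i = e2 i.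
Proof.
move=> [[vv aa bb] [va vb ab]] tr; have [_ _ cc] := crs_dt vv aa va.
have z : dt (fun i => crs v e1 i - e2 i) (fun i => crs v e1 i - e2 i) = 0.
  transitivity (dt (crs v e1) (crs v e1) - 2 * dt (crs v e1) e2 + dt e2 e2); first by rewrite !dtE; ring.
  by rewrite cc tr bb; ring.
move: z; rewrite dtE -!expr2 => z.
have p0 := sqr_ge0 (crs v e1 o0 - e2 o0); have p1 := sqr_ge0 (crs v e1 o1 - e2 o1).
have p2 := sqr_ge0 (crs v e1 o2 - e2 o2).
have h (y : R) : y ^+ 2 <= 0 -> y = 0 by move=> y0; apply/eqP; rewrite -sqrf_eq0 eq_le y0 sqr_ge0.
by apply: ord3P; apply/eqP; rewrite -subr_eq0; apply/eqP/h; lra.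
Qed.

Lemma onb_crs2 (v e1 e2 : 'I_3 -> R) : onb v e1 e2 -> (forall i, crs v e1 i = e2 i) -> forall i, crs v e2 i = - e1 i.
Proof.
move=> [[vv aa bb] [va vb ab]] h i; rewrite -(_ : crs v e1 = e2); last exact/funext.
move: vv va; rewrite !dtE => vv va; move: i; apply: ord3P; rewrite !crsE.
- transitivity ((v o0 * e1 o0 + v o1 * e1 o1 + v o2 * e1 o2) * v o0 - (v o0 * v o0 + v o1 * v o1 + v o2 * v o2) * e1 o0); [ring|by rewrite va vv; ring].
- transitivity ((v o0 * e1 o0 + v o1 * e1 o1 + v o2 * e1 o2) * v o1 - (v o0 * v o0 + v o1 * v o1 + v o2 * v o2) * e1 o1); [ring|by rewrite va vv; ring].
- transitivity ((v o0 * e1 o0 + v o1 * e1 o1 + v o2 * e1 o2) * v o2 - (v o0 * v o0 + v o1 * v o1 + v o2 * v o2) * e1 o2); [ring|by rewrite va vv; ring].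
Qed.

End Orthonormal.

(** * The parallel frame of the initial curve *)

Section DataFrame.
Context {R : realType}.
Variables (m : nat) (W : 'I_3 -> nat -> R -> R).
Hypothesis m1 : (1 <= m)%N.
Hypothesis jW : forall i, jet (2 * m + 1) (W i).
Hypothesis W1 : forall s, dt (at_ W 0 s) (at_ W 0 s) = 1.
Hypothesis hP : forall k, (1 <= k <= m)%N -> forall i, PK k W i 0%N 0 = 0 /\ PK k W i 0%N 1 = 0.

Lemma AC_dt (e e' g g' : 'I_3 -> R -> R) : (forall i, L2 (g i)) -> (forall i, L2 (g' i)) ->
  (forall i, AC (e i) (g i)) -> (forall i, AC (e' i) (g' i)) ->
  AC (fun s => dt (e^~ s) (e'^~ s)) (fun s => \sum_i (g i s * e' i s + e i s * g' i s)).
Proof.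
move=> Lg Lg' Ae Ae'.
have A i := ACM (Lg i) (Lg' i) (Ae i) (Ae' i); have L i := ACM_L2 (Lg i) (Lg' i) (Ae i) (Ae' i).
have H := ACD (L2D (L o0) (L o1)) (L o2) (ACD (L o0) (L o1) (A o0) (A o1)) (A o2).
move=> s; have := H s; rewrite !dtE /= => ->; congr (_ + _).
by apply: eq_prim => x _; rewrite sum3.
Qed.

Lemma prim_0 (g : R -> R) s : (forall x, g x = 0) -> prim g s = 0.
Proof. by move=> g0; rewrite prim_def -[RHS]int01_0; apply: eq_int01 => x _; rewrite g0 mulr0. Qed.

(** The derivative is 0 almost everywhere and continuous, hence 0 everywhere. *)
Lemma AC_const_0 (f g g' : R -> R) : (forall s, f s = f 0) -> L2 g -> AC f g -> L2 g' -> AC g g' ->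
  forall s, g s = 0.
Proof.
move=> fc Lg Af Lg' Ag.
have cg := AC_continuous Lg' Ag.
have Lf : L2 f by apply: (@eq_L2 _ (cst (f 0))); [move=> x _; rewrite fc|exact: L2_cst].
have d1 : is_wderiv 1 f g by apply: (AC_wderiv1 Lf Lg Af); exact: aeq_refl.
have A0 : AC f (cst 0) by move=> s; rewrite fc prim_0// addr0.
have d2 : is_wderiv 1 f (cst 0) by apply: (AC_wderiv1 Lf (L2_cst 0) A0); exact: aeq_refl.
have ae := wderiv_uniq d1 d2.
have z : forall s, 0 <= s <= 1 -> g s = 0.
  apply: cos_complete => // k; rewrite /coef (aeq_int01 (g := cst 0 \* ej k 0)).
  - rewrite -[RHS](int01_0 (R := R)); apply: eq_int01 => x _; by rewrite /= mul0r.
  - by apply: L2_meas; apply: cont_L2; apply: contM => //; exact: ej_continuous.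
  - by apply: L2_meas; apply: cont_L2; apply: contM; [exact: cst_continuous|exact: ej_continuous].
  - exact: aeqM ae (aeq_refl _).
move=> s; have [s0|s0] := leP s 0; first by rewrite (AC_clip_le0 Ag s0) z// lexx ler01.
have [s1|s1] := leP 1 s; first by rewrite (AC_clip_ge1 Ag s1) z// lexx ler01.
by rewrite z// !ltW.
Qed.

Lemma DW0 n s : (1 <= n)%N -> (n <= 2 * m)%N -> DP W W s n 0 0 = 0.
Proof.
pose D : nat -> R -> R := jD (jD (jM (W o0) (W o0)) (jM (W o1) (W o1))) (jM (W o2) (W o2)).
have DE n' x : D n' x = DP W W x n' 0 0 by rewrite /D /jD /DP sum3.
have mm : (1 <= 2 * m + 1)%N by lia.
have jD' : jet (2 * m + 1) D by apply: jet_D; [apply: jet_D|]; exact: jet_M.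
have D0 x : D 0%N x = 1 by rewrite DE DP0 W1.
suff H k : (k <= 2 * m)%N -> forall i x, (1 <= i <= k)%N -> D i x = 0.
  by move=> n1 nm; rewrite -DE; apply: (H n) => //; rewrite n1 leqnn.
elim: k => [|k IH] km i x; first by lia.
have [->|ne] := eqVneq i k.+1; last by move=> h; apply: IH; lia.
move=> _; have h y : D k y = D k 0.
  case: (k) IH km => [|k'] IH km; first by rewrite !D0.
  by rewrite !IH//; lia.
have i1 : (k < 2 * m + 1)%N by lia. have i2 : (k.+1 < 2 * m + 1)%N by lia.
exact: (AC_const_0 h (jet_L2 jD' i1) (jet_AC jD' i1) (jet_L2 jD' i2) (jet_AC jD' i2)).
Qed.

Let W0c i : continuous (W i 0%N). Proof. by apply: jet_continuous (jW i) _; lia. Qed.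
Let W1c i : continuous (W i 1%N). Proof. by apply: jet_continuous (jW i) _; lia. Qed.
Let WA i : AC (W i 0%N) (W i 1%N). Proof. by apply: jet_AC (jW i) _; lia. Qed.

Lemma dt_WW1 s : dt (at_ W 0 s) (at_ W 1 s) = 0.
Proof.
have := @DW0 1%N s isT ltac:(lia); rewrite DPS !DP0 dtC => h.
move: (dt _ _) h => y; lra.
Qed.

Definition qf (e : 'I_3 -> R -> R) (s : R) : R := dt (e^~ s) (at_ W 1 s).
(** Relatively parallel normal fields: the derivative of [e] is along the curve of directions v
    itself, so angles between such fields are constant. *)
Definition tfield (e : 'I_3 -> R -> R) := [/\ forall i, continuous (e i),
  forall i, AC (e i) (fun s => - (qf e s * W i 0%N s)) & forall s, dt (e^~ s) (at_ W 0 s) = 0].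

Lemma qf_continuous e : (forall i, continuous (e i)) -> continuous (qf e).
Proof.
move=> ce s; rewrite /qf; under eq_fun do rewrite dtE.
by do 2 ?apply: cvgD; apply: cvgM; (exact: ce || exact: W1c).
Qed.

Let cder e i : (forall i, continuous (e i)) -> L2 (fun s => - (qf e s * W i 0%N s)).
Proof. by move=> ce; apply: L2N; apply: cont_L2; apply: contM; [exact: qf_continuous|exact: W0c]. Qed.

(** Solve the linear equation e' = - (e . v') v; as |v| = 1, the product e . v has derivative 0. *)
Lemma tfield_ex e0 : dt e0 (at_ W 0 0) = 0 -> exists e, tfield e /\ forall i, e i 0 = e0 i.
Proof.
move=> e0b; pose A i k (s : R) := - (W i 0%N s * W k 1%N s).
have [i k|e [ei ce Ae]] := @lin_ode R 'I_3 A e0.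
  by move=> s; apply: cvgN; apply: cvgM; [exact: W0c|exact: W1c].
have Ae' i : AC (e i) (fun s => - (qf e s * W i 0%N s)).
  by apply: AC_eq (Ae i) => s; rewrite /A /qf dtE sum3 /at_; ring.
exists e; split => //; split => //.
have H := AC_dt (fun i => cder i ce) (fun i => jet_L2 (jW i) (i := 1%N) ltac:(lia)) Ae' WA.
move=> s; have := H s; rewrite /= => h.
rewrite [LHS]h (_ : dt (e^~ 0) (at_ W 0 0) = 0) ?add0r; last first.
  by rewrite (_ : e^~ 0 = e0)//; apply/funext => i; exact: ei.
apply: prim_0 => x; have w1 := W1 x; move: w1; rewrite !dtE sum3 /qf dtE /at_ => w1.
set q := _ + e o2 x * _.
transitivity (- q * (W o0 0%N x * W o0 0%N x + W o1 0%N x * W o1 0%N x + W o2 0%N x * W o2 0%N x) + q); first by rewrite /q; ring.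
by rewrite w1 mulr1 addNr.
Qed.

Lemma tfield_dt e e' : tfield e -> tfield e' -> forall s, dt (e^~ s) (e'^~ s) = dt (e^~ 0) (e'^~ 0).
Proof.
move=> [ce Ae he] [ce' Ae' he'] s.
rewrite [LHS](AC_dt (fun i => cder i ce) (fun i => cder i ce') Ae Ae' s) prim_0 ?addr0// => x.
have h1 := he x; have h2 := he' x; move: h1 h2; rewrite !dtE sum3 /at_ => h1 h2.
transitivity (- qf e x * (e' o0 x * W o0 0%N x + e' o1 x * W o1 0%N x + e' o2 x * W o2 0%N x) -
  qf e' x * (e o0 x * W o0 0%N x + e o1 x * W o1 0%N x + e o2 x * W o2 0%N x)); first by ring.
by rewrite h1 h2 !mulr0 subrr.
Qed.

(* reflecting the curve at an end point of I negates the field *)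
Lemma tfield_even e : tfield e -> exists q, evenjet m q /\ forall s, q 0%N s = qf e s.
Proof.
move=> [ce Ae he].
have pW x : x = 0 \/ x = 1 -> forall n, (n <= 2 * m)%N -> par (at_ W 0 x) (odd n) (at_ W n x).
  move=> hx; apply: parity => //.
    by move=> n on nm; apply: DW0 => //; case: n on {nm}.
  by move=> k km i; have [h0 h1] := hP km i; case: hx => ->.
pose good k (JE : 'I_3 -> nat -> R -> R) := [/\ forall i, JE i 0%N = e i, forall i, jet k (JE i) &
  forall x, x = 0 \/ x = 1 -> forall n, (n < k)%N -> par (at_ W 0 x) (~~ odd n) (at_ JE n x)].
pose qJ (JE : 'I_3 -> nat -> R -> R) : nat -> R -> R := fun n s => DP JE (fun i k => W i (1 + k)%N) s n 0 0.
have qj k JE : (1 <= k <= 2 * m)%N -> good k JE -> [/\ jet k (qJ JE), forall s, qJ JE 0%N s = qf e s &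
    forall x, x = 0 \/ x = 1 -> forall n, (n < k)%N -> odd n -> qJ JE n x = 0].
  move=> km [J0 jJ pJ]; have jW' i : jet k (fun n => W i (1 + n)%N).
    by apply: jet_shift; apply: jet_le (jW i); lia.
  have k1 : (1 <= k)%N by lia.
  split.
  - have : jet k (jD (jD (jM (JE o0) (fun n => W o0 (1 + n)%N)) (jM (JE o1) (fun n => W o1 (1 + n)%N))) (jM (JE o2) (fun n => W o2 (1 + n)%N))).
      by apply: jet_D; [apply: jet_D|]; exact: jet_M.
    by apply: eq_jet' => n s; rewrite /qJ /DP sum3.
  - move=> s; rewrite /qJ DP0 /qf; congr (dt _ _); by apply/funext => i; rewrite /at_ J0.
  - move=> x hx n nk on; rewrite /qJ; apply: DP_0 => p q _ _ e1.
    apply: (par_dot (W1 x) (o := ~~ odd p)); first by apply: pJ => //; lia.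
    rewrite negbK (_ : odd p = odd (1 + q)); last first.
      have opq : odd (p + q) by rewrite e1 !addn0.
      by move: opq; rewrite oddD /=; case: (odd p); case: (odd q).
    by apply: (pW x hx (1 + q)%N); lia.
have par0 x : par (at_ W 0 x) true (fun i => e i x) by rewrite /= dtC.
(* Regularity and parity of [e] and [q] grow together: a jet of [e] gives one of [q] of the same
   order, and e' = - q v then gives one more order for [e]. *)
have H k : (k < 2 * m)%N -> exists JE, good k.+1 JE.
  elim: k => [_|k IH km].
    exists (fun i => jcons (e i) (fun _ s => - (qf e s * W i 0%N s))); split => //.
      by move=> i; apply: jet_cons; [exact: Ae|split => //; exact: cder].
    by move=> x hx [|//] _; exact: par0.
  have [JE gJ] := IH ltac:(lia); have km' : (1 <= k.+1 <= 2 * m)%N by lia.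
  have [jq q0 pq] := qj _ _ km' gJ.
  exists (fun i => jcons (e i) (jZ (-1) (jM (qJ JE) (W i)))); split => //.
    move=> i; apply: jet_cons; first by apply: AC_eq (Ae i) => s; rewrite /jZ /jM /= q0 mulN1r.
    by apply/jet_Z/jet_M => //; apply: jet_le (jW i); lia.
  move=> x hx [|n] nk; first exact: par0.
  rewrite /= negbK; apply: (@eq_par _ _ _ (fun i => -1 * SP (qJ JE) W x n 0 0 i)) => [//|].
  apply: par_Z; apply: SP_par => p q _ _ e1.
  have [op|ep] := boolP (odd p).
    by apply: eq_par (par_0 _ _) => i; rewrite pq ?mul0r//; lia.
  apply: par_Z; rewrite (_ : odd n = odd q); first by apply: (pW x hx q); lia.
  have -> : n = (p + q)%N by lia.
  by rewrite oddD (negbTE ep).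
have [JE gJ] := H (2 * m).-1 ltac:(lia); rewrite (_ : (2 * m).-1.+1 = 2 * m)%N in gJ; last by lia.
have km' : (1 <= 2 * m <= 2 * m)%N by lia.
have [jq q0 pq] := qj _ _ km' gJ.
exists (qJ JE); split => //; split => // i im oi.
by split; apply: pq => //; [left|right].
Qed.

(** The two fields start from a unit normal and its cross product with v, and stay orthonormal;
    expanding v' in the basis, without component along v, gives the frame equations. *)
Theorem data_frame : exists (q : bool -> nat -> R -> R) (e1 e2 : 'I_3 -> R -> R),
  [/\ forall j, evenjet m (q j),
      forall i, Ksys (q false 0%N) (q true 0%N) (fun=> 0) (fun=> 0) (fun=> 0) (W i 0%N) (e1 i) (e2 i),
      forall i, continuous (e1 i) /\ continuous (e2 i),
      onb (at_ W 0 0) (e1^~ 0) (e2^~ 0) &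
      forall i, e2 i 0 = crs (at_ W 0 0) (e1^~ 0) i].
Proof.
have [e0 [ee be]] := perp_ex (W1 0).
have [bf ef ff] := crs_dt (W1 0) ee be.
have [e1 [t1 i1]] := @tfield_ex e0 ltac:(by rewrite dtC).
have [e2 [t2 i2]] := @tfield_ex (crs (at_ W 0 0) e0) ltac:(by rewrite dtC).
have [q1 [eq1 q1E]] := tfield_even t1; have [q2 [eq2 q2E]] := tfield_even t2.
have E1 : e1^~ 0 = e0 by apply/funext.
have E2 : e2^~ 0 = crs (at_ W 0 0) e0 by apply/funext.
have o s : onb (at_ W 0 s) (e1^~ s) (e2^~ s).
  have [_ _ h1] := t1; have [_ _ h2] := t2.
  split; split; rewrite ?W1 ?(tfield_dt t1 t1) ?(tfield_dt t2 t2) ?(tfield_dt t1 t2) ?E1 ?E2 //.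
    by rewrite dtC.
  by rewrite dtC.
exists (fun j => if j then q2 else q1), e1, e2; split.
- by case.
- move=> i; have [c1 A1 h1] := t1; have [c2 A2 h2] := t2; split.
  + apply: AC_eq (WA i) => s; rewrite addr0 q1E q2E.
    rewrite -[LHS]/(at_ W 1 s i) (onb_expand (at_ W 1 s) i (o s)) dt_WW1 mul0r add0r.
    by rewrite /qf.
  + by apply: AC_eq (A1 i) => s; rewrite addr0 q1E.
  + by apply: AC_eq (A2 i) => s; rewrite addr0 q2E.
- by move=> i; have [c1 _ _] := t1; have [c2 _ _] := t2.
- exact: o.
- by move=> i; rewrite E1 -E2.
Qed.

End DataFrame.

(** * The flow rebuilt from the Schroedinger equation *)

Section Evolution.
Context {R : realType}.

Lemma aeq_cont01 (g g' : R -> R) : continuous g -> continuous g' -> aeq g g' ->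
  forall s, 0 <= s <= 1 -> g s = g' s.
Proof.
move=> cg cg' ae s s01; apply/eqP; rewrite -subr_eq0; apply/eqP; move: s s01.
have cd : continuous (g \- g') by move=> s; apply: cvgB; [exact: cg|exact: cg'].
apply: (cos_complete cd) => k; rewrite /coef (aeq_int01 (g := cst 0 \* ej k 0)).
- rewrite -[RHS](int01_0 (R := R)); apply: eq_int01 => x _; by rewrite /= mul0r.
- by apply: L2_meas; apply: cont_L2; apply: contM => //; exact: ej_continuous.
- by apply: L2_meas; apply: cont_L2; apply: contM; [exact: cst_continuous|exact: ej_continuous].
- apply: aeqM (aeq_refl _); have h := aeqB ae (aeq_refl g').
  by apply: aeq_trans h _; apply: eq_aeq => x _ /=; rewrite subrr.
Qed.

Lemma AC_uniq01 (f g g' : R -> R) : L2 f -> AC f g -> AC f g' -> continuous g -> continuous g' ->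
  forall s, 0 <= s <= 1 -> g s = g' s.
Proof.
move=> Lf Ag Ag' cg cg'; apply: aeq_cont01 => //.
have d1 : is_wderiv 1 f g by apply: (AC_wderiv1 Lf (cont_L2 cg) Ag); exact: aeq_refl.
have d2 : is_wderiv 1 f g' by apply: (AC_wderiv1 Lf (cont_L2 cg') Ag'); exact: aeq_refl.
exact: wderiv_uniq d1 d2.
Qed.

Local Notation zf := (fun _ : R => 0 : R).

Lemma Ksys_uniq (q1 q2 x y z x' y' z' : R -> R) : continuous q1 -> continuous q2 ->
  continuous x -> continuous y -> continuous z -> continuous x' -> continuous y' -> continuous z' ->
  Ksys q1 q2 zf zf zf x y z -> Ksys q1 q2 zf zf zf x' y' z' ->
  x 0 = x' 0 -> y 0 = y' 0 -> z 0 = z' 0 -> forall s, x s = x' s.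
Proof.
move=> c1 c2 cx cy cz cx' cy' cz' K K' ix iy iz s.
have L0 : L2 zf := L2_cst 0.
have Kd := Ksys_lin c1 c2 (-1) L0 L0 L0 cx cy cz L0 L0 L0 cx' cy' cz' K K'.
have cc (f g : R -> R) : continuous f -> continuous g -> continuous (fun s => -1 * f s + g s).
  by move=> cf cg u; apply: cvgD; [apply: cvgM; [exact: cvg_cst|exact: cf]|exact: cg].
have LL : L2 (fun s : R => -1 * 0 + 0 : R) := L2D (L2Z (-1) L0) L0.
have n0 : L2norm (fun s : R => -1 * 0 + 0 : R) = 0.
  by rewrite -[RHS](L2norm0 (R := R)); apply: eq_L2norm => u _; rewrite mulr0 addr0.
have := Ksys_sup c1 c2 LL LL LL (cc _ _ cx cx') (cc _ _ cy cy') (cc _ _ cz cz') Kd.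
have zz (w : R) : -1 * w + w = 0 by ring.
rewrite ix iy iz => /(_ (zz _) (zz _) (zz _) s) [+ _ _].
rewrite !n0 !addr0 mulr0 normr_le0 => /eqP h; apply/eqP; rewrite -subr_eq0 -oppr_eq0; apply/eqP.
by rewrite -h; ring.
Qed.

Lemma triple_sqr (v e1 e2 : 'I_3 -> R) : onb v e1 e2 -> dt (crs v e1) e2 ^+ 2 = 1.
Proof.
move=> o; have [[vv aa bb] [va vb ab]] := o; have [h1 h2 h3] := crs_dt vv aa va.
pose T := dt (crs v e1) e2.
have e i := onb_expand (crs v e1) i o.
have ec : crs v e1 = fun i => T * e2 i.
  by apply/funext => i; rewrite e h1 h2 !mul0r !add0r (dtC e2).
have t2 (c : R) : dt (fun i => c * e2 i) (fun i => c * e2 i) = c ^+ 2 * dt e2 e2 by rewrite !dtE; ring.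
by rewrite -/T; move: h3; rewrite ec t2 bb mulr1.
Qed.

Variables (m : nat) (W : 'I_3 -> nat -> R -> R).
Hypothesis m1 : (1 <= m)%N.
Hypothesis jW : forall i, jet (2 * m + 1) (W i).
Hypothesis W1 : forall s, dt (at_ W 0 s) (at_ W 0 s) = 1.
Hypothesis hP : forall k, (1 <= k <= m)%N -> forall i, PK k W i 0%N 0 = 0 /\ PK k W i 0%N 1 = 0.

Theorem evolution : exists V : R -> 'I_3 -> nat -> R -> R,
  [/\ forall i, CJ (2 * m).+1 (fun t => V t i),
      forall t s, 0 <= t -> 0 <= s <= 1 -> dt (at_ (V t) 0 s) (at_ (V t) 0 s) = 1,
      forall i s, V 0 i 0%N s = W i 0%N s,
      forall t i, 0 <= t -> V t i 0%N 0 = W i 0%N 0 /\ V t i 0%N 1 = W i 0%N 1 &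
      forall t i, 0 <= t -> L2norm (fun s => (r - t)^-1 * (V r i 0%N s - V t i 0%N s) -
          crs (at_ (V t) 0 s) (at_ (V t) 2 s) i) @[r --> N1 t] --> (0 : R)].
Proof.
have [q [e1 [e2 [eq K0 ce o0' e2E]]]] := data_frame m1 jW W1 hP.
have [Q [eQ Q0 cQ dQ]] := NLS_global m1 eq.
have cq t j : 0 <= t -> continuous (Q t j 0%N).
  by move=> t0; have [jq _] := eQ t j t0; apply: jet_continuous jq _; lia.
(* At each time the three Cartesian components of the frame solve the same scalar system, from the
   frame of the data at s = 0; at negative times the choice is arbitrary. *)
have exX (p : 'I_3 * R) : exists X : (R -> R) * (R -> R) * (R -> R), 0 <= p.2 ->
   [/\ Ksys (Q p.2 false 0%N) (Q p.2 true 0%N) zf zf zf X.1.1 X.1.2 X.2,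
      [/\ continuous X.1.1, continuous X.1.2 & continuous X.2] &
      [/\ X.1.1 0 = W p.1 0%N 0, X.1.2 0 = e1 p.1 0 & X.2 0 = e2 p.1 0]].
  have [t0|nt] := pselect (0 <= p.2); last by exists (zf, zf, zf) => /nt.
  have [x [y [z [K c i]]]] := Ksys_ex (W p.1 0%N 0) (e1 p.1 0) (e2 p.1 0) (cq p.2 false t0) (cq p.2 true t0).
  by exists (x, y, z).
have [X HX] := choice exX.
pose x i t := (X (i, t)).1.1; pose y i t := (X (i, t)).1.2; pose z i t := (X (i, t)).2.
have KX i t : 0 <= t -> Ksys (Q t false 0%N) (Q t true 0%N) zf zf zf (x i t) (y i t) (z i t).
  by move=> t0; have [] := HX (i, t) t0.
have cX i t : 0 <= t -> [/\ continuous (x i t), continuous (y i t) & continuous (z i t)].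
  by move=> t0; have [] := HX (i, t) t0.
have iX i t : 0 <= t -> [/\ x i t 0 = W i 0%N 0, y i t 0 = e1 i 0 & z i t 0 = e2 i 0].
  by move=> t0; have [] := HX (i, t) t0.
have exJ i := frame_jets m1 eQ (fun t j => @cQ t j) (KX i) (cX i) (iX i) (leqnn (2 * m)).
have [J HJ] := choice exJ.
pose V t i := J i t.
have V0 t i : V t i 0%N = x i t by have [JY [JZ [_ h]]] := HJ i; have [] := h t.
have cJ i : CJ (2 * m).+1 (fun t => V t i) by have [JY [JZ [[h _ _] _]]] := HJ i.
have L0 : L2 zf := L2_cst 0.
have ob t s : 0 <= t -> onb (fun i => x i t s) (fun i => y i t s) (fun i => z i t s).
  move=> t0; apply: col_onb => i k.
  have [c1 c2 c3] := cX i t t0; have [c1' c2' c3'] := cX k t t0.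
  rewrite (Ksys_inner (cq t false t0) (cq t true t0) L0 L0 L0 c1 c2 c3 c1' c2' c3' (KX i t t0) (KX k t t0)).
  rewrite prim_0 ?addr0; last by move=> u; ring.
  have [-> -> ->] := iX i t t0; have [-> -> ->] := iX k t t0.
  exact: (onb_col o0').
(* The triple product is 1 or -1, continuous in s and 1 at s = 0, so it stays 1 by the intermediate
   value theorem. *)
have rh t s : 0 <= t -> 0 <= s <= 1 -> forall i, crs (fun i => x i t s) (fun i => y i t s) i = z i t s.
  move=> t0 /andP[s0 s1]; apply: onb_crs; first exact: ob.
  pose Tr u := dt (crs (fun i => x i t u) (fun i => y i t u)) (fun i => z i t u).
  have T2 u : Tr u ^+ 2 = 1 by apply: triple_sqr; exact: ob.
  have T0 : Tr 0 = 1.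
    have [[vv aa bb] _] := o0'; rewrite -bb; congr (dt _ _); apply/funext => i; last by have [_ _ ->] := iX i t t0.
    rewrite e2E /crs; have [a1 b1 _] := iX (i + 1) t t0; have [a2 b2 _] := iX (i + 2%:R) t t0.
    by rewrite a1 b1 a2 b2.
  have cx i u : {for u, continuous (x i t)} by have [h _ _] := cX i t t0; exact: h.
  have cy i u : {for u, continuous (y i t)} by have [_ h _] := cX i t t0; exact: h.
  have cz i u : {for u, continuous (z i t)} by have [_ _ h] := cX i t t0; exact: h.
  have cT : continuous Tr.
    move=> u; rewrite /Tr; under eq_fun do rewrite dtE !crsE.
    by do 2 ?apply: cvgD; apply: cvgM; try exact: cz; apply: cvgB; apply: cvgM; (exact: cx || exact: cy).
  have : Tr s = 1 \/ Tr s = -1.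
    have /eqP := T2 s; rewrite sqrf_eq1 => /orP[/eqP|/eqP]; [left|right] => //.
  case=> // Ts; exfalso.
  have := @IVT R Tr 0 s 0 s0 (continuous_subspaceT cT); rewrite T0 Ts.
  have -> : Num.min 1 (-1) = -1 :> R by apply/min_idPr; lra.
  have -> : Num.max 1 (-1) = 1 :> R by apply/max_idPl; lra.
  move=> /(_ ltac:(by apply/andP; split; lra)) [u _ Tu].
  by have := T2 u; rewrite Tu expr0n /= => /eqP; rewrite eq_sym oner_eq0.
have rh2 t s : 0 <= t -> 0 <= s <= 1 -> forall i, crs (fun i => x i t s) (fun i => z i t s) i = - y i t s.
  by move=> t0 s01; apply: onb_crs2; [exact: ob|exact: rh].
have jq t j : 0 <= t -> jet (2 * m) (Q t j) by move=> t0; have [] := eQ t j t0.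
have jV t i : 0 <= t -> jet (2 * m).+1 (V t i) by move=> t0; have [] := cJ i t t0.
(* [frame_jets] only specifies the entry of order 0; the next two are identified as its unique
   continuous derivatives. *)
have V1 t i : 0 <= t -> forall s, 0 <= s <= 1 -> V t i 1%N s = Q t false 0%N s * y i t s + Q t true 0%N s * z i t s.
  move=> t0; have [c1 c2 c3] := cX i t t0; have [ax ay az] := KX i t t0.
  apply: (AC_uniq01 (f := x i t)).
  - exact: cont_L2.
  - by rewrite -V0; apply: jet_AC (jV t i t0) _.
  - by apply: AC_eq ax => s; rewrite addr0.
  - by apply: jet_continuous (jV t i t0) _; lia.
  - by move=> s; apply: cvgD; apply: cvgM; (exact: cq || exact: c2 || exact: c3).
have V2 t i : 0 <= t -> forall s, 0 <= s <= 1 -> V t i 2 s =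
   Q t false 1%N s * y i t s + Q t true 1%N s * z i t s - (Q t false 0%N s ^+ 2 + Q t true 0%N s ^+ 2) * x i t s.
  move=> t0; have [c1 c2 c3] := cX i t t0; have [ax ay az] := KX i t t0.
  have i0 : (0 < 2 * m)%N by lia. have i1 : (1 < 2 * m)%N by lia.
  have cq1 j : continuous (Q t j 1%N) := jet_continuous (jq t j t0) i1.
  have [l1 l2 l3] := Ksys_L2 (cq t false t0) (cq t true t0) L0 L0 L0 c1 c2 c3.
  have A0 j := jet_AC (jq t j t0) i0; have L1' j : L2 (Q t j 1%N) := cont_L2 (cq1 j).
  have A1 := ACD (ACM_L2 (L1' false) l2 (A0 false) ay) (ACM_L2 (L1' true) l3 (A0 true) az) (ACM (L1' false) l2 (A0 false) ay) (ACM (L1' true) l3 (A0 true) az).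
  have AV := jet_AC (jV t i t0) (i := 1%N) ltac:(lia).
  pose f' s := Q t false 1%N s * y i t s + Q t true 1%N s * z i t s - (Q t false 0%N s ^+ 2 + Q t true 0%N s ^+ 2) * x i t s.
  have cf' : continuous f'.
    move=> s; apply: cvgB; first by apply: cvgD; apply: cvgM; (exact: cq1 || exact: c2 || exact: c3).
    apply: cvgM; last exact: c1.
    by apply: cvgD; (under eq_fun do rewrite expr2; apply: cvgM; exact: cq).
  have V101 s : 0 <= s <= 1 -> V t i 1%N s = Q t false 0%N s * y i t s + Q t true 0%N s * z i t s by exact: V1.
  have AV' : AC (V t i 1%N) f'.
    have h s : 0 <= s <= 1 -> V t i 1%N s = V t i 1%N 0 + prim f' s.
      move=> s01; rewrite V101// V101 ?lexx ?ler01//; have := A1 s; rewrite /= => ->; congr (_ + _).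
      by apply: eq_prim => u _; rewrite /f' /=; ring.
    have h' := AC_of_01 h; move=> s; have := h' s; rewrite /=.
    have cl : V t i 1%N (clip s) = V t i 1%N s.
      have [s0|s0] := leP s 0; first by rewrite (AC_clip_le0 AV s0) /clip min_l ?(le_trans s0 ler01)// max_l.
      have [s1|s1] := leP 1 s; first by rewrite (AC_clip_ge1 AV s1) /clip min_r// max_r.
      by rewrite clipE// !ltW.
    by rewrite cl clipE// lexx ler01.
  apply: (AC_uniq01 (f := V t i 1%N)) => //.
  - by apply: jet_L2 (jV t i t0) _; lia.
  - by apply: jet_continuous (jV t i t0) _; lia.
have gE t i s : 0 <= t -> 0 <= s <= 1 ->
    crs (at_ (V t) 0 s) (at_ (V t) 2 s) i = gx Q (y i) (z i) t s.
  move=> t0 s01; have h1 := rh t s t0 s01 i; have h2 := rh2 t s t0 s01 i.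
  rewrite /gx -h1 -(opprK (y i t s)) -h2 /crs /at_ !V0 !(V2 t _ t0 s s01); ring.
have dx i t s r := @x_derive R m Q m1 eQ _ _ _ _ _ _ (KX i) (cX i) (iX i) t r s.
have dc i t (t0 : 0 <= t) := ex_err_cvg (fun t j => @cQ t j) (fun t j => @dQ t j) (W i 0%N 0) (e1 i 0) (e2 i 0) t0.
have V0E i s : V 0 i 0%N s = W i 0%N s.
  have [c1 c2 c3] := cX i 0 (lexx 0); have [d1 d2] := ce i.
  have [ix iy iz] := iX i 0 (lexx 0).
  have E j : Q 0 j 0%N = q j 0%N by apply/funext => u; exact: Q0.
  have := KX i 0 (lexx 0); rewrite !E V0 => K1.
  have cq' j : continuous (q j 0%N) by rewrite -E; exact: cq.
  have cW : continuous (W i 0%N) by apply: jet_continuous (jW i) _; lia.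
  exact: (Ksys_uniq (cq' false) (cq' true) c1 c2 c3 cW d1 d2 K1 (K0 i)).
exists V; split => //.
- by move=> t s t0 s01; have [[h _ _] _] := ob t s t0; rewrite /at_ -[RHS]h; congr (dt _ _); apply/funext => i; rewrite V0.
- move=> t i t0; split; first by rewrite V0; have [] := iX i t t0.
  rewrite -V0E !V0; apply: (@const_of_o R (fun t => x i t 1) t); last by rewrite t0 lexx.
  move=> r /andP[r0 _]; apply: cvg0_nearle (dc i r r0).
  apply: filterS2 (near_N1_neq r) (near_N1_ge0 r) => w wr w0.
  have := dx i r 1 w r0 w0 wr.
  (* At s = 1 the Neumann condition makes the velocity 0, so the boundary value is constant in
     time. *)
  have z1 j : Q r j 1%N 1 = 0 by have [_ o] := eQ r j r0; have [_ ->] := o 1%N ltac:(lia) isT.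
  by rewrite /gx !z1 oppr0 !mul0r addr0 subr0.
- move=> t i t0; apply: cvg0_nearle (dc i t t0).
  apply: filterS2 (near_N1_neq t) (near_N1_ge0 t) => r rt r0.
  rewrite ger0_norm ?L2norm_ge0//.
  rewrite (eq_L2norm (g := fun s => (r - t)^-1 * (x i r s - x i t s) - gx Q (y i) (z i) t s)); last first.
    by move=> s /I01_01 s01; rewrite gE// !V0.
  have [c1 c2 c3] := cX i t t0; have [c1' _ _] := cX i r r0.
  apply: L2norm_bounded; last by move=> s _; exact: dx.
  apply: cont_meas => s; apply: cvgB.
    by apply: cvgM; [exact: cvg_cst|apply: cvgB; [exact: c1'|exact: c1]].
  have cq1 j : continuous (Q t j 1%N) by apply: jet_continuous (jq t j t0) _; lia.
  apply: cvgD; apply: cvgM; [apply: cvgN; exact: cq1|exact: c2|exact: cq1|exact: c3].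
Qed.

End Evolution.

(** * Sine coefficients *)

Section SineSeries.
Context {R : realType}.
Implicit Types (f g : R -> R).

(** Up to sign the normalised sine coefficient; it is 0 for k = 0. *)
Definition scoef f k : R := int01 (f \* ej k 1) / lam k.

Lemma lam_gt0 k : (0 < k)%N -> 0 < lam k :> R.
Proof. by move=> k0; rewrite /lam mulr_gt0 ?pi_gt0// ltr0n. Qed.

Lemma ej01 s : ej 0 1 s = 0 :> R.
Proof. by rewrite /ej /lam mulr0 expr1 mulr0 mul0r. Qed.

Lemma int01_ej01 f : int01 (f \* ej 0 1) = 0.
Proof. by rewrite -[RHS](int01_0 (R := R)); apply: eq_int01 => x _; rewrite /= ej01 mulr0. Qed.

Lemma scoefM f k : scoef f k / lam k * int01 (f \* ej k 1) = scoef f k ^+ 2.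
Proof.
rewrite /scoef; case: k => [|k]; first by rewrite int01_ej01 !mul0r expr0n.
by field; rewrite gt_eqF// lam_gt0.
Qed.

Lemma scoef_lam f k : scoef f k / lam k * lam k ^+ 1 = scoef f k.
Proof.
case: k => [|k]; first by rewrite /scoef int01_ej01 !mul0r.
by rewrite expr1 mulfVK// gt_eqF// lam_gt0.
Qed.

Lemma bessel_sin f n : L2 f -> \sum_(k < n) scoef f k ^+ 2 <= L2norm f ^+ 2.
Proof.
move=> Lf; pose S := Sf (fun k => scoef f k / lam k) 1 n.
have LS : L2 S by exact: Sf_L2.
have Ld : L2 (f \- S) by exact: L2B.
have : 0 <= L2norm (f \- S) ^+ 2 := sqr_ge0 _.
rewrite L2norm_sqr//.
rewrite (eq_int01 (g := ((f \* f) \+ (S \* S)) \- (fun x => 2 * (S \* f) x))); last by move=> x _ /=; ring.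
rewrite int01B; [|by apply: L1D; exact: L1M|by apply: L1Z; exact: L1M].
rewrite int01D; [|exact: L1M|exact: L1M].
rewrite int01Z; last exact: L1M.
rewrite -!L2norm_sqr// Sf_norm int01_Sf//.
have -> : \sum_(k < n) (scoef f k / lam k * lam k ^+ 1) ^+ 2 = \sum_(k < n) scoef f k ^+ 2.
  by apply: eq_bigr => k _; rewrite scoef_lam.
have -> : \sum_(k < n) scoef f k / lam k * int01 (ej k 1 \* f) = \sum_(k < n) scoef f k ^+ 2.
  by apply: eq_bigr => k _; rewrite int01_mulC scoefM.
move: (\sum_(_ < n) _) (_ ^+ 2) => x y; lra.
Qed.

(** By parts the primitive of [f] has no cosine coefficient except the constant one, so it is
    constant. *)
Lemma sin_complete f : L2 f -> (forall k, int01 (f \* ej k 1) = 0) -> aeq f (cst 0).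
Proof.
move=> Lf h; have AP : AC (prim f) f by move=> s; rewrite prim0 add0r.
have cP : continuous (prim f) := AC_continuous Lf AP.
have LP : L2 (prim f) := cont_L2 cP.
pose c := coef (prim f) 0.
have cc k : coef (prim f \- cst c) k = 0.
  rewrite /coef (eq_int01 (g := (prim f \* ej k 0) \- (fun x => c * (ej 0 0 \* ej k 0) x))); last first.
    move=> x _ /=; have -> : ej 0 0 x = 1 :> R by rewrite /ej /nk /lam /= mulr0 expr0 mul0r cos0 !mulr1.
    by ring.
  rewrite int01B; [|exact: L1M LP (ej_L2 k 0)|by apply: L1Z; apply: L1M; exact: ej_L2].
  rewrite int01Z; last by apply: L1M; exact: ej_L2.
  rewrite ej_orth0; have [<-|k0] := eqVneq 0%N k; first by rewrite mulr1 subrr.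
  rewrite mulr0 subr0 -/(coef (prim f) k).
  have := int01_byparts Lf (ej_L2 k 2) AP (@ej_AC R k 1).
  have [-> ->] := @ej_odd R k 1 isT; rewrite !mulr0 subrr h add0r => h2.
  have : - (lam k ^+ 2 * coef (prim f) k) = 0.
    rewrite -h2 /coef -int01Z; last exact: L1M LP (ej_L2 k 0).
    rewrite -int01N; last by apply: L1Z; exact: L1M LP (ej_L2 k 0).
    by apply: eq_int01 => x _; rewrite /= ej2; ring.
  move/eqP; rewrite oppr_eq0 mulf_eq0 => /orP[|/eqP//].
  by rewrite expf_eq0 /= gt_eqF// lam_gt0// lt0n eq_sym.
have cd : continuous (prim f \- cst c) by move=> s; apply: cvgB; [exact: cP|exact: cvg_cst].
have z := cos_complete cd cc.
have d1 : is_wderiv 1 (prim f) f by apply: (AC_wderiv1 LP Lf AP); exact: aeq_refl.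
have A0 : AC (cst c) (cst 0) by exact: AC_cst.
have d2 : is_wderiv 1 (prim f) (cst 0).
  apply: (AC_wderiv1 LP (L2_cst 0) A0); apply: eq_aeq => x /I01_01 x01.
  by apply/eqP; rewrite -subr_eq0; apply/eqP; exact: z x01.
exact: wderiv_uniq d1 d2.
Qed.

(** The sine series converges to some [g] of norm at most [D]; [f] and [g] have the same
    coefficients. *)
Lemma sin_norm f D : L2 f -> 0 <= D -> (forall n, \sum_(k < n) scoef f k ^+ 2 <= D ^+ 2) -> L2norm f <= D.
Proof.
move=> Lf D0 H; pose c k := scoef f k / lam k.
have Hc n : \sum_(k < n) (c k * lam k ^+ 1) ^+ 2 <= D ^+ 2.
  by apply: le_trans (H n); apply: ler_sum => k _; rewrite scoef_lam.
have [g [Lg cg]] := Sf_cvL2 (c := c) (i := 1%N) Hc.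
have gn : L2norm g <= D.
  apply: (cvL2_le _ Lg cg); first by move=> n; exact: Sf_L2.
  by move=> n; apply: le_sqr_ge0 => //; rewrite Sf_norm.
have ge l : int01 (g \* ej l 1) = int01 (f \* ej l 1).
  have c1 := cvL2_ip (fun n => Sf_L2 c 1 n) Lg (ej_L2 l 1) cg.
  apply: (cvg_unique _ c1) => //; apply: cvg_near_cst; exists l.+1 => // n /= ln.
  rewrite int01_Sf; last exact: ej_L2.
  rewrite (bigD1 (Ordinal ln))//= ej_orth eqxx mul1r big1 ?addr0; last first.
    move=> i il; rewrite ej_orth (_ : (nat_of_ord i == l) = false) ?mul0r ?mulr0//.
    by apply/negbTE; rewrite -val_eqE in il.
  rewrite /c /scoef; case: l {ln c1} => [|l]; first by rewrite int01_ej01 !mul0r.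
  by rewrite expr1; field; rewrite gt_eqF// lam_gt0.
have Ld : L2 (f \- g) by exact: L2B.
have ae : aeq (f \- g) (cst 0).
  apply: sin_complete => // k.
  rewrite (eq_int01 (g := (f \* ej k 1) \- (g \* ej k 1))); last by move=> x _ /=; ring.
  by rewrite int01B ?ge ?subrr//; apply: L1M => //; exact: ej_L2.
rewrite (aeq_L2norm (g := g))//.
have h := aeqD ae (aeq_refl g).
by apply: aeq_trans (aeq_trans _ h) _; apply: eq_aeq => x _ /=; ring.
Qed.

End SineSeries.

(** * Differentiability in time passes to the space derivative *)

Section Upgrade.
Context {R : realType}.

(** An affine extension to negative times makes the one-sided derivative at 0 two-sided. *)
Lemma one_sided_ext (f w : R -> R) :
  (forall t, 0 <= t -> (r - t)^-1 * (f r - f t) - w t @[r --> N1 t] --> (0 : R)) ->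
  forall t : R, 0 <= t -> is_derive t 1 (fun r => if r < 0 then f 0 + r * w 0 else f r) (w t).
Proof.
move=> H t t0; pose g (r : R) := if r < 0 then f 0 + r * w 0 else f r.
have gt : g t = f t by rewrite /g ltNge t0.
have lim : h^-1 *: (g (h *: 1 + t) - g t) @[h --> (0 : R)^'] --> w t.
  apply/subr_cvg0/cvgr0Pnorm_lt => e e0; have /cvgN1P Ht := H t t0; have [d d0 Hd] := Ht e e0.
  pose d' := if t == 0 then d else Num.min d t.
  have d'0 : 0 < d'.
    by rewrite /d'; case: eqP => // /eqP tn; rewrite lt_min d0 lt_def tn.
  have d'd : d' <= d by rewrite /d'; case: eqP => // _; rewrite ge_min lexx.
  apply/nbhs_ballP; exists d' => //= h; rewrite /ball/= sub0r normrN => hd h0.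
  have e1 : h *: (1 : R) = h by exact: mulr1.
  rewrite e1 gt /GRing.scale/=; have [ht|ht] := leP 0 (h + t).
    rewrite /g (_ : (h + t < 0) = false); last by rewrite ltNge ht.
    have := Hd (h + t) ht; rewrite addrK; apply.
      by rewrite -subr_eq0 addrK.
    exact: lt_le_trans hd d'd.
  have tz : t = 0.
    apply/eqP; apply: contraT => tn; move: hd; rewrite /d' (negbTE tn) lt_min => /andP[_].
    rewrite ltr_norml => /andP[h1 _]; lra.
  rewrite /g ht tz addr0 (_ : h^-1 * _ - _ = 0) ?normr0//; field; exact: h0.
apply: DeriveDef; first by apply/cvg_ex; exists (w t); exact: lim.
exact/cvg_lim.
Qed.

Lemma psum_unit K (b : nat -> unit -> R) : psum K b = \sum_(k < K) b k tt ^+ 2.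
Proof.
rewrite /psum -(pair_bigA _ (fun (k : 'I_K) j => b k j ^+ 2))/=.
by apply: eq_bigr => k _; rewrite (bigD1 tt)//= big1 ?addr0// => -[].
Qed.

Variables (F0 F1 W0 W1 : R -> R -> R).
Hypothesis AF : forall t, 0 <= t -> AC (F0 t) (F1 t).
Hypothesis LF : forall t, 0 <= t -> L2 (F1 t).
Hypothesis AW : forall t, 0 <= t -> AC (W0 t) (W1 t).
Hypothesis LW : forall t, 0 <= t -> L2 (W1 t).
Hypothesis cW : forall t, 0 <= t -> L2norm (W1 r \- W1 t) @[r --> N0 t] --> (0 : R).
Hypothesis dF : forall t, 0 <= t ->
  L2norm (fun s => (r - t)^-1 * (F0 r s - F0 t s) - W0 t s) @[r --> N1 t] --> (0 : R).

Let LF0 t : 0 <= t -> L2 (F0 t).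
Proof. by move=> t0; apply: cont_L2; exact: AC_continuous (LF t0) (AF t0). Qed.
Let LW0 t : 0 <= t -> L2 (W0 t).
Proof. by move=> t0; apply: cont_L2; exact: AC_continuous (LW t0) (AW t0). Qed.

Let parts (f g : R -> R) k : L2 g -> AC f g -> scoef g k = - (int01 (f \* ej k 2) / lam k).
Proof.
move=> Lg A; have := int01_byparts Lg (ej_L2 k 2) A (@ej_AC R k 1).
have [-> ->] := @ej_odd R k 1 isT; rewrite !mulr0 subrr => /eqP; rewrite addr_eq0 => /eqP h.
by rewrite /scoef h mulNr.
Qed.

Let dscoef k t : 0 <= t ->
  (r - t)^-1 * (scoef (F1 r) k - scoef (F1 t) k) - scoef (W1 t) k @[r --> N1 t] --> (0 : R).
Proof.
move=> t0.
have c : (L2norm (ej k 2) / lam k : R) * L2norm (fun s => (r - t)^-1 * (F0 r s - F0 t s) - W0 t s) @[r --> N1 t] --> (0 : R).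
  by apply: cvg0Ml; exact: dF.
apply: cvg0_nearle c; apply: filterS (near_N1_ge0 t) => r r0.
rewrite (parts k (LF r0) (AF r0)) (parts k (LF t0) (AF t0)) (parts k (LW t0) (AW t0)).
pose g s := (r - t)^-1 * (F0 r s - F0 t s) - W0 t s.
have L i : L2 (F0 i) -> L1 (F0 i \* ej k 2) by move=> h; exact: L1M h (ej_L2 k 2).
have LWe : L1 (W0 t \* ej k 2) by exact: L1M (LW0 t0) (ej_L2 k 2).
have Lg : L2 g by apply: L2B; [apply: L2Z; apply: L2B; exact: LF0|exact: LW0].
have -> : (r - t)^-1 * (- (int01 (F0 r \* ej k 2) / lam k) - - (int01 (F0 t \* ej k 2) / lam k)) - - (int01 (W0 t \* ej k 2) / lam k) =
    - (int01 (g \* ej k 2) / lam k).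
  rewrite (eq_int01 (f := g \* ej k 2) (g := (fun s => (r - t)^-1 * ((F0 r \* ej k 2) \- (F0 t \* ej k 2)) s) \- (W0 t \* ej k 2))); last first.
    by move=> s _; rewrite /g /=; ring.
  have Ld := L1B (L _ (LF0 r0)) (L _ (LF0 t0)).
  rewrite (int01B (L1Z _ Ld) LWe) (int01Z _ Ld) (int01B (L _ (LF0 r0)) (L _ (LF0 t0))); ring.
rewrite normrN normrM normfV (@ger0_norm _ (lam k)) ?lam_ge0// mulrAC (mulrC (L2norm (ej k 2))).
by rewrite ler_wpM2r ?invr_ge0 ?lam_ge0//; exact: int01_CS Lg (ej_L2 k 2).
Qed.

Lemma scoefB (f g : R -> R) k : L2 f -> L2 g -> scoef (f \- g) k = scoef f k - scoef g k.
Proof.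
move=> Lf Lg; rewrite /scoef -mulrBl -int01B; [|exact: L1M Lf (ej_L2 k 1)|exact: L1M Lg (ej_L2 k 1)].
by congr (_ / _); apply: eq_int01 => x _ /=; ring.
Qed.

Lemma scoefZ (a : R) (f : R -> R) k : L2 f -> scoef (fun s => a * f s) k = a * scoef f k.
Proof.
move=> Lf; rewrite /scoef mulrA -int01Z; last exact: L1M Lf (ej_L2 k 1).
by congr (_ / _); apply: eq_int01 => x _ /=; ring.
Qed.

(** Sines vanish at both ends, so by parts the sine coefficients of [F1] are pairings of [F0] with
    cosines, without any boundary condition on [F0]. They are thus differentiable with derivatives
    the coefficients of [W1]; continuity of [W1] and the mean value inequality in l^2 make this
    uniform. *)
Lemma upgrade1 t : 0 <= t ->
  L2norm (fun s => (r - t)^-1 * (F1 r s - F1 t s) - W1 t s) @[r --> N1 t] --> (0 : R).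
Proof.
move=> t0; apply/cvgN1P => e e0; have e2 : 0 < e / 2 by rewrite divr_gt0.
have /cvgN0P/(_ _ e2)[d d0 Hd] := cW t0.
exists d => // r r0 nrt rt; rewrite ger0_norm ?L2norm_ge0//.
apply: (le_lt_trans (y := e / 2)); last by rewrite ltr_pdivrMr// ltr_pMr// ltr1n.
have Ld : L2 (F1 r \- F1 t) by exact: L2B (LF r0) (LF t0).
have Lg : L2 (fun s => (r - t)^-1 * (F1 r s - F1 t s) - W1 t s) by exact: L2B (L2Z _ Ld) (LW t0).
apply: sin_norm => //; first exact: ltW.
pose sx k (x : R) := if x < 0 then scoef (F1 0) k + x * scoef (W1 0) k else scoef (F1 x) k.
have dsx k (x : R) : 0 <= x -> is_derive x 1 (sx k) (scoef (W1 x) k).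
  by move=> x0; exact: (one_sided_ext (fun t t0 => dscoef k t0) x0).
have sxE k x : 0 <= x -> sx k x = scoef (F1 x) k by move=> x0; rewrite /sx ltNge x0.
have key (x y : R) : 0 <= x -> x <= y -> (forall z, x <= z <= y -> `|z - t| < d) ->
    le2 (sub2 (fun k (_ : unit) => sx k y - y * scoef (W1 t) k) (fun k _ => sx k x - x * scoef (W1 t) k)) (e / 2 * y - e / 2 * x).
  move=> x0 xy hz; apply: (@le2_derive R unit (fun z k _ => sx k z - z * scoef (W1 t) k) (fun z k _ => scoef (W1 z) k - scoef (W1 t) k) (fun z => e / 2 * z) (fun=> e / 2)) => //.
  - move=> k i z /andP[xz zy]; have dz := dsx k z (le_trans x0 xz).
    have d1 : is_derive (z : R) 1 (fun z : R => scoef (W1 t) k * z) (scoef (W1 t) k).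
      have := is_deriveZ (scoef (W1 t) k) (is_derive_id z (1 : R)); rewrite [X in is_derive _ _ _ X -> _](_ : _ = scoef (W1 t) k)//; exact: mulr1.
    have := is_deriveB dz d1.
    rewrite (_ : _ - _ = (fun z => sx k z - z * scoef (W1 t) k)) //.
    by apply/funext => z'; rewrite mulrC.
  - move=> z _; have := is_deriveZ (e / 2) (is_derive_id z (1 : R)); rewrite [X in is_derive _ _ _ X -> _](_ : _ = e / 2)//; exact: mulr1.
  - move=> z /[dup] zz /andP[xz _]; have z0 := le_trans x0 xz.
    split=> [|K]; first exact: ltW.
    rewrite psum_unit; have LB : L2 (W1 z \- W1 t) by exact: L2B (LW z0) (LW t0).
    apply: (@le_trans _ _ (\sum_(k < K) scoef (W1 z \- W1 t) k ^+ 2)).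
      by apply: ler_sum => k _; rewrite (scoefB k (LW z0) (LW t0)).
    apply: (le_trans (bessel_sin K LB)); rewrite ler_sqr ?nnegrE ?L2norm_ge0 ?(ltW e2)//.
    by have := Hd z z0 (hz z zz); rewrite ger0_norm ?L2norm_ge0// => /ltW.
have fin : le2 (fun k (_ : unit) => scoef (F1 r) k - scoef (F1 t) k - (r - t) * scoef (W1 t) k) (e / 2 * `|r - t|).
  have [tr|tr] := leP t r.
    rewrite ger0_norm ?subr_ge0// mulrBr.
    apply: eq_le2 (key t r t0 tr _) => [k i|z /andP[tz zr]]; first by rewrite /sub2 !sxE//; ring.
    by apply: le_lt_trans rt; rewrite !ger0_norm ?subr_ge0// lerB.
  rewrite distrC ger0_norm ?subr_ge0 ?(ltW tr)// mulrBr.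
  apply: eq_le2 (le2N (key r t r0 (ltW tr) _)) => [k i|z /andP[tz zr]]; first by rewrite /sub2 !sxE//; ring.
  by apply: le_lt_trans rt; rewrite distrC (distrC r) !ger0_norm ?subr_ge0 ?(ltW tr)// lerB.
move=> n; have n0 : `|r - t| != 0 by rewrite normr_eq0 subr_eq0.
have := le2Z (r - t)^-1 fin; rewrite normfV (_ : _^-1 * (e / 2 * _) = e / 2); last by rewrite mulrCA mulVf// mulr1.
move=> [_ /(_ n)]; apply: le_trans; rewrite psum_unit; apply: ler_sum => k _.
rewrite (scoefB k (L2Z _ Ld) (LW t0)) (scoefZ _ k Ld) (scoefB k (LF r0) (LF t0)).
rewrite le_eqVlt; apply/orP; left; apply/eqP; congr (_ ^+ 2).
by field; rewrite subr_eq0.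
Qed.

End Upgrade.

(** * Time derivatives of curves of jets *)

Section JetCurveCalculus.
Context {R : realType}.
Implicit Types (F G H : R -> nat -> R -> R) (n j : nat).

Definition dq (r t : R) (F : R -> nat -> R -> R) : nat -> R -> R := jZ (r - t)^-1 (jB (F r) (F t)).
Definition dJ n F G := forall t, 0 <= t -> HN n (jB (dq r t F) (G t)) @[r --> N1 t] --> (0 : R).
Fixpoint CjJ j n F : Prop := CJ n F /\
  match j with 0%N => True | j'.+1 => exists G, dJ n F G /\ CjJ j' n G end.

Lemma CjJ_CJ j n F : CjJ j n F -> CJ n F. Proof. by case: j => [|j] []. Qed.

Lemma HN_cvg (T : Type) (FF : set_system T) {FFF : Filter FF} n (X : T -> nat -> R -> R) :
  (forall i, (i <= n)%N -> L2norm (X r i) @[r --> FF] --> (0 : R)) -> HN n (X r) @[r --> FF] --> (0 : R).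
Proof.
elim: n => [|n IH] h; first by under eq_fun do rewrite /HN big_ord1; exact: h.
under eq_fun do rewrite /HN big_ord_recr /=.
by apply: cvg0D; [apply: IH => i im; apply: h; exact: leqW|exact: h].
Qed.

(** Differentiability at order 0 climbs one order at a time by [upgrade1]. *)
Lemma dJ_upgrade n F G : CJ n F -> CJ n G ->
  (forall t, 0 <= t -> L2norm (fun s => (r - t)^-1 * (F r 0%N s - F t 0%N s) - G t 0%N s) @[r --> N1 t] --> (0 : R)) ->
  dJ n F G.
Proof.
move=> cF cG d0.
have H i : (i <= n)%N -> forall t, 0 <= t ->
    L2norm (fun s => (r - t)^-1 * (F r i s - F t i s) - G t i s) @[r --> N1 t] --> (0 : R).
  elim: i => [_|i IH im]; first exact: d0.
  apply: (@upgrade1 R (fun t => F t i) (fun t => F t i.+1) (fun t => G t i) (fun t => G t i.+1)).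
  - by move=> t t0; have [jF _] := cF t t0; exact: jet_AC jF im.
  - by move=> t t0; have [jF _] := cF t t0; exact: jet_L2 jF im.
  - by move=> t t0; have [jG _] := cG t t0; exact: jet_AC jG im.
  - by move=> t t0; have [jG _] := cG t t0; exact: jet_L2 jG im.
  - move=> t t0; have [_ hG] := cG t t0; apply: cvg0_le hG => r.
    rewrite ger0_norm ?L2norm_ge0//; apply: le_trans (HN_ge _ im).
    by rewrite le_eqVlt; apply/orP; left; apply/eqP; apply: eq_L2norm => s _; rewrite jBE.
  - by apply: IH; exact: ltnW.
move=> t t0; apply: HN_cvg => i im; have := H i im t t0.
rewrite (_ : (fun r => L2norm _) = (fun r => L2norm (jB (dq r t F) (G t) i)))//.
by apply/funext => r; apply: eq_L2norm => s _; rewrite jBE /dq /jZ jBE.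
Qed.

Lemma dJ_le n n' F G : (n' <= n)%N -> dJ n F G -> dJ n' F G.
Proof.
move=> nn d t t0; apply: cvg0_le (d t t0) => r; rewrite ger0_norm ?HN_ge0//; exact: HN_mono.
Qed.

Lemma CjJ_le j n n' F : (n' <= n)%N -> CjJ j n F -> CjJ j n' F.
Proof.
move=> nn; elim: j F => [|j IH] F [cF h]; split; try exact: CJ_le cF; try by [].
by have [G [d cG]] := h; exists G; split; [exact: dJ_le d|exact: IH].
Qed.

Lemma CjJ_S j n F : CjJ j.+1 n F -> CjJ j n F.
Proof.
elim: j F => [|j IH] F [cF [G [d cG]]]; split=> //.
by exists G; split => //; exact: IH.
Qed.

Lemma jet_dq n F r t : CJ n F -> 0 <= r -> 0 <= t -> jet n (dq r t F).
Proof. by move=> cF r0 t0; apply/jet_Z/jet_B; [case: (cF r r0)|case: (cF t t0)]. Qed.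

Lemma dJ_D n F G F' G' : CJ n F -> CJ n G -> CJ n F' -> CJ n G' -> dJ n F F' -> dJ n G G' ->
  dJ n (fun t => jD (F t) (G t)) (fun t => jD (F' t) (G' t)).
Proof.
move=> cF cG cF' cG' dF dG t t0.
apply: cvg0_nearle (cvg0D (dF t t0) (dG t t0)); apply: filterS (near_N1_ge0 t) => r r0.
rewrite ger0_norm ?HN_ge0//.
rewrite (@eq_HN _ _ _ (jD (jB (dq r t F) (F' t)) (jB (dq r t G) (G' t)))); last first.
  by move=> i s; rewrite /jD !jBE /dq /jZ !jBE /jD; ring.
have [jF' _] := cF' t t0; have [jG' _] := cG' t t0.
by apply: HN_D; apply: jet_B => //; exact: jet_dq.
Qed.

Lemma dJ_Z n (a : R) F F' : CJ n F -> CJ n F' -> dJ n F F' -> dJ n (fun t => jZ a (F t)) (fun t => jZ a (F' t)).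
Proof.
move=> cF cF' dF t t0.
apply: cvg0_nearle (cvg0Ml `|a| (dF t t0)); apply: filterS (near_N1_ge0 t) => r r0.
rewrite ger0_norm ?HN_ge0//.
rewrite (@eq_HN _ _ _ (jZ a (jB (dq r t F) (F' t)))); last first.
  by move=> i s; rewrite /jZ !jBE /dq /jZ !jBE /jZ; ring.
have [jF' _] := cF' t t0.
by rewrite HN_Z//; apply: jet_B => //; exact: jet_dq.
Qed.

Lemma HN_M_le n (K L : nat -> R -> R) : (1 <= n)%N -> jet n K -> jet n L ->
  HN n (jM K L) <= cM n * (HN n K * HN n L).
Proof. by move=> n1 jK jL; rewrite mulrA; exact: PJ_HN_alg. Qed.

Lemma PJ_Z1 (a : R) (K L : nat -> R -> R) k p q s : PJ (jZ a K) L k p q s = a * PJ K L k p q s.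
Proof. by elim: k p q => [|k IH] p q /=; rewrite ?IH /jZ; ring. Qed.
Lemma PJ_Z2 (a : R) (K L : nat -> R -> R) k p q s : PJ K (jZ a L) k p q s = a * PJ K L k p q s.
Proof. by elim: k p q => [|k IH] p q /=; rewrite ?IH /jZ; ring. Qed.

Lemma dJ_M n F G F' G' : (1 <= n)%N -> CJ n F -> CJ n G -> CJ n F' -> CJ n G' -> dJ n F F' -> dJ n G G' ->
  dJ n (fun t => jM (F t) (G t)) (fun t => jD (jM (F' t) (G t)) (jM (F t) (G' t))).
Proof.
move=> n1 cF cG cF' cG' dF dG t t0.
have [jF _] := cF t t0; have [jG hG] := cG t t0; have [jF' _] := cF' t t0; have [jG' _] := cG' t t0.
have hG1 := cvg_N1 hG.
have c : cM n * (HN n (jB (dq r t F) (F' t)) * (HN n (G t) + HN n (jB (G r) (G t))) +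
    (HN n (F' t) * HN n (jB (G r) (G t)) + HN n (F t) * HN n (jB (dq r t G) (G' t)))) @[r --> N1 t] --> (0 : R).
  apply: cvg0Ml; apply: cvg0D.
    have := cvgM (dF t t0) (cvgD (cvg_cst (HN n (G t))) hG1); rewrite mul0r; exact.
  by apply: cvg0D; apply: cvg0Ml => //; exact: dG.
apply: cvg0_nearle c; apply: filterS (near_N1_ge0 t) => r r0.
have [jGr _] := cG r r0; have [jFr _] := cF r r0.
rewrite ger0_norm ?HN_ge0//.
have dqF := jet_dq cF r0 t0; have dqG := jet_dq cG r0 t0.
have j1 := jet_B dqF jF'; have j2 := jet_B jGr jG; have j3 := jet_B dqG jG'.
rewrite (@eq_HN _ _ _ (jD (jM (jB (dq r t F) (F' t)) (G r)) (jD (jM (F' t) (jB (G r) (G t))) (jM (F t) (jB (dq r t G) (G' t)))))); last first.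
  move=> i s; rewrite /jD jBE /dq /jZ jBE /jM !(PJ_B1, PJ_B2).
  by rewrite (PJ_Z1 (r - t)^-1 (jB (F r) (F t))) (PJ_Z2 (r - t)^-1 (F t) (jB (G r) (G t))) !(PJ_B1, PJ_B2); ring.
have m1 := jet_M n1 j1 jGr; have m2 := jet_M n1 jF' j2; have m3 := jet_M n1 jF j3.
apply: (le_trans (HN_D m1 (jet_D m2 m3))).
have c0 : 0 <= cM n :> R by apply: le_trans (cM_ge1 n).
rewrite mulrDr; apply: lerD.
  apply: (le_trans (HN_M_le n1 j1 jGr)); rewrite ler_wpM2l// ler_wpM2l ?HN_ge0//; exact: HN_bd.
by rewrite mulrDr; apply: (le_trans (HN_D m2 m3)); apply: lerD; exact: HN_M_le.
Qed.

Lemma CjJ_D j n F G : CjJ j n F -> CjJ j n G -> CjJ j n (fun t => jD (F t) (G t)).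
Proof.
elim: j F G => [|j IH] F G [cF hF] [cG hG]; split; try exact: CJ_D; try by [].
have [F' [dF cF']] := hF; have [G' [dG cG']] := hG.
exists (fun t => jD (F' t) (G' t)); split; last exact: IH.
exact: (dJ_D cF cG (CjJ_CJ cF') (CjJ_CJ cG') dF dG).
Qed.

Lemma CjJ_Z j n a F : CjJ j n F -> CjJ j n (fun t => jZ a (F t)).
Proof.
elim: j F => [|j IH] F [cF hF]; split; try exact: CJ_Z; try by [].
have [F' [dF cF']] := hF; exists (fun t => jZ a (F' t)); split; last exact: IH.
exact: (dJ_Z a cF (CjJ_CJ cF') dF).
Qed.

Lemma CjJ_M j n F G : (1 <= n)%N -> CjJ j n F -> CjJ j n G -> CjJ j n (fun t => jM (F t) (G t)).
Proof.
move=> n1; elim: j F G => [|j IH] F G hF hG; have cF := CjJ_CJ hF; have cG := CjJ_CJ hG; split; try exact: CJ_M; try by [].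
have hF1 := CjJ_S hF; have hG1 := CjJ_S hG.
have [_ [F' [dF cF']]] := hF; have [_ [G' [dG cG']]] := hG.
exists (fun t => jD (jM (F' t) (G t)) (jM (F t) (G' t))); split.
  exact: (dJ_M n1 cF cG (CjJ_CJ cF') (CjJ_CJ cG') dF dG).
by apply: CjJ_D; exact: IH.
Qed.

Lemma CjJ_shift j p n F : CjJ j (p + n) F -> CjJ j n (fun t i => F t (p + i)%N).
Proof.
elim: j F => [|j IH] F [cF hF]; split; try exact: CJ_shift; try by [].
have [F' [dF cF']] := hF; exists (fun t i => F' t (p + i)%N); split; last exact: IH.
move=> t t0; apply: HN_cvg => i im.
have h := dF t t0; apply: cvg0_le h => r; rewrite ger0_norm ?L2norm_ge0//.
apply: le_trans (@HN_ge R (p + n) (jB (dq r t F) (F' t)) (p + i) _); last by rewrite leq_add2l.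
by rewrite le_eqVlt; apply/orP; left; apply/eqP; apply: eq_L2norm => s _; rewrite !jBE /dq /jZ !jBE.
Qed.

Variables (m : nat) (V : R -> 'I_3 -> nat -> R -> R).
Hypothesis m1 : (1 <= m)%N.
Hypothesis cV : forall i, CJ (2 * m).+1 (fun t => V t i).
Hypothesis dV : forall t i, 0 <= t -> L2norm (fun s => (r - t)^-1 * (V r i 0%N s - V t i 0%N s) -
          crs (at_ (V t) 0 s) (at_ (V t) 2 s) i) @[r --> N1 t] --> (0 : R).

(** The derivative v x v_ss has the time regularity of v, two space orders lower; orders stay at
    least 1, where products are allowed. *)
Lemma CjJ_evolution j : (j <= m)%N -> forall i, CjJ j (2 * m + 1 - 2 * j) (fun t => V t i).
Proof.
elim: j => [_|j IH jm] i; first by rewrite muln0 subn0 addn1; split.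
set n := (2 * m + 1 - 2 * j.+1)%N; have n1 : (1 <= n)%N by rewrite /n; lia.
have e2 : (2 * m + 1 - 2 * j = 2 + n)%N by rewrite /n; lia.
have hV k : CjJ j (2 + n) (fun t => V t k) by rewrite -e2; apply: IH; exact: ltnW.
have hV0 k : CjJ j n (fun t => V t k) by apply: CjJ_le (hV k); exact: leq_addl.
have hV2 k : CjJ j n (fun t l => V t k (2 + l)%N) by exact: CjJ_shift (hV k).
have hW : CjJ j n (fun t => cj (V t) (fun k l => V t k (2 + l)%N) i).
  by apply: CjJ_D; last apply: CjJ_Z; apply: CjJ_M.
split; first by exact: CjJ_CJ (hV0 i).
exists (fun t => cj (V t) (fun k l => V t k (2 + l)%N) i); split => //.
apply: dJ_upgrade; [exact: CjJ_CJ (hV0 i)|exact: CjJ_CJ hW|].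
move=> t t0; have := dV i t0.
rewrite (_ : (fun r => L2norm _) = (fun r => L2norm (fun s => (r - t)^-1 * (V r i 0%N s - V t i 0%N s) - cj (V t) (fun k l => V t k (2 + l)%N) i 0%N s)))//.
by apply/funext => r; apply: eq_L2norm => s _; rewrite /cj jBE.
Qed.

End JetCurveCalculus.

(** * From jets to the Sobolev spaces and traces of the statement *)

Section Bridge.
Context {R : realType}.
Implicit Types (u w : R -> 'rV[R]_3) (U : 'I_3 -> nat -> R -> R).

(** The jet of the continuous representative, for a function known only almost everywhere on the
    interval. *)
Definition rep n u U := forall i, [/\ L2 (coord u i), jet n (U i) & aeq (coord u i) (U i 0%N)].

Lemma rep_le n n' u U : (n' <= n)%N -> rep n u U -> rep n' u U.
Proof. by move=> nn h i; have [h1 h2 h3] := h i; split => //; exact: jet_le h2. Qed.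

Lemma rep_sobolev n u U : rep n u U -> sobolev n u.
Proof.
move=> h i; have [h1 h2 h3] := h i; split => // k kn; exists (U i k).
exact: jet_wderiv h2 h1 h3 kn.
Qed.

Lemma sobolev_rep n u : sobolev n u -> exists U, rep n u U.
Proof.
move=> h; have H i : exists F, jet n F /\ aeq (coord u i) (F 0%N).
  by have [h1 h2] := h i; exact: sobolev1_jet h1 h2.
have [U HU] := choice H; exists U => i; have [h1 _] := h i; have [h2 h3] := HU i; by split.
Qed.

Lemma rep_wderiv n u U i k : rep n u U -> (k <= n)%N -> L2 (wderiv k (coord u i)) /\ aeq (wderiv k (coord u i)) (U i k).
Proof. by move=> h kn; have [h1 h2 h3] := h i; exact: jet_wderivE h2 h1 h3 kn. Qed.

Lemma sum_sqr_le (I : finType) (x : I -> R) : (forall i, 0 <= x i) -> \sum_i x i ^+ 2 <= (\sum_i x i) ^+ 2.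
Proof.
move=> x0; rewrite expr2 mulr_sumr; apply: ler_sum => i _; rewrite expr2 ler_wpM2r//.
by rewrite (bigD1 i)//= lerDl; apply: sumr_ge0.
Qed.

Lemma sobolev_norm_le n u U : rep n u U -> sobolev_norm n u <= \sum_i HN n (U i).
Proof.
move=> h; have E i k : (k <= n)%N -> L2norm (wderiv k (coord u i)) = L2norm (U i k).
  move=> kn; have [l ae] := rep_wderiv i h kn; have [_ jU _] := h i.
  exact: aeq_L2norm l (jet_L2 jU kn) ae.
have S0 : 0 <= \sum_i HN n (U i) by apply: sumr_ge0 => i _; exact: HN_ge0.
rewrite -[leRHS]ger0_norm// -sqrtr_sqr /sobolev_norm ler_wsqrtr//.
apply: (@le_trans _ _ (\sum_(i < 3) (HN n (U i)) ^+ 2)); last first.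
  by apply: sum_sqr_le => i; exact: HN_ge0.
apply: ler_sum => i _; apply: (@le_trans _ _ (\sum_(k < n.+1) L2norm (U i k) ^+ 2)).
  by apply: ler_sum => k _; rewrite E// -ltnS.
by apply: sum_sqr_le => k; exact: L2norm_ge0.
Qed.

Lemma sobolev_norm_ge0 n u : 0 <= sobolev_norm n u. Proof. exact: sqrtr_ge0. Qed.

Lemma HN_sobolev n u U i : rep n u U -> HN n (U i) <= n.+1%:R * sobolev_norm n u.
Proof.
move=> h; rewrite /HN -[X in X%:R](card_ord n.+1) mulr_natl -sumr_const; apply: ler_sum => k _.
have kn : (k <= n)%N by rewrite -ltnS.
have [l ae] := rep_wderiv i h kn; have [_ jU _] := h i.
rewrite -(aeq_L2norm l (jet_L2 jU kn) ae); apply: le_sqr_ge0; first exact: sqrtr_ge0.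
rewrite sqr_sqrtr; last by apply: sumr_ge0 => i' _; apply: sumr_ge0 => k' _; exact: sqr_ge0.
rewrite (bigD1 i)//= (bigD1 k)//= -addrA lerDl addr_ge0//; apply: sumr_ge0 => *; rewrite ?sqr_ge0//.
by apply: sumr_ge0 => *; exact: sqr_ge0.
Qed.

Lemma coordB u w i : coord (u \- w) i = coord u i \- coord w i.
Proof. by apply/funext => s; rewrite /coord /= !mxE. Qed.

Lemma rep_B n u w U U' : rep n u U -> rep n w U' -> rep n (u \- w) (fun i => jB (U i) (U' i)).
Proof.
move=> h h' i; have [h1 h2 h3] := h i; have [h1' h2' h3'] := h' i; rewrite coordB; split.
- exact: L2B.
- exact: jet_B.
- by apply: aeq_trans (aeqB h3 h3') _; apply: eq_aeq => s _; rewrite jBE.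
Qed.

Lemma rep_Z n (a : R) u U : rep n u U -> rep n (fun s => a *: u s) (fun i => jZ a (U i)).
Proof.
move=> h i; have [h1 h2 h3] := h i.
have e : coord (fun s => a *: u s) i = fun s => a * coord u i s by apply/funext => s; rewrite /coord mxE.
by rewrite e; split; [exact: L2Z|exact: jet_Z|exact: aeqZ].
Qed.

Lemma Hcont_jets n (v : R -> R -> 'rV[R]_3) (U : R -> 'I_3 -> nat -> R -> R) :
  (forall t, 0 <= t -> rep n (v t) (U t)) -> (forall i, CJ n (fun t => U t i)) -> Hcontinuous n v.
Proof.
move=> hr hc; split; first by move=> t t0; exact: rep_sobolev (hr t t0).
move=> t t0.
have c : \sum_(i < 3) HN n (jB (U r i) (U t i)) @[r --> N0 t] --> (0 : R).
  under eq_fun do rewrite sum3.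
  by apply: cvg0D; [apply: cvg0D|]; apply: (proj2 (hc _ t t0)).
apply: cvg0_nearle c; apply: filterS (near_N0_ge0 t) => r r0.
rewrite ger0_norm ?sobolev_norm_ge0//; exact: sobolev_norm_le (rep_B (hr r r0) (hr t t0)).
Qed.

Lemma jets_Hcont n (v : R -> R -> 'rV[R]_3) : Hcontinuous n v ->
  exists U : R -> 'I_3 -> nat -> R -> R, (forall t, 0 <= t -> rep n (v t) (U t)) /\
    forall i, CJ n (fun t => U t i).
Proof.
move=> [hs hc].
have H (t : R) : exists U, 0 <= t -> rep n (v t) U.
  have [t0|nt] := pselect (0 <= t); last by exists (fun _ _ _ => 0) => /nt.
  by have [U HU] := sobolev_rep (hs t t0); exists U.
have [U HU] := choice H; exists U.
have G i (t : R) : 0 <= t -> HN n (jB (U r i) (U t i)) @[r --> N0 t] --> (0 : R).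
  move=> t0; have c : n.+1%:R * sobolev_norm n (v r \- v t) @[r --> N0 t] --> (0 : R) by apply: cvg0Ml; exact: hc.
  apply: cvg0_nearle c; apply: filterS (near_N0_ge0 t) => r r0.
  by rewrite ger0_norm ?HN_ge0//; exact: (HN_sobolev i (rep_B (HU r r0) (HU t t0))).
by split => // i t t0; split; [have [] := HU t t0 i|exact: G].
Qed.

Definition vec (U : 'I_3 -> nat -> R -> R) : R -> 'rV[R]_3 := fun s => \row_i U i 0%N s.

Lemma coord_vec U i : coord (vec U) i = U i 0%N.
Proof. by apply/funext => s; rewrite /coord /vec mxE. Qed.

Lemma rep_vec n U : (forall i, jet n (U i)) -> rep n (vec U) U.
Proof. by move=> h i; rewrite coord_vec; split => //; [exact: jet_L2 (h i) _|exact: aeq_refl]. Qed.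

Lemma Hderiv_jets n (U W : R -> 'I_3 -> nat -> R -> R) : (forall i, CJ n (fun t => U t i)) ->
  (forall i, CJ n (fun t => W t i)) -> (forall i, dJ n (fun t => U t i) (fun t => W t i)) ->
  forall t, 0 <= t -> is_Hderiv n (fun t => vec (U t)) t (vec (W t)).
Proof.
move=> cU cW dU t t0.
have rU r : 0 <= r -> rep n (vec (U r)) (U r) by move=> r0; apply: rep_vec => i; have [] := cU i r r0.
have rW : rep n (vec (W t)) (W t) by apply: rep_vec => i; have [] := cW i t t0.
split; first exact: rep_sobolev rW.
have c : \sum_(i < 3) HN n (jB (dq r t (fun t => U t i)) (W t i)) @[r --> N1 t] --> (0 : R).
  under eq_fun do rewrite sum3.
  by apply: cvg0D; [apply: cvg0D|]; exact: dU.
apply: cvg0_nearle c; apply: filterS (near_N1_ge0 t) => r r0.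
rewrite ger0_norm ?sobolev_norm_ge0//.
exact: (sobolev_norm_le (rep_B (rep_Z (r - t)^-1 (rep_B (rU r r0) (rU t t0))) rW)).
Qed.

Lemma CjHm_jets j n (U : R -> 'I_3 -> nat -> R -> R) : (forall i, CjJ j n (fun t => U t i)) ->
  CjHm j n (fun t => vec (U t)).
Proof.
elim: j U => [|j IH] U h; have cU i := CjJ_CJ (h i).
  split => //; apply: Hcont_jets (cU) => t t0; apply: rep_vec => i; by have [] := cU i t t0.
split; first by apply: Hcont_jets (cU) => t t0; apply: rep_vec => i; have [] := cU i t t0.
have H i : exists G, dJ n (fun t => U t i) G /\ CjJ j n G by have [_] := h i.
have [G HG] := choice H.
pose W t i := G i t.
exists (fun t => vec (W t)); split; last by apply: IH => i; have [] := HG i.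
by apply: Hderiv_jets => // i; have [d c] := HG i => //; exact: CjJ_CJ c.
Qed.

Lemma sobolev_le n n' u : (n' <= n)%N -> sobolev n u -> sobolev n' u.
Proof. by move=> nn h i; have [h1 h2] := h i; split => // k kn; apply: h2; exact: leq_trans nn. Qed.

Lemma sobolev_norm_mono n n' u : (n' <= n)%N -> sobolev_norm n' u <= sobolev_norm n u.
Proof.
move=> nn; rewrite /sobolev_norm ler_wsqrtr//; apply: ler_sum => i _.
rewrite -!(big_mkord xpredT (fun k => L2norm (wderiv k (coord u i)) ^+ 2)).
rewrite [leRHS](big_cat_nat (n := n'.+1))//= lerDl; apply: sumr_ge0 => k _; exact: sqr_ge0.
Qed.

Lemma CjHm_le j n n' (v : R -> R -> 'rV[R]_3) : (n' <= n)%N -> CjHm j n v -> CjHm j n' v.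
Proof.
move=> nn; elim: j v => [|j IH] v [[hs hc] h]; (split; [split; [by move=> t t0; exact: sobolev_le (hs t t0)|]|]).
- move=> t t0; apply: cvg0_le (hc t t0) => r; rewrite ger0_norm ?sobolev_norm_ge0//; exact: sobolev_norm_mono.
- by [].
- move=> t t0; apply: cvg0_le (hc t t0) => r; rewrite ger0_norm ?sobolev_norm_ge0//; exact: sobolev_norm_mono.
have [w [dw cw]] := h; exists w; split; last exact: IH.
move=> t t0; have [s d] := dw t t0; split; first exact: sobolev_le s.
by apply: cvg0_le d => r; rewrite ger0_norm ?sobolev_norm_ge0//; exact: sobolev_norm_mono.
Qed.

(** Measurability is assumed because equality almost everywhere does not yield Borel
    measurability. *)
Lemma aeq_L2 (f g : R -> R) : measurable_fun I01 f -> L2 g -> aeq f g -> L2 f.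
Proof.
move=> mf Lg fg; apply/L2P; split => //.
have [mg /integrableP[_ L1g]] := (L2P g).1 Lg.
have mff : measurable_fun I01 (f \* f) by exact: measurable_funM.
have mgg : measurable_fun I01 (g \* g) by exact: measurable_funM.
apply/integrableP; split; first exact/measurable_EFinP.
rewrite (_ : (\int[@lebesgue_measure R]_(x in I01) `|(f x * f x)%:E| = \int[@lebesgue_measure R]_(x in I01) `|(g x * g x)%:E|)%E)//.
apply: ae_eq_integral => //.
- by apply: measurableT_comp => //; exact/measurable_EFinP.
- by apply: measurableT_comp => //; exact/measurable_EFinP.
- by apply: aeS fg => x h Ix /=; rewrite h.
Qed.

Lemma eqI_coord u w : eqI u w -> forall i, aeq (coord u i) (coord w i).
Proof. by move=> h i; apply: aeS h => s h Is; rewrite /coord h. Qed.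

Lemma coord_eqI u w : (forall i, aeq (coord u i) (coord w i)) -> eqI u w.
Proof.
move=> h; have := aeS2 (fun x (h1 : I01 x -> coord u o0 x = coord w o0 x) (h2 : I01 x -> coord u o1 x = coord w o1 x) => conj h1 h2) (h o0) (h o1).
move=> h01; apply: aeS2 h01 (h o2) => s [h0 h1] h2 Is.
by apply/rowP; apply: ord3P; [exact: h0|exact: h1|exact: h2].
Qed.

Lemma trace_rep n u U x (c : 'rV[R]_3) : (1 <= n)%N -> rep n u U -> x = 0 \/ x = 1 -> has_trace u x c ->
  forall i, U i 0%N x = c 0 i.
Proof.
move=> n1 h hx [w [cw ew <-]] i.
have x01 : 0 <= x <= 1 by case: hx => ->; rewrite ?lexx ler01.
have [h1 h2 h3] := h i.
have cwi : continuous (fun s : R => w (clip s) 0 i).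
  (* The trace representative is continuous within [0, 1] only; composing with [clip] makes it
     continuous on the line. *)
  have c1 (s : R) : `[0, 1]%classic (clip s) by have := clip01 s; rewrite /= in_itv/=.
  move=> s; have H : clip r @[r --> s] --> within `[0, 1]%classic (nbhs (clip s)).
    move=> P HP.
    have X : \forall r \near s, `[0, 1]%classic (clip r) -> P (clip r) := @clip_continuous R s [set z | `[0, 1]%classic z -> P z] HP.
    exact: filterS (fun r h => h (c1 r)) X.
  have H1 : w r @[r --> within `[0, 1]%classic (nbhs (clip s))] --> w (clip s).
    by move/subspace_continuousP : cw; apply; exact: c1.
  exact: (cvg_comp _ _ (cvg_comp _ _ H H1) (@coord_continuous _ 1 3 0 i (w (clip s)))).
have := aeq_cont01 cwi (jet_continuous h2 n1).
have ae : aeq (fun s => w (clip s) 0 i) (U i 0%N).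
  apply: (aeq_trans _ (aeq_trans (aeq_sym (eqI_coord ew i)) h3)).
  by apply: eq_aeq => s /I01_01 s01; rewrite clipE.
by move=> /(_ ae x x01) <-; rewrite clipE.
Qed.

Lemma rep_trace n U x (c : 'rV[R]_3) : (1 <= n)%N -> (forall i, jet n (U i)) -> (forall i, U i 0%N x = c 0 i) ->
  has_trace (vec U) x c.
Proof.
move=> n1 jU h; exists (vec U); split.
- have cU (i : 'I_3) (y e : R) : 0 < e -> \forall r \near y, `|U i 0%N y - U i 0%N r| < e.
    by move=> e0; have /cvgrPdist_lt/(_ e e0) := @jet_continuous _ _ _ _ (jU i) n1 y.
  have cP (y : R) P : nbhs (vec U y) P -> \forall r \near y, P (vec U r).
    move=> /nbhs_ballP[e /= e0 eP].
    near=> r; apply: eP; split => // k j; rewrite /vec !mxE; move: j.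
    by apply: ord3P; near: r; exact: cU.
  by apply: continuous_subspaceT => s P; exact: cP.
- exact: aeI.
- by apply/rowP => i; rewrite mxE.
Unshelve. all: by end_near.
Qed.

End Bridge.

(** * The compatibility conditions read on jets *)

Section DataBridge.
Context {R : realType}.
Implicit Types (u w : R -> 'rV[R]_3) (U W : 'I_3 -> nat -> R -> R).

Lemma eq_rep n u U U' : (forall i k s, U i k s = U' i k s) -> rep n u U -> rep n u U'.
Proof.
move=> e h i; have [h1 h2 h3] := h i; split => //; first exact: eq_jet' (e i) h2.
by apply: aeq_trans h3 _; apply: eq_aeq.
Qed.

Lemma coord_cross u w i s : coord (fun s => cross (u s) (w s)) i s =
  coord u (i + 1) s * coord w (i + 2%:R) s - coord u (i + 2%:R) s * coord w (i + 1) s.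
Proof. by rewrite /coord /cross mxE. Qed.

Lemma rep_cross n u w U W : (1 <= n)%N -> rep n u U -> rep n w W ->
  rep n (fun s => cross (u s) (w s)) (cj U W).
Proof.
move=> n1 hu hw i.
have jc : jet n (cj U W i).
  by apply: jet_B; apply: jet_M => //; [have [_ ? _] := hu (i + 1)|have [_ ? _] := hw (i + 2%:R)
    |have [_ ? _] := hu (i + 2%:R)|have [_ ? _] := hw (i + 1)].
have ae : aeq (coord (fun s => cross (u s) (w s)) i) (cj U W i 0%N).
  have A k k' : aeq (coord u k \* coord w k') (U k 0%N \* W k' 0%N).
    by have [_ _ h] := hu k; have [_ _ h'] := hw k'; exact: aeqM.
  apply: aeq_trans (aeq_trans (aeqB (A (i + 1) (i + 2%:R)) (A (i + 2%:R) (i + 1))) _).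
    by apply: eq_aeq => s _; rewrite coord_cross.
  by apply: eq_aeq => s _; rewrite /cj jBE.
split => //; apply: aeq_L2 ae; last exact: jet_L2 jc _.
have mu k : measurable_fun I01 (coord u k) by have [h _ _] := hu k; exact: L2_meas.
have mw k : measurable_fun I01 (coord w k) by have [h _ _] := hw k; exact: L2_meas.
rewrite (_ : coord _ i = fun s => coord u (i + 1) s * coord w (i + 2%:R) s - coord u (i + 2%:R) s * coord w (i + 1) s); last first.
  by apply/funext => s; exact: coord_cross.
by apply: measurable_funB; apply: measurable_funM.
Qed.

Lemma rep_Ds k n u U : rep (k + n) u U -> rep n (Ds k u) (fun i m => U i (k + m)%N).
Proof.
move=> h i; have [l ae] := rep_wderiv i h (leq_addr n k); have [_ j _] := h i.
have e : coord (Ds k u) i = wderiv k (coord u i) by apply/funext => s; rewrite /coord /Ds mxE.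
by rewrite e; split => //; [exact: jet_shift|rewrite addn0].
Qed.

Lemma rep_D n u w U W : rep n u U -> rep n w W ->
  rep n (fun s => u s + w s) (fun i => jD (U i) (W i)).
Proof.
move=> hu hw i; have [h1 h2 h3] := hu i; have [h1' h2' h3'] := hw i.
have e : coord (fun s => u s + w s) i = coord u i \+ coord w i by apply/funext => s; rewrite /coord /= mxE.
by rewrite e; split; [exact: L2D|exact: jet_D|exact: aeqD].
Qed.

Lemma rep_sum n N (u : 'I_N -> R -> 'rV[R]_3) (U : 'I_N -> 'I_3 -> nat -> R -> R) :
  (forall j, rep n (u j) (U j)) ->
  rep n (fun s => \sum_j u j s) (fun i m s => \sum_j U j i m s).
Proof.
elim: N u U => [|N IH] u U h.
  apply: (@eq_rep _ _ (fun=> jC 0)).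
    by move=> i k s; rewrite big_ord0 /jC; case: ifP.
  move=> i; rewrite (_ : coord _ i = cst 0); last first.
    by apply/funext => s; rewrite /coord big_ord0 mxE.
  split; [exact: L2_cst|exact: jet_C|exact: eq_aeq].
have h' := rep_D (h ord0) (IH (fun j => u (lift ord0 j)) (fun j => U (lift ord0 j)) (fun j => h (lift ord0 j))).
rewrite (_ : (fun s => _) = fun s => u ord0 s + \sum_j u (lift ord0 j) s); last first.
  by apply/funext => s; rewrite big_ord_recl.
by apply: eq_rep h' => i k s; rewrite /jD big_ord_recl.
Qed.

(** Each P_k costs 2k derivatives, so at least one is left and the trace makes sense. *)
Lemma rep_Pcomp m v0 W : rep (2 * m + 1) v0 W -> forall k, (k <= m)%N ->
  rep (2 * m + 1 - 2 * k) (Pcomp k v0) (PK k W).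
Proof.
move=> h; elim/ltn_ind => -[|k] IH km; first by rewrite muln0 subn0.
rewrite PcompS; apply: (@eq_rep _ _ (fun i m s => \sum_(j < k.+1) 'C(k, j)%:R *
   cj (PK j W) (fun i m => PK (k - j) W i (2 + m)%N) i m s)).
  by move=> i p s; rewrite PKS.
apply: rep_sum => j; apply: rep_Z; have jk : (j <= k)%N by rewrite -ltnS.
apply: rep_cross; first by lia.
- apply: (@rep_le _ (2 * m + 1 - 2 * j)); [by lia|apply: IH; lia].
apply: rep_Ds; apply: (@rep_le _ (2 * m + 1 - 2 * (k - j))); [by lia|apply: IH; lia].
Qed.

Lemma unit_rep n u U : (1 <= n)%N -> rep n u U -> unit_length u ->
  forall s, dt (at_ U 0 s) (at_ U 0 s) = 1.
Proof.
move=> n1 h hu; have ac i : AC (U i 0%N) (U i 1%N) by have [_ j _] := h i; exact: jet_AC j n1.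
have l1 i : L2 (U i 1%N) by have [_ j _] := h i; exact: jet_L2 j n1.
have c i : continuous (U i 0%N) by exact: AC_continuous (l1 i) (ac i).
have cd : continuous (fun s => dt (at_ U 0 s) (at_ U 0 s)).
  move=> s; rewrite (_ : (fun s => _) = fun s => U o0 0%N s * U o0 0%N s + U o1 0%N s * U o1 0%N s + U o2 0%N s * U o2 0%N s).
    by apply: cvgD; [apply: cvgD|]; apply: cvgM; exact: c.
  by apply/funext => r; rewrite dtE.
have ae : aeq (fun s => dt (at_ U 0 s) (at_ U 0 s)) (cst 1).
  have [_ _ a0] := h o0; have [_ _ a1] := h o1; have [_ _ a2] := h o2.
  have := aeqD (aeqD (aeqM a0 a0) (aeqM a1 a1)) (aeqM a2 a2); move=> /aeq_sym A.
  apply: aeq_trans (aeq_trans A _); first by apply: eq_aeq => s _; rewrite dtE.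
  apply: aeS hu => s hs Is; have := hs Is; rewrite /enorm sum3 => e.
  by rewrite /= -!expr2 -[LHS]sqr_sqrtr ?addr_ge0 ?sqr_ge0// /coord e expr1n.
have H := aeq_cont01 cd (@cst_continuous _ _ _) ae.
have e0 : dt (at_ U 0 0) (at_ U 0 0) = 1 by apply: H; rewrite lexx ler01.
have e1 : dt (at_ U 0 1) (at_ U 0 1) = 1 by apply: H; rewrite lexx ler01.
move=> s; have [s0|s0] := leP s 0.
  by rewrite -e0 !dtE /at_ !(fun i => AC_clip_le0 (ac i) s0).
have [s1|s1] := leP 1 s; last by apply: H; rewrite !ltW.
by rewrite -e1 !dtE /at_ !(fun i => AC_clip_ge1 (ac i) s1).
Qed.

Lemma rep_unit n u U : (1 <= n)%N -> rep n u U ->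
  (forall s, 0 <= s <= 1 -> dt (at_ U 0 s) (at_ U 0 s) = 1) -> unit_length u.
Proof.
move=> n1 h hu; have [_ _ a0] := h o0; have [_ _ a1] := h o1; have [_ _ a2] := h o2.
have A := aeqD (aeqD (aeqM a0 a0) (aeqM a1 a1)) (aeqM a2 a2).
apply: aeS A => s /= hs Is; have := hs Is; rewrite /enorm sum3 !expr2 /coord => ->.
by have := hu s (I01_01 Is); rewrite dtE /at_ => ->; rewrite sqrtr1.
Qed.

Lemma data_rep m a v0 : (1 <= m)%N -> unit_length v0 -> compatible_up_to m a v0 ->
  exists W, [/\ rep (2 * m + 1) v0 W, forall s, dt (at_ W 0 s) (at_ W 0 s) = 1,
    forall i, W i 0%N 0 = a 0 i /\ W i 0%N 1 = (e3 : 'rV[R]_3) 0 i &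
    forall k, (1 <= k <= m)%N -> forall i, PK k W i 0%N 0 = 0 /\ PK k W i 0%N 1 = 0].
Proof.
move=> m1 hu hc; have [hs _] := hc m (leqnn m); have [W HW] := sobolev_rep hs; exists W.
have n1 : (1 <= 2 * m + 1)%N by lia.
split => //; first exact: unit_rep n1 HW hu.
  have [_ /= [t0 t1]] := hc 0%N (leq0n m) => i.
  by split; [exact: trace_rep n1 HW (or_introl erefl) t0 i|exact: trace_rep n1 HW (or_intror erefl) t1 i].
move=> k /andP[k1 km] i; have [_] := hc k km; rewrite (_ : (k == 0%N) = false); last by apply/eqP; lia.
move=> [t0 t1]; have h := rep_Pcomp HW km; have nk : (1 <= 2 * m + 1 - 2 * k)%N by lia.
split; first by rewrite (trace_rep nk h (or_introl erefl) t0 i) mxE.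
by rewrite (trace_rep nk h (or_intror erefl) t1 i) mxE.
Qed.

End DataBridge.

(** * Gronwall inequality from an open initial time *)

Section Gronwall.
Context {R : realType}.

(** The equation is known for t > 0 only: Gronwall is applied from x > 0, and x tends to 0, where
    [E] tends to 0. *)
Lemma gronwall_right (E e : R -> R) (K T : R) : 0 <= K -> 0 < T ->
  (forall t, 0 < t -> (r - t)^-1 * (E r - E t) - e t @[r --> N1 t] --> (0 : R)) ->
  (forall t, 0 < t <= T -> e t <= K * E t) ->
  (forall t, 0 <= E t) -> E r @[r --> N0 (0 : R)] --> (0 : R) -> E T = 0.
Proof.
move=> K0 T0 dE eE E0 cE.
have step x : 0 < x <= T -> E T <= E x * expR (K * T).
  move=> /andP[x0 xT]; pose f r := E (x + r); pose w r := e (x + r).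
  have H (t : R) : 0 <= t -> (r - t)^-1 * (f r - f t) - w t @[r --> N1 t] --> (0 : R).
    move=> t0; have xt : 0 < x + t by exact: ltr_wpDr.
    have /cvgN1P D := dE _ xt; apply/cvgN1P => y y0; have [d d0 Hd] := D y y0; exists d => // r r0 rt rd.
    have q : x + r - (x + t) = r - t by ring.
    have := Hd (x + r); rewrite q; apply => //; first by rewrite addr_ge0// ltW.
    by rewrite -subr_eq0 q subr_eq0.
  pose g (r : R) := if r < 0 then f 0 + r * w 0 else f r.
  have gE r : 0 <= r -> g r = f r by move=> r0; rewrite /g ltNge r0.
  have dg (r : R) : 0 <= r -> is_derive r 1 g (w r) by exact: one_sided_ext H r.
  pose D (r : R) := - (g r * expR (- K * r)).
  have dl (r : R) : is_derive r 1 (fun r => - K * r) (- K).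
    by have := is_deriveZ (- K) (is_derive_id r 1); rewrite /GRing.scale /= mulr1; exact.
  have dD (r : R) : 0 <= r <= T - x -> is_derive r 1 D ((K * g r - w r) * expR (- K * r)).
    move=> /andP[r0 _]; have de := @is_derive1_comp R expR (fun r => - K * r) r _ _ (is_derive_expR (- K * r)) (dl r).
    have := is_deriveN (is_deriveM (dg r r0) de); rewrite /GRing.scale /=.
    by move=> h; apply: is_derive_eq h _; ring.
  have : D 0 <= D (T - x).
    apply: (derive_mono (D := D)) dD _; first by rewrite subr_ge0.
    move=> r /andP[r0 rT]; rewrite mulr_ge0 ?expR_ge0// subr_ge0 gE// /f; apply: eE.
    by rewrite ltr_wpDr//=; lra.
  have Tx : 0 <= T - x by rewrite subr_ge0.
  rewrite /D !gE// /f addr0 mulr0 expR0 mulr1 lerN2 (_ : x + (T - x) = T); last by ring.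
  move=> h; have h2 : E T <= E x * expR (K * (T - x)).
    have ex : expR (- K * (T - x)) * expR (K * (T - x)) = 1 by rewrite -expRD mulNr addNr expR0.
    by rewrite -[E T]mulr1 -ex mulrA ler_wpM2r ?expR_ge0.
  apply: le_trans h2 _; rewrite ler_wpM2l// ler_expR ler_wpM2l//; lra.
apply/eqP; rewrite eq_le E0 andbT leNgt; apply/negP => ET.
have y0 : 0 < E T / expR (K * T) by rewrite divr_gt0// expR_gt0.
have /cvgN0P C := cE; have [d d0 Hd] := C _ y0; pose x := Num.min T (d / 2).
have x0 : 0 < x by rewrite /x lt_min T0 divr_gt0.
have xT : x <= T by rewrite /x ge_min lexx.
have xd : `|x - 0| < d.
  rewrite subr0 gtr0_norm//; apply: (@le_lt_trans _ _ (d / 2)); first by rewrite /x ge_min lexx orbT.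
  lra.
have := Hd x (ltW x0) xd; rewrite ger0_norm// ltr_pdivlMr ?expR_gt0//.
by rewrite ltNge step// x0 xT.
Qed.

Lemma CJ_bounded n (F : R -> nat -> R -> R) (T : R) : 0 <= T -> CJ n F -> exists M, forall t, 0 <= t <= T -> HN n (F t) <= M.
Proof.
move=> T0 cF; pose p (t : R) := Num.max 0 t.
have p0 t : 0 <= p t by rewrite /p le_max lexx.
have pl x y : `|p x - p y| <= `|x - y|.
  by apply: max_lip; rewrite distrC.
have cf : continuous (fun t => HN n (F (p t))).
  move=> t; apply/cvgrPdist_lt => e e0; have [jt ct] := cF _ (p0 t).
  have /cvgN0P H := ct; have [d d0 Hd] := H e e0; apply/nbhs_ballP; exists d => //= r; rewrite /ball/= => rd.
  have := Hd (p r) (p0 r) (le_lt_trans (pl r t) _); rewrite distrC => /(_ rd).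
  rewrite ger0_norm ?HN_ge0//; apply: le_lt_trans; have [jr _] := cF _ (p0 r).
  have h1 := HN_bd jr jt; have h2 := HN_bd jt jr.
  have e1 : HN n (jB (F (p t)) (F (p r))) = HN n (jB (F (p r)) (F (p t))).
    rewrite -[LHS]mul1r -[X in X * _](normrN1 R) -HN_Z; last exact: jet_B.
    by apply: eq_HN => i s; rewrite /jZ !jBE; ring.
  rewrite e1 in h2; move: (HN n (jB _ _)) (HN n (F _)) (HN n (F _)) h1 h2 => a b c h1 h2.
  by rewrite ler_norml; apply/andP; split; lra.
have [c _ Hc] := EVT_max T0 (continuous_subspaceT cf).
exists (HN n (F (p c))) => t /andP[t0 tT]; have := Hc t; rewrite in_itv/= t0 tT => /(_ isT).
by rewrite {1}/p max_r.
Qed.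

End Gronwall.

(** * Energy estimate for the difference of two solutions *)

Section Uniqueness.
Context {R : realType}.
Variables U W : R -> 'I_3 -> nat -> R -> R.
Hypothesis cU : forall i, CJ 3 (fun t => U t i).
Hypothesis cW : forall i, CJ 3 (fun t => W t i).
Hypothesis dU : forall t i, 0 < t -> L2norm (fun s => (r - t)^-1 * (U r i 0%N s - U t i 0%N s) -
  crs (at_ (U t) 0 s) (at_ (U t) 2 s) i) @[r --> N1 t] --> (0 : R).
Hypothesis dW : forall t i, 0 < t -> L2norm (fun s => (r - t)^-1 * (W r i 0%N s - W t i 0%N s) -
  crs (at_ (W t) 0 s) (at_ (W t) 2 s) i) @[r --> N1 t] --> (0 : R).
Hypothesis bUW : forall t i, 0 < t -> U t i 0%N 0 = W t i 0%N 0 /\ U t i 0%N 1 = W t i 0%N 1.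
Hypothesis iUW : forall i s, 0 <= s <= 1 -> U 0 i 0%N s = W 0 i 0%N s.

Let Z t i := jB (U t i) (W t i).
Let cZ i : CJ 3 (fun t => Z t i). Proof. exact: CJ_D (cU i) (CJ_Z (-1) (cW i)). Qed.
Let jZt t i : 0 <= t -> jet 3 (Z t i). Proof. by move=> t0; have [] := cZ i t0. Qed.
Let jUt t i : 0 <= t -> jet 3 (U t i). Proof. by move=> t0; have [] := cU i t0. Qed.
Let jWt t i : 0 <= t -> jet 3 (W t i). Proof. by move=> t0; have [] := cW i t0. Qed.
Let LZ t i k : 0 <= t -> (k <= 3)%N -> L2 (Z t i k). Proof. by move=> t0; exact: jet_L2 (jZt i t0). Qed.
(** The H^1 seminorm is used because the L^2 estimate does not close: it brings in the first
    derivative of the difference. *)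
Let E t := \sum_(i < 3) int01 (Z t i 1%N \* Z t i 1%N).
Let zt t i s := crs (at_ (U t) 0 s) (at_ (U t) 2 s) i - crs (at_ (W t) 0 s) (at_ (W t) 2 s) i.
Let e t := - \sum_(i < 3) int01 (zt t i \* (fun s => 2 * Z t i 2 s)).

Lemma L2_crs_jets (V V' : 'I_3 -> nat -> R -> R) (i : 'I_3) : (forall i, jet 3 (V i)) -> (forall i, jet 3 (V' i)) ->
  L2 (fun s => crs (at_ V 0 s) (at_ V' 2 s) i).
Proof.
move=> h h'; have := @L2B R (V (i + 1) 0%N \* V' (i + 2%:R) 2) (V (i + 2%:R) 0%N \* V' (i + 1) 2).
by apply; apply: (prod_L2 (m := 3)).
Qed.

Let L_zt t i : 0 <= t -> L2 (zt t i).
Proof. by move=> t0; apply: L2B; apply: L2_crs_jets => k; [exact: jUt|exact: jUt|exact: jWt|exact: jWt]. Qed.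

Let cLZ t i k : 0 <= t -> (k <= 3)%N -> L2norm (Z r i k \- Z t i k) @[r --> N0 t] --> (0 : R).
Proof.
move=> t0 k3; have [_ c] := cZ i t0; apply: cvg0_le c => r; rewrite ger0_norm ?L2norm_ge0//.
rewrite (_ : (Z r i k \- Z t i k) = jB (Z r i) (Z t i) k); last by apply/funext => s; rewrite jBE.
exact: HN_ge.
Qed.

Let Z0b t i : 0 < t -> Z t i 0%N 0 = 0 /\ Z t i 0%N 1 = 0.
Proof. by move=> t0; have [h0 h1] := bUW i t0; rewrite /Z !jBE h0 h1 !subrr. Qed.

Let dZ t i : 0 < t -> L2norm ((fun s => (r - t)^-1 * (Z r i 0%N s - Z t i 0%N s)) \- zt t i) @[r --> N1 t] --> (0 : R).
Proof.
move=> t0; have t0' := ltW t0.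
have c : L2norm (fun s => (r - t)^-1 * (U r i 0%N s - U t i 0%N s) - crs (at_ (U t) 0 s) (at_ (U t) 2 s) i) +
  L2norm (fun s => (r - t)^-1 * (W r i 0%N s - W t i 0%N s) - crs (at_ (W t) 0 s) (at_ (W t) 2 s) i) @[r --> N1 t] --> (0 : R).
  by apply: cvg0D; [exact: dU|exact: dW].
apply: cvg0_nearle c; apply: filterS (near_N1_ge0 t) => r r0; rewrite ger0_norm ?L2norm_ge0//.
have LL (F : R -> 'I_3 -> nat -> R -> R) : (forall t i, 0 <= t -> jet 3 (F t i)) ->
  L2 (fun s => (r - t)^-1 * (F r i 0%N s - F t i 0%N s) - crs (at_ (F t) 0 s) (at_ (F t) 2 s) i).
  move=> h; apply: (L2B (f := fun s => (r - t)^-1 * (F r i 0%N s - F t i 0%N s))).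
    by apply: L2Z; apply: L2B; apply: jet_L2 (h _ _ _) _.
  by apply: L2_crs_jets => k; exact: h.
apply: (le_trans _ (L2norm_triangleB (LL U jUt) (LL W jWt))).
by rewrite le_eqVlt; apply/orP; left; apply/eqP; apply: eq_L2norm => s _; rewrite /= /zt /Z !jBE; ring.
Qed.

(** As [Z] is 0 at both ends, E r - E t is by parts minus the pairing of Z r - Z t with the second
    derivative of Z r + Z t; so L^2 differentiability of [Z] in time suffices. *)
Let dE t : 0 < t -> (r - t)^-1 * (E r - E t) - e t @[r --> N1 t] --> (0 : R).
Proof.
move=> t0; have t0' := ltW t0; apply/subr_cvg0; rewrite /e sum3.
pose Dq i r s := (r - t)^-1 * (Z r i 0%N s - Z t i 0%N s); pose S i r := Z r i 2 \+ Z t i 2.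
have n0 := near_N1_ge0 t.
have LD i r : 0 <= r -> L2 (Dq i r) by move=> r0; apply/L2Z/L2B; exact: LZ.
have LS i r : 0 <= r -> L2 (S i r) by move=> r0; apply/L2D; exact: LZ.
have L2Zt i : L2 (fun s => 2 * Z t i 2 s) by apply/L2Z; exact: LZ.
have h i : int01 (Dq i r \* S i r) @[r --> N1 t] --> int01 (zt t i \* (fun s => 2 * Z t i 2 s)).
  have f1 : \forall r \near N1 t, L2 (Dq i r) by apply: filterS n0 => r; exact: LD.
  have f2 : \forall r \near N1 t, L2 (S i r) by apply: filterS n0 => r; exact: LS.
  apply: (int01_cvg f1 f2 (L_zt i t0') (L2Zt i) (dZ i t0)).
  have c := cvg_N1 (@cLZ t i 2 t0' isT); apply: cvg0_le c => r; rewrite ger0_norm ?L2norm_ge0//.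
  by rewrite (@eq_L2norm R _ (Z r i 2 \- Z t i 2))// => s _; rewrite /S /=; ring.
have c3 : - (int01 (Dq o0 r \* S o0 r) + int01 (Dq o1 r \* S o1 r) + int01 (Dq o2 r \* S o2 r)) @[r --> N1 t] -->
   - (int01 (zt t o0 \* (fun s => 2 * Z t o0 2 s)) + int01 (zt t o1 \* (fun s => 2 * Z t o1 2 s)) + int01 (zt t o2 \* (fun s => 2 * Z t o2 2 s))).
  by apply: cvgN; apply: cvgD; [apply: cvgD|]; exact: h.
move: c3; apply: cvg_trans; apply: near_eq_cvg.
have np : \forall r \near N1 t, 0 < r.
  apply/nbhs_ballP; exists t => //= r; rewrite /ball/= => rt _ _.
  by move: rt; rewrite ltr_norml => /andP[_ ?]; lra.
apply: filterS np => r r0; have r0' := ltW r0.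
have q i : int01 (Z r i 1%N \* Z r i 1%N) - int01 (Z t i 1%N \* Z t i 1%N) =
   - int01 ((Z r i 0%N \- Z t i 0%N) \* S i r).
  have a1 : AC (Z r i 0%N \- Z t i 0%N) (Z r i 1%N \- Z t i 1%N).
    by apply: ACB; [exact: LZ|exact: LZ|exact: jet_AC (jZt i r0') _|exact: jet_AC (jZt i t0') _].
  have a2 : AC (Z r i 1%N \+ Z t i 1%N) (S i r).
    by apply: ACD; [exact: LZ|exact: LZ|exact: jet_AC (jZt i r0') _|exact: jet_AC (jZt i t0') _].
  have L1' : L2 (Z r i 1%N \- Z t i 1%N) by apply: L2B; exact: LZ.
  have := int01_byparts L1' (LS i r r0') a1 a2.
  have [br0 br1] := Z0b i r0; have [bt0 bt1] := Z0b i t0.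
  rewrite /= br0 br1 bt0 bt1 !subrr !mul0r subrr => /eqP; rewrite addr_eq0 => /eqP <-.
  rewrite -int01B; [|by apply: L1M; exact: LZ|by apply: L1M; exact: LZ].
  by apply: eq_int01 => s _ /=; ring.
have q2 i : int01 (Dq i r \* S i r) = (r - t)^-1 * int01 ((Z r i 0%N \- Z t i 0%N) \* S i r).
  rewrite -int01Z; last by apply: L1M; [apply: L2B; exact: LZ|exact: LS].
  by apply: eq_int01 => s _; rewrite /Dq /= mulrA.
have q3 i : int01 (Z r i 1%N \* Z r i 1%N) = - int01 ((Z r i 0%N \- Z t i 0%N) \* S i r) + int01 (Z t i 1%N \* Z t i 1%N).
  by rewrite -q subrK.
by rewrite !q2 /E !sum3 !q3; ring.
Qed.

Lemma sum_int01 (h h' : 'I_3 -> R -> R) : (forall i, L1 (h i)) -> (forall i, L1 (h' i)) ->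
  (forall s, \sum_i h i s = \sum_i h' i s) -> \sum_i int01 (h i) = \sum_i int01 (h' i).
Proof.
have S (k : 'I_3 -> R -> R) : (forall i, L1 (k i)) -> \sum_i int01 (k i) = int01 (k o0 \+ k o1 \+ k o2).
  by move=> L; rewrite sum3 !int01D//; exact: L1D.
move=> L L' e1; rewrite !S//; apply: eq_int01 => s _; have := e1 s; rewrite !sum3; exact.
Qed.

Let sh t i m := W t i (2 + m)%N.
Let jsh t i : 0 <= t -> jet 1 (sh t i).
Proof. by move=> t0; exact: (@jet_shift R 1 2 _ (jWt i t0)). Qed.
Let jcZ t i : 0 <= t -> jet 1 (cj (Z t) (sh t) i).
Proof.
by move=> t0; apply: jet_B; apply: jet_M => //; first [exact: jsh|exact: jet_le (jZt _ t0)].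
Qed.
Let cr t i s := crs (at_ (Z t) 0 s) (at_ (W t) 3 s) i.

Let L_cr t i : 0 <= t -> L2 (cr t i).
Proof.
move=> t0; have := @L2B R (Z t (i + 1) 0%N \* W t (i + 2%:R) 3) (Z t (i + 2%:R) 0%N \* W t (i + 1) 3).
by apply; apply: (prod_L2 (m := 3)) => //; first [exact: jZt|exact: jWt].
Qed.

(** With z_t = u x z_ss + z x w_ss, the first term is orthogonal to z_ss; after moving one
    derivative off z_ss, z_s x w_ss is orthogonal to z_s. *)
Let eE t : 0 < t -> e t = 2 * \sum_(i < 3) int01 (cr t i \* Z t i 1%N).
Proof.
move=> t0; have t0' := ltW t0.
have A i : int01 (cj (Z t) (sh t) i 0%N \* Z t i 2) = - int01 (cj (Z t) (sh t) i 1%N \* Z t i 1%N).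
  have := int01_byparts (jet_L2 (jcZ i t0') (leqnn 1)) (LZ i t0' (isT : 2 <= 3)%N) (jet_AC (jcZ i t0') (ltnSn 0)) (jet_AC (jZt i t0') (isT : 1 < 3)%N).
  have cj0 x : (forall j, Z t j 0%N x = 0) -> cj (Z t) (sh t) i 0%N x = 0.
    by move=> h; have := cj_CP (Z t) (sh t) 0 x i; rewrite CP0 /at_ => ->; rewrite /crs !h !mul0r subrr.
  rewrite !cj0; last 2 first. by move=> j; have [] := Z0b j t0. by move=> j; have [] := Z0b j t0.
  by rewrite !mul0r subrr => /eqP; rewrite addrC addr_eq0 => /eqP.
have Lc k i : (k <= 1)%N -> L2 (cj (Z t) (sh t) i k) by move=> k1; exact: jet_L2 (jcZ i t0') k1.
rewrite /e (@sum_int01 _ (fun i s => 2 * (cj (Z t) (sh t) i 0%N \* Z t i 2) s)); first last.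
- move=> s; rewrite !sum3 /zt.
  have X i : cj (Z t) (sh t) i 0%N s = crs (at_ (Z t) 0 s) (at_ (W t) 2 s) i.
    by have := cj_CP (Z t) (sh t) 0 s i; rewrite CP0.
  rewrite /= !X !crsE /at_ /Z !jBE; ring.
- by move=> i; apply/L1Z/L1M; [exact: Lc|exact: LZ].
- by move=> i; apply: L1M; [exact: L_zt|apply/L2Z; exact: LZ].
have B i : int01 (fun s => 2 * (cj (Z t) (sh t) i 0%N \* Z t i 2) s) = - 2 * int01 (cj (Z t) (sh t) i 1%N \* Z t i 1%N).
  by rewrite int01Z ?A; [ring|apply: L1M; [exact: Lc|exact: LZ]].
rewrite (@sum_int01 (fun i => cr t i \* Z t i 1%N) (fun i => cj (Z t) (sh t) i 1%N \* Z t i 1%N)).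
- by rewrite !sum3 !B; ring.
- by move=> i; apply: L1M; [exact: L_cr|exact: LZ].
- by move=> i; apply: L1M; [exact: Lc|exact: LZ].
move=> s; rewrite !sum3 /cr.
have X i : cj (Z t) (sh t) i 1%N s = crs (at_ (Z t) 1 s) (at_ (W t) 2 s) i + crs (at_ (Z t) 0 s) (at_ (W t) 3 s) i.
  by have := cj_CP (Z t) (sh t) 1 s i; rewrite CPS !CP0.
rewrite /= !X !crsE /at_; ring.
Qed.

Let E0 t : 0 <= E t.
Proof. by apply: sumr_ge0 => i _; apply: int01_ge0 => s _ /=; rewrite -expr2 sqr_ge0. Qed.

Let Z1E t i : 0 <= t -> L2norm (Z t i 1%N) <= Num.sqrt (E t).
Proof.
move=> t0; apply: le_sqr_ge0; first exact: sqrtr_ge0.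
rewrite sqr_sqrtr ?E0// L2norm_sqr; last exact: LZ.
rewrite /E (bigD1 i)//= lerDl; apply: sumr_ge0 => k _; apply: int01_ge0 => s _ /=; rewrite -expr2 sqr_ge0//.
Qed.

Let Z0E t i s : 0 < t -> `|Z t i 0%N s| <= Num.sqrt (E t).
Proof.
move=> t0; have t0' := ltW t0; have [b0 _] := Z0b i t0.
have ac := jet_AC (jZt i t0') (isT : 0 < 3)%N.
rewrite ac b0 add0r; apply: le_trans (Z1E i t0'); apply: prim_bound; exact: LZ.
Qed.

(** Since z vanishes at s = 0, its sup norm is at most the square root of [E]; each of the three
    components contributes 2 M E, and there is a factor 2 in front. *)
Let e_le t M : 0 < t -> (forall k, HN 3 (W t k) <= M) -> e t <= 12 * M * E t.
Proof.
move=> t0 hM; have t0' := ltW t0; rewrite eE//; set y := Num.sqrt (E t).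
have y0 : 0 <= y by exact: sqrtr_ge0.
have M0 : 0 <= M := le_trans (HN_ge0 _ _) (hM o0).
have p j k : L2norm (W t k 3 \* Z t j 0%N) <= y * M.
  have LW : L2 (W t k 3) := jet_L2 (jWt k t0') (leqnn 3).
  apply: le_trans (L2normM_bounded LW _ _) _.
  - apply: cont_meas; exact: (AC_continuous (LZ j t0' (isT : 1 <= 3)%N) (jet_AC (jZt j t0') (isT : 0 < 3)%N)).
  - by move=> s _; exact: Z0E t0.
  - by rewrite ler_wpM2l//; apply: le_trans (hM k); exact: HN_ge.
have Lp j k : L2 (W t k 3 \* Z t j 0%N).
  by apply: (prod_L2 (m := 3)) => //; first [exact: jZt|exact: jWt].
have q i : int01 (cr t i \* Z t i 1%N) <= 2 * M * E t.
  apply: le_trans (ler_norm _) _; apply: le_trans (int01_CS (L_cr i t0') (LZ i t0' (isT : 1 <= 3)%N)) _.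
  have c1 : L2norm (cr t i) <= 2 * (y * M).
    rewrite (@eq_L2norm R _ ((W t (i + 2%:R) 3 \* Z t (i + 1) 0%N) \- (W t (i + 1) 3 \* Z t (i + 2%:R) 0%N))); last first.
      by move=> s _; rewrite /cr /crs /at_ /=; ring.
    apply: le_trans (L2norm_triangleB (Lp _ _) (Lp _ _)) _.
    by have := p (i + 1) (i + 2%:R); have := p (i + 2%:R) (i + 1); move: (L2norm _) (L2norm _) => c d; lra.
  have c2 := Z1E i t0'; apply: le_trans (ler_pM (L2norm_ge0 _) (L2norm_ge0 _) c1 c2) _.
  by rewrite -/y -[X in _ <= 2 * M * X](sqr_sqrtr (E0 t)) -/y expr2 le_eqVlt; apply/orP; left; apply/eqP; ring.
rewrite sum3; have := q o0; have := q o1; have := q o2; move: (int01 _) (int01 _) (int01 _) => x0 x1 x2.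
move: (M * E t) (mulrA 2 M (E t)) (mulrA 12 M (E t)) => z <- <-; lra.
Qed.

Let cE : E r @[r --> N0 (0 : R)] --> (0 : R).
Proof.
have z0 i s : Z 0 i 1%N s = 0.
  have ac := jet_AC (@jZt 0 i (lexx 0)) (isT : 0 < 3)%N.
  have z x : 0 <= x <= 1 -> Z 0 i 0%N x = 0 by move=> x01; rewrite /Z jBE iUW// subrr.
  have z00 : Z 0 i 0%N 0 = 0 by apply: z; rewrite lexx ler01.
  apply: (AC_const_0 _ (@LZ 0 i 1 (lexx 0) isT) ac (@LZ 0 i 2 (lexx 0) isT) (jet_AC (@jZt 0 i (lexx 0)) (isT : 1 < 3)%N)) => x.
  rewrite z00; have [x0|x0] := leP x 0; first by rewrite (AC_clip_le0 ac x0).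
  have [x1|x1] := leP 1 x; last by apply: z; rewrite !ltW.
  by rewrite (AC_clip_ge1 ac x1); apply: z; rewrite lexx ler01.
have h i : int01 (Z r i 1%N \* Z r i 1%N) @[r --> N0 (0 : R)] --> (0 : R).
  have f : \forall r \near N0 (0 : R), L2 (Z r i 1%N) by apply: filterS (near_N0_ge0 0) => r r0; exact: LZ.
  have := int01_cvg f f (@LZ 0 i 1 (lexx 0) isT) (@LZ 0 i 1 (lexx 0) isT) (@cLZ 0 i 1 (lexx 0) isT) (@cLZ 0 i 1 (lexx 0) isT).
  have -> : int01 (Z 0 i 1%N \* Z 0 i 1%N) = 0.
    by rewrite -[RHS]int01_0; apply: eq_int01 => s _; rewrite /= z0 mul0r.
  exact.
rewrite /E; under eq_fun do rewrite sum3.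
by apply: cvg0D; [apply: cvg0D|].
Qed.

Theorem jets_uniq t : 0 <= t -> forall i s, 0 <= s <= 1 -> U t i 0%N s = W t i 0%N s.
Proof.
rewrite le_eqVlt => /orP[/eqP <-|t0]; first exact: iUW.
have H i : exists M, forall r, 0 <= r <= t -> HN 3 (W r i) <= M by exact: CJ_bounded (ltW t0) (cW i).
have [M0 h0] := H o0; have [M1 h1] := H o1; have [M2 h2] := H o2.
pose M := Num.max M0 (Num.max M1 M2).
have hM r : 0 <= r <= t -> forall k, HN 3 (W r k) <= M.
  move=> rt; apply: ord3P; rewrite /M !le_max; [by rewrite h0|by rewrite h1 ?orbT|by rewrite h2 ?orbT].
have Mge : 0 <= M by apply: le_trans (HN_ge0 3 (W 0 o0)) (hM 0 _ o0); rewrite lexx ltW.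
have Et : E t = 0.
  apply: (@gronwall_right R E e (12 * M) t _ t0 (fun x x0 => dE x0) _ E0 cE); first by rewrite mulr_ge0.
  by move=> r /andP[r0 rt]; apply: e_le => //; apply: hM; rewrite (ltW r0).
move=> i s _; have := Z0E i s t0; rewrite Et sqrtr0 normr_le0 /Z jBE subr_eq0 => /eqP; exact.
Qed.

End Uniqueness.

(** * Solutions in the sense of the statement *)

Section Solutions.
Context {R : realType}.
Implicit Types (v w : R -> R -> 'rV[R]_3) (U : R -> 'I_3 -> nat -> R -> R).

Definition vs (U : 'I_3 -> nat -> R -> R) := cj U (fun i m => U i (2 + m)%N).

Lemma rep_rhs n (u : R -> 'rV[R]_3) (U : 'I_3 -> nat -> R -> R) : (1 <= n)%N -> rep (2 + n) u U ->
  rep n (fun s => cross (u s) (Ds 2 u s)) (vs U).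
Proof. by move=> n1 h; apply: rep_cross => //; [apply: rep_le h; lia|exact: rep_Ds]. Qed.

Lemma vs_crs (V : 'I_3 -> nat -> R -> R) i s : vs V i 0%N s = crs (at_ V 0 s) (at_ V 2 s) i.
Proof. by have := cj_CP V (fun i m => V i (2 + m)%N) 0 s i; rewrite CP0. Qed.

Lemma rep_dq v U r t : rep 3 (v t) (U t) -> rep 3 (v r) (U r) ->
  rep 0 ((fun s => (r - t)^-1 *: (v r s - v t s)) \- (fun s => cross (v t s) (Ds 2 (v t) s)))
    (fun i => jB (jZ (r - t)^-1 (jB (U r i) (U t i))) (vs (U t) i)).
Proof.
move=> ht hr; apply: rep_B; last by apply: (@rep_le _ 1) => //; exact: rep_rhs.
by apply: (@rep_le _ 3) => //; apply: rep_Z; exact: rep_B.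
Qed.

Lemma HN_dq U r t i : HN 0 (jB (jZ (r - t)^-1 (jB (U r i) (U t i))) (vs (U t) i)) =
  L2norm (fun s => (r - t)^-1 * (U r i 0%N s - U t i 0%N s) - crs (at_ (U t) 0 s) (at_ (U t) 2 s) i).
Proof. by rewrite /HN big_ord1; apply: eq_L2norm => s _; rewrite jBE /jZ jBE vs_crs. Qed.

(** The equation in L^2 depends only on the representing jets, so it can be transferred in both
    directions. *)
Lemma Hderiv_rhs v U t : 0 < t -> (forall r, 0 <= r -> rep 3 (v r) (U r)) ->
  is_Hderiv 0 v t (fun s => cross (v t s) (Ds 2 (v t) s)) <->
  forall i, L2norm (fun s => (r - t)^-1 * (U r i 0%N s - U t i 0%N s) -
    crs (at_ (U t) 0 s) (at_ (U t) 2 s) i) @[r --> N1 t] --> (0 : R).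
Proof.
move=> t0 h; have ht := h t (ltW t0); split=> [[_ d] i|H].
  apply: cvg0_nearle d; apply: filterS (near_N1_ge0 t) => r r0.
  rewrite ger0_norm ?L2norm_ge0// -HN_dq; apply: le_trans (HN_sobolev i (rep_dq ht (h r r0))) _.
  by rewrite mul1r.
split; first by apply: (@rep_sobolev _ 0 _ (vs (U t))); apply: (@rep_le _ 1) => //; exact: rep_rhs.
have c : \sum_(i < 3) HN 0 (jB (jZ (r - t)^-1 (jB (U r i) (U t i))) (vs (U t) i)) @[r --> N1 t] --> (0 : R).
  under eq_fun do rewrite sum3 !HN_dq.
  by apply: cvg0D; [apply: cvg0D|]; exact: H.
apply: cvg0_nearle c; apply: filterS (near_N1_ge0 t) => r r0.
rewrite ger0_norm ?sobolev_norm_ge0//; exact: sobolev_norm_le (rep_dq ht (h r r0)).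
Qed.

Lemma solution_uniq a (u : R -> 'rV[R]_3) v w : is_solution a u v -> is_solution a u w ->
  Hcontinuous 3 v -> Hcontinuous 3 w -> forall t, 0 <= t -> eqI (v t) (w t).
Proof.
move=> [_ dv iv bv] [_ dw iw bw] /jets_Hcont[V [rV cV]] /jets_Hcont[W [rW cW]] t t0.
have dV r i : 0 < r -> L2norm (fun s => (r' - r)^-1 * (V r' i 0%N s - V r i 0%N s) -
  crs (at_ (V r) 0 s) (at_ (V r) 2 s) i) @[r' --> N1 r] --> (0 : R).
  by move=> r0; have /(Hderiv_rhs r0 rV) := dv r r0; exact.
have dW r i : 0 < r -> L2norm (fun s => (r' - r)^-1 * (W r' i 0%N s - W r i 0%N s) -
  crs (at_ (W r) 0 s) (at_ (W r) 2 s) i) @[r' --> N1 r] --> (0 : R).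
  by move=> r0; have /(Hderiv_rhs r0 rW) := dw r r0; exact.
have bVW r i : 0 < r -> V r i 0%N 0 = W r i 0%N 0 /\ V r i 0%N 1 = W r i 0%N 1.
  move=> r0; have [bv0 bv1] := bv r r0; have [bw0 bw1] := bw r r0; have r0' := ltW r0.
  rewrite (trace_rep _ (rV r r0') (or_introl erefl) bv0 i)// (trace_rep _ (rW r r0') (or_introl erefl) bw0 i)//.
  by rewrite (trace_rep _ (rV r r0') (or_intror erefl) bv1 i)// (trace_rep _ (rW r r0') (or_intror erefl) bw1 i).
have iVW i s : 0 <= s <= 1 -> V 0 i 0%N s = W 0 i 0%N s.
  have [_ jv av] := rV 0 (lexx 0) i; have [_ jw aw] := rW 0 (lexx 0) i.
  apply: aeq_cont01; [exact: jet_continuous jv _|exact: jet_continuous jw _|].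
  apply: aeq_trans (aeq_sym av) (aeq_trans _ aw).
  exact: aeq_trans (eqI_coord iv i) (aeq_sym (eqI_coord iw i)).
have H := jets_uniq cV cW dV dW bVW iVW t0.
apply: coord_eqI => i; have [_ _ av] := rV t t0 i; have [_ _ aw] := rW t t0 i.
apply: aeq_trans av (aeq_trans _ (aeq_sym aw)); apply: eq_aeq => s /I01_01; exact: H.
Qed.

End Solutions.

Theorem theorem2p2 (R : realType) (a : 'rV[R]_3) (ha : enorm a = 1)
    (l : nat) (v0 : R -> 'rV[R]_3)
    (hreg : sobolev (l + 3) v0)
    (hunit : unit_length v0)
    (hcomp : compatible_up_to ((l + 3) %/ 2) a v0) :
  let solution_in_class (v : R -> R -> 'rV[R]_3) :=
    [/\ is_solution a v0 v,
        forall t : R, 0 <= t -> unit_length (v t) &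
        forall j : nat, (j <= (l + 3) %/ 2)%N -> CjHm j (l + 3 - 2 * j) v] in
  exists v : R -> R -> 'rV[R]_3,
    solution_in_class v /\
    forall w : R -> R -> 'rV[R]_3,
      solution_in_class w -> forall t : R, 0 <= t -> eqI (w t) (v t).
Proof.
move=> class; set m := ((l + 3) %/ 2)%N in class hcomp *.
have m1 : (1 <= m)%N by rewrite /m; lia.
(* The condition of order m places the data in H^(2m+1), and 2m + 1 >= l + 3. *)
have [W [rW W1 bW PW]] := data_rep m1 hunit hcomp.
have jW i : jet (2 * m + 1) (W i) by have [] := rW i.
have hP k : (1 <= k <= m)%N -> forall i, PK k W i 0%N 0 = 0 /\ PK k W i 0%N 1 = 0 by exact: PW.
have [V [cV V1 V0 bV dV]] := evolution m1 jW W1 hP.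
have jV t i : 0 <= t -> jet (2 * m).+1 (V t i) by move=> t0; have [] := cV i t t0.
have rV t : 0 <= t -> rep (2 * m).+1 (vec (V t)) (V t) by move=> t0; apply: rep_vec => i; exact: jV.
have rV3 t : 0 <= t -> rep 3 (vec (V t)) (V t) by move=> /rV; apply: rep_le; lia.
have m3 : (1 <= (2 * m).+1)%N by [].
pose v t := vec (V t).
have vC : class v.
  split.
  - split=> [t /ltW t0|t t0||t /ltW t0].
    + by apply: sobolev_le (rep_sobolev (rV3 t t0)).
    + by apply/(Hderiv_rhs t0 rV3) => i; apply: dV; exact: ltW.
    + apply: coord_eqI => i; have [_ _ aw] := rW i; rewrite coord_vec.
      by apply: aeq_trans (aeq_sym aw); apply: eq_aeq => s _; exact: V0.
    + have [bW0 bW1] : (forall i, W i 0%N 0 = a 0 i) /\ (forall i, W i 0%N 1 = (e3 : 'rV[R]_3) 0 i).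
        by split=> i; have [] := bW i.
      split; apply: (@rep_trace _ (2 * m).+1) => // i; try exact: jV.
        by have [-> _] := bV t i t0.
      by have [_ ->] := bV t i t0.
  - by move=> t t0; apply: (rep_unit m3 (rV t t0)) => s; exact: V1.
  move=> j jm; apply: (@CjHm_le _ j (2 * m + 1 - 2 * j)); first by rewrite /m; lia.
  apply: CjHm_jets => i; exact: (CjJ_evolution m1 cV dV jm).
exists v; split => // w [sw _ cw] t t0; have [sv _ cv] := vC.
(* Continuity in H^3, which the class contains for every l, is what the energy estimate needs. *)
have H3 u : CjHm 0 (l + 3 - 2 * 0) u -> Hcontinuous 3 u.
  by move=> h; have [] : CjHm 0 3 u by apply: CjHm_le h; lia.
have hw : Hcontinuous 3 w by apply: H3; exact: cw.
have hv : Hcontinuous 3 v by apply: H3; exact: cv.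
apply: (solution_uniq sw sv hw hv t0).
Qed.
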